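(* Any Segre product of projective curves has rational Hilbert-Kunz multiplicity. More precisely, let $R_1,\ldots,R_r$ be standard graded rings with $\dim R_i=2$ for each $i$, over an algebraically closed field $k$ of characteristic $p>0$, and let $I_i\subset R_i$ be homogeneous ideals such that $\ell(R_i/I_i)<\infty$. Then $e_{HK}(R_1\#\cdots\#R_r,\,I_1\#\cdots\#I_r)$ is a rational number.
   Context: A standard graded ring over $k$ is a Noetherian graded ring $R=\bigoplus_{m\ge0}R_m$ with $R_0=k$, generated over $k$ by $R_1$. The Segre product $R\#S$ of graded rings $R,S$ over $k$ is given by $(R\#S)_n=R_n\otimes_kS_n$; for homogeneous ideals $I\subset R$, $J\subset S$, the ideal $I\#J\subset R\#S$ is given by $(I\#J)_n=I_n\otimes_kJ_n$; these extend to several factors. For a standard graded ring $R$ of dimension $d$ and a homogeneous ideal $I$ with $\ell(R/I)<\infty$, $e_{HK}(R,I)=\lim_{n\to\infty}\ell(R/I^{[p^n]})/p^{nd}$, where $I^{[p^n]}$ is the ideal generated by the $p^n$-th powers of elements of $I$. *)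

(* Defs.v *)
From HB Require Import structures.
From mathcomp Require Import all_boot all_order all_algebra.
From mathcomp Require Import all_classical reals topology normedtype sequences.
From mathcomp Require Import -(notations) finmap monalg.

Set Implicit Arguments.
Unset Strict Implicit.
Unset Printing Implicit Defensive.

Import Order.TTheory GRing.Theory Num.Theory.
Import numFieldNormedType.Exports.

Local Open Scope classical_set_scope.
Local Open Scope ring_scope.

Section Ideals.
Variable A : comNzRingType.
Implicit Types (I J P X : set A) (n d : nat).

Definition is_ideal I : Prop :=
  [/\ I 0, forall x y, I x -> I y -> I (x + y) & forall a x, I x -> I (a * x)].

Definition ideal_gen X : set A :=
  [set x | forall J, is_ideal J -> X `<=` J -> J x].

Lemma is_ideal_gen X : is_ideal (ideal_gen X).
Proof.
split=> [J [] //|x y hx hy J hJ XJ|a x hx J hJ XJ]; case: (hJ) => _ hD hM.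
- by apply: hD; [apply: hx|apply: hy].
- by apply: hM; apply: hx.
Qed.

Definition is_prime P : Prop :=
  [/\ is_ideal P, ~ P 1 & forall x y, P (x * y) -> P x \/ P y].

Definition noetherian : Prop :=
  forall I, is_ideal I -> exists s : seq A, I = ideal_gen [set` s].

Definition max_of (Q : nat -> Prop) n : Prop :=
  Q n /\ forall m, Q m -> (m <= n)%N.

Definition prime_chain n : Prop :=
  exists P : nat -> set A,
    (forall i, (i <= n)%N -> is_prime (P i)) /\
    (forall i, (i < n)%N -> P i `<` P i.+1).

Definition krull_dim d : Prop := max_of prime_chain d.

Definition ideal_chain_above I n : Prop :=
  exists J : nat -> set A,
    [/\ forall i, (i <= n)%N -> is_ideal (J i),
        I `<=` J 0%N &
        forall i, (i < n)%N -> J i `<` J i.+1].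

(* [colength I n] : the A-module A / I has length n; its submodules are the
   J / I with J an ideal containing I. *)
Definition colength I n : Prop := max_of (ideal_chain_above I) n.

Definition frobenius_power I (q : nat) : set A :=
  ideal_gen [set x ^+ q | x in I].

(* The limit defining e_HK(A, I) exists and equals e. *)
Definition hilbert_kunz (K : realType) (p : nat) I (e : K) : Prop :=
  exists d (l : nat -> nat),
    [/\ krull_dim d,
        forall n, colength (frobenius_power I (p ^ n)) (l n) &
        (l n)%:R / (p ^ (n * d))%:R @[n --> \oo] --> e].

End Ideals.

Section Spans.
Variables (k : fieldType) (V : lmodType k).

Definition is_subspace (W : set V) : Prop :=
  W 0 /\ forall (a : k) x y, W x -> W y -> W (a *: x + y).

Definition kspan (X : set V) : set V :=
  [set x | forall W, is_subspace W -> X `<=` W -> W x].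

End Spans.

Record std_graded (k : fieldType) := StdGraded {
  sg_ring :> comAlgType k;
  sg_piece : nat -> set sg_ring;
  sg_subspace : forall n, is_subspace (sg_piece n);
  sg_decomp : forall x, exists N (c : nat -> sg_ring),
    (forall n, sg_piece n (c n)) /\ x = \sum_(n < N) c n;
  sg_direct : forall N (c : nat -> sg_ring),
    (forall n, sg_piece n (c n)) -> \sum_(n < N) c n = 0 ->
    forall n, (n < N)%N -> c n = 0;
  sg_mul : forall m n x y,
    sg_piece m x -> sg_piece n y -> sg_piece (m + n)%N (x * y);
  sg_piece0 : sg_piece 0%N = range (fun a : k => a%:A);
  sg_gen : forall B : set sg_ring,
    is_subspace B -> B 1 -> (forall x y, B x -> B y -> B (x * y)) ->
    sg_piece 1%N `<=` B -> B = setT;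
  sg_noetherian : noetherian sg_ring
}.

Definition homogeneous_ideal (k : fieldType) (R : std_graded k) (I : set R) :
    Prop :=
  is_ideal I /\
  forall N (c : nat -> R), (forall n, sg_piece n (c n)) ->
    I (\sum_(n < N) c n) -> forall n, (n < N)%N -> I (c n).

Section SegreProduct.
Variables (k : fieldType) (r : nat) (R : 'I_r -> std_graded k).

(* A family of homogeneous elements x_i of R_i, all of the same degree n; it
   stands for the pure tensor x_1 (x) ... (x) x_r in (R_1)_n (x) ... (x) (R_r)_n. *)
Definition htuple :=
  {t : nat * {dffun forall i, R i} | `[< forall i, sg_piece t.1 (t.2 i) >]}.

HB.instance Definition _ := Choice.on htuple.

Definition hdeg (t : htuple) : nat := (val t).1.
Definition hcomp (t : htuple) (i : 'I_r) : R i := (val t).2 i.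

Lemma hcompP t i : sg_piece (hdeg t) (hcomp t i).
Proof. by move: i; apply/asboolP; exact: (valP t). Qed.

Definition mk_htuple n (x : forall i, R i) (hx : forall i, sg_piece n (x i)) :
    htuple :=
  exist _ (n, finfun x : {dffun forall i, R i})
    (introT (asboolP _) (fun i => eq_ind_r (sg_piece n) (hx i) (ffunE x i))).

Lemma htuple_eq (s t : htuple) :
  hdeg s = hdeg t -> (forall i, hcomp s i = hcomp t i) -> s = t.
Proof.
case: s t => [[m x] hx] [[n y] hy]; rewrite /hdeg /hcomp /= => mn xy.
by apply: val_inj => /=; congr pair => //; apply/ffunP.
Qed.

Definition htuple_one : htuple :=
  @mk_htuple 0 (fun=> 1) (fun i => eq_ind_r (fun P : set (R i) => P 1)
    (ex_intro2 _ _ 1 I (scale1r 1)) (sg_piece0 (R i))).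

Definition htuple_mul (s t : htuple) : htuple :=
  mk_htuple (fun i => sg_mul (hcompP s i) (hcompP t i)).

Lemma hcomp_one i : hcomp htuple_one i = 1.
Proof. exact: ffunE. Qed.

Lemma hcomp_mul s t i : hcomp (htuple_mul s t) i = hcomp s i * hcomp t i.
Proof. exact: ffunE. Qed.

Lemma htuple_mulA : associative htuple_mul.
Proof.
move=> s t u; apply: htuple_eq => [|i]; first exact: addnA.
by rewrite !hcomp_mul mulrA.
Qed.

Lemma htuple_mulC : commutative htuple_mul.
Proof.
move=> s t; apply: htuple_eq => [|i]; first exact: addnC.
by rewrite !hcomp_mul mulrC.
Qed.

Lemma htuple_mul1 : left_id htuple_one htuple_mul.
Proof. by move=> t; apply: htuple_eq => // i; rewrite hcomp_mul hcomp_one mul1r. Qed.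

(* A monomType may not have nontrivial units, so a fresh unit [None] is adjoined
   to the monoid of homogeneous tuples; [segre_relations] identifies it with
   [htuple_one]. *)
Definition htuple1 := option htuple.

HB.instance Definition _ := Choice.on htuple1.

Definition htuple1_mul (s t : htuple1) : htuple1 :=
  if s is Some s' then (if t is Some t' then Some (htuple_mul s' t') else s)
  else t.

Lemma htuple1_mulA : associative htuple1_mul.
Proof. by case=> [s|] [t|] [u|] //=; rewrite htuple_mulA. Qed.

Lemma htuple1_mul1l : left_id None htuple1_mul. Proof. by []. Qed.

Lemma htuple1_mul1r : right_id None htuple1_mul. Proof. by case. Qed.

Lemma htuple1_unit s t : htuple1_mul s t = None -> s = None /\ t = None.
Proof. by case: s t => [s|] [t|]. Qed.

Lemma htuple1_mulC : commutative htuple1_mul.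
Proof. by case=> [s|] [t|] //=; rewrite htuple_mulC. Qed.

HB.instance Definition _ := Choice_isMonomialDef.Build htuple1
  htuple1_mulA htuple1_mul1l htuple1_mul1r htuple1_unit.
HB.instance Definition _ :=
  MonomialDef_isConomialDef.Build htuple1 htuple1_mulC.

(* The i-th component of z is a x_i + y_i; x, y and z agree elsewhere. *)
Definition slot_comb (i : 'I_r) (a : k) (x y z : htuple) : Prop :=
  [/\ hdeg x = hdeg z, hdeg y = hdeg z,
      hcomp z i = a *: hcomp x i + hcomp y i &
      forall j, j != i -> hcomp x j = hcomp z j /\ hcomp y j = hcomp z j].

Definition multilinear (W : lmodType k) (f : htuple -> W) : Prop :=
  forall i a x y z, slot_comb i a x y z -> f z = a *: f x + f y.

(* The k-algebra of the monoid of homogeneous tuples. *)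
Definition htuple_alg : comAlgType k := malg htuple1 k.

Definition hmonom (t : htuple) : htuple_alg := mkmalgU (Some t) 1.

Definition segre_relations : set htuple_alg :=
  [set u | u = hmonom htuple_one - 1 \/
     exists i a x y z, slot_comb i a x y z /\
       u = hmonom z - (a *: hmonom x + hmonom y)].

Definition segre_kernel : pred htuple_alg :=
  fun u => `[< ideal_gen segre_relations u >].

Section LinearExtension.
Variables (W : lmodType k) (f : htuple -> W).

Let f1 (m : htuple1) : W := f (odflt htuple_one m).

Definition lin_ext (u : htuple_alg) : W :=
  \sum_(m <- msupp u) mcoeff m u *: f1 m.

Lemma lin_extEw (u : htuple_alg) (d : finset_of (Phant htuple1)) :
  fsubset (msupp u) d -> lin_ext u = \sum_(m <- d) mcoeff m u *: f1 m.
Proof.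
move=> le; rewrite /lin_ext (big_fset_incl _ le) // => m _ /mcoeff_outdom ->.
by rewrite scale0r.
Qed.

Lemma lin_ext_linear : linear lin_ext.
Proof.
move=> a u v; pose d := fsetU (msupp u) (msupp v).
have le_u : fsubset (msupp u) d by apply: fsubsetUl.
have le_v : fsubset (msupp v) d by apply: fsubsetUr.
rewrite (@lin_extEw _ d); last first.
  apply: fsubset_trans (msuppD_le _ _) _.
  by rewrite fsubUset le_v andbT; apply: fsubset_trans (msuppZ_le _ _) le_u.
rewrite (lin_extEw le_u) (lin_extEw le_v) scaler_sumr -big_split /=.
by apply: eq_bigr => m _; rewrite mcoeffD mcoeffZ scalerDl scalerA.
Qed.

HB.instance Definition _ := GRing.isLinear.Build k htuple_alg W _ lin_ext
  lin_ext_linear.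

Lemma lin_extU m : lin_ext (mkmalgU m 1) = f1 m.
Proof.
by rewrite (lin_extEw msuppU_le) big_seq_fset1 mcoeffUU scale1r.
Qed.

Hypothesis f_multilinear : multilinear f.

Lemma slot_comb_mul i a s x y z : slot_comb i a x y z ->
  slot_comb i a (htuple_mul s x) (htuple_mul s y) (htuple_mul s z).
Proof.
case=> dx dy zi xyz; split; rewrite ?hcomp_mul.
- by rewrite /hdeg /= -!/(hdeg _) dx.
- by rewrite /hdeg /= -!/(hdeg _) dy.
- by rewrite zi mulrDr scalerAr.
- by move=> j /xyz[xz yz]; rewrite !hcomp_mul xz yz.
Qed.

Lemma mul_hmonom (m : htuple1) (t : htuple) :
  (mkmalgU m 1 : htuple_alg) * hmonom t =
  hmonom (if m is Some s then htuple_mul s t else t).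
Proof.
rewrite /hmonom [LHS]malgME !msuppU !oner_eq0 !big_seq_fset1 !mcoeffUU mulr1.
by case: m.
Qed.

Lemma htuple_algE (u : htuple_alg) :
  u = \sum_(m <- msupp u) mcoeff m u *: (mkmalgU m 1 : htuple_alg).
Proof.
rewrite {1}[u]monalgE; apply: eq_bigr => m _; apply/malgP => m'.
by rewrite mcoeffZ !mcoeffU mulrnAr mulr1.
Qed.

Lemma lin_ext_mul (m : htuple1) (t : htuple) :
  lin_ext ((mkmalgU m 1 : htuple_alg) * hmonom t) =
  f (if m is Some s then htuple_mul s t else t).
Proof. by rewrite mul_hmonom lin_extU /f1; case: m. Qed.

Lemma lin_ext_kernel u : ideal_gen segre_relations u -> lin_ext u = 0.
Proof.
move=> /(_ [set x | forall y, lin_ext (y * x) = 0]) h.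
rewrite -[u]mul1r; apply: h => [|x x_rel y] {u}.
  split=> [y|x x' hx hx' y|a x hx y]; first by rewrite mulr0 linear0.
    by rewrite mulrDr linearD /= hx hx' addr0.
  by rewrite (mulrA y a x); apply: hx.
rewrite [y]htuple_algE mulr_suml linear_sum big1 //= => m _.
rewrite -scalerAl linearZ /=; apply/eqP; rewrite scaler_eq0; apply/orP; right.
apply/eqP; case: x_rel => [->|[i [a [s [t [z [stz ->]]]]]]].
  rewrite mulrBr mulr1 linearB /= lin_ext_mul lin_extU /f1.
  by case: m => [s|] /=; rewrite ?[htuple_mul s _]htuple_mulC ?htuple_mul1 subrr.
rewrite mulrBr mulrDr -(scalerAr a _ (hmonom s)) linearB linearP /=.
apply/eqP; rewrite subr_eq0; apply/eqP.
apply: etrans (lin_ext_mul m z) _.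
transitivity (a *: f (if m is Some v then htuple_mul v s else s) +
              f (if m is Some v then htuple_mul v t else t)).
  apply: (f_multilinear (i := i)).
  by case: m => // v; apply: slot_comb_mul.
by congr (_ *: _ + _); apply/esym; exact: lin_ext_mul.
Qed.

End LinearExtension.

Local Open Scope quotient_scope.

Section Augmentation.

Definition coef0 (i : 'I_r) (x : R i) : k := xget 0 [set a : k | x = a%:A].

Lemma coef0E i (a : k) : coef0 (a%:A : R i) = a.
Proof.
rewrite /coef0; case: xgetP => [b _ /= /eqP|/(_ a)/(_ erefl)//].
by rewrite -subr_eq0 -scalerBl scaler_eq0 oner_eq0 orbF subr_eq0 => /eqP.
Qed.

Lemma coef0_linear i (a : k) (x y : R i) :
  sg_piece 0%N x -> sg_piece 0%N y -> coef0 (a *: x + y) = a * coef0 x + coef0 y.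
Proof.
rewrite sg_piece0 => -[b _ <-] [c _ <-].
by rewrite scalerA -scalerDl !coef0E.
Qed.

(* Kills the relations and maps 1 to 1, so the quotient ring is nonzero. *)
Definition augmentation (t : htuple) : k^o :=
  if hdeg t == 0%N then \prod_i coef0 (hcomp t i) else 0.

Lemma augmentation_multilinear : multilinear augmentation.
Proof.
move=> i a x y z [dx dy zi xyz]; rewrite /augmentation dx dy.
case: eqP => [z0|_]; last by rewrite scaler0 addr0.
have x0 : sg_piece 0%N (hcomp x i) by rewrite -z0 -dx; apply: hcompP.
have y0 : sg_piece 0%N (hcomp y i) by rewrite -z0 -dy; apply: hcompP.
have prodE t : (forall j, j != i -> hcomp t j = hcomp z j) ->
    \prod_j coef0 (hcomp t j) =
    coef0 (hcomp t i) * \prod_(j | j != i) coef0 (hcomp z j).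
  by move=> tz; rewrite (bigD1 i) //=; congr (_ * _); apply: eq_bigr => j /tz->.
rewrite (prodE x) => [|j /xyz[]//]; rewrite (prodE y) => [|j /xyz[]//].
by rewrite (prodE z) // zi coef0_linear // mulrDl -mulrA.
Qed.

Lemma augmentation_one : augmentation htuple_one = 1.
Proof.
rewrite /augmentation eqxx big1 // => i _.
by rewrite hcomp_one -[1]scale1r coef0E.
Qed.

End Augmentation.

Lemma segre_kernel_idealr : idealr_closed segre_kernel.
Proof.
have [h0 hD hM] := is_ideal_gen segre_relations.
split=> [||a u v /asboolP hu /asboolP hv].
- exact/asboolP.
- apply/asboolP => /(lin_ext_kernel augmentation_multilinear)/eqP.
  by rewrite lin_extU /= augmentation_one oner_eq0.
- by apply/asboolP; apply: (hD) => //; apply: hM.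
Qed.

HB.instance Definition _ :=
  isIdealr.Build htuple_alg segre_kernel segre_kernel_idealr.

Let segre_quot := @Quotient.quot htuple_alg (segre_kernel : idealr htuple_alg).

Definition segre : Type := segre_quot.

HB.instance Definition _ := GRing.ComNzRing.copy segre segre_quot.

Definition segre_pi (u : htuple_alg) : segre := \pi_segre_quot u.

HB.instance Definition _ :=
  GRing.RMorphism.copy segre_pi (\pi_segre_quot : htuple_alg -> segre_quot).

Definition segre_scale (a : k) (x : segre) : segre := segre_pi a%:A * x.

Lemma segre_scaleA a b x : segre_scale a (segre_scale b x) = segre_scale (a * b) x.
Proof.
rewrite /segre_scale mulrA -rmorphM; congr (_ * _).
by rewrite -scalerAl mul1r scalerA.
Qed.

Lemma segre_scale1 : left_id 1 segre_scale.
Proof. by move=> x; rewrite /segre_scale scale1r rmorph1 mul1r. Qed.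

Lemma segre_scaleDr : right_distributive segre_scale +%R.
Proof. by move=> a x y; rewrite /segre_scale mulrDr. Qed.

Lemma segre_scaleDl x : {morph segre_scale^~ x : a b / a + b}.
Proof. by move=> a b; rewrite /segre_scale scalerDl rmorphD mulrDl. Qed.

HB.instance Definition _ := GRing.Zmodule_isLmodule.Build k segre
  segre_scaleA segre_scale1 segre_scaleDr segre_scaleDl.

Lemma segre_scaleAl (a : k) (x y : segre) : a *: (x * y) = (a *: x) * y.
Proof. exact: mulrA. Qed.

HB.instance Definition _ := GRing.Lmodule_isLalgebra.Build k segre segre_scaleAl.
HB.instance Definition _ := GRing.Lalgebra_isComAlgebra.Build k segre.

Definition pure_tensor (t : htuple) : segre := segre_pi (hmonom t).

(* The lemmas up to [segre_universal] characterise [segre]: its product is componentwise on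
   pure tensors, which span it, and the universal property says that it is the
   direct sum over n of the tensor products of the (R_i)_n. *)
Lemma pure_tensor1 : pure_tensor htuple_one = 1.
Proof.
apply/eqP; rewrite -subr_eq0 -(rmorph1 segre_pi) -rmorphB.
rewrite -(rmorph0 segre_pi) -Quotient.idealrBE subr0.
by apply/asboolP => J _; apply; left.
Qed.

Lemma pure_tensorM s t :
  pure_tensor s * pure_tensor t = pure_tensor (htuple_mul s t).
Proof. by rewrite -rmorphM; congr segre_pi; apply: (mul_hmonom (Some s)). Qed.

Lemma segre_piZ a u : segre_pi (a *: u) = a *: segre_pi u.
Proof. by rewrite -[a *: u]mulr_algl rmorphM. Qed.

Lemma pure_tensor_multilinear : multilinear pure_tensor.
Proof.
move=> i a x y z xyz; apply/eqP; rewrite -segre_piZ -rmorphD.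
rewrite -Quotient.idealrBE; apply/asboolP => J _; apply; right.
by exists i, a, x, y, z.
Qed.

Lemma segre_span : kspan (range pure_tensor) = setT.
Proof.
apply/seteqP; split=> // x _ W [W0 WD] XW; elim/quotW: x => u.
rewrite [u]htuple_algE -/(segre_pi _) rmorph_sum /=.
elim/big_ind: _ => // [y z Wy Wz|m _]; first by rewrite -[y]scale1r; apply: WD.
rewrite segre_piZ -[_ *: _]addr0; apply: WD => //.
case: m => [t|]; first by apply: XW; exists t.
apply: XW; exists htuple_one => //; rewrite pure_tensor1.
exact: esym (rmorph1 segre_pi).
Qed.

Lemma segre_universal (W : lmodType k) (f : htuple -> W) : multilinear f ->
  exists g : segre -> W, linear g /\ forall t, g (pure_tensor t) = f t.
Proof.
move=> f_lin; pose g (x : segre) := lin_ext f (repr x).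
have gE u : g (segre_pi u) = lin_ext f u.
  apply/eqP; rewrite -subr_eq0 -linearB; apply/eqP.
  apply: lin_ext_kernel => //.
  have /eqP := reprK (segre_pi u).
  by rewrite -Quotient.idealrBE => /asboolP.
exists g; split=> [a x y|t]; last by rewrite gE lin_extU.
elim/quotW: x => u; elim/quotW: y => v.
have -> : a *: segre_pi u + segre_pi v = segre_pi (a *: u + v).
  by rewrite -segre_piZ -rmorphD.
by rewrite !gE linearP.
Qed.

Definition segre_piece (n : nat) : set segre :=
  kspan [set pure_tensor t | t in [set t | hdeg t = n]].

Definition segre_ideal_piece (I : forall i, set (R i)) (n : nat) : set segre :=
  kspan [set pure_tensor t | t in [set t | hdeg t = n /\ forall i, I i (hcomp t i)]].

Definition segre_ideal (I : forall i, set (R i)) : set segre :=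
  kspan (\bigcup_n segre_ideal_piece I n).

End SegreProduct.

(* Main.v *)
Require Import Defs.
From HB Require Import structures.
From mathcomp Require Import all_boot all_order all_algebra fieldext.
From mathcomp Require Import all_classical reals topology normedtype.
From mathcomp Require Import zify ring lra.

(* Write P = P_(i,m) for the degree m piece of R_i, and q = p^e. The degree n piece of the
   Frobenius power of I_1 # ... # I_r is the sum over d, with q d <= n, of the tensor products
   of the spaces A_d = A_(i,d) generated by the v^q u with v in (I_i)_d and u in P_(n - q d).
   If x, y in P_1 are parameters of R_i, then P_n = x^q P_(n-q) + y^q P_(n-q) for n >= 2 q + c;
   hence, if q J + c <= n < q (J + 1), the A_d with d < J are contained in A_(J-1), and the
   piece is the sum of the tensor products of the A_(J-1) and of the A_J. Its dimension is
   prod a_(J-1) + prod a_J - prod (a_(J-1) + a_J - s_J), where a_d = dim A_d and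
   s_J = dim (A_(J-1) + A_J). For n >= q (D + 1) + c it is the whole piece of the Segre product,
   so the colength is a finite sum of such terms up to O(q^r).

   Each of a_d, s_J is, up to O(1), a fixed piecewise linear function of (n, q), with rational
   coefficients and breakpoints ("ramp"). Indeed R_i is, up to bounded dimension, a lattice in a
   k(t)-space, t = x / y, on which elements of R_i act by commuting matrices; their p^e-th
   powers become simultaneously diagonalizable over a finite extension L of k(t), which reduces
   the question to the k-dimension of the solutions of a relation sum_i nu_i^q m_i = 0 in L with
   bounded poles. The dimension increases by the rank of the solutions of bounded degree,
   hence is piecewise linear in n; a p-basis of L compares q with p q and shows that the
   breakpoints grow by p up to O(1). They split into clusters at bounded distance, and the sum
   of the breakpoints below a gap is the degree of the Frobenius pull-back of a subbundle, which
   is r0 q + O(1) with r0 an integer. So the breakpoints are rational multiples of q, up to O(1).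

   The sum over n of a product of r ramps is then rho q^(r+1) + O(q^r) with rho rational, by
   the formula for sums of powers, whereas the Segre product has dimension r + 1. *)

Set Implicit Arguments.
Unset Strict Implicit.
Unset Printing Implicit Defensive.

Import Order.TTheory GRing.Theory Num.Theory.
Import numFieldNormedType.Exports.
Local Open Scope classical_set_scope.
Local Open Scope ring_scope.

(** * Dimensions of subspaces *)

(** The R_i may be neither reduced nor irreducible, so there is no smooth curve to carry vector
    bundles. What replaces it is that dimensions matter only up to O(1): such an error in one of the
    r factors costs O(q^(r-1)) in a degree n = O(q), hence O(q^r) in the sum over n. Torsion,
    denominators and changes of basis then become shifts of n by a constant, and what is left is
    linear algebra over a finite extension of k(t) filtered by pole order. The part of the
    Harder-Narasimhan filtration is played by the levels at which the rank of the sections jumps. A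
    gap between two jumps that exceeds the error constants can only widen under Frobenius, so the
    span of the sections below it is the pull-back of one fixed space; this is where an integer, and
    with it rationality, enters. Jumps that are never separated by such a gap all agree with their
    mean up to O(1). Krull dimension and length are given by chains of ideals. Both are translated
    into dimensions over k: a chain of primes forces growth, a lack of parameters produces primes,
    and a graded ideal of finite colength can be enlarged by one dimension at a time. *)

Section Dimension.
Variable k : fieldType.

Section OneSpace.
Variable V : lmodType k.
Implicit Types (W X Y : set V).

Definition lspan (T : finType) (e : T -> V) : set V :=
  [set x | exists a : T -> k, x = \sum_i a i *: e i].

Definition lindep (T : finType) (e : T -> V) : Prop :=
  forall a : T -> k, \sum_i a i *: e i = 0 -> forall i, a i = 0.

(** A relation, because [V] may be infinite-dimensional and [W] is only a set: finiteness is part of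
    the assertion. *)
Definition hasdim W n : Prop := exists2 e : 'I_n -> V, lindep e & W = lspan e.

Definition lcomb n (e : 'I_n -> V) (u : 'rV[k]_n) : V := \sum_i u 0 i *: e i.

Lemma lcomb_linear n (e : 'I_n -> V) : linear (lcomb e).
Proof.
move=> a u v; rewrite /lcomb scaler_sumr -big_split; apply: eq_bigr => i _.
by rewrite !mxE scalerDl scalerA.
Qed.
HB.instance Definition _ n (e : 'I_n -> V) :=
  GRing.isLinear.Build k 'rV[k]_n V _ (lcomb e) (lcomb_linear e).

Lemma lcomb_mul n m (e : 'I_n -> V) (u : 'rV[k]_m) (A : 'M[k]_(m, n)) :
  lcomb e (u *m A) = \sum_j u 0 j *: lcomb e (row j A).
Proof. by rewrite mulmx_sum_row linear_sum; apply: eq_bigr => j _; rewrite linearZ. Qed.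

Lemma lspan_lcomb n (e : 'I_n -> V) : lspan e = range (lcomb e).
Proof.
apply/seteqP; split=> [x [a ->]|_ [u _ <-]]; last by exists (u 0).
by exists (\row_i a i) => //; apply: eq_bigr => i _; rewrite mxE.
Qed.

Lemma lcomb_inj n (e : 'I_n -> V) : lindep e -> injective (lcomb e).
Proof.
move=> ind u v uv; apply/rowP => i; apply/eqP; rewrite -subr_eq0.
have : lcomb e (u - v) = 0 by rewrite linearB /= uv subrr.
by move=> /ind/(_ i); rewrite !mxE => ->.
Qed.

Lemma lspan_subspace (T : finType) (e : T -> V) : is_subspace (lspan e).
Proof.
split=> [|a _ _ [b ->] [c ->]].
  by exists (fun=> 0); rewrite big1 // => i _; rewrite scale0r.
exists (fun i => a * b i + c i); rewrite scaler_sumr -big_split; apply: eq_bigr => i _.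
by rewrite scalerDl scalerA.
Qed.

Lemma hasdim_subspace W n : hasdim W n -> is_subspace W.
Proof. by case=> e _ ->; apply: lspan_subspace. Qed.

Lemma subspaceD W x y : is_subspace W -> W x -> W y -> W (x + y).
Proof. by move=> [_ h] Wx Wy; rewrite -[x]scale1r; apply: h. Qed.

Lemma subspaceZ W a x : is_subspace W -> W x -> W (a *: x).
Proof. by move=> [h0 h] Wx; rewrite -[_ *: _]addr0; apply: h. Qed.

Lemma subspaceN W x : is_subspace W -> W x -> W (- x).
Proof. by move=> sW Wx; rewrite -scaleN1r; apply: subspaceZ. Qed.

Lemma subspaceB W x y : is_subspace W -> W x -> W y -> W (x - y).
Proof. by move=> sW Wx Wy; apply: subspaceD => //; apply: subspaceN. Qed.

Lemma subspace_sum W (T : Type) (s : seq T) (P : pred T) (f : T -> V) :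
  is_subspace W -> (forall i, P i -> W (f i)) -> W (\sum_(i <- s | P i) f i).
Proof.
move=> sW Wf; elim/big_ind: _ => //; first by case: sW.
by move=> x y; apply: subspaceD.
Qed.

Lemma lspan_sub W (T : finType) (e : T -> V) :
  is_subspace W -> (forall i, W (e i)) -> lspan e `<=` W.
Proof. by move=> sW We _ [a ->]; apply: subspace_sum => // i _; apply: subspaceZ. Qed.

Lemma lspan_mem (T : finType) (e : T -> V) i : lspan e (e i).
Proof.
exists (fun j => (j == i)%:R); rewrite (bigD1 i) //= eqxx scale1r big1 ?addr0 //.
by move=> j /negbTE ->; rewrite scale0r.
Qed.

Lemma hasdim_basis (T : finType) (e : T -> V) : lindep e -> hasdim (lspan e) #|T|.
Proof.
move=> ind; have bij : {on xpredT, bijective (@enum_val T predT)} by exact/onW_bij/enum_val_bij.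
exists (e \o enum_val) => [a a0 i|].
  rewrite -[i]enum_valK; apply: (ind (a \o enum_rank)).
  rewrite (reindex _ bij) -[RHS]a0; apply: eq_bigr => j _ /=.
  by rewrite enum_valK.
apply/seteqP; split=> _ [a ->].
  by exists (a \o enum_val); rewrite (reindex _ bij).
exists (a \o enum_rank); rewrite [RHS](reindex _ bij) /=.
by apply: eq_bigr => i _; rewrite enum_valK.
Qed.
End OneSpace.

(** A matrix of maximal rank with row space inside [S] spans [S], since adjoining a further vector
    of [S] would raise the rank. *)
Lemma rV_subspace m (S : set 'rV[k]_m) : is_subspace S ->
  exists M : 'M[k]_m, forall v, S v <-> (v <= M)%MS.
Proof.
move=> sS; pose P r := `[< exists2 M : 'M[k]_m, (\rank M = r)%N & forall v, (v <= M)%MS -> S v >].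
have P0 : exists r, P r.
  exists 0%N; apply/asboolP; exists 0; first exact: mxrank0.
  by move=> v; rewrite submx0 => /eqP ->; case: sS.
have Pb r : P r -> (r <= m)%N by move=> /asboolP[M <- _]; apply: rank_leq_col.
case: (ex_maxnP P0 Pb) => r /asboolP[M rM MS] max; exists M => v; split=> [Sv|/MS//].
have : P (\rank (M + v)%MS).
  apply/asboolP; exists (M + v)%MS => // u /sub_addsmxP[[a b] /= ->].
  apply: subspaceD => //; first by apply: MS; apply: submxMl.
  by rewrite [b]mx11_scalar mul_scalar_mx; apply: subspaceZ.
move=> /max; rewrite -rM => le; have := mxrank_leqif_eq (addsmxSl M v).
case=> _; rewrite eqn_leq le mxrankS ?addsmxSl // => /esym/andP[_ h].
exact: submx_trans (addsmxSr _ _) h.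
Qed.

Section DimTheory.
Variable V : lmodType k.
Implicit Types (W X Y : set V).

Lemma hasdim_mx m (e : 'I_m -> V) p (M : 'M[k]_(p, m)) : lindep e ->
  hasdim (lcomb e @` [set v | (v <= M)%MS]) (\rank M).
Proof.
move=> ind; exists (fun i => lcomb e (row i (row_base M))) => [a a0 i|].
  have : lcomb e ((\row_i a i) *m row_base M) = 0.
    rewrite mulmx_sum_row linear_sum -[RHS]a0; apply: eq_bigr => j _.
    by rewrite linearZ mxE.
  rewrite -(linear0 (lcomb e)) => /(lcomb_inj ind)/eqP.
  rewrite mulmx_free_eq0 ?row_base_free // => /eqP/rowP/(_ i).
  by rewrite !mxE.
apply/seteqP; split=> [_ [v /= vM <-]|_ [a ->]].
  have : (v <= row_base M)%MS by rewrite eq_row_base.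
  move=> /submxP[b ->]; exists (b 0).
  by rewrite mulmx_sum_row linear_sum; apply: eq_bigr => j _; rewrite linearZ.
exists ((\row_i a i) *m row_base M) => /=.
  by rewrite -(eq_row_base M) submxMl.
rewrite mulmx_sum_row linear_sum; apply: eq_bigr => j _.
by rewrite linearZ mxE.
Qed.

Lemma lspan_bound (T : finType) (e : T -> V) m (f : 'I_m -> V) : lindep e ->
  (forall i, lspan f (e i)) -> (#|T| <= m)%N.
Proof.
move=> ind ef.
have h i : exists u : 'rV[k]_m, e i = lcomb f u.
  by have := ef i; rewrite lspan_lcomb => -[u _ <-]; exists u.
have [M eM] := choice h.
pose A := \matrix_(i < #|T|) M (enum_val i).
suff : row_free A by rewrite /row_free => /eqP <-; exact: rank_leq_col.
rewrite -kermx_eq0; apply/eqP/row_matrixP => j; rewrite row0.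
set v := row j _; have vA : v *m A = 0 by rewrite -row_mul mulmx_ker row0.
have v0 := ind (fun i => v 0 (enum_rank i)) _.
apply/rowP => i; rewrite [RHS]mxE -[i]enum_valK v0 //.
have bij : {on xpredT, bijective (@enum_val T predT)} by exact/onW_bij/enum_val_bij.
rewrite (reindex _ bij); transitivity (lcomb f (v *m A)); last by rewrite vA linear0.
rewrite mulmx_sum_row linear_sum.
by apply: eq_bigr => l _; rewrite /= enum_valK linearZ eM rowK.
Qed.

Lemma hasdim_le W W' n m : W `<=` W' -> hasdim W n -> hasdim W' m -> (n <= m)%N.
Proof.
move=> WW [e ie We] [f _ W'f]; rewrite -[n]card_ord; apply: (lspan_bound ie (f := f)) => i.
by rewrite -W'f; apply: WW; rewrite We; apply: lspan_mem.
Qed.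

Lemma hasdim_inj W n m : hasdim W n -> hasdim W m -> n = m.
Proof. by move=> h1 h2; apply/eqP; rewrite eqn_leq (hasdim_le _ h1 h2) // (hasdim_le _ h2 h1). Qed.

Lemma hasdim_ge W n (T : finType) (e : T -> V) : hasdim W n -> lindep e ->
  (forall i, W (e i)) -> (#|T| <= n)%N.
Proof.
move=> hW ie We; apply: (hasdim_le _ (hasdim_basis ie) hW).
by apply: lspan_sub => //; apply: hasdim_subspace hW.
Qed.

(** Inside the span of a finite family a subspace becomes a row space, so that sums, intersections
    and dimensions are computed by matrix ranks. *)
Lemma sub_chart X m (e : 'I_m -> V) : is_subspace X -> X `<=` lspan e ->
  exists M : 'M[k]_m, X = lcomb e @` [set v | (v <= M)%MS].
Proof.
move=> sX Xe; have [|M hM] := @rV_subspace m (lcomb e @^-1` X).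
  split=> [|a u v /= Xu Xv]; first by rewrite /= linear0; case: sX.
  by rewrite linearP; case: sX => _; apply.
exists M; apply/seteqP; split=> [x Xx|_ [v /= /hM Xv <-]//].
have := Xe _ Xx; rewrite lspan_lcomb => -[u _ ux]; exists u => //=.
by apply/hM; rewrite /= ux.
Qed.

Lemma hasdim_sub X W m : is_subspace X -> X `<=` W -> hasdim W m ->
  exists2 n, (n <= m)%N & hasdim X n.
Proof.
move=> sX XW [e ie We]; have [|M XM] := @sub_chart X m e sX; first by rewrite -We.
by exists (\rank M); [apply: rank_leq_col|rewrite XM; apply: hasdim_mx].
Qed.

Definition sadd X Y : set V := [set z | exists x y, [/\ X x, Y y & z = x + y]].

Lemma sadd_subspace X Y : is_subspace X -> is_subspace Y -> is_subspace (sadd X Y).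
Proof.
move=> sX sY; split=> [|a _ _ [x [y [Xx Yy ->]]] [x' [y' [Xx' Yy' ->]]]].
  by exists 0, 0; rewrite addr0; split=> //; [case: sX|case: sY].
exists (a *: x + x'), (a *: y + y'); split; [by case: sX => _; apply|by case: sY => _; apply|].
by rewrite scalerDr addrACA.
Qed.

Lemma sadd_subl X Y : is_subspace Y -> X `<=` sadd X Y.
Proof. by move=> [Y0 _] x Xx; exists x, 0; rewrite addr0. Qed.

Lemma sadd_subr X Y : is_subspace X -> Y `<=` sadd X Y.
Proof. by move=> [X0 _] x Xx; exists 0, x; rewrite add0r. Qed.

Lemma sadd_sub X Y W : is_subspace W -> X `<=` W -> Y `<=` W -> sadd X Y `<=` W.
Proof. by move=> sW XW YW _ [x [y [/XW Wx /YW Wy ->]]]; apply: subspaceD. Qed.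

Lemma setI_subspace X Y : is_subspace X -> is_subspace Y -> is_subspace (X `&` Y).
Proof.
move=> [X0 sX] [Y0 sY]; split=> [|a x y [? ?] [? ?]]; first by split.
by split; [apply: sX|apply: sY].
Qed.

Lemma lcomb_adds m (e : 'I_m -> V) (A B : 'M[k]_m) :
  sadd (lcomb e @` [set v | (v <= A)%MS]) (lcomb e @` [set v | (v <= B)%MS]) =
  lcomb e @` [set v | (v <= A + B)%MS].
Proof.
apply/seteqP; split=> [_ [_ [_ [[u /= uA <-] [v /= vB <-] ->]]]|_ [u /= /sub_addsmxP[[a b] /= ->] <-]].
  exists (u + v); last by rewrite linearD.
  by apply: addmx_sub_adds.
exists (lcomb e (a *m A)), (lcomb e (b *m B)); rewrite -linearD; split=> //.
  by exists (a *m A) => //=; apply: submxMl.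
by exists (b *m B) => //=; apply: submxMl.
Qed.

Lemma lcomb_cap m (e : 'I_m -> V) (A B : 'M[k]_m) : lindep e ->
  (lcomb e @` [set v | (v <= A)%MS]) `&` (lcomb e @` [set v | (v <= B)%MS]) =
  lcomb e @` [set v | (v <= A :&: B)%MS].
Proof.
move=> ie; apply/seteqP; split=> [_ [[u /= uA <-] [v /= vB /(lcomb_inj ie) uv]]|_ [u /= + <-]].
  by exists u => //=; rewrite sub_capmx uA -uv.
by rewrite sub_capmx => /andP[uA uB]; split; exists u.
Qed.
End DimTheory.

Section Maps.
Variables (V V' : lmodType k) (f : {linear V -> V'}).

(** Rank-nullity: in coordinates the kernel is the row space of [M], and the complement [M^C] maps
    isomorphically onto the image. *)
Lemma hasdim_img W n : hasdim W n -> exists a b,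
  [/\ hasdim (f @` W) a, hasdim (W `&` [set x | f x = 0]) b & n = (a + b)%N].
Proof.
move=> [e ie We]; have [|M hM] := @rV_subspace n [set u | f (lcomb e u) = 0].
  split=> [|a u v /= u0 v0]; first by rewrite /= !linear0.
  by rewrite !linearP /= u0 v0 scaler0 addr0.
exists (\rank (M^C)%MS), (\rank M); split; last by rewrite mxrank_compl subnK ?rank_leq_col.
- exists (fun i => f (lcomb e (row i (row_base M^C)%MS))) => [a a0 i|].
    have u0 : f (lcomb e ((\row_i a i) *m row_base M^C%MS)) = 0.
      rewrite lcomb_mul linear_sum; apply: etrans a0; apply: eq_bigr => j _.
      by rewrite linearZ mxE.
    have /hM uM : [set u | f (lcomb e u) = 0] ((\row_i a i) *m row_base M^C%MS) by [].
    have : ((\row_i a i) *m row_base M^C%MS <= M :&: M^C)%MS.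
      by rewrite sub_capmx uM -(eq_row_base M^C%MS) submxMl.
    rewrite capmx_compl submx0 mulmx_free_eq0 ?row_base_free // => /eqP/rowP/(_ i).
    by rewrite !mxE.
  apply/seteqP; split=> [_ [x + <-]|_ [a ->]].
    rewrite We lspan_lcomb => -[u _ <-].
    have /sub_addsmxP[[a b] /= uab] : (u <= M + row_base M^C)%MS.
      by rewrite (adds_eqmx (eqmx_refl _) (eq_row_base _)) submx_full // addsmx_compl_full.
    exists (b 0); rewrite uab !linearD /=.
    have /hM -> : (a *m M <= M)%MS by apply: submxMl.
    rewrite add0r lcomb_mul linear_sum; apply: eq_bigr => j _.
    by rewrite linearZ.
  exists (lcomb e ((\row_i a i) *m row_base M^C%MS)).
    by rewrite We lspan_lcomb; eexists.
  rewrite lcomb_mul linear_sum; apply: eq_bigr => j _.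
  by rewrite linearZ mxE.
- suff -> : W `&` [set x | f x = 0] = lcomb e @` [set v | (v <= M)%MS] by apply: hasdim_mx.
  apply/seteqP; split=> [x []|_ [u /= /hM fu <-]].
    by rewrite We lspan_lcomb => -[u _ <-] /= fu; exists u => //; apply/hM.
  by split=> //; rewrite We lspan_lcomb; exists u.
Qed.

Lemma hasdim_img_inj W n : (forall x, W x -> f x = 0 -> x = 0) ->
  hasdim W n -> hasdim (f @` W) n.
Proof.
move=> finj hW; have [a [b [ha hb ->]]] := hasdim_img hW.
suff -> : b = 0%N by rewrite addn0.
have h0 : hasdim (W `&` [set x | f x = 0]) 0.
  exists (fun i : 'I_0 => 0) => [c _ []//|].
  apply/seteqP; split=> [x [Wx /= fx]|_ [c ->]].
    by exists (fun=> 0); rewrite big_ord0; apply: finj.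
  by rewrite big_ord0; split; [case: (hasdim_subspace hW)|rewrite /= linear0].
exact: hasdim_inj hb h0.
Qed.
End Maps.

Section MoreDim.
Variable V : lmodType k.
Implicit Types (W X Y : set V).

Lemma lspan_hasdim m (e : 'I_m -> V) : exists2 n, (n <= m)%N & hasdim (lspan e) n.
Proof.
have h : hasdim [set: 'rV[k]_m] m.
  exists (fun i => delta_mx 0 i) => [a a0 i|].
    have := congr1 (fun u : 'rV_m => u 0 i) a0; rewrite summxE (bigD1 i) //= big1 => [|j /negbTE ji].
      by rewrite !mxE !eqxx mulr1 addr0.
    by rewrite !mxE eqxx eq_sym ji mulr0.
  apply/seteqP; split=> // u _; exists (u 0); exact: row_sum_delta.
have [a [b [ha _ mab]]] := hasdim_img (lcomb e) h.
by exists a; [rewrite mab leq_addr|rewrite lspan_lcomb].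
Qed.

Lemma hasdim_le_card X (T : finType) (e : T -> V) : is_subspace X ->
  X `<=` lspan e -> exists2 n, (n <= #|T|)%N & hasdim X n.
Proof.
move=> sX Xe; have bij : {on xpredT, bijective (@enum_val T predT)} by exact/onW_bij/enum_val_bij.
have [n nT hn] := lspan_hasdim (e \o (@enum_val T predT)).
have [|m mn hm] := hasdim_sub sX _ hn; last by exists m => //; apply: leq_trans mn nT.
by move=> x /Xe[a ->]; exists (a \o enum_val); rewrite (reindex _ bij).
Qed.

(** A basis of the sum serves as common coordinates for [X] and [Y]. *)
Lemma hasdim_add X Y n m : hasdim X n -> hasdim Y m -> exists a b,
  [/\ hasdim (sadd X Y) a, hasdim (X `&` Y) b & (a + b = n + m)%N].
Proof.
move=> hX hY; have sX := hasdim_subspace hX; have sY := hasdim_subspace hY.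
have [e ie Xe] := hX; have [f jf Yf] := hY.
pose g (i : 'I_n + 'I_m) := match i with inl i => e i | inr j => f j end.
have [|r _ [h ih Wh]] := @hasdim_le_card (sadd X Y) _ g (sadd_subspace sX sY).
  move=> _ [x [y [+ + ->]]]; rewrite Xe Yf => -[a ->] [b ->].
  apply: subspaceD; first exact: lspan_subspace.
    apply: subspace_sum => [|i _]; first exact: lspan_subspace.
    by apply: subspaceZ; [exact: lspan_subspace|exact: (lspan_mem g (inl i))].
  apply: subspace_sum => [|i _]; first exact: lspan_subspace.
  by apply: subspaceZ; [exact: lspan_subspace|exact: (lspan_mem g (inr i))].
have [|A XA] := @sub_chart _ X _ h sX; first by rewrite -Wh; apply: sadd_subl.
have [|B YB] := @sub_chart _ Y _ h sY; first by rewrite -Wh; apply: sadd_subr.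
exists (\rank (A + B)%MS), (\rank (A :&: B)%MS); split.
- by rewrite XA YB lcomb_adds; apply: hasdim_mx.
- by rewrite XA YB lcomb_cap //; apply: hasdim_mx.
rewrite mxrank_sum_cap; congr (_ + _)%N.
  by apply: (@hasdim_inj V X) => //; rewrite XA; apply: hasdim_mx.
by apply: (@hasdim_inj V Y) => //; rewrite YB; apply: hasdim_mx.
Qed.

Lemma hasdim0 : hasdim ([set 0] : set V) 0.
Proof.
exists (fun i : 'I_0 => 0) => [c _ []//|].
apply/seteqP; split=> [x ->|_ [c ->]]; last by rewrite big_ord0.
by exists (fun=> 0); rewrite big_ord0.
Qed.

Lemma hasdim_add_le X Y n m a : hasdim X n -> hasdim Y m -> hasdim (sadd X Y) a ->
  (a <= n + m)%N.
Proof.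
move=> hX hY ha; have [a' [b [ha' _ <-]]] := hasdim_add hX hY.
by rewrite (hasdim_inj ha ha') leq_addr.
Qed.

Lemma hasdim_eq X Y n : hasdim X n -> hasdim Y n -> X `<=` Y -> X = Y.
Proof.
move=> hX hY XY; apply/seteqP; split=> // y Yy; apply: contrapT => nXy.
have [e ie Xe] := hX.
pose g (i : 'I_1 + 'I_n) := if i is inr i then e i else y.
have ig : lindep g.
  move=> a; rewrite big_sumType big_ord1 /= => a0.
  have aN : a (inl ord0) = 0.
    apply/eqP; apply: contra_notT nXy => aN; rewrite Xe.
    have -> : y = - (a (inl ord0))^-1 *: \sum_i a (inr i) *: e i.
      apply: (scalerI aN); rewrite scalerA mulrN divff // scaleN1r.
      by apply/eqP; rewrite -addr_eq0 a0.
    by apply: subspaceZ; [exact: lspan_subspace|exists (a \o inr)].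
  move: a0; rewrite aN scale0r add0r => /(ie (a \o inr)) h [i|i]; last exact: h.
  by rewrite ord1.
have : (#|{: 'I_1 + 'I_n}| <= n)%N.
  apply: (hasdim_ge hY ig) => -[i|i] //=.
  by apply: XY; rewrite Xe; apply: lspan_mem.
by rewrite card_sum !card_ord ltnn.
Qed.

Lemma hasdim_lt X Y n m : hasdim X n -> hasdim Y m -> X `<` Y -> (n < m)%N.
Proof.
move=> hX hY [XY nYX]; rewrite ltn_neqAle (hasdim_le XY hX hY) andbT.
by apply/eqP => nm; apply: nYX; rewrite (@hasdim_eq X Y n) // nm.
Qed.
End MoreDim.

(** A basis of a complement, stated as independence modulo [X]: this is the form in which
    [slope_pind] compares leading coefficients. *)
Lemma complement (V : lmodType k) (X Y : set V) a b :
  hasdim X a -> hasdim Y b -> X `<=` Y -> exists u : 'I_(b - a) -> V,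
    (forall i, Y (u i)) /\ forall c : 'I_(b - a) -> k, X (\sum_i c i *: u i) -> forall i, c i = 0.
Proof.
move=> hX [e ie Ye] XY; have [|M XM] := @sub_chart _ X _ e (hasdim_subspace hX).
  by rewrite -Ye.
have rM : (\rank (M^C)%MS = b - a)%N.
  by rewrite mxrank_compl; congr (_ - _)%N; apply: (@hasdim_inj _ X) => //; rewrite XM; apply: hasdim_mx.
rewrite -rM; exists (fun i => lcomb e (row i (row_base M^C)%MS)); split=> [i|c].
  by rewrite Ye lspan_lcomb; eexists.
rewrite -(_ : lcomb e ((\row_i c i) *m row_base M^C%MS) = \sum_i c i *: lcomb e (row i (row_base M^C)%MS)); last first.
  by rewrite lcomb_mul; apply: eq_bigr => j _; rewrite mxE.
rewrite XM => -[v /= vM /(lcomb_inj ie) vE] i.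
have : ((\row_i c i) *m row_base M^C%MS <= M :&: M^C)%MS.
  by rewrite sub_capmx -{1}vE vM -(eq_row_base M^C%MS) submxMl.
rewrite capmx_compl submx0 mulmx_free_eq0 ?row_base_free // => /eqP/rowP/(_ i).
by rewrite !mxE.
Qed.

(** * Semilinear maps *)

Section Semilinear.
Variables (V V' : lmodType k) (s : k -> k) (f : V -> V').
Hypotheses (s_surj : forall a, exists b, s b = a) (s0 : forall a, s a = 0 -> a = 0).
Hypotheses (fD : {morph f : x y / x + y}) (fZ : forall a x, f (a *: x) = s a *: f x).

(** Applied with [s] the Frobenius of k, which is onto because k is perfect, and with [s = id] to
    additive maps that commute with scalars but are not packed as linear maps. *)
Lemma hasdim_semilinear W n : (forall x, W x -> f x = 0 -> x = 0) ->
  hasdim W n -> hasdim (f @` W) n.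
Proof.
move=> finj [e ie We]; have f0 : f 0 = 0.
  by apply: (addrI (f 0)); rewrite -fD !addr0.
have fsum (a : 'I_n -> k) : f (\sum_i a i *: e i) = \sum_i s (a i) *: f (e i).
  by elim/big_rec2: _ => // i y x _ <-; rewrite fD fZ.
have lift (a : 'I_n -> k) : exists b, forall i, s (b i) = a i.
  by have [b hb] := choice (fun i => s_surj (a i)); exists b.
exists (f \o e) => [a a0 i|].
  have [b ba] := lift a; rewrite -ba.
  have b0 : \sum_i b i *: e i = 0.
    apply: finj; first by rewrite We; exists b.
    by rewrite fsum -[RHS]a0; apply: eq_bigr => j _; rewrite ba.
  (* It remains to see that [s 0 = 0]: scaling by 0 gives [s 0 *: f (e i) = 0], and [f (e i)] is
     nonzero because [e i] is. *)
  rewrite (ie _ b0); have := fZ 0 (e i); rewrite scale0r f0.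
  move=> /esym/eqP; rewrite scaler_eq0 => /orP[/eqP//|/eqP fe0].
  have := finj (e i) _ fe0; rewrite We => /(_ (lspan_mem e i)) e0.
  have := ie (fun j => (j == i)%:R) _ i; rewrite eqxx => h.
  suff /eqP : (1 : k) = 0 by rewrite oner_eq0.
  apply: h; rewrite (bigD1 i) //= eqxx e0 scaler0 big1 ?addr0 // => j /negbTE ->.
  by rewrite scale0r.
apply/seteqP; split=> [_ [x + <-]|_ [a ->]].
  by rewrite We => -[a ->]; exists (s \o a); rewrite fsum.
have [b ba] := lift a; exists (\sum_i b i *: e i); first by rewrite We; exists b.
by rewrite fsum; apply: eq_bigr => j _; rewrite ba.
Qed.
End Semilinear.
End Dimension.

(** * Graded algebras and Krull dimension *)

Section IdealFacts.
Variable A : comNzRingType.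
Implicit Types (I J : set A).

Lemma ideal0 I : is_ideal I -> I 0. Proof. by case. Qed.
Lemma idealD I x y : is_ideal I -> I x -> I y -> I (x + y). Proof. by case=> _ h _; apply: h. Qed.
Lemma idealMl I a x : is_ideal I -> I x -> I (a * x). Proof. by case=> _ _; apply. Qed.
Lemma idealMr I a x : is_ideal I -> I x -> I (x * a).
Proof. by move=> hI Ix; rewrite mulrC; apply: idealMl. Qed.
Lemma idealN I x : is_ideal I -> I x -> I (- x).
Proof. by move=> hI Ix; rewrite -mulN1r; apply: idealMl. Qed.
Lemma idealB I x y : is_ideal I -> I x -> I y -> I (x - y).
Proof. by move=> hI Ix Iy; apply: idealD => //; apply: idealN. Qed.
Lemma ideal_sum I (T : Type) (s : seq T) (Q : pred T) (f : T -> A) : is_ideal I ->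
  (forall i, Q i -> I (f i)) -> I (\sum_(i <- s | Q i) f i).
Proof. by move=> hI If; elim/big_ind: _ => //; [apply: ideal0|move=> x y; apply: idealD]. Qed.

Definition idadd I m (x : 'I_m -> A) : set A :=
  [set z | exists y (a : 'I_m -> A), I y /\ z = y + \sum_i a i * x i].

Lemma idadd_ideal I m (x : 'I_m -> A) : is_ideal I -> is_ideal (idadd I x).
Proof.
move=> hI; split.
- by exists 0, (fun=> 0); split; [exact: ideal0|rewrite big1 ?addr0 // => i _; rewrite mul0r].
- move=> _ _ [y [a [Iy ->]]] [z [b [Iz ->]]]; exists (y + z), (fun i => a i + b i); split.
    exact: idealD.
  by rewrite addrACA -big_split; congr (_ + _); apply: eq_bigr => i _; rewrite mulrDl.
- move=> c _ [y [a [Iy ->]]]; exists (c * y), (fun i => c * a i); split; first exact: idealMl.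
  by rewrite mulrDr mulr_sumr; congr (_ + _); apply: eq_bigr => i _; rewrite mulrA.
Qed.

Lemma idadd_sub I m (x : 'I_m -> A) : I `<=` idadd I x.
Proof. by move=> z Iz; exists z, (fun=> 0); split=> //; rewrite big1 ?addr0 // => i _; rewrite mul0r. Qed.

Lemma idadd_mem I m (x : 'I_m -> A) i : is_ideal I -> idadd I x (x i).
Proof.
move=> hI; exists 0, (fun j => (j == i)%:R); split; first exact: ideal0.
rewrite (bigD1 i) //= eqxx mul1r big1 ?addr0 ?add0r // => j /negbTE ->.
by rewrite mul0r.
Qed.

End IdealFacts.

Section KspanFacts.
Variables (k : fieldType) (V : lmodType k).
Implicit Types X W : set V.

Lemma kspan_subspace X : is_subspace (kspan X).
Proof.
split=> [W [] //|a x y hx hy W sW XW]; case: (sW) => _; apply; [exact: hx|exact: hy].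
Qed.
Lemma kspan_incl X : X `<=` kspan X. Proof. by move=> x Xx W _; apply. Qed.
Lemma kspan_min X W : is_subspace W -> X `<=` W -> kspan X `<=` W.
Proof. by move=> sW XW x; apply. Qed.
Lemma kspanZ X a x : kspan X x -> kspan X (a *: x).
Proof. exact: (@subspaceZ _ _ (kspan X) a x (kspan_subspace X)). Qed.
Lemma kspanS X W : X `<=` W -> kspan X `<=` kspan W.
Proof. by move=> XW; apply: kspan_min (kspan_subspace _) _ => x /XW; apply: kspan_incl. Qed.

End KspanFacts.

Lemma ideal_subspace (k : fieldType) (A : comAlgType k) (I : set A) : is_ideal I -> is_subspace I.
Proof.
move=> hI; split=> [|a x y Ix Iy]; first exact: ideal0.
by apply: idealD => //; rewrite -mulr_algl; apply: idealMl.
Qed.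

Lemma idealZ (k : fieldType) (A : comAlgType k) (I : set A) a x : is_ideal I -> I x -> I (a *: x).
Proof. by move=> hI Ix; rewrite -mulr_algl; apply: idealMl. Qed.

(** The common ground of the R_i and of their Segre product: finiteness is kept only for the piece
    of degree 1, and generation in degree 1 is stated piece by piece. *)
Record grading (k : fieldType) (A : comAlgType k) (P : nat -> set A) : Prop := Grading {
  gr_sub : forall n, is_subspace (P n);
  gr_ex : forall x, exists N (c : nat -> A), (forall n, P n (c n)) /\ x = \sum_(n < N) c n;
  gr_dir : forall N (c : nat -> A), (forall n, P n (c n)) -> \sum_(n < N) c n = 0 ->
    forall n, (n < N)%N -> c n = 0;
  gr_mul : forall m n x y, P m x -> P n y -> P (m + n)%N (x * y);
  gr_0 : P 0%N = range (fun a : k => a%:A);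
  gr_fin : exists m, hasdim (P 1%N) m;
  gr_gen : forall n, P n.+1 `<=` kspan [set z | exists a b, [/\ P 1%N a, P n b & z = a * b]]
}.

Section Grading.
Variables (k : closedFieldType) (A : comAlgType k) (P : nat -> set A).
Hypothesis gP : grading P.
Let sP := gr_sub gP.

(* The homogeneous decomposition of f.[1] is stored as the polynomial f. *)
Definition hpoly (f : {poly A}) : Prop := forall n, P n f`_n.

Lemma hpolyD f g : hpoly f -> hpoly g -> hpoly (f + g).
Proof. by move=> hf hg n; rewrite coefD; apply: subspaceD. Qed.

Lemma hpolyN f : hpoly f -> hpoly (- f).
Proof. by move=> hf n; rewrite coefN; apply: subspaceN. Qed.

Lemma hpolyM f g : hpoly f -> hpoly g -> hpoly (f * g).
Proof.
move=> hf hg n; rewrite coefM; apply: subspace_sum => // i _.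
by have := gr_mul gP (hf i) (hg (n - i)%N); rewrite subnKC // -ltnS.
Qed.

Lemma hpolyXn n x : P n x -> hpoly (x *: 'X^n).
Proof.
move=> Px m; rewrite coefZ coefXn; case: eqP => [->|_]; first by rewrite mulr1.
by rewrite mulr0; case: (sP m).
Qed.

Lemma hpoly_inj f g : hpoly f -> hpoly g -> f.[1] = g.[1] -> f = g.
Proof.
move=> hf hg fg; apply/eqP; rewrite -subr_eq0; apply/eqP.
have h := hpolyD hf (hpolyN hg); set e := f - g in h *.
have e1 : \sum_(i < size e) e`_i = 0.
  have : e.[1] = 0 by rewrite hornerD hornerN fg subrr.
  by rewrite horner_coef; under eq_bigr do rewrite expr1n mulr1.
apply/polyP => i; rewrite coef0; case: (ltnP i (size e)) => [lt|]; last exact: nth_default.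
exact: (gr_dir gP (c := fun i => e`_i)) lt.
Qed.

Lemma hpoly_ex x : exists f, hpoly f /\ f.[1] = x.
Proof.
have [N [c [Pc ->]]] := gr_ex gP x; exists (\poly_(n < N) c n); split=> [n|].
  by rewrite coef_poly; case: ifP => // _; case: (sP n).
by rewrite horner_poly; apply: eq_bigr => i _; rewrite expr1n mulr1.
Qed.

Definition dec x : {poly A} := projT1 (cid (hpoly_ex x)).

Lemma decP x : hpoly (dec x). Proof. by rewrite /dec; case: cid => f []. Qed.
Lemma decK x : (dec x).[1] = x. Proof. by rewrite /dec; case: cid => f []. Qed.
Lemma decE x f : hpoly f -> f.[1] = x -> dec x = f.
Proof. by move=> hf fx; apply: hpoly_inj => //; rewrite ?decK //; apply: decP. Qed.
Lemma decD x y : dec (x + y) = dec x + dec y.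
Proof. by apply: decE; [apply: hpolyD; apply: decP|rewrite hornerD !decK]. Qed.
Lemma decM x y : dec (x * y) = dec x * dec y.
Proof. by apply: decE; [apply: hpolyM; apply: decP|rewrite hornerM !decK]. Qed.
Lemma dec_hom n x : P n x -> dec x = x *: 'X^n.
Proof. by move=> Px; apply: decE; [apply: hpolyXn|rewrite hornerZ hornerXn expr1n mulr1]. Qed.
Lemma P1 : P 0%N 1.
Proof. by rewrite (gr_0 gP); exists 1 => //; rewrite scale1r. Qed.
Lemma P0 n : P n 0. Proof. by case: (sP n). Qed.
Lemma dec0 : dec 0 = 0. Proof. by rewrite (dec_hom (P0 0)) scale0r. Qed.
Lemma decZ a x : dec (a *: x) = a%:A *: dec x.
Proof.
rewrite -[a *: x]mulr_algl decM (dec_hom (n := 0%N)) ?expr0 ?alg_polyC ?mul_polyC //.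
by rewrite (gr_0 gP); exists a.
Qed.
Lemma dec_sum (T : Type) (s : seq T) (Q : pred T) (f : T -> A) :
  dec (\sum_(i <- s | Q i) f i) = \sum_(i <- s | Q i) dec (f i).
Proof. by elim/big_rec2: _ => [|i y x _ <-]; rewrite ?dec0 ?decD. Qed.
Lemma dec_sumE x : x = \sum_(i < size (dec x)) (dec x)`_i.
Proof.
rewrite -{1}[x]decK horner_coef; apply: eq_bigr => i _.
by rewrite expr1n mulr1.
Qed.

Definition homog (I : set A) : Prop := is_ideal I /\ forall x n, I x -> I (dec x)`_n.

Lemma homog_idadd I m d (x : 'I_m -> A) : homog I -> (forall i, P d (x i)) -> homog (idadd I x).
Proof.
move=> [hI Ih] Px; have hI' := idadd_ideal x hI; split=> // _ n [y [a [Iy ->]]].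
rewrite decD coefD dec_sum coef_sum; apply: idealD => //.
  by apply: idadd_sub; apply: Ih.
apply: ideal_sum => // i _; rewrite decM (dec_hom (Px i)) -scalerAr coefZ.
by apply: idealMr => //; apply: idadd_mem.
Qed.

Lemma P_decomp m n : P (m + n)%N `<=` kspan [set z | exists a b, [/\ P m a, P n b & z = a * b]].
Proof.
elim: m => [|m IH] z.
  move=> Pz; apply: kspan_incl; exists 1, z; split=> //; [exact: P1|by rewrite mul1r].
rewrite addSn => /(gr_gen gP); apply: kspan_min; first exact: kspan_subspace.
move=> _ [a [b [Pa /IH Wb ->]]]; move: b Wb.
apply: kspan_min => [|_ [c [d [Pc Pd ->]]]].
  split=> [|e u v /= Wu Wv]; first by rewrite /= mulr0; case: (kspan_subspace [set z | exists a b, [/\ P m.+1 a, P n b & z = a * b]]).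
  by rewrite mulrDr -scalerAr; case: (kspan_subspace [set z | exists a b, [/\ P m.+1 a, P n b & z = a * b]]) => _; apply.
apply: kspan_incl; exists (a * c), d; split=> //; last by rewrite mulrA.
by rewrite -add1n; apply: (gr_mul gP).
Qed.

Lemma P_incl_ideal I c n : is_ideal I -> P c `<=` I -> (c <= n)%N -> P n `<=` I.
Proof.
move=> hI PI cn z; rewrite -(subnK cn) => /P_decomp; apply: kspan_min.
  exact: ideal_subspace.
by move=> _ [a [b [_ /PI Ib ->]]]; apply: idealMl.
Qed.

Lemma homog_prime I : homog I -> ~ I 1 ->
  (forall m n a b, P m a -> P n b -> I (a * b) -> I a \/ I b) -> is_prime I.
Proof.
move=> [hI Ih] I1 pr; split=> // x y Ixy; apply: contrapT => /not_orP[nx ny].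
have ex z : ~ I z -> exists i, ~~ `[< I (dec z)`_i >].
  move=> nz; apply: contrapT => /forallNP h; apply: nz; rewrite [z]dec_sumE.
  by apply: ideal_sum => // i _; have /negP := h i; rewrite negbK => /asboolP.
(* [i] and [j] are the least degrees of components outside [I]. In degree i + j of the product every
   term other than the product of these two components lies in [I]. *)
case: (ex_minnP (ex _ nx)) => i /asboolP ni mi.
case: (ex_minnP (ex _ ny)) => j /asboolP nj mj.
have := Ih _ (i + j)%N Ixy; rewrite decM coefM.
have li : (i < (i + j).+1)%N by rewrite ltnS leq_addr.
rewrite (bigD1 (Ordinal li)) //= addKn => Is.
have : I ((dec x)`_i * (dec y)`_j).
  set u := _ * _ in Is *; set v := \sum_(_ | _) _ in Is.
  rewrite -[u](addrK v); apply: idealB => //; apply: ideal_sum => // l li'.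
  have {li'} nl : (l : nat) != i by [].
  case: (ltngtP l i) => [lt|gt|e]; last by rewrite e eqxx in nl.
    apply: idealMr => //; apply/asboolP/negPn/negP => /mi.
    by rewrite leqNgt lt.
  apply: idealMl => //; apply/asboolP/negPn/negP => /mj.
  by rewrite leqNgt => /negP; apply; have := ltn_ord l; lia.
by case/(pr i j (dec x)`_i (dec y)`_j (decP x i) (decP y j)).
Qed.

(** The quotient by [I] has a linear system of parameters of length m: by [P_incl_ideal], filling
    one degree c means filling all later ones. This is the graded form of having dimension at most
    m. *)
Definition sopdim I m : Prop := exists x : 'I_m -> A,
  (forall i, P 1%N (x i)) /\ exists c, P c `<=` idadd I x.

Lemma sopdim_step I m x : is_ideal I -> P 1%N x ->
  sopdim (idadd I (fun _ : 'I_1 => x)) m -> sopdim I m.+1.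
Proof.
move=> hI Px [y [Py [c Pc]]].
exists (fun i => if unlift ord0 i is Some j then y j else x); split.
  by move=> i; case: unlift.
exists c => z /Pc [u [a [[v [b [Iv ->]]] ->]]].
exists v, (fun i => if unlift ord0 i is Some j then a j else b ord0); split=> //.
rewrite big_ord1 big_ord_recl unlift_none addrA; congr (_ + _).
by apply: eq_bigr => i _; rewrite liftK.
Qed.

Lemma P_hasdim n : exists m, hasdim (P n) m.
Proof.
elim: n => [|n [m [e _ Pn]]].
  suff [m _ hm] : exists2 m, (m <= #|'I_1|)%N & hasdim (P 0) m by exists m.
  apply: (@hasdim_le_card _ _ _ _ (fun _ : 'I_1 => 1)) => // x.
  by rewrite (gr_0 gP) => -[a _ <-]; exists (fun=> a); rewrite big_ord1.
have [d [f _ P1]] := gr_fin gP.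
pose g (ij : 'I_d * 'I_m) := f ij.1 * e ij.2.
suff [r _ hr] : exists2 r, (r <= #|{: 'I_d * 'I_m}|)%N & hasdim (P n.+1) r by exists r.
apply: (@hasdim_le_card _ _ _ _ g) => // x /(gr_gen gP).
apply: kspan_min; first exact: lspan_subspace.
move=> _ [a [b [+ + ->]]]; rewrite P1 Pn => -[u ->] [v ->].
exists (fun ij => u ij.1 * v ij.2); rewrite mulr_suml.
transitivity (\sum_i \sum_j (u i * v j) *: g (i, j)); last first.
  by rewrite pair_bigA /=; apply: eq_bigr => -[].
apply: eq_bigr => i _; rewrite mulr_sumr; apply: eq_bigr => j _.
by rewrite -scalerAl -scalerAr scalerA.
Qed.

(* Being a system of parameters is an open condition on the line x + t w. *)
Lemma sop_line I m c (x w : 'I_m -> A) : homog I -> (forall i, P 1%N (x i)) ->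
  (forall i, P 1%N (w i)) -> P c `<=` idadd I x -> exists2 q : {poly k}, q != 0 &
  forall t, ~~ root q t -> P c.+1 `<=` idadd I (fun i => x i + t *: w i).
Proof.
move=> [hI Ih] Px Pw Pc; have [N hN] := P_hasdim c.+1.
have [e ie PE] := hN.
have Pe j : P c.+1 (e j) by rewrite PE; apply: lspan_mem.
have h (j : 'I_N) : exists ua : A * ('I_m -> A), [/\ I ua.1, forall i, P c (ua.2 i) & e j = ua.1 + \sum_i ua.2 i * x i].
  have [u [a [Iu ea]]] := P_incl_ideal (idadd_ideal x hI) Pc (leqnSn c) (Pe j).
  exists ((dec u)`_c.+1, fun i => (dec (a i))`_c); split; [exact: Ih|by move=> i; apply: decP|].
  have := congr1 (fun z => (dec z)`_c.+1) ea; rewrite (dec_hom (Pe j)) coefZ coefXn eqxx mulr1 => ->.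
  rewrite decD coefD dec_sum coef_sum; congr (_ + _); apply: eq_bigr => i _.
  by rewrite decM (dec_hom (Px i)) -scalerAr coefZ expr1 coefMX mulrC.
have [ua hua] := choice h.
have hB j : exists b : 'I_N -> k, \sum_i (ua j).2 i * w i = \sum_l b l *: e l.
  suff : P c.+1 (\sum_i (ua j).2 i * w i) by rewrite PE.
  apply: subspace_sum => // i _; rewrite -addn1; apply: (gr_mul gP) => //.
  by case: (hua j).
have [b hb] := choice hB.
(* Modulo I + (x + t w) the basis [e] of degree c + 1 satisfies (1 + t B) e = 0, so it vanishes
   there wherever det (1 + t B) is nonzero. This determinant is the required polynomial in t; it is
   1 at t = 0. *)
pose B : 'M[k]_N := \matrix_(j, l) b j l.
pose M : 'M[{poly k}]_N := 1%:M + 'X *: map_mx polyC B.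
have MT t : map_mx (horner_eval t) M = 1%:M + t *: B.
  apply/matrixP => i j; rewrite !mxE /= /horner_eval !hornerE.
  by case: (i == j); rewrite ?mulr1n ?mulr0n !hornerE.
exists (\det M).
  apply/eqP => d0; have : (\det (map_mx (horner_eval 0) M)) = 0 by rewrite det_map_mx d0 rmorph0.
  by rewrite MT scale0r addr0 det1 => /eqP; rewrite oner_eq0.
move=> t rt; have uT : 1%:M + t *: B \in unitmx.
  by rewrite unitmxE unitfE -MT det_map_mx.
set z := fun i => _; have hz := idadd_ideal z hI.
rewrite PE; apply: lspan_sub; first exact: ideal_subspace.
have cong j : idadd I z (\sum_l (1%:M + t *: B) j l *: e l).
  have -> : \sum_l (1%:M + t *: B) j l *: e l = (ua j).1 + \sum_i (ua j).2 i * z i.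
    have [_ _ ej] := hua j.
    transitivity (e j + t *: \sum_l b j l *: e l).
      rewrite (bigD1 j) //= [in RHS](bigD1 j) //= !mxE eqxx scalerDl scale1r -addrA; congr (_ + _).
      rewrite scalerDr scalerA; congr (_ + _); rewrite scaler_sumr; apply: eq_bigr => l lj.
      by rewrite !mxE eq_sym (negbTE lj) add0r scalerA.
    rewrite -hb ej -addrA; congr (_ + _); rewrite scaler_sumr -big_split.
    by apply: eq_bigr => i _; rewrite /z mulrDr -scalerAr.
  apply: idealD => //; first by apply: idadd_sub; case: (hua j).
  by apply: ideal_sum => // i _; apply: idealMl => //; apply: idadd_mem.
move=> j; have -> : e j = \sum_l invmx (1%:M + t *: B) j l *: \sum_r (1%:M + t *: B) l r *: e r.
  transitivity (\sum_r (invmx (1%:M + t *: B) *m (1%:M + t *: B)) j r *: e r).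
    rewrite mulVmx // (bigD1 j) //= mxE eqxx scale1r big1 ?addr0 // => r.
    by rewrite eq_sym mxE => /negbTE ->; rewrite scale0r.
  under [RHS]eq_bigr do rewrite scaler_sumr; rewrite exchange_big /=.
  apply: eq_bigr => r _; rewrite mxE scaler_suml; apply: eq_bigr => l _.
  by rewrite scalerA.
apply: subspace_sum => [|l _]; first exact: ideal_subspace.
by apply: subspaceZ; first exact: ideal_subspace.
Qed.

(** On the line joining x to y, parameters for [I] fail at finitely many t, and so do parameters for
    [J], with 1 - t in place of t; k is infinite. *)
Lemma sop_common I J m : homog I -> homog J -> sopdim I m -> sopdim J m ->
  exists x : 'I_m -> A, (forall i, P 1%N (x i)) /\
    exists c, P c `<=` idadd I x /\ P c `<=` idadd J x.
Proof.
move=> hI hJ [x [Px [c Pc]]] [y [Py [d Pd]]].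
have Pw i : P 1%N (y i - x i) by apply: subspaceB.
have Pw' i : P 1%N (x i - y i) by apply: subspaceB.
have [q q0 hq] := sop_line hI Px Pw Pc; have [r r0 hr] := sop_line hJ Py Pw' Pd.
have : q * (r \Po (1 - 'X)) != 0.
  rewrite mulf_neq0 //; apply/eqP => rX; move/eqP: r0; apply.
  have := congr1 (fun s => s \Po (1 - 'X)) rX; rewrite comp_poly0 -comp_polyA.
  suff -> : (1 - 'X) \Po (1 - 'X) = 'X :> {poly k} by rewrite comp_polyXr.
  by rewrite comp_polyB comp_polyC comp_polyX opprB addrC subrK.
move=> /closed_nonrootP[t]; rewrite rootM negb_or => /andP[tq tr].
exists (fun i => x i + t *: (y i - x i)); split=> [i|].
  by apply: subspaceD => //; apply: subspaceZ.
exists (maxn c.+1 d.+1); split.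
  by apply: P_incl_ideal (hq _ tq) (leq_maxl _ _); apply: idadd_ideal; case: hI.
have tr' : ~~ root r (1 - t) by move: tr; rewrite /root horner_comp !hornerE.
have := hr _ tr'; have -> : (fun i => y i + (1 - t) *: (x i - y i)) = (fun i => x i + t *: (y i - x i)).
  apply/funext => i; rewrite -[x i - y i]opprB scalerN scalerBl scale1r; set v := t *: _.
  by rewrite !opprB [y i + _]addrCA [y i + _]addrCA subrr addr0 addrC.
move=> h; apply: P_incl_ideal h (leq_maxr _ _); apply: idadd_ideal; by case: hJ.
Qed.

Lemma chain_bound (F : set (set A)) n (y : 'I_n -> A) : F !=set0 -> total_on F subset ->
  (forall j, exists2 X, F X & X (y j)) -> exists2 X, F X & forall j, X (y j).
Proof.
move=> [X0 FX0] tot; elim: n y => [|n IH] y h; first by exists X0 => // -[].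
have [X FX Xy] := IH (y \o lift ord0) (fun j => h (lift ord0 j)).
have [Y FY Yy] := h ord0.
have [XY|YX] := tot _ _ FX FY.
  by exists Y => // j; case: (unliftP ord0 j) => [i ->|-> //]; apply/XY/Xy.
by exists X => // j; case: (unliftP ord0 j) => [i ->|->]; [apply: Xy|apply: YX].
Qed.

(* "sopdim > m" passes to unions of chains because it concerns one finite-dimensional
   piece P c at a time, so Zorn's lemma applies without any noetherianity. *)
Lemma prime_above I m : homog I -> ~ sopdim I m ->
  exists J, [/\ homog J, is_prime J, I `<=` J & ~ sopdim J m].
Proof.
move=> hI nI; pose G J := [/\ homog J, I `<=` J & ~ sopdim J m].
pose Q (J : set A) := J = set0 \/ G J.
have [F FQ tot|J [QJ maxJ]] := @Zorn_bigcup A Q.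
  have [[X0 [FX0 X0n]]|none] := pselect (exists X, F X /\ X !=set0); last first.
    left; apply/seteqP; split=> // x [X FX Xx]; apply: none; exists X; split=> //.
    by exists x.
  have good X x : F X -> X x -> G X.
    by move=> FX Xx; case: (FQ _ FX) => // X0'; rewrite X0' in Xx.
  have [x0 X0x0] := X0n; have [[hX0 _] IX0 _] := good _ _ FX0 X0x0.
  right; split; [split; [split|]| |].
  - by exists X0 => //; apply: ideal0.
  - move=> x y [X FX Xx] [Y FY Yy]; have [XY|YX] := tot _ _ FX FY.
      by exists Y => //; have [[hY _] _ _] := good _ _ FY Yy; apply: idealD (XY _ Xx) Yy.
    by exists X => //; have [[hX _] _ _] := good _ _ FX Xx; apply: idealD Xx (YX _ Yy).
  - by move=> a x [X FX Xx]; have [[hX _] _ _] := good _ _ FX Xx; exists X => //; apply: idealMl.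
  - by move=> x n [X FX Xx]; exists X => //; case: (good _ _ FX Xx) => -[_ h] _ _; apply: h.
  - by move=> x /IX0 X0x; exists X0.
  move=> [x [Px [c Pc]]]; have [N [e _ PE]] := P_hasdim c.
  have h j : exists ya : A * ('I_m -> A), (\bigcup_(X in F) X) ya.1 /\ e j = ya.1 + \sum_i ya.2 i * x i.
    have : P c (e j) by rewrite PE; apply: lspan_mem.
    by move=> /Pc [y [a ya]]; exists (y, a).
  have [ya hya] := choice h.
  have [||X FX Xy] := @chain_bound F N (fun j => (ya j).1) _ tot; first by exists X0.
    by move=> j; have [[X FX Xy] _] := hya j; exists X.
  have gX : G X.
    case: (FQ _ FX) => // XE; case: N {PE h hya Xy} e ya => [|N] e ya in Xy PE hya *; last first.
      by have := Xy ord0; rewrite XE.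
    exfalso; have [_ _] := good _ _ FX0 X0x0; apply; exists x; split=> //; exists c.
    by rewrite PE => _ [a ->]; rewrite big_ord0; apply: (ideal0 (idadd_ideal x hX0)).
  have [[hX _] _] := gX; apply; exists x; split=> //; exists c; rewrite PE.
  apply: lspan_sub => [|j]; first exact/ideal_subspace/idadd_ideal.
  by have [_ ->] := hya j; exists (ya j).1, (ya j).2.
have {QJ} [hJ IJ nJ] : G J.
  case: QJ => // J0; exfalso; apply: (maxJ I); last by right; split.
  by rewrite J0; split=> // /(_ 0); apply; case: hI => /ideal0.
have max d a : P d a -> ~ J a -> sopdim (idadd J (fun _ : 'I_1 => a)) m.
  move=> Pa nJa; apply: contrapT => ns; apply: (maxJ (idadd J (fun _ : 'I_1 => a))).
    split=> [|h]; first exact: idadd_sub.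
    by apply: nJa; apply: h; apply: (idadd_mem _ ord0); case: hJ.
  right; split=> //; first by apply: homog_idadd hJ _ => _; exact: Pa.
  by move=> x /IJ; apply: idadd_sub.
exists J; split=> //; apply: homog_prime => // [J1|d d' a b Pa Pb Jab].
  apply: nJ; exists (fun=> 0); split=> [i|]; first exact: P0.
  exists 0%N => x _; apply: idadd_sub; rewrite -[x]mulr1; apply: idealMl => //; by case: hJ.
(* If a b lies in J but a and b do not, then J + (a) and J + (b) have common parameters x by
   maximality. The product of J + (a) + (x) and J + (b) + (x) lies in J + (x), so x would be
   parameters for J. *)
apply: contrapT => /not_orP[na nb].
have hJa : homog (idadd J (fun _ : 'I_1 => a)) by apply: homog_idadd hJ _ => _; exact: Pa.
have hJb : homog (idadd J (fun _ : 'I_1 => b)) by apply: homog_idadd hJ _ => _; exact: Pb.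
have [x [Px [c [Pca Pcb]]]] := sop_common hJa hJb (max _ _ Pa na) (max _ _ Pb nb).
have hK := idadd_ideal x hJ.1; have JK := @idadd_sub _ J _ x.
apply: nJ; exists x; split=> //; exists (c + c)%N => z /P_decomp.
apply: kspan_min; first exact: ideal_subspace.
move=> _ [u [v [/Pca [_ [e [[y [r [Jy ->]]] ->]]] /Pcb [_ [e' [[y' [r' [Jy' ->]]] ->]]] ->]]].
rewrite !big_ord1.
set s := \sum_i e i * x i; set s' := \sum_i e' i * x i.
have Ks : idadd J x s by apply: ideal_sum => // i _; apply: idealMl => //; apply: idadd_mem; case: hJ.
have Ks' : idadd J x s' by apply: ideal_sum => // i _; apply: idealMl => //; apply: idadd_mem; case: hJ.
rewrite -addrA [y + _]addrC -addrA mulrDl; apply: idealD => //; last first.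
  by apply: idealMr => //; apply: idealD => //; apply: JK.
rewrite -addrA [y' + _]addrC -addrA mulrDr; apply: idealD => //; last first.
  by apply: idealMl => //; apply: idealD => //; apply: JK.
by rewrite mulrACA; apply: idealMl => //; apply: JK.
Qed.

Lemma irrelevant_prime : is_prime [set z | (dec z)`_0%N = 0].
Proof.
have scal z : exists b : k, (dec z)`_0%N = b%:A.
  by have := decP z 0; rewrite (gr_0 gP) => -[b _ <-]; exists b.
split=> [|/=|x y /=].
- split=> [|x y /= x0 y0|a x /= x0]; first by rewrite /= dec0 coef0.
    by rewrite decD coefD x0 y0 addr0.
  by rewrite decM coefM big_ord1 x0 mulr0.
- by rewrite (dec_hom P1) coefZ coefXn mulr1 => /eqP; rewrite oner_eq0.
rewrite decM coefM big_ord1; have [a ->] := scal x; have [b ->] := scal y.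
rewrite -scalerAl mul1r scalerA => /eqP; rewrite scaler_eq0 oner_eq0 orbF mulf_eq0.
by move=> /orP[] /eqP ->; rewrite scale0r; [left|right].
Qed.

Lemma homog_proper I : homog I -> ~ I 1 -> I `<=` [set z | (dec z)`_0%N = 0].
Proof.
move=> [hI Ih] I1 z Iz /=; have := Ih _ 0%N Iz; have := decP z 0.
rewrite (gr_0 gP) => -[a _ <-] Ia; have [->|a0] := eqVneq a 0; first by rewrite scale0r.
exfalso; apply: I1; have -> : 1 = a^-1 *: (a%:A : A) by rewrite scalerA mulVf // scale1r.
exact: idealZ.
Qed.

(** Each step passes to a prime J above [I] with the same failure, then to J + (x) for a linear form
    x outside J, where one parameter fewer must still fail. The last prime of the chain is the
    irrelevant ideal. *)
Lemma prime_chain_ex m I : homog I -> ~ sopdim I m ->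
  exists C : nat -> set A, [/\ forall i, (i <= m.+1)%N -> is_prime (C i),
    forall i, (i < m.+1)%N -> C i `<` C i.+1 & I `<=` C 0%N].
Proof.
elim: m I => [|m IH] I hI nI; have [J [hJ pJ IJ nJ]] := prime_above hI nI;
  have hJ' := hJ.1.
  exists (fun i => if i is 0 then J else [set z | (dec z)`_0%N = 0]); split=> //.
    by case=> [|[|//]] _ //; apply: irrelevant_prime.
  case=> // _; split; first by apply: homog_proper => //; case: pJ.
  move=> h; apply: nJ; exists (fun=> 0); split=> [i|]; first exact: P0.
  exists 1%N => x Px; apply: idadd_sub; apply: h => /=.
  by rewrite (dec_hom Px) coefZ coefXn mulr0.
have [x [Px nJx]] : exists x, P 1%N x /\ ~ J x.
  apply: contrapT => /forallNP h; apply: nJ; exists (fun=> 0); split=> [i|]; first exact: P0.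
  exists 1%N => x Px; apply: idadd_sub; apply: contrapT => nJx.
  by apply: (h x).
have hJx : homog (idadd J (fun _ : 'I_1 => x)) by apply: homog_idadd hJ _ => _; exact: Px.
have [|C [Cp Cs JC]] := IH _ hJx; first by move=> h; apply: nJ; apply: sopdim_step h.
exists (fun i => if i is j.+1 then C j else J); split=> //.
- by case=> [|i] //; apply: Cp.
- case=> [|i] lt; last exact: Cs.
  split=> [z Jz|h]; first by apply: JC; apply: idadd_sub.
  by apply: nJx; apply: h; apply: JC; apply: (idadd_mem _ ord0).
Qed.

Lemma homog0 : homog [set 0].
Proof.
split; first split=> [//|_ _ -> ->|a _ ->]; rewrite /= ?addr0 ?mulr0 //.
by move=> _ n ->; rewrite dec0 coef0.
Qed.

(** The sum of the pieces of degree less than n, as [dec x] has one coefficient per degree. *)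
Definition Acum n : set A := [set x | (size (dec x) <= n)%N].

Lemma Acum_subspace n : is_subspace (Acum n).
Proof.
split=> [|a x y /= hx hy]; first by rewrite /Acum /= dec0 size_poly0.
rewrite /Acum /= decD decZ; apply: leq_trans (size_polyD _ _) _.
by rewrite geq_max hy andbT; apply: leq_trans (size_scale_leq _ _) hx.
Qed.

Lemma Acum_hom n d x : P d x -> (d < n)%N -> Acum n x.
Proof.
move=> Px dn; rewrite /Acum /= (dec_hom Px); apply: leq_trans (size_scale_leq _ _) _.
by rewrite size_polyXn.
Qed.

Lemma AcumS n a b : hasdim (Acum n) a -> hasdim (P n) b -> hasdim (Acum n.+1) (a + b).
Proof.
move=> ha hb; have [c [d [hc hd <-]]] := hasdim_add ha hb.
have -> : d = 0%N.
  apply: hasdim_inj hd _; suff -> : Acum n `&` P n = [set 0] by apply: hasdim0.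
  apply/seteqP; split=> [x [/= sx Px]|_ ->]; last by split; [case: (Acum_subspace n)|exact: P0].
  have := leq_sizeP _ _ sx n (leqnn n).
  by rewrite (dec_hom Px) coefZ coefXn eqxx mulr1.
rewrite addn0; suff <- : sadd (Acum n) (P n) = Acum n.+1 by [].
apply/seteqP; split.
  apply: sadd_sub; first exact: Acum_subspace.
    by move=> x /= h; apply: leq_trans h _.
  by move=> x Px; apply: Acum_hom Px _.
move=> x /= sx; exists (x - (dec x)`_n), (dec x)`_n; split; [|exact: decP|by rewrite subrK].
apply/leq_sizeP => j nj; rewrite decD -scaleN1r decZ coefD coefZ (dec_hom (decP x n)) coefZ coefXn.
rewrite scaleN1r mulN1r; case: eqP => [->|/eqP ne]; first by rewrite mulr1 subrr.
by rewrite mulr0 subr0; apply: (leq_sizeP _ _ sx); rewrite ltn_neqAle eq_sym ne.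
Qed.

Lemma Acum0 : hasdim (Acum 0) 0.
Proof.
suff -> : Acum 0 = [set 0] by apply: hasdim0.
apply/seteqP; split=> [x|_ ->]; last by case: (Acum_subspace 0).
by rewrite /Acum /= leqn0 size_poly_eq0 => /eqP x0; rewrite [x]dec_sumE x0 size_poly0 big_ord0.
Qed.

Lemma Acum_hasdim n : exists m, hasdim (Acum n) m.
Proof.
elim: n => [|n [a ha]]; first by exists 0%N; apply: Acum0.
by have [b hb] := P_hasdim n; exists (a + b)%N; apply: AcumS.
Qed.

(** Exponents below N in L variables. The recursion splits off the first variable, which is the one
    [chain_indep] eliminates. *)
Fixpoint mindex N L : finType := if L is L'.+1 then ('I_N * mindex N L')%type else unit.
Fixpoint monom N L (z : nat -> A) : mindex N L -> A :=
  match L return mindex N L -> A with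
  | 0 => fun=> 1
  | L'.+1 => fun t => z 0%N ^+ t.1 * monom (z \o succn) t.2
  end.

Lemma card_mindex N L : #|mindex N L| = (N ^ L)%N.
Proof. by elim: L => [|L IH] /=; rewrite ?card_unit // card_prod card_ord IH expnS. Qed.

Lemma monom_size N L z D (t : mindex N L) : (forall i, (size (dec (z i)) <= D.+1)%N) ->
  (size (dec (monom z t)) <= L * N * D + 1)%N.
Proof.
elim: L z t => [|L IH] z /= t hz.
  by rewrite (dec_hom P1); apply: leq_trans (size_scale_leq _ _) _; rewrite size_polyXn.
have hX i : (size (dec (z 0%N ^+ i)) <= i * D + 1)%N.
  elim: i => [|i IHi]; first by rewrite (dec_hom P1); apply: leq_trans (size_scale_leq _ _) _; rewrite size_polyXn.
  rewrite exprS decM; apply: leq_trans (size_polyMleq _ _) _.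
  apply: (@leq_trans (D.+1 + (i * D + 1)).-1); last by rewrite mulSn; lia.
  by rewrite -!subn1 leq_sub2r // leq_add.
rewrite decM; apply: leq_trans (size_polyMleq _ _) _; rewrite mulSn mulnDl.
apply: (@leq_trans ((t.1 * D + 1) + (L * N * D + 1)).-1).
  by rewrite -!subn1 leq_sub2r // leq_add // IH // => i; apply: hz.
have : (t.1 * D <= N * D)%N by rewrite leq_mul2r ltnW ?orbT.
lia.
Qed.

(* A relation among z_0, z_1, ... modulo C 0 can be divided by a power of z_0 and
   then reduced modulo z_0, which gives a relation among z_1, ... modulo C 1. *)
Lemma chain_indep N L (C : nat -> set A) (z : nat -> A) (f : mindex N L -> k) :
  (forall i, (i <= L)%N -> is_prime (C i)) -> (forall i, (i < L)%N -> C i `<=` C i.+1) ->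
  (forall i, (i < L)%N -> C i.+1 (z i) /\ ~ C i (z i)) ->
  C 0%N (\sum_t f t *: monom z t) -> forall t, f t = 0.
Proof.
elim: L C z f => [|L IH] C z f Cp Cs Cz /=.
  have [hC C1 _] := Cp 0%N (leqnn 0).
  move=> h [] ; have [//|f0] := eqVneq (f tt) 0; exfalso; apply: C1.
  have {}h : C 0%N (f tt *: 1).
    by rewrite (_ : f tt *: 1 = \sum_t f t *: 1) // (bigD1 tt) //= big1 ?addr0 // => -[].
  have -> : 1 = (f tt)^-1 *: (f tt *: 1) :> A by rewrite scalerA mulVf // scale1r.
  exact: idealZ.
move=> h; pose g (a : 'I_N) := \sum_t f (a, t) *: monom (z \o succn) t.
have {}h : C 0%N (\sum_(a < N) z 0%N ^+ a * g a).
  suff -> : \sum_(a < N) z 0%N ^+ a * g a = \sum_t f t *: (z 0%N ^+ t.1 * monom (z \o succn) t.2) by [].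
  transitivity (\sum_(a < N) \sum_(t : mindex N L) f (a, t) *: (z 0%N ^+ a * monom (z \o succn) t)).
    by apply: eq_bigr => a _; rewrite mulr_sumr; apply: eq_bigr => t _; rewrite scalerAr.
  by rewrite pair_bigA /=; apply: eq_bigr => -[].
suff main a : forall t, f (a, t) = 0 by case=> a t; apply: main.
have [m] := ubnP (val a); elim: m a => // m IHm a am.
apply: (IH (C \o succn) (z \o succn) (fun t => f (a, t))) => [i iL|i iL|i iL|].
- exact: Cp.
- exact: Cs.
- exact: Cz.
have [hC0 _ pr0] := Cp 0%N (leq0n _); have [hC1 _ _] := Cp 1%N isT.
have [C1z C0z] := Cz 0%N isT.
have h2 : C 0%N (z 0%N ^+ a * (g a + \sum_(b < N | (a < b)%N) z 0%N ^+ (b - a) * g b)).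
  rewrite mulrDr [X in _ + X]mulr_sumr; move: h; rewrite (bigD1 a) //= (bigID (fun b : 'I_N => (a < b)%N)) /=.
  rewrite addrA [X in _ + X]big1 ?addr0 => [|b /andP[ba ab]].
    suff -> : \sum_(i < N | (i != a) && (a < i)%N) z 0%N ^+ i * g i =
      \sum_(b < N | (a < b)%N) z 0%N ^+ a * (z 0%N ^+ (b - a) * g b) by [].
    apply: eq_big => [b|b /andP[_ ab]]; first by case: (ltnP a b) => ab; rewrite ?andbF // andbT -val_eqE neq_ltn ab orbT.
    by rewrite mulrA -exprD subnKC // ltnW.
  rewrite /g big1 ?mulr0 // => t _; rewrite IHm ?scale0r //.
  have : (b < a)%N by rewrite ltn_neqAle val_eqE ba leqNgt.
  by move=> /leq_trans; apply.
have {}h2 : C 0%N (g a + \sum_(b < N | (a < b)%N) z 0%N ^+ (b - a) * g b).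
  move: h2; set w := g a + _; move: w => w; elim: (nat_of_ord a) => [|i IHi]; first by rewrite mul1r.
  by rewrite exprS -mulrA => /pr0[//|]; apply: IHi.
rewrite /= -/(g a) -[g a](addrK (\sum_(b < N | (a < b)%N) z 0%N ^+ (b - a) * g b)).
apply: idealB => //; first exact: Cs.
apply: ideal_sum => // b ab; apply: idealMr => //.
by rewrite -(subnSK ab) exprS; apply: idealMr.
Qed.

(** Elements z_i of C_(i+1) outside C_i give N^L independent monomials in degrees at most L N D, so
    a chain of length L forces growth of order L. *)
Lemma chain_growth L : prime_chain A L -> exists D, forall N n,
  hasdim (Acum (L * N * D + 1)) n -> (N ^ L <= n)%N.
Proof.
move=> [C [Cp Cs]].
have hz i : exists z, (i < L)%N -> C i.+1 z /\ ~ C i z.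
  have [iL|] := ltnP i L; last by exists 0.
  have [_ h] := Cs i iL; apply: contrapT => /forallNP hn; apply: h => z Cz.
  by apply: contrapT => nz; apply: (hn z).
have [z' hz'] := choice hz; pose z i := if (i < L)%N then z' i else 0.
pose D := (\max_(i < L) size (dec (z i)))%N; exists D => N n hn.
have zD i : (size (dec (z i)) <= D.+1)%N.
  have [iL|iL] := ltnP i L; last by rewrite /z ltnNge iL /= dec0 size_poly0.
  by apply: leqW; apply: (leq_bigmax (F := fun i : 'I_L => size (dec (z i))) (Ordinal iL)).
rewrite -card_mindex; apply: (hasdim_ge hn (e := @monom N L z)) => [f f0 t|t].
  apply: (@chain_indep N L C z f Cp) => // [i /Cs[]//|i iL|].
    by rewrite /z iL; apply: hz'.
  by rewrite f0; have [/ideal0] := Cp 0%N (leq0n _).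
exact: monom_size.
Qed.

(** Every degree from c on lies in the ideal of the parameters, so A is spanned by the monomials in
    x times a basis [e] of the degrees below c. *)
Lemma sop_growth m : sopdim [set 0] m -> exists K, forall n,
  exists2 a, (a <= K * n.+1 ^ m)%N & hasdim (Acum n) a.
Proof.
move=> [x [Px [c Pc]]]; have [b [e _ PE]] := Acum_hasdim c.
exists b => n.
pose g (t : {ffun 'I_m -> 'I_n.+1} * 'I_b) : A := (\prod_i x i ^+ t.1 i) * e t.2.
suff [a] : exists2 a, (a <= #|{: {ffun 'I_m -> 'I_n.+1} * 'I_b}|)%N & hasdim (Acum n) a.
  by rewrite card_prod card_ffun !card_ord mulnC; exists a.
apply: (@hasdim_le_card _ _ _ _ g (Acum_subspace n)).
pose S j := kspan [set y | exists (al : 'I_m -> nat) l, (\sum_i al i <= j)%N /\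
  y = (\prod_i x i ^+ al i) * e l].
have SS i j : (i <= j)%N -> S i `<=` S j.
  move=> ij; apply: kspanS => _ [al [l [h ->]]]; exists al, l; split=> //.
  exact: leq_trans h ij.
have PS j : P j `<=` S j.
  elim: j => [|j IHj].
    move=> y; rewrite /S.
    case: (ltnP 0 c) => [c0 Py|].
      have : Acum c y by apply: Acum_hom Py c0.
      rewrite PE => -[u ->]; apply: subspace_sum => [|l _]; first exact: kspan_subspace.
      apply: kspanZ.
      apply: kspan_incl; exists (fun=> 0%N), l; split; first by rewrite big1.
      by rewrite big1 ?mul1r // => i _.
    (* c = 0 is impossible: it would put 1 into an ideal generated by linear forms. *)
    rewrite leqn0 => /eqP c0 Py; have P1' := P1; rewrite -c0 in P1'.
    exfalso; have [z [a [-> /(congr1 (fun y => (dec y)`_0%N))]]] := Pc _ P1'.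
    rewrite add0r dec_sum coef_sum (dec_hom P1) coefZ coefXn mulr1 big1.
      by move=> /eqP; rewrite oner_eq0.
    by move=> i _; rewrite decM (dec_hom (Px i)) -scalerAr coefZ expr1 coefMX mulr0.
  have [jc|cj] := ltnP j.+1 c.
    move=> y Py; have : Acum c y by apply: Acum_hom Py jc.
    rewrite PE => -[u ->]; apply: subspace_sum => [|l _]; first exact: kspan_subspace.
    apply: kspanZ.
    apply: kspan_incl; exists (fun=> 0%N), l; split; first by rewrite big1.
    by rewrite big1 ?mul1r // => i _.
  move=> y Py; have [z [a [-> ya]]] := P_incl_ideal (idadd_ideal x homog0.1) Pc cj Py.
  have {ya} -> : y = \sum_i (dec (a i))`_j * x i.
    have := congr1 (fun z => (dec z)`_j.+1) ya.
    rewrite (dec_hom Py) coefZ coefXn eqxx mulr1 add0r dec_sum coef_sum => ->.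
    apply: eq_bigr => i _.
    by rewrite decM (dec_hom (Px i)) -scalerAr coefZ expr1 coefMX mulrC.
  apply: subspace_sum => [|i _]; first exact: kspan_subspace.
  have := IHj _ (decP (a i) j); move: (_`_j) => w; move: w.
  apply: kspan_min => [|_ [al [l [sal ->]]]].
    split=> [|d u v /= Su Sv]; first by rewrite /= mul0r; case: (kspan_subspace [set y | exists (al : 'I_m -> nat) l, (\sum_i al i <= j.+1)%N /\ y = (\prod_i x i ^+ al i) * e l]).
    by rewrite mulrDl -scalerAl; case: (kspan_subspace [set y | exists (al : 'I_m -> nat) l, (\sum_i al i <= j.+1)%N /\ y = (\prod_i x i ^+ al i) * e l]) => _; apply.
  apply: kspan_incl; exists (fun i' => (i' == i) + al i')%N, l; split.
    by rewrite big_split /= (bigD1 i) //= eqxx big1 ?addn0 ?add1n // => i' /negbTE ->.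
  rewrite mulrAC; congr (_ * _); under [RHS]eq_bigr do rewrite exprD.
  rewrite big_split /= mulrC; congr (_ * _).
  by rewrite (bigD1 i) //= eqxx expr1 big1 ?mulr1 // => i' /negbTE ->.
move=> y /= sy; rewrite [y]dec_sumE; apply: subspace_sum => [|j _]; first exact: lspan_subspace.
have /SS : (j <= n)%N by apply: ltnW; apply: leq_trans (ltn_ord j) sy.
move=> /(_ _ (PS _ _ (decP y j))); apply: kspan_min; first exact: lspan_subspace.
move=> _ [al [l [sal ->]]].
have -> : (\prod_i x i ^+ al i) * e l = g ([ffun i => inord (al i)], l).
  rewrite /g /=; congr (_ * _); apply: eq_bigr => i _; rewrite ffunE inordK // ltnS.
  by apply: leq_trans sal; rewrite (bigD1 i) //= leq_addr.
exact: lspan_mem.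
Qed.
End Grading.

(** * Filtered extensions of k(t) *)

Section RestrictionOfScalars.
Variables (k : fieldType) (L : nzRingType) (j : {rmorphism k -> L}) (V : lmodType L).
(** The [let] keeps [j] in the type, so that the scalar action attached to it is the one along
    [j]. *)
Definition restr : Type := let _ := j in V.
HB.instance Definition _ := GRing.Zmodule.copy restr V.
Definition restr_scale (a : k) (v : restr) : restr := (j a *: (v : V)).
Lemma restr_scaleA a b v : restr_scale a (restr_scale b v) = restr_scale (a * b) v.
Proof. by rewrite /restr_scale scalerA rmorphM. Qed.
Lemma restr_scale1 : left_id 1 restr_scale.
Proof. by move=> v; rewrite /restr_scale rmorph1 scale1r. Qed.
Lemma restr_scaleDr : right_distributive restr_scale +%R.
Proof. by move=> a u v; rewrite /restr_scale scalerDr. Qed.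
Lemma restr_scaleDl v : {morph restr_scale^~ v : a b / a + b}.
Proof. by move=> a b; rewrite /restr_scale rmorphD scalerDl. Qed.
HB.instance Definition _ := GRing.Zmodule_isLmodule.Build k restr
  restr_scaleA restr_scale1 restr_scaleDr restr_scaleDl.
Lemma restrZ (a : k) (v : restr) : a *: v = (j a *: (v : V)) :> V.
Proof. by []. Qed.
End RestrictionOfScalars.

Notation "f %:F" := (tofrac f) : ring_scope.

Lemma frac_ex (R : idomainType) (a : {fraction R}) :
  exists2 D : R, D != 0 & exists n, D%:F * a = n%:F.
Proof.
elim/quotW: a => x; exists (frac x).2; first exact: denom_ratioP.
exists (frac x).1.
unlock FracField.tofrac; rewrite -[LHS]FracField.pi_mul; apply/eqmodP.
rewrite /= FracField.equivfE /FracField.mulf !numden_Ratio ?mulf_neq0 ?oner_eq0 ?denom_ratioP //.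
by rewrite !mulr1 !mul1r mulrC.
Qed.

Lemma clear_denom (F : fieldType) (T : finType) (a : T -> {fraction {poly F}}) :
  exists2 D : {poly F}, D != 0 & exists n, forall i,
    exists2 f : {poly F}, (size f <= n)%N & D%:F * a i = f%:F.
Proof.
have h i : exists Dn : {poly F} * {poly F}, Dn.1 != 0 /\ Dn.1%:F * a i = Dn.2%:F.
  by have [D D0 [n e]] := frac_ex (a i); exists (D, n).
have [Dn hDn] := choice h.
exists (\prod_i (Dn i).1); first by apply/prodf_neq0 => i _; case: (hDn i).
pose f i := (\prod_(j | j != i) (Dn j).1) * (Dn i).2.
exists (\max_i size (f i))%N => i; exists (f i); first exact: (leq_bigmax (F := fun i => size (f i))).
by rewrite (bigD1 i) //= /f !rmorphM /=; case: (hDn i) => _ <-; rewrite mulrAC mulrC.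
Qed.

(* A finite extension L of k(t), given with the coordinates in a basis. *)
Record funfield (k : closedFieldType) := Funfield {
  ff_L : fieldType;
  ff_io : {rmorphism {fraction {poly k}} -> ff_L};
  ff_g : nat;
  ff_co : ff_L -> 'rV[{fraction {poly k}}]_ff_g;
  ff_coD : forall a b, ff_co (a + b) = ff_co a + ff_co b;
  ff_coZ : forall a b, ff_co (ff_io a * b) = a *: ff_co b;
  ff_inj : injective ff_co;
  ff_surj : forall u, exists b, ff_co b = u
}.

Section FunctionField.
Variables (k : closedFieldType) (FF : funfield k).
Notation K := {fraction {poly k}}.
Notation L := (ff_L FF).
Notation io := (@ff_io k FF).
Notation g := (ff_g FF).
Notation co := (@ff_co k FF).
Let coD := @ff_coD k FF.
Let coZ := @ff_coZ k FF.
Let co_inj := @ff_inj k FF.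
Let co_surj := @ff_surj k FF.

Lemma co0 : co 0 = 0.
Proof. by apply: (addrI (co 0)); rewrite -coD !addr0. Qed.

Lemma co_sum (T : Type) (s : seq T) (Q : pred T) (f : T -> L) :
  co (\sum_(i <- s | Q i) f i) = \sum_(i <- s | Q i) co (f i).
Proof. by elim/big_rec2: _ => [|i y x _ <-]; rewrite ?co0 ?coD. Qed.

Definition pol (f : {poly k}) : L := io f%:F.
HB.instance Definition _ := GRing.RMorphism.copy pol (io \o (@tofrac {poly k})).
Definition cst (a : k) : L := pol a%:P.
HB.instance Definition _ := GRing.RMorphism.copy cst (pol \o polyC).

Lemma pol_inj : injective pol.
Proof. by move=> a b /fmorph_inj/eqP; rewrite tofrac_eq => /eqP. Qed.
Lemma pol_eq0 f : (pol f == 0) = (f == 0).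
Proof. by rewrite -(rmorph0 pol) (inj_eq pol_inj). Qed.
Lemma co_pol f b : co (pol f * b) = f%:F *: co b. Proof. exact: coZ. Qed.

Definition be (j : 'I_g) : L := projT1 (cid (co_surj (delta_mx 0 j))).
Lemma co_be j : co (be j) = delta_mx 0 j. Proof. by rewrite /be; case: cid. Qed.
Lemma coE b : b = \sum_j io (co b 0 j) * be j.
Proof.
apply: co_inj; rewrite co_sum [LHS]row_sum_delta; apply: eq_bigr => j _.
by rewrite coZ co_be.
Qed.

(** A filtration by pole order at infinity. The basis of L is arbitrary, so it is not
    multiplicative; [Ob_ex] and [Ob_mul] pay for denominators and products by a fixed polynomial D
    and a fixed shift c. *)
Definition Ob n : set L := [set b | forall j, exists2 f : {poly k}, (size f <= n)%N & co b 0 j = f%:F].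

Lemma ObD n a b : Ob n a -> Ob n b -> Ob n (a + b).
Proof.
move=> ha hb j; have [f sf fa] := ha j; have [h sh hb'] := hb j; exists (f + h).
  by apply: leq_trans (size_polyD _ _) _; rewrite geq_max sf sh.
by rewrite coD mxE fa hb' rmorphD.
Qed.
Lemma Ob0 n : Ob n 0.
Proof. by move=> j; exists 0; rewrite ?size_poly0 // co0 mxE rmorph0. Qed.
Lemma Ob_pol n m (f : {poly k}) b : (size f <= m.+1)%N -> Ob n b -> Ob (n + m) (pol f * b).
Proof.
move=> sf hb j; have [h sh e] := hb j; exists (f * h); last by rewrite coZ mxE e rmorphM.
have [->|h0] := eqVneq h 0; first by rewrite mulr0 size_poly0.
by apply: leq_trans (size_polyMleq _ _) _; lia.
Qed.
Lemma Ob_cst n a b : Ob n b -> Ob n (cst a * b).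
Proof. by move=> hb; rewrite -[n]addn0; apply: Ob_pol => //; apply: size_polyC_leq1. Qed.
Lemma Ob_le n m b : (n <= m)%N -> Ob n b -> Ob m b.
Proof. by move=> nm hb j; have [f sf e] := hb j; exists f => //; apply: leq_trans nm. Qed.
Lemma Ob_zero b : Ob 0 b -> b = 0.
Proof.
move=> hb; apply: co_inj; rewrite co0; apply/rowP => j; have [f] := hb j.
by rewrite leqn0 size_poly_eq0 => /eqP -> ->; rewrite mxE rmorph0.
Qed.
Lemma Ob_sum n (T : Type) (s : seq T) (Q : pred T) (f : T -> L) :
  (forall i, Q i -> Ob n (f i)) -> Ob n (\sum_(i <- s | Q i) f i).
Proof. by move=> h; elim/big_ind: _ => //; [exact: Ob0|exact: ObD]. Qed.
Lemma Ob_ex (T : finType) (b : T -> L) :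
  exists2 D : {poly k}, D != 0 & exists n, forall i, Ob n (pol D * b i).
Proof.
have [D D0 [n hn]] := clear_denom (fun ij : T * 'I_g => co (b ij.1) 0 ij.2).
by exists D => //; exists n => i j; have [f sf e] := hn (i, j); exists f; rewrite // coZ mxE.
Qed.

Lemma Ob_mul (T : finType) (b : T -> L) : exists2 D : {poly k}, D != 0 &
  exists c, forall i n x, Ob n x -> Ob (n + c) (pol D * b i * x).
Proof.
have [D D0 [c hc]] := Ob_ex (fun ij : T * 'I_g => b ij.1 * be ij.2).
exists D => //; exists c => i n x hx.
rewrite [x]coE mulr_sumr; apply: Ob_sum => j _.
have [f sf ->] := hx j.
have -> : pol D * b i * (io f%:F * be j) = pol f * (pol D * (b i * be j)) by rewrite -/(pol f); ring.
have h := @Ob_pol c (size f).-1 f _ (leqSpred _) (hc (i, j)).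
by apply: Ob_le h; rewrite addnC leq_add2r; apply: leq_trans (leq_pred _) sf.
Qed.

Section Filtration.
Variable s : nat.
Implicit Types (w : 'I_s -> nat) (n : nat).
Notation V := (restr cst 'rV[L]_s).

(** The sections of a direct sum of twists. Subtraction is truncated, so the i-th entry is zero for
    n <= w i. *)
Definition Fw w n : set V := [set m | forall i, Ob (n - w i) ((m : 'rV[L]_s) 0 i)].

Lemma Fw_subspace w n : is_subspace (Fw w n).
Proof.
split=> [i|a x y hx hy i]; first by rewrite mxE; exact: Ob0.
by rewrite !mxE; apply: ObD => //; apply: Ob_cst.
Qed.

Lemma Fw_le w n m : (n <= m)%N -> Fw w n `<=` Fw w m.
Proof. by move=> nm x hx i; apply: Ob_le (hx i); rewrite leq_sub2r. Qed.

Definition tmul (v : V) : V := pol 'X *: (v : 'rV[L]_s).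

Lemma Fw_pol w n m (f : {poly k}) (v : 'rV[L]_s) : (size f <= m.+1)%N -> Fw w n v -> Fw w (n + m) (pol f *: v).
Proof.
move=> sf hv i; rewrite mxE; have [le|gt] := leqP (w i) n.
  by rewrite -addnBAC //; apply: Ob_pol.
have := hv i; rewrite (eqP (ltnW gt : n - w i == 0)%N) => /Ob_zero ->.
by rewrite mulr0; exact: Ob0.
Qed.

Lemma Fw_t w n v : Fw w n v -> Fw w n.+1 (tmul v).
Proof. by rewrite -addn1; apply: Fw_pol; rewrite size_polyX. Qed.

Lemma Fw_hasdim w n : hasdim (Fw w n) (g * \sum_i (n - w i)).
Proof.
pose J (i : 'I_s) : finType := ('I_(n - w i) * 'I_g)%type.
pose T := {i : 'I_s & J i}.
pose b (x : T) : V := (pol 'X^((tagged x).1) * be (tagged x).2) *: (delta_mx 0 (tag x) : 'rV[L]_s).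
have -> : (g * \sum_i (n - w i) = #|{: T}|)%N.
  rewrite card_tagged sumnE big_map big_enum /= big_distrr /=.
  by apply: eq_bigr => i _; rewrite card_prod !card_ord mulnC.
have sumE (a : T -> k) i : (\sum_x a x *: b x : 'rV[L]_s) 0 i =
   \sum_j pol (\sum_(l < n - w i) a (@Tagged _ i J (l, j)) *: 'X^l) * be j.
  rewrite summxE.
  transitivity (\sum_i' \sum_(y : J i') (a (Tagged J y) *: b (Tagged J y) : 'rV[L]_s) 0 i).
    by rewrite (sig_big_dep (fun _ => true) (fun _ _ => true) (fun i' (y : J i') => (a (Tagged J y) *: b (Tagged J y) : 'rV[L]_s) 0 i)) /=; apply: eq_bigr => -[i' y].
  rewrite (bigD1 i) //= [X in _ + X]big1 ?addr0; last first.
    move=> i' ni; apply: big1 => y _; rewrite !mxE /= eq_sym (negbTE ni) ?andbF.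
    by rewrite !mulr0.
  transitivity (\sum_l \sum_j (a (@Tagged _ i J (l, j)) *: b (@Tagged _ i J (l, j)) : 'rV[L]_s) 0 i).
    by rewrite pair_bigA /=; apply: eq_bigr => -[].
  rewrite exchange_big /=.
  apply: eq_bigr => j _; rewrite rmorph_sum mulr_suml; apply: eq_bigr => l _.
  by rewrite !mxE !eqxx mulr1 -mul_polyC rmorphM /= mulrA.
have coS (a : T -> k) i j : co ((\sum_x a x *: b x : 'rV[L]_s) 0 i) 0 j = (\sum_(l < n - w i) a (@Tagged _ i J (l, j)) *: 'X^l)%:F.
  rewrite sumE co_sum summxE (bigD1 j) //= co_pol co_be !mxE !eqxx mulr1.
  rewrite [X in _ + X]big1 ?addr0 // => j' nj.
  by rewrite co_pol co_be !mxE eq_sym (negbTE nj) andbF mulr0.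
suff -> : Fw w n = lspan b.
  apply: hasdim_basis => a a0 [i [l j]].
  have := coS a i j; rewrite a0 mxE co0 mxE => /esym/eqP; rewrite tofrac_eq0 => /eqP/polyP/(_ l).
  rewrite coef0 coef_sum (bigD1 l) //= coefZ coefXn eqxx mulr1 big1 ?addr0 // => l' nl.
  by rewrite coefZ coefXn eq_sym val_eqE (negbTE nl) mulr0.
apply/seteqP; split=> [m hm|_ [a ->] i j]; last first.
  exists (\sum_(l < n - w i) a (@Tagged _ i J (l, j)) *: 'X^l); last exact: coS.
  apply: (big_ind (fun f : {poly k} => size f <= n - w i)%N) => [|f h sf sh|l _].
  - by rewrite size_poly0.
  - by apply: leq_trans (size_polyD _ _) _; rewrite geq_max sf sh.
  - by apply: leq_trans (size_scale_leq _ _) _; rewrite size_polyXn.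
have h (ij : 'I_s * 'I_g) : exists f : {poly k}, (size f <= n - w ij.1)%N /\ co ((m : 'rV[L]_s) 0 ij.1) 0 ij.2 = f%:F.
  by have [f sf e] := hm ij.1 ij.2; exists f.
have [f hf] := choice h.
exists (fun x : T => (f (tag x, (tagged x).2))`_(nat_of_ord (tagged x).1)).
apply/rowP => i; apply: co_inj; apply/rowP => j; rewrite coS.
have [sf ->] := hf (i, j); congr (_%:F); apply/polyP => l; rewrite coef_sum.
have [lt|ge] := ltnP l (n - w i).
  rewrite (bigD1 (Ordinal lt)) //= coefZ coefXn eqxx mulr1 big1 ?addr0 // => l' nl.
  by rewrite coefZ coefXn -[l]/(val (Ordinal lt)) eq_sym val_eqE (negbTE nl) mulr0.
rewrite nth_default ?(leq_trans sf) // big1 // => l' _.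
by rewrite coefZ coefXn gtn_eqF ?mulr0 // (leq_trans (ltn_ord l')).
Qed.
End Filtration.

Definition pind s (T : finType) (u : T -> 'rV[L]_s) : Prop :=
  forall f : T -> {poly k}, \sum_x pol (f x) *: u x = 0 -> forall x, f x = 0.

Lemma pind_lindep s (T : finType) (u : T -> 'rV[L]_s) m : pind u ->
  lindep (fun xa : T * 'I_m => pol 'X^(xa.2) *: u xa.1 : restr cst 'rV[L]_s).
Proof.
move=> ind a a0 [x i]; have <- : (\sum_(i < m) a (x, i) *: 'X^i)`_i = a (x, i).
  rewrite coef_sum (bigD1 i) //= coefZ coefXn eqxx mulr1 big1 ?addr0 // => i' ni.
  by rewrite coefZ coefXn eq_sym val_eqE (negbTE ni) mulr0.
rewrite (ind (fun x => \sum_(i < m) a (x, i) *: 'X^i)) ?coef0 //; apply: etrans a0.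
transitivity (\sum_x \sum_(i < m) (a (x, i) *: (pol 'X^i *: u x : restr cst 'rV[L]_s) : 'rV[L]_s)); last first.
  by rewrite pair_bigA /=; apply: eq_bigr => -[].
apply: eq_bigr => y _; rewrite rmorph_sum scaler_suml; apply: eq_bigr => l _.
by rewrite restrZ scalerA -mul_polyC rmorphM.
Qed.

(** The factor g is the degree of L over k(t). The bound results from comparing the k-dimensions of
    the multiples by t^i, i < m, with those of a level n + m as m grows. *)
Lemma pind_rank s r (T : finType) (u : T -> 'rV[L]_s) (G : 'M[L]_(r, s)) : pind u ->
  (forall x, (u x <= G)%MS) -> (#|T| <= g * r)%N.
Proof.
move=> ind uG; have h x : exists y, u x = y *m G by apply/submxP.
have [y hy] := choice h.
have [D D0 [n hn]] := Ob_ex (fun xi : T * 'I_r => y xi.1 0 xi.2).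
pose v x := pol D *: y x.
have iv : pind v.
  move=> f f0 x; suff : f x * D = 0 by move/eqP; rewrite mulf_eq0 (negbTE D0) orbF => /eqP.
  apply: (ind (fun x => f x * D)).
  transitivity ((\sum_x pol (f x) *: v x) *m G); last by rewrite f0 mul0mx.
  rewrite mulmx_suml; apply: eq_bigr => z _.
  by rewrite -!scalemxAl -hy scalerA rmorphM.
have bound m : (#|T| * m <= g * r * (n + m))%N.
  have := hasdim_ge (Fw_hasdim (fun=> 0%N) (n + m)) (pind_lindep (m := m) iv).
  rewrite card_prod card_ord sum_nat_const card_ord subn0 mulnA; apply => -[x i] /=.
  apply: Fw_le (Fw_pol (m := i) _ (n := n) _); first by rewrite leq_add2l ltnW.
    by rewrite size_polyXn.
  by move=> j; rewrite subn0 mxE; apply: (hn (x, j)).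
rewrite leqNgt; apply/negP => lt.
have := bound (g * r * n).+1; have : ((g * r).+1 * (g * r * n).+1 <= #|T| * (g * r * n).+1)%N by rewrite leq_mul2r lt orbT.
move: (g * r)%N => N; nia.
Qed.

(** * Growth of a subspace along the pole filtration *)

Section Slopes.
Variables (s : nat) (w : 'I_s -> nat) (U : set 'rV[L]_s).
Hypothesis UL : is_subspace U.
Notation V := (restr cst 'rV[L]_s).
Definition Un n : set V := U `&` Fw w n.

Lemma Uk : is_subspace (U : set V).
Proof. by case: UL => h0 h; split=> // a x y; apply: h. Qed.

Lemma Un_subspace n : is_subspace (Un n).
Proof. by apply: setI_subspace; [exact: Uk|exact: Fw_subspace]. Qed.

Lemma Un_hasdim n : exists m, hasdim (Un n) m.
Proof.
have [|m _ hm] := hasdim_sub (Un_subspace n) _ (Fw_hasdim w n); last by exists m.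
by move=> x [].
Qed.

Lemma Un_le n m : (n <= m)%N -> Un n `<=` Un m.
Proof. by move=> nm x [Ux /(Fw_le nm) Fx]. Qed.

(* Elements with independent leading coefficients are independent over k[t]. *)
Lemma slope_pind n a b : hasdim (Un n) a -> hasdim (Un n.+1) b ->
  exists u : 'I_(b - a) -> 'rV[L]_s, (forall l, Un n.+1 (u l)) /\ pind u.
Proof.
move=> ha hb; have [u [uU ui]] := complement ha hb (Un_le (leqnSn n)).
exists u; split=> // f f0.
have h (x : 'I_(b - a) * ('I_s * 'I_g)) : exists q : {poly k},
    (size q <= n.+1 - w x.2.1)%N /\ co ((u x.1 : 'rV[L]_s) 0 x.2.1) 0 x.2.2 = q%:F.
  by have [_ /(_ x.2.1 x.2.2)[q sq e]] := uU x.1; exists q.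
have [q hq] := choice h.
have rel i j : \sum_l f l * q (l, (i, j)) = 0.
  have := congr1 (fun v : 'rV[L]_s => co (v 0 i) 0 j) f0.
  rewrite summxE co_sum summxE mxE co0 mxE => e; apply/eqP; rewrite -tofrac_eq0 rmorph_sum -[X in _ == X]e.
  apply/eqP/eq_bigr => l _; rewrite mxE co_pol mxE rmorphM; congr (_ * _).
  by case: (hq (l, (i, j))) => _ ->.
(* Otherwise combine the u_l with the coefficients of top degree M - 1 of the f_l. The coefficient
   of degree n - w i of this combination is that of degree M - 1 + n - w i in the relation, hence
   zero; so the combination lies in [Un n], against independence modulo [Un n]. *)
apply: contrapT => /existsNP[l0 /eqP fl0].
pose M := (\max_l size (f l))%N.
have fM l : (size (f l) <= M)%N by apply: (leq_bigmax (F := fun l => size (f l))).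
have M0 : (0 < M)%N by apply: leq_trans (fM l0); rewrite size_poly_gt0.
have [l1 hl1] : exists l, size (f l) = M.
  rewrite /M; have [|l ->] := @bigop.eq_bigmax _ (fun l => size (f l)); last by exists l.
  by apply/card_gt0P; exists l0.
have c0 : ~ Un n (\sum_l (f l)`_M.-1 *: u l).
  move=> /ui/(_ l1)/eqP; rewrite -hl1 -lead_coefE lead_coef_eq0 -size_poly_eq0 hl1.
  by rewrite eqn0Ngt M0.
apply: c0.
split; first by apply: subspace_sum; [exact: Uk|move=> l _; apply: subspaceZ (Uk) _; case: (uU l)].
move=> i j; exists (\sum_l (f l)`_M.-1 *: q (l, (i, j))); last first.
  rewrite summxE co_sum summxE rmorph_sum; apply: eq_bigr => l _.
  by rewrite mxE co_pol mxE -mul_polyC rmorphM; case: (hq (l, (i, j))) => _ ->.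
apply/leq_sizeP => d nd; rewrite coef_sum.
have [gt|le] := ltnP n (w i).
  rewrite big1 // => l _; have [+ _] := hq (l, (i, j)).
  by rewrite (eqP (gt : n.+1 - w i == 0)%N) leqn0 size_poly_eq0 => /eqP ->; rewrite coefZ coef0 mulr0.
move: nd; rewrite leq_eqVlt => /orP[/eqP <-|lt]; last first.
  rewrite big1 // => l _; have [sq _] := hq (l, (i, j)).
  by rewrite coefZ [X in _ * X]nth_default ?mulr0 //; apply: leq_trans sq _; rewrite subSn.
have := congr1 (fun f : {poly k} => f`_(M.-1 + (n - w i))) (rel i j).
rewrite coef0 coef_sum; apply: etrans; apply: eq_bigr => l _; rewrite coefZ coefM.
have lt : (M.-1 < (M.-1 + (n - w i)).+1)%N by rewrite ltnS leq_addr.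
rewrite (bigD1 (Ordinal lt)) //= addKn big1 ?addr0 // => d' nd.
have [ltM|geM] := ltnP d' M.-1; last first.
  rewrite [(f l)`_d']nth_default ?mul0r //; apply: leq_trans (fM l) _.
  have : (d' != M.-1 :> nat) by apply: contraNneq nd => e; apply/eqP/val_inj.
  by move: geM M0; clear; lia.
rewrite [X in _ * X]nth_default ?mulr0 //; have [sq _] := hq (l, (i, j)).
apply: leq_trans sq _; rewrite subSn //=; have := ltn_ord d'; lia.
Qed.

(** The dimensions of X_m = U_n + t U_n + ... + t^m U_n are concave in m and at least #|T| (m + 1),
    so already the first increment is at least #|T|. *)
Lemma pind_slope n a b (T : finType) (u : T -> 'rV[L]_s) : hasdim (Un n) a -> hasdim (Un n.+1) b ->
  (forall x, Un n (u x)) -> pind u -> (a + #|T| <= b)%N.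
Proof.
move=> ha hb uU ui.
pose X := fix X m : set V := if m is m'.+1 then sadd (X m') (@tmul s @` X m') else Un n.
have tU m : U m -> U (tmul m) by move=> h; apply: subspaceZ.
have tlin : linear (@tmul s) by move=> c x y; rewrite /tmul scalerDr !restrZ !scalerA mulrC.
have pX0 : pol 'X != 0 by rewrite pol_eq0 polyX_eq0.
have ht W m : hasdim W m -> hasdim (@tmul s @` W) m.
  apply: (hasdim_semilinear (s := id)) => //.
  - by move=> c; exists c.
  - by move=> x y; rewrite /tmul scalerDr.
  - by move=> c x; rewrite /tmul !restrZ !scalerA mulrC.
  - by move=> x _ h; apply: (scalerI pX0); rewrite [LHS]h scaler0.
have XU m : X m `<=` Un (n + m).
  elim: m => [|m IH]; first by rewrite addn0.
  rewrite addnS; apply: sadd_sub (Un_subspace _) _ _.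
    by move=> x /IH; apply: Un_le.
  by move=> _ [x /IH[Ux Fx] <-]; split; [apply: tU|apply: Fw_t].
have Xd m : exists d, hasdim (X m) d.
  elim: m => [|m [d hd]]; first by exists a.
  by have [d' [_ [h _ _]]] := hasdim_add hd (ht _ _ hd); exists d'.
have [d hd] := choice Xd.
have XX m : X m `<=` X m.+1.
  by apply: sadd_subl; apply: hasdim_subspace (ht _ _ (hd m)).
have tX m : @tmul s @` X m `<=` X m.+1.
  by apply: sadd_subr; apply: hasdim_subspace (hd m).
have conc m : (d m.+2 + d m <= d m.+1 + d m.+1)%N.
  have [c [c' [hc hc' <-]]] := hasdim_add (hd m.+1) (ht _ _ (hd m.+1)).
  rewrite (hasdim_inj (hd m.+2) hc) leq_add2l.
  apply: hasdim_le _ (ht _ _ (hd m)) hc' => x hx; split; first exact: tX.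
  by case: hx => y /XX Xy <-; exists y.
have d0 : d 0%N = a by apply: hasdim_inj (hd 0%N) ha.
have d1 : (d 1%N <= b)%N by apply: hasdim_le _ (hd 1%N) hb; have := XU 1%N; rewrite addn1.
have grow m : (#|T| * m.+1 <= d m)%N.
  have := hasdim_ge (hd m) (pind_lindep (m := m.+1) ui); rewrite card_prod card_ord; apply=> -[x [i im]] /=.
  elim: i m im => [|i IH] m im.
    rewrite expr0 rmorph1 scale1r; elim: m {im} => [|m IH]; [exact: uU|exact: XX].
  case: m im => // m im; rewrite (_ : pol 'X^(i.+1) *: u x = tmul (pol 'X^i *: u x)); last by rewrite /tmul scalerA -rmorphM -exprS.
  apply: tX; exists (pol 'X^i *: u x) => //.
  exact: IH.
have inc m : (d m.+1 + d 0 <= d m + d 1)%N.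
  by elim: m => [|m IH]; [rewrite addnC|have := conc m; lia].
have lin m : (d m + m * d 0 <= d 0 + m * d 1)%N.
  by elim: m => [|m IH] //; have := inc m; rewrite !mulSn; lia.
have := lin (d 0%N).+1; have := grow (d 0%N).+1; rewrite -d0 in d1 *.
have : (d 0 <= d 1)%N := hasdim_le (XX 0%N) (hd 0%N) (hd 1%N).
move: (d _) => D; move: d1; move: (d 0) (d 1) => e f; nia.
Qed.
End Slopes.

(** Multiplying the rows of G by a basis of L over k(t), cleared of denominators by D, gives g r
    vectors at level n + c that are independent over k[t]. The shift c depends on L only. *)
Lemma free_slope : exists c, forall s (w : 'I_s -> nat) (U : set 'rV[L]_s), is_subspace U ->
  forall r (G : 'M[L]_(r, s)) n a b, row_free G -> (forall l, Un w U n (row l G)) ->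
  hasdim (Un w U (n + c)) a -> hasdim (Un w U (n + c).+1) b -> (a + g * r <= b)%N.
Proof.
have [D D0 [c hc]] := Ob_mul be.
exists c => s w U UL r G n a b fG GU ha hb.
pose u (x : 'I_g * 'I_r) := (pol D * be x.1) *: row x.2 G.
have -> : (g * r = #|{: 'I_g * 'I_r}|)%N by rewrite card_prod !card_ord.
apply: (pind_slope UL ha hb (u := u)) => [[j l]|f].
  split; first by apply: subspaceZ => //; case: (GU l).
  move=> i; rewrite /u [X in Ob _ X]mxE; have [_ /(_ i)] := GU l.
  have [le|gt] := leqP (w i) n; first by rewrite -addnBAC //; apply: hc.
  rewrite (eqP (ltnW gt : n - w i == 0)%N) => /Ob_zero ->.
  by rewrite mulr0; exact: Ob0.
move=> f0 [j l].
have : (\row_l \sum_j pol (f (j, l)) * (pol D * be j)) *m G = 0.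
  rewrite mulmx_sum_row; apply: etrans f0.
  transitivity (\sum_j \sum_l pol (f (j, l)) *: u (j, l)); last first.
    by rewrite pair_bigA /=; apply: eq_bigr => -[].
  rewrite exchange_big /=; apply: eq_bigr => l' _; rewrite mxE scaler_suml; apply: eq_bigr => j' _.
  by rewrite /u scalerA.
have e (a' : {poly k}) j' : co (pol a' * (pol D * be j')) 0 j = (a' * D)%:F * (j == j')%:R.
  by rewrite mulrA -rmorphM co_pol co_be !mxE eqxx.
move=> /eqP; rewrite mulmx_free_eq0 // => /eqP/rowP/(_ l); rewrite !mxE => /(congr1 (fun x => co x 0 j)).
rewrite co0 co_sum summxE mxE; under eq_bigr do rewrite e.
rewrite (bigD1 j) //= eqxx mulr1 big1 => [|j' /negbTE nj]; last by rewrite eq_sym nj mulr0.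
by rewrite addr0 => /eqP; rewrite tofrac_eq0 mulf_eq0 (negbTE D0) orbF => /eqP.
Qed.
End FunctionField.

(** * The p-basis of L and relations between p-th powers *)

Section FrobeniusBasis.
Variables (k : closedFieldType) (p : nat) (hp : p \in [pchar k]) (FF : funfield k).
Notation L := (ff_L FF).
Notation g := (ff_g FF).
Local Notation pol := (@pol k FF).
Local Notation cst := (@cst k FF).
Local Notation co := (@ff_co k FF).

Lemma p_gt0 : (0 < p)%N.
Proof. exact: prime_gt0 (pcharf_prime hp). Qed.

Lemma g_gt0 : (0 < g)%N.
Proof.
rewrite lt0n; apply/negP => /eqP g0.
suff /eqP : (1 : L) = 0 by rewrite oner_eq0.
by apply: (@ff_inj k FF); apply/rowP => i; have := ltn_ord i; rewrite {2}g0.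
Qed.

Lemma pchL : p \in [pchar L].
Proof. by rewrite (fmorph_pchar cst). Qed.

Lemma frobD (R : comNzRingType) (x y : R) : p \in [pchar R] -> (x + y) ^+ p = x ^+ p + y ^+ p.
Proof. by move=> h; have := pFrobenius_autD_comm h (mulrC x y); rewrite !pFrobenius_autE. Qed.

Lemma frob_sum (R : comNzRingType) (T : Type) (s : seq T) (Q : pred T) (f : T -> R) :
  p \in [pchar R] -> (\sum_(i <- s | Q i) f i) ^+ p = \sum_(i <- s | Q i) f i ^+ p.
Proof.
move=> h; elim/big_rec2: _ => [|i y x _ <-]; last by rewrite frobD.
by rewrite expr0n eqn0Ngt p_gt0.
Qed.

Lemma proot (a : k) : exists b, b ^+ p = a.
Proof.
have /closed_rootP[b] : size ('X^p - a%:P : {poly k}) != 1%N.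
  by rewrite size_XnsubC ?p_gt0 // eqSS -lt0n p_gt0.
by rewrite /root !hornerE subr_eq0 => /eqP; exists b.
Qed.

(** k is perfect, so k[X] is free over its p-th powers on the X^a with a < p. *)
Lemma poly_frob_dec n (f : {poly k}) : (size f <= p * n)%N ->
  exists2 h : 'I_p -> {poly k}, (forall a, size (h a) <= n)%N & f = \sum_(a < p) 'X^a * h a ^+ p.
Proof.
have pchP : p \in [pchar {poly k}] by rewrite pchar_poly.
elim: n f => [|n IH] f sf.
  exists (fun=> 0) => [a|]; first by rewrite size_poly0.
  move: sf; rewrite muln0 leqn0 size_poly_eq0 => /eqP ->; rewrite big1 // => a _.
  by rewrite expr0n eqn0Ngt p_gt0 mulr0.
have [|h sh hE] := IH (drop_poly p f).
  by rewrite size_drop_poly leq_subLR -mulnS.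
have [r hr] := choice (fun a : 'I_p => proot f`_a).
exists (fun a => (r a)%:P + 'X * h a) => [a|].
  apply: leq_trans (size_polyD _ _) _; rewrite geq_max (leq_trans (size_polyC_leq1 _)) //.
  apply: leq_trans (size_polyMleq _ _) _; rewrite size_polyX /=.
  exact: sh.
rewrite -{1}[f](poly_take_drop p) hE mulr_suml; under [RHS]eq_bigr do rewrite frobD // mulrDr.
rewrite big_split /=; congr (_ + _).
  apply/polyP => i; rewrite coef_take_poly coef_sum.
  have [lt|ge] := ltnP i p.
    rewrite (bigD1 (Ordinal lt)) //= -rmorphXn /= hr coefMC coefXn eqxx mul1r big1 ?addr0 // => j nj.
    rewrite -rmorphXn coefMC coefXn -[i]/(val (Ordinal lt)) eq_sym val_eqE.
    by rewrite (negbTE nj) mul0r.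
  rewrite big1 // => j _; rewrite -rmorphXn coefMC coefXn gtn_eqF ?mul0r //.
  exact: leq_trans (ltn_ord j) ge.
apply: eq_bigr => a _; rewrite exprMn -!mulrA; congr (_ * _).
by rewrite mulrC.
Qed.

Lemma Ob_coef n (x : L) : Ob n x -> exists2 f : 'I_g -> {poly k}, (forall j, size (f j) <= n)%N &
  x = \sum_j pol (f j) * be j.
Proof.
move=> hx; have h j : exists f : {poly k}, (size f <= n)%N /\ co x 0 j = f%:F.
  by have [f sf e] := hx j; exists f.
have [f hf] := choice h; exists f => [j|]; first by case: (hf j).
by rewrite {1}[x]coE; apply: eq_bigr => j _; case: (hf j) => _ ->.
Qed.

(** With [frob_lb]: expansion along a p-basis sends level n to level p n up to a bounded shift, in
    both directions. *)
Lemma frob_ub (T : finType) (u : T -> L) : exists2 D : {poly k}, D != 0 & exists c, forall n b,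
  (forall j, Ob n (b j)) -> Ob (p * n + c) (pol D * \sum_j u j * b j ^+ p).
Proof.
have [D D0 [c hc]] := Ob_ex (fun ji : T * 'I_g => u ji.1 * be ji.2 ^+ p).
exists D => //; exists c => n b hb; rewrite mulr_sumr; apply: Ob_sum => j _.
have [f sf ->] := Ob_coef (hb j).
rewrite frob_sum ?pchL // !mulr_sumr; apply: Ob_sum => i _.
have -> : pol D * (u j * (pol (f i) * be i) ^+ p) = pol (f i ^+ p) * (pol D * (u j * be i ^+ p)).
  by rewrite exprMn rmorphXn; ring.
have h := Ob_pol (f := f i ^+ p) (m := ((size (f i)).-1 * p)%N) (size_poly_exp_leq _ _) (hc (j, i)).
apply: Ob_le h; rewrite addnC leq_add2r mulnC leq_mul2l.
by rewrite (leq_trans (leq_pred _) (sf i)) orbT.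
Qed.

Definition frob_free m (u : 'I_m -> L) : Prop :=
  forall b : 'I_m -> L, \sum_j u j * b j ^+ p = 0 -> forall j, b j = 0.
Definition frob_span m (u : 'I_m -> L) : Prop :=
  forall x, exists b : 'I_m -> L, x = \sum_j u j * b j ^+ p.

Lemma frob_lb m (u : 'I_m -> L) : frob_span u -> exists2 D : {poly k}, D != 0 & exists c, forall n x,
  Ob (p * n) x -> exists2 b : 'I_m -> L, (forall j, Ob (n + c) (b j)) &
    pol D ^+ p * x = \sum_j u j * b j ^+ p.
Proof.
move=> su; have [c' hc'] := choice (fun ai : 'I_p * 'I_g => su (pol 'X^(ai.1) * be ai.2)).
have [D D0 [c hc]] := Ob_ex (fun aij : ('I_p * 'I_g) * 'I_m => c' aij.1 aij.2).
exists D => //; exists c => n x /Ob_coef[f sf xE].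
have hex i : exists h : 'I_p -> {poly k}, (forall a, size (h a) <= n)%N /\ f i = \sum_(a < p) 'X^a * h a ^+ p.
  by have [h sh e] := poly_frob_dec (sf i); exists h.
have [h hh] := choice hex.
exists (fun j => \sum_i \sum_a pol (h i a) * (pol D * c' (a, i) j)) => [j|].
  apply: Ob_sum => i _; apply: Ob_sum => a _; rewrite addnC.
  by apply: Ob_pol (hc (a, i, j)); apply: leqW; case: (hh i).
rewrite xE mulr_sumr.
transitivity (\sum_i \sum_a \sum_j u j * (pol (h i a) * (pol D * c' (a, i) j)) ^+ p).
  apply: eq_bigr => i _; have [_ {1}->] := hh i.
  rewrite rmorph_sum mulr_suml mulr_sumr; apply: eq_bigr => a _.
  have e : pol ('X^a * h i a ^+ p) * be i = pol (h i a) ^+ p * (pol 'X^a * be i) 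
    by rewrite [RHS]mulrA; congr (_ * _); rewrite [LHS](rmorphM pol) mulrC; congr (_ * _); apply: rmorphXn.
  transitivity (pol D ^+ p * (pol (h i a) ^+ p * (pol 'X^a * be i))); first by rewrite -e.
  rewrite (hc' (a, i)) mulr_sumr mulr_sumr; apply: eq_bigr => j _.
  by rewrite !exprMn; ring.
under eq_bigr do rewrite exchange_big /=.
rewrite exchange_big /=; apply: eq_bigr => j _.
rewrite frob_sum ?pchL // mulr_sumr; apply: eq_bigr => i _.
by rewrite frob_sum ?pchL // mulr_sumr.
Qed.

Notation VV m s := (restr cst 'M[L]_(m, s)).

Lemma rows_hasdim m s (X : set (restr cst 'rV[L]_s)) a : hasdim X a ->
  hasdim ([set M | forall j, X (row j (M : 'M[L]_(m, s)))] : set (VV m s)) (m * a).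
Proof.
move=> [e ie Xe].
pose b (x : 'I_m * 'I_a) : VV m s := \matrix_(j, i) (if j == x.1 then (e x.2 : 'rV[L]_s) 0 i else 0).
have rowE (c : 'I_m * 'I_a -> k) j : row j (\sum_x c x *: b x : 'M[L]_(m, s)) = \sum_l c (j, l) *: e l :> 'rV[L]_s.
  apply/rowP => i; rewrite mxE !summxE.
  transitivity (\sum_j' \sum_l (c (j', l) *: b (j', l) : 'M[L]_(m, s)) j i).
    by rewrite pair_bigA /=; apply: eq_bigr => -[].
  rewrite (bigD1 j) //= [X in _ + X]big1 ?addr0 => [|j' nj].
    by apply: eq_bigr => l _; rewrite !mxE eqxx.
  by apply: big1 => l _; rewrite !mxE eq_sym (negbTE nj) mulr0.
have -> : (m * a = #|{: 'I_m * 'I_a}|)%N by rewrite card_prod !card_ord.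
suff -> : ([set M | forall j, X (row j (M : 'M[L]_(m, s)))] : set (VV m s)) = lspan b.
  apply: hasdim_basis => c c0 [j l]; apply: (ie (fun l => c (j, l))).
  by rewrite -[LHS]rowE c0 row0.
apply/seteqP; split=> [M hM|_ [c ->] j]; last first.
  by rewrite /= rowE Xe; exists (fun l => c (j, l)).
have h j : exists c : 'I_a -> k, row j (M : 'M[L]_(m, s)) = \sum_l c l *: e l by have := hM j; rewrite Xe.
have [c hc] := choice h; exists (fun x => c x.1 x.2).
by apply/row_matrixP => j; rewrite rowE hc.
Qed.

Lemma cst_frob (a : k) : cst (a ^+ p) = cst a ^+ p.
Proof. exact: rmorphXn. Qed.

(** A p-semilinear map from m copies of a space of rows to rows, injective when [u] is free over
    p-th powers. It compares dimensions at level n with those at level p n. *)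
Definition fcomb m s (u : 'I_m -> L) (D : L) (M : VV m s) : restr cst 'rV[L]_s :=
  \row_i (D * \sum_j u j * (M : 'M[L]_(m, s)) j i ^+ p).

Lemma fcomb_hasdim m s (u : 'I_m -> L) D (X : set (VV m s)) a : frob_free u -> D != 0 ->
  hasdim X a -> hasdim (@fcomb m s u D @` X) a.
Proof.
move=> fu D0; apply: (hasdim_semilinear (s := fun x : k => x ^+ p)).
- exact: proot.
- move=> M N; apply/rowP => i; rewrite !mxE -mulrDr -big_split; congr (_ * _).
  by apply: eq_bigr => j _; rewrite mxE frobD ?pchL // mulrDr.
- move=> c M; apply/rowP => i; rewrite !mxE mulrCA; congr (_ * _); rewrite mulr_sumr.
  by apply: eq_bigr => j _; rewrite restrZ mxE exprMn [X in _ = X * _](cst_frob c) mulrCA.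
- move=> M _ M0; apply/matrixP => j i; rewrite [RHS]mxE.
  apply: (fu (fun j => (M : 'M[L]_(m, s)) j i)); have := congr1 (fun v : 'rV[L]_s => v 0 i) M0.
  by rewrite !mxE => /eqP; rewrite mulf_eq0 (negbTE D0) => /eqP.
Qed.

(** The degree of L over its p-th powers is read off from dimensions: m copies of level n embed into
    level p n + c, of dimension g (p n + c). [frob_span_ge] is the reverse comparison. *)
Lemma frob_free_le m (u : 'I_m -> L) : frob_free u -> (m <= p)%N.
Proof.
move=> fu; have [D D0 [c hc]] := frob_ub u.
have bound n : (g * (m * n) <= g * (p * n + c))%N.
  have h1 : hasdim (Fw (FF := FF) (fun _ : 'I_1 => 0%N) n) (g * n).
    by have := Fw_hasdim FF (fun _ : 'I_1 => 0%N) n; rewrite big_ord1 subn0.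
  have h2 := fcomb_hasdim fu (_ : pol D != 0) (rows_hasdim m h1).
  rewrite pol_eq0 D0 mulnCA in h2; apply: hasdim_le _ (h2 isT) _; last first.
    by have := Fw_hasdim FF (fun _ : 'I_1 => 0%N) (p * n + c); rewrite big_ord1 subn0; apply.
  move=> _ [M hM <-] i; rewrite subn0 mxE; apply: hc => j.
  by have := hM j i; rewrite subn0 mxE.
have := bound (c.+1); rewrite leq_pmul2l ?g_gt0 //.
move: (p) => q; nia.
Qed.

Lemma frob_span_ge m (u : 'I_m -> L) : frob_free u -> frob_span u -> (p <= m)%N.
Proof.
move=> fu su; have [D D0 [c hc]] := frob_lb su.
have bound n : (p * n <= m * (n + c))%N.
  rewrite -(leq_pmul2l g_gt0).
  have h0 : hasdim (Fw (FF := FF) (fun _ : 'I_1 => 0%N) (p * n)) (g * (p * n)).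
    by have := Fw_hasdim FF (fun _ : 'I_1 => 0%N) (p * n); rewrite big_ord1 subn0.
  have h1 : hasdim (Fw (FF := FF) (fun _ : 'I_1 => 0%N) (n + c)) (g * (n + c)).
    by have := Fw_hasdim FF (fun _ : 'I_1 => 0%N) (n + c); rewrite big_ord1 subn0.
  have h2 := fcomb_hasdim fu (_ : (pol D ^+ p)^-1 != 0) (rows_hasdim m h1).
  have pD : pol D ^+ p != 0 by rewrite expf_neq0 // pol_eq0.
  rewrite invr_eq0 pD mulnCA in h2; apply: hasdim_le _ h0 (h2 isT).
  move=> v hv; have := hv 0; rewrite subn0 => /hc[b hb e].
  exists (\matrix_(j, i) b j : 'M[L]_(m, 1)) => [j i|]; first by rewrite subn0 !mxE.
  apply/rowP => i; rewrite ord1 mxE; under eq_bigr do rewrite mxE.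
  by rewrite -e mulKf.
have := bound (m * c).+1; have := p_gt0; move: (p) => q; nia.
Qed.

Lemma pbasis : exists2 u : 'I_p -> L, frob_free u & frob_span u.
Proof.
pose P m := `[< exists u : 'I_m -> L, frob_free u >].
have P0 : exists m, P m.
  by exists 0%N; apply/asboolP; exists (fun=> 0) => b _ [].
have Pb m : P m -> (m <= p)%N by move=> /asboolP[u]; apply: frob_free_le.
case: (ex_maxnP P0 Pb) => m /asboolP[u fu] max.
have su : frob_span u.
  move=> x; apply: contrapT => nx.
  suff : P m.+1 by move=> /max; rewrite ltnn.
  apply/asboolP; exists (fun j => if unlift ord0 j is Some j' then u j' else x) => b.
  rewrite big_ord_recl unlift_none; under eq_bigr do rewrite liftK.
  move=> b0; have b00 : b ord0 = 0.
    apply/eqP; apply: contra_notT nx => nb; exists (fun j => - b (lift ord0 j) / b ord0).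
    have bp : b ord0 ^+ p != 0 by rewrite expf_neq0.
    apply: (mulIf bp); rewrite mulr_suml; apply/eqP; rewrite -subr_eq0 -[X in _ == X]b0.
    rewrite -sumrN; apply/eqP; congr (_ + _); apply: eq_bigr => j _.
    rewrite -mulrA -exprMn mulfVK // -mulrN; congr (_ * _).
    by apply/eqP; rewrite eqr_oppLR -addr_eq0 -frobD ?pchL // addrC subrr expr0n eqn0Ngt p_gt0.
  by move=> j; case: (unliftP ord0 j) => [j' ->|->] //; apply: (fu (fun j => b (lift ord0 j))); rewrite -[RHS]b0 b00 expr0n eqn0Ngt p_gt0 mulr0 add0r.
have mp : m = p by apply/eqP; rewrite eqn_leq (frob_free_le fu) (frob_span_ge fu su).
by move: u fu su; rewrite mp => u fu su; exists u.
Qed.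

Lemma Un_slope_le s (w : 'I_s -> nat) (U : set 'rV[L]_s) n c a b : is_subspace U ->
  hasdim (Un w U n) a -> hasdim (Un w U (n + c)) b -> (b <= a + c * (g * s))%N.
Proof.
move=> sU ha; elim: c b => [|c IH] b.
  by rewrite addn0 mul0n addn0 => hb; rewrite (hasdim_inj hb ha).
rewrite addnS => hb; have [m hm] := Un_hasdim w sU (n + c).
have [u [_ iu]] := slope_pind sU hm hb.
have := pind_rank iu (fun x => submx1 (u x)); rewrite card_ord.
have := IH _ hm; lia.
Qed.

Definition rel_space s (nu : 'I_s -> L) : set 'rV[L]_s := [set m | \sum_i nu i * m 0 i = 0].

Lemma rel_subspace s (nu : 'I_s -> L) : is_subspace (rel_space nu).
Proof.
split=> [|a x y hx hy]; rewrite /rel_space /=.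
  by rewrite big1 // => i _; rewrite mxE mulr0.
transitivity (a * (\sum_i nu i * x 0 i) + \sum_i nu i * y 0 i); last by rewrite hx hy mulr0 addr0.
rewrite mulr_sumr -big_split; apply: eq_bigr => i _; rewrite !mxE /=; ring.
Qed.

(** Writing m_i = sum_j u_j x_ij^p in a p-basis splits the relation sum_i nu_i^p m_i = 0 into the p
    relations sum_i nu_i x_ij = 0. The constant depends neither on [nu] nor on [w], so the
    comparison can be used at every stage e. *)
Lemma frob_compare s : exists C, forall (nu : 'I_s -> L) w n a b,
  hasdim (Un w (rel_space nu) n) a ->
  hasdim (Un (fun i => p * w i)%N (rel_space (fun i => nu i ^+ p)) (p * n)) b ->
  (b <= p * a + C)%N /\ (p * a <= b + C)%N.
Proof.
have [u fu su] := pbasis; have [D D0 [c hc]] := frob_ub u; have [E E0 [d hd]] := frob_lb su.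
exists (p * (d * (g * s)) + c * (g * s))%N => nu w n a b ha hb.
have sumF (x : 'I_s -> 'I_p -> L) : \sum_i nu i ^+ p * (\sum_j u j * x i j ^+ p) =
    \sum_j u j * (\sum_i nu i * x i j) ^+ p.
  under eq_bigr do rewrite mulr_sumr; rewrite exchange_big; apply: eq_bigr => j _.
  rewrite frob_sum ?pchL // mulr_sumr; apply: eq_bigr => i _.
  by rewrite exprMn mulrCA.
have D0' : pol D != 0 by rewrite pol_eq0.
have E0' : pol E ^+ p != 0 by rewrite expf_neq0 // pol_eq0.
split.
  have [a' ha'] := Un_hasdim w (rel_subspace nu) (n + d).
  have le' := Un_slope_le (rel_subspace nu) ha ha'.
  suff : (b <= p * a')%N.
    move=> h; apply: leq_trans h _; rewrite addnA -mulnDr.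
    by apply: leq_trans (leq_addr _ _); rewrite leq_mul2l le' orbT.
  have h2 := fcomb_hasdim fu (invr_neq0 E0') (rows_hasdim p ha').
  apply: hasdim_le _ hb h2 => m [mU mF].
  have hb' i : exists x : 'I_p -> L, [/\ forall j, Ob (n + d - w i) (x j) & pol E ^+ p * (m : 'rV[L]_s) 0 i = \sum_j u j * x j ^+ p].
    have mi : Ob (p * (n - w i)) ((m : 'rV[L]_s) 0 i) by rewrite mulnBr; apply: mF.
    have [x hx e] := hd _ _ mi; have [le|gt] := leqP (w i) n.
      by exists x; split=> // j; rewrite -addnBAC.
    have m0 : (m : 'rV[L]_s) 0 i = 0.
      by apply: Ob_zero; move: mi; rewrite (eqP (ltnW gt : n - w i == 0)%N) muln0.
    have x0 : forall j, x j = 0 by apply: fu; rewrite -e m0 mulr0.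
    by exists x; split=> // j; rewrite x0; apply: Ob0.
  have [x hx] := choice hb'.
  exists (\matrix_(j, i) x i j : 'M[L]_(p, s)) => [j|].
    split=> [|i]; last by rewrite !mxE; case: (hx i) => + _; apply.
    rewrite /rel_space /=; under eq_bigr do rewrite !mxE.
    move: j; apply: fu; rewrite -sumF; transitivity (pol E ^+ p * \sum_i nu i ^+ p * (m : 'rV[L]_s) 0 i).
      rewrite mulr_sumr; apply: eq_bigr => i _; case: (hx i) => _ <-.
      by rewrite mulrCA.
    by rewrite [X in _ * X]mU mulr0.
  apply/rowP => i; rewrite mxE; apply: (mulfI E0'); rewrite mulVKf //.
  by case: (hx i) => _ ->; apply: eq_bigr => j _; rewrite mxE.
have [b' hb'] := Un_hasdim (fun i => p * w i)%N (rel_subspace (fun i => nu i ^+ p)) (p * n + c).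
have le' := Un_slope_le (rel_subspace _) hb hb'.
suff : (p * a <= b')%N by move=> h; apply: leq_trans h _; apply: leq_trans le' _; rewrite leq_add2l leq_addl.
apply: hasdim_le _ (fcomb_hasdim fu D0' (rows_hasdim p ha)) hb'.
move=> _ [M hM <-]; split=> [|i].
  rewrite /rel_space /=; under eq_bigr do rewrite mxE mulrCA.
  rewrite -mulr_sumr sumF big1 ?mulr0 // => j _; have [h _] := hM j.
  have -> : \sum_i nu i * (M : 'M[L]_(p, s)) j i = 0.
    by rewrite -[RHS]h; apply: eq_bigr => i _; rewrite !mxE.
  by rewrite expr0n eqn0Ngt p_gt0 mulr0.
rewrite mxE; have Mi j : Ob (n - w i) ((M : 'M[L]_(p, s)) j i) by have [_ /(_ i)] := hM j; rewrite mxE.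
have [le|gt] := leqP (w i) n.
  by rewrite -addnBAC ?leq_mul2l ?le ?orbT // -mulnBr; apply: hc.
rewrite big1 ?mulr0; first exact: Ob0.
move=> j _; have := Mi j; rewrite (eqP (ltnW gt : n - w i == 0)%N) => /Ob_zero ->.
by rewrite expr0n eqn0Ngt p_gt0 mulr0.
Qed.
End FrobeniusBasis.

(** * Degrees of Frobenius pull-backs *)

Lemma hasdim_pre (k : fieldType) (V V' : lmodType k) (f : {linear V -> V'}) (S : set V) b :
  is_subspace S -> (forall x, S x -> f x = 0 -> x = 0) -> hasdim (f @` S) b -> hasdim S b.
Proof.
move=> sS fi [e ie fS].
have h i : exists x, S x /\ f x = e i by have [x Sx <-] : (f @` S) (e i); [rewrite fS; apply: lspan_mem|exists x].
have [e' he'] := choice h; have fe a : f (\sum_i a i *: e' i) = \sum_i a i *: e i.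
  by rewrite linear_sum; apply: eq_bigr => i _; rewrite linearZ; case: (he' i) => _ ->.
have eS : lspan e' `<=` S by apply: lspan_sub => // i; case: (he' i).
exists e' => [a a0|]; first by apply: ie; rewrite -fe a0 linear0.
apply/seteqP; split=> // x Sx; have : (f @` S) (f x) by exists x.
rewrite fS => -[a fx]; exists a; apply/eqP; rewrite -subr_eq0; apply/eqP.
apply: fi; last by rewrite linearB /= fe fx subrr.
by apply: subspaceB => //; apply: eS; exists a.
Qed.

Section PolyLattice.
Variable k : closedFieldType.
Notation P := {poly k}.

Lemma poly_eval0 (f : P) : (forall c, f.[c] = 0) -> f = 0.
Proof.
move=> f0; apply/eqP; apply: contraT => nf.
have /closed_rootP[c] : size (f * 'X + 1%:P) != 1%N.
  by rewrite size_MXaddC (negbTE nf) /= eqSS size_poly_eq0.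
by rewrite /root !hornerE f0 mul0r add0r oner_eq0.
Qed.

(** Each coefficient of T Q is a polynomial function on the infinite field k that vanishes
    everywhere. Divisibility and degree bounds known at constants thereby pass to coefficients, in
    [dvd_eval] and [size_eval]. *)
Lemma coef_eval0 (T : {linear P -> P}) (Q : {poly P}) :
  (forall c, T Q.[c%:P] = 0) -> forall i, T Q`_i = 0.
Proof.
move=> h i; apply/polyP => l; rewrite coef0.
have : \poly_(j < size Q) (T Q`_j)`_l = 0.
  apply: poly_eval0 => c; rewrite horner_poly.
  apply: (@etrans _ _ (T Q.[c%:P])`_l); last by rewrite h coef0.
  rewrite horner_coef linear_sum coef_sum; apply: eq_bigr => j _.
  have -> : Q`_j * c%:P ^+ j = c ^+ j *: Q`_j by rewrite -rmorphXn mulrC mul_polyC.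
  by rewrite linearZ coefZ mulrC.
move/polyP/(_ i); rewrite coef_poly coef0; case: ltnP => // le _.
by rewrite [Q`_i]nth_default // linear0 coef0.
Qed.

Lemma dvd_eval (C : P) (Q : {poly P}) : (forall c, C %| Q.[c%:P]) -> forall i, C %| Q`_i.
Proof.
move=> h i; pose f (x : P) : P := x %% C; have lin : linear f.
  by move=> a x y; rewrite /f modpD modpZl.
pose T := HB.pack_for {linear P -> P} f (GRing.isLinear.Build _ _ _ _ _ lin).
have : T Q`_i = 0 by apply: coef_eval0 => c; apply/eqP; apply: h.
by move=> /eqP.
Qed.

Lemma dvd_horner (C : P) (Q : {poly P}) x : (forall i, C %| Q`_i) -> C %| Q.[x].
Proof.
move=> h; rewrite horner_coef; elim/big_ind: _ => [|a b|i _]; first exact: dvdp0.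
  exact: dvdp_add.
by rewrite dvdp_mulr.
Qed.

Lemma size_eval m (Q : {poly P}) : (forall c, (size Q.[c%:P] <= m)%N) -> forall i, (size (Q`_i)%R <= m)%N.
Proof.
move=> h i; have : drop_poly m Q`_i = 0.
  by apply: coef_eval0 => c; apply: drop_poly_eq0.
move=> d0; rewrite -[Q`_i](poly_take_drop m) d0 mul0r addr0.
exact: size_take_poly.
Qed.

Notation VP N := (restr (@polyC k) 'rV[P]_N).

Lemma poly_rows_hasdim N n : hasdim ([set u | forall j, (size ((u : 'rV[P]_N) ord0 j) <= n)%N] : set (VP N)) (N * n).
Proof.
pose b (x : 'I_N * 'I_n) : VP N := 'X^(x.2) *: (delta_mx 0 x.1 : 'rV[P]_N).
have sumE (a : 'I_N * 'I_n -> k) i : (\sum_x a x *: b x : 'rV[P]_N) 0 i = \sum_(l < n) a (i, l) *: 'X^l.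
  rewrite summxE; transitivity (\sum_i' \sum_l (a (i', l) *: b (i', l) : 'rV[P]_N) 0 i).
    by rewrite pair_bigA /=; apply: eq_bigr => -[].
  rewrite (bigD1 i) //= [X in _ + X]big1 ?addr0 => [|i' ni].
    by apply: eq_bigr => l _; rewrite !mxE !eqxx mulr1 mul_polyC.
  by apply: big1 => l _; rewrite !mxE !eqxx eq_sym (negbTE ni) !mulr0.
have -> : (N * n = #|{: 'I_N * 'I_n}|)%N by rewrite card_prod !card_ord.
have coefS (a : 'I_n -> k) l : (\sum_(l < n) a l *: 'X^l : P)`_(nat_of_ord l) = a l.
  rewrite coef_sum (bigD1 l) //= coefZ coefXn eqxx mulr1 big1 ?addr0 // => l' nl.
  by rewrite coefZ coefXn eq_sym val_eqE (negbTE nl) mulr0.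
set S := (X in hasdim X); suff -> : S = lspan b.
  apply: hasdim_basis => a a0 [i l]; rewrite -(coefS (fun l => a (i, l))) -sumE a0 mxE coef0 //.
apply/seteqP; split=> [u hu|_ [a ->] j]; last first.
  rewrite /= sumE; elim/big_ind: _ => [|x y sx sy|l _]; first by rewrite size_poly0.
    by apply: leq_trans (size_polyD _ _) _; rewrite geq_max sx sy.
  by apply: leq_trans (size_scale_leq _ _) _; rewrite size_polyXn.
exists (fun x => ((u : 'rV[P]_N) 0 x.1)`_(nat_of_ord x.2)); apply/rowP => i.
rewrite sumE /= -[LHS]coefK poly_def.
have := hu i; move: (u 0 i) => f sf; rewrite -(big_mkord xpredT (fun l => f`_l *: 'X^l)) -(big_mkord xpredT (fun l => f`_l *: 'X^l)).
rewrite [RHS](big_cat_nat _ (n := size f)) //= [X in _ + X]big_nat_cond [X in _ + X]big1 ?addr0 // => l /andP[/andP[le _] _].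
by rewrite nth_default // scale0r.
Qed.

(** A left null vector v of A(tau), normalized by v_i = 1, shows that row i of A can be replaced by
    v A / (X - tau); [E] undoes this replacement. *)
Lemma peel_root N (A : 'M[P]_N) tau : root (\det A) tau -> exists i E A',
  [/\ A = E *m A', \det E = 'X - tau%:P &
      forall w : 'rV[P]_N, (w 0 i).[tau] = 0 <-> exists u, w = u *m E].
Proof.
move=> rt; have /eqP : \det (map_mx (horner_eval tau) A) = 0.
  by rewrite det_map_mx; apply/eqP.
move=> /eqP/eqP/det0P[v0 /rV0Pn[i vi0] v0A].
pose v := (v0 0 i)^-1 *: v0.
have vi : v 0 i = 1 by rewrite mxE mulVf.
have vA : v *m map_mx (horner_eval tau) A = 0 by rewrite -scalemxAl v0A scaler0.
pose E : 'M[P]_N := \matrix_(a, b) if a == i then (if b == i then 'X - tau%:P else - (v 0 b)%:P) else (a == b)%:R.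
pose vr : 'rV[P]_N := map_mx polyC v *m A.
have dv j : 'X - tau%:P %| vr 0 j.
  rewrite dvdp_XsubCl /root /vr mxE horner_sum; have := congr1 (fun u : 'rV[k]_N => u 0 j) vA.
  rewrite !mxE => e; rewrite -[X in _ == X]e; apply/eqP/eq_bigr => l _.
  by rewrite !mxE hornerM hornerC.
pose A' : 'M[P]_N := \matrix_(a, b) if a == i then vr 0 b %/ ('X - tau%:P) else A a b.
have EA : A = E *m A'.
  apply/matrixP => a b; rewrite mxE; have [->|ni] := eqVneq a i; last first.
    rewrite (bigD1 a) //= !mxE (negbTE ni) eqxx mul1r big1 ?addr0 // => l nl.
    by rewrite !mxE (negbTE ni) eq_sym (negbTE nl) mul0r.
  rewrite (bigD1 i) //=; have -> : E i i * A' i b = vr 0 b by rewrite [E i i]mxE [A' i b]mxE !eqxx mulrC divpK.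
  rewrite [vr 0 b]mxE (bigD1 i) //= [X in X * _]mxE vi mul1r -addrA -big_split /= big1 ?addr0 // => l nl.
  by rewrite [E i l]mxE [A' l b]mxE [X in X * _ + _]mxE eqxx (negbTE nl) mulNr subrr.
exists i, E, A'; split=> // [|w].
  rewrite (expand_det_col _ i) (bigD1 i) //= [X in _ + X]big1 ?addr0 => [|a na]; last first.
    by rewrite !mxE (negbTE na) mul0r.
  rewrite !mxE !eqxx /cofactor -signr_odd addnn odd_double expr0 mul1r.
  rewrite (_ : row' i _ = 1%:M) ?det1 ?mulr1 //; apply/matrixP => a b.
  by rewrite !mxE eq_sym (negbTE (neq_lift _ _)) (inj_eq lift_inj).
have uE (u : 'rV[P]_N) j : (u *m E) 0 j = if j == i then u 0 i * ('X - tau%:P) else u 0 j - u 0 i * (v 0 j)%:P.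
  rewrite mxE (bigD1 i) //= !mxE eqxx; case: eqP => [->|/eqP nj].
    rewrite big1 ?addr0 // => l nl; by rewrite !mxE (negbTE nl) mulr0.
  rewrite (bigD1 j) //= !mxE (negbTE nj) eqxx mulr1 big1 ?addr0; first by rewrite mulrN addrC.
  by move=> l /andP[nl nlj]; rewrite !mxE (negbTE nl) (negbTE nlj) mulr0.
split=> [wi|[u ->]]; last first.
  by rewrite uE eqxx hornerM hornerXsubC subrr mulr0.
pose u0 := w 0 i %/ ('X - tau%:P).
have u0E : u0 * ('X - tau%:P) = w 0 i by rewrite divpK // dvdp_XsubCl /root wi.
exists (\row_j if j == i then u0 else w 0 j + u0 * (v 0 j)%:P).
apply/rowP => j; rewrite uE !mxE eqxx; case: eqP => [->|_]; first by rewrite u0E.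
by rewrite addrK.
Qed.

(** The roots of V1 are stripped off the left of A one at a time. *)
Lemma peel N (A : 'M[P]_N) V1 V2 : V1 != 0 -> V2 != 0 -> \det A = V1 * V2 ->
  exists X1 X2 : 'M[P]_N, [/\ A = X1 *m X2, \det X1 %= V1 & \det X2 %= V2].
Proof.
move=> + V20; elim: {V1}(size V1) {-2}V1 (erefl (size V1)) A => [|m IH] V1 sV A V10 dA.
  by move: V10; rewrite -size_poly_eq0 sV.
have [m0|m0] := eqVneq m 0%N.
  have [c c0 V1E] : exists2 c, c != 0 & V1 = c%:P.
    by apply/size_poly1P; rewrite sV m0.
  exists 1%:M, A; split; first by rewrite mul1mx.
    by rewrite det1 V1E eqp_sym -size_poly_eq1 size_polyC c0.
  by rewrite dA V1E mul_polyC; apply: eqp_scale.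
have /closed_rootP[tau rt] : size V1 != 1%N by rewrite sV eqSS.
have [|i [E [A' [AE dE _]]]] := @peel_root N A tau; first by rewrite dA rootM rt.
have [W V1W] : exists W, V1 = W * ('X - tau%:P) by apply/factor_theorem.
have W0 : W != 0 by apply: contraNneq V10 => W0; rewrite V1W W0 mul0r.
have [|| X1 [X2 [A'E d1 d2]]] := IH W _ A' W0.
- by apply/eqP; rewrite -eqSS -sV V1W size_Mmonic ?monicXsubC // size_XsubC addn2.
- have XT : 'X - tau%:P != 0 :> P by rewrite polyXsubC_eq0.
  apply: (mulfI XT).
  by rewrite -dE -det_mulmx -AE dA V1W dE; ring.
exists (E *m X1), X2; split=> //; first by rewrite -mulmxA -A'E.
by rewrite det_mulmx dE V1W mulrC eqp_mul2r ?polyXsubC_eq0.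
Qed.

(** Riemann-Roch on the line: each root of det A imposes one linear condition, once n is large. *)
Lemma lattice_index N (A : 'M[P]_N) : \det A != 0 -> exists n1, forall n, (n1 <= n)%N ->
  exists2 m, hasdim ([set u | forall j, (size ((((u : 'rV[P]_N) *m A) ord0 j)%R) <= n)%N] : set (VP N)) m &
    (m + (size (\det A)).-1 = N * n)%N.
Proof.
move E : (size (\det A)) => m; elim: m A E => [|m IH] A sA nz.
  by move: nz; rewrite -size_poly_eq0 sA.
have [m0|m0] := eqVneq m 0%N.
  exists 0%N => n _; exists (N * n)%N; last by rewrite m0 addn0.
  have uA : A \in unitmx.
    have [c c0 dc] : exists2 c, c != 0 & \det A = c%:P by apply/size_poly1P; rewrite sA m0.
    by rewrite unitmxE dc rmorph_unit // unitfE.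
  set S := (X in hasdim X); pose f (v : VP N) : VP N := (v : 'rV[P]_N) *m invmx A.
  suff -> : S = f @` [set u | forall j, (size ((u : 'rV[P]_N) ord0 j) <= n)%N].
    apply: (hasdim_semilinear (s := id)) (poly_rows_hasdim N n).
    - by move=> c; exists c.
    - by move=> x y; rewrite /f mulmxDl.
    - by move=> c x; rewrite /f !restrZ scalemxAl.
    - move=> x _ /(congr1 (fun u : 'rV[P]_N => u *m A)).
      by rewrite /f mulmxKV // mul0mx.
  apply/seteqP; split=> [u hu|_ [v hv <-] j]; last by rewrite /f mulmxKV.
  by exists ((u : 'rV[P]_N) *m A) => //; rewrite /f mulmxK.
have /closed_rootP[tau rt] : size (\det A) != 1%N by rewrite sA eqSS.
have [i [E [A' [AE dE imE]]]] := peel_root rt.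
have XT : 'X - tau%:P != 0 :> P by rewrite polyXsubC_eq0.
have dA : \det A = \det A' * ('X - tau%:P) by rewrite AE det_mulmx dE mulrC.
have nz' : \det A' != 0 by apply: contraNneq nz => h; rewrite dA h mul0r.
have [|n1 hn1] := IH A' _ nz'.
  by apply/eqP; rewrite -eqSS -sA dA size_Mmonic ?monicXsubC // size_XsubC addn2.
(* n must reach the sizes in row i of A', so that the i-th unit vector satisfies the bound and the
   condition w_i(tau) = 0 has codimension exactly 1. *)
exists (maxn n1 (\max_j size (A' i j))) => n; rewrite geq_max => /andP[le1 le2].
have [m' hm' e'] := hn1 n le1.
pose ev (u : VP N) : k^o := ((u : 'rV[P]_N) 0 i).[tau].
have evl : linear ev by move=> a u v; rewrite /ev restrZ !mxE hornerD hornerM hornerC.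
pose evL := HB.pack_for {linear VP N -> k^o} ev (GRing.isLinear.Build _ _ _ _ _ evl).
have [a [b [ha hb ab]]] := hasdim_img evL hm'.
have a1 : a = 1%N.
  have h1 : hasdim [set: k^o] 1.
    exists (fun=> 1) => [c c0 j|].
      by move: c0; rewrite ord1 big_ord1 => /eqP; rewrite scaler_eq0 oner_eq0 orbF => /eqP.
    by apply/seteqP; split=> // x _; exists (fun=> x); rewrite big_ord1 [RHS]mulr1.
  move: ha; set X := (X in hasdim X a) => ha; apply: (hasdim_inj ha); suff -> : X = setT by [].
  apply/seteqP; split=> // x _; exists (x%:P *: (delta_mx 0 i : 'rV[P]_N)).
    move=> j; rewrite -scalemxAl -rowE !mxE.
    rewrite mul_polyC; apply: leq_trans (size_scale_leq _ _) _; apply: leq_trans le2.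
    exact: (leq_bigmax (F := fun j => size (A' i j))).
  by rewrite /= /ev !mxE !eqxx mulr1 hornerC.
exists b; last by rewrite -e' ab a1 add1n addSnnS prednK // lt0n.
pose f (u : VP N) : VP N := (u : 'rV[P]_N) *m E.
have fl : linear f by move=> c u v; rewrite /f !restrZ mulmxDl scalemxAl.
have dE0 : \det E != 0 by rewrite dE.
pose fL := HB.pack_for {linear VP N -> VP N} f (GRing.isLinear.Build _ _ _ _ _ fl).
apply: (hasdim_pre (f := fL)).
- split=> [j|c u v hu hv j]; first by rewrite mul0mx mxE size_poly0.
  rewrite restrZ mulmxDl mxE -scalemxAl mxE mul_polyC; apply: leq_trans (size_polyD _ _) _.
  by rewrite geq_max hv (leq_trans (size_scale_leq _ _)) ?hu.
- move=> u _ /= /(congr1 (fun u : 'rV[P]_N => u *m \adj E)).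
  rewrite /f -mulmxA mul_mx_adj mul0mx mul_mx_scalar => /eqP; rewrite scalemx_eq0 (negbTE dE0).
  by move/eqP.
suff <- : [set u : VP N | (forall j : 'I_N, (size (((u : 'rV[P]_N) *m A') ord0 j) <= n)%N)] `&` [set x | evL x = 0] = f @` [set u | (forall j : 'I_N, (size (((u : 'rV[P]_N) *m A) ord0 j) <= n)%N)] by [].
apply/seteqP; split=> [w [hw /imE[u wE]]|_ [u hu <-]].
  by exists u => // j; rewrite AE mulmxA -wE.
split=> [j|]; first by rewrite /f -mulmxA -AE.
by apply/imE; exists u.
Qed.
End PolyLattice.

(** * Determinants over L and norms to k(t) *)

Lemma det_sylvester (R : comNzRingType) m n (U : 'M[R]_(m, n)) (V : 'M[R]_(n, m)) :
  \det (1%:M + U *m V) = \det (1%:M + V *m U).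
Proof.
have e1 : block_mx 1%:M 0 V 1%:M *m block_mx 1%:M U (- V) 1%:M = block_mx 1%:M U 0 (1%:M + V *m U).
  by rewrite mulmx_block !mul1mx !mul0mx !mulmx1 !addr0 subrr addrC.
have e2 : block_mx 1%:M U (- V) 1%:M *m block_mx 1%:M 0 V 1%:M = block_mx (1%:M + U *m V) U 0 1%:M.
  by rewrite mulmx_block !mulmx1 !mul1mx !mulmx0 !add0r addNr.
have := congr1 determinant e1; have := congr1 determinant e2.
by rewrite !det_mulmx !det_lblock !det_ublock !det1 !mulr1 !mul1r => <- <-.
Qed.

Section TensorIndex.
Variable g : nat.

Definition pidx m (I : 'I_(m * g)) : 'I_m * 'I_g := enum_val (cast_ord (esym (mxvec_cast m g)) I).
Lemma pidxK m i j : @pidx m (mxvec_index i j) = (i, j).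
Proof. by rewrite /pidx /mxvec_index cast_ordK enum_rankK. Qed.
Lemma pidx_inj m : injective (@pidx m).
Proof. by move=> I J /enum_val_inj/cast_ord_inj. Qed.
Lemma pidx_mxvec m I : mxvec_index (@pidx m I).1 (pidx I).2 = I.
Proof. by apply: pidx_inj; rewrite pidxK -surjective_pairing. Qed.
Lemma sum_pidx (V : nmodType) m (F : 'I_(m * g) -> V) : \sum_I F I = \sum_i \sum_j F (mxvec_index i j).
Proof.
rewrite pair_bigA /= (reindex (fun ij : 'I_m * 'I_g => mxvec_index ij.1 ij.2)) //=.
by exists (@pidx m) => [[i j] _|I _]; [rewrite pidxK|rewrite pidx_mxvec].
Qed.

Section Tens.
Variable R : comNzRingType.
Definition kron m n (M : 'M[R]_(m, n)) : 'M[R]_(m * g, n * g) :=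
  \matrix_(I, J) (M (pidx I).1 (pidx J).1 *+ ((pidx I).2 == (pidx J).2)).
End Tens.
Lemma map_kron (R S : comNzRingType) (f : {rmorphism R -> S}) m n (M : 'M[R]_(m, n)) :
  map_mx f (kron M) = kron (map_mx f M).
Proof. by apply/matrixP => I J; rewrite !mxE rmorphMn. Qed.
End TensorIndex.

Section Norm.
Variables (k : closedFieldType) (FF : funfield k).
Notation K := {fraction {poly k}}.
Notation L := (ff_L FF).
Notation io := (@ff_io k FF).
Notation g := (ff_g FF).
Notation co := (@ff_co k FF).
Local Notation pol := (@pol k FF).
Local Notation cst := (@cst k FF).

(** Multiplication by [b] in the basis [be], acting on rows from the right; locked so that [mxE]
    does not open it. *)
Definition mat (b : L) : 'M[K]_g := locked (\matrix_(i, j) co (be i * b) 0 j).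
Lemma matE b i j : mat b i j = co (be i * b) 0 j.
Proof. by rewrite /mat -lock mxE. Qed.

Lemma co_mat x b : co (x * b) = co x *m mat b.
Proof.
rewrite {1}[x]coE mulr_suml co_sum mulmx_sum_row; apply: eq_bigr => i _.
rewrite -mulrA ff_coZ; congr (_ *: _); by apply/rowP => j; rewrite mxE matE.
Qed.
Lemma matM a b : mat (a * b) = mat a *m mat b.
Proof.
apply/row_matrixP => i; rewrite row_mul; have rE x : row i (mat x) = co (be i * x) by apply/rowP => j; rewrite mxE matE.
by rewrite !rE mulrA co_mat.
Qed.
Lemma matD a b : mat (a + b) = mat a + mat b.
Proof. by apply/matrixP => i j; rewrite mxE !matE mulrDr ff_coD mxE. Qed.
Lemma mat_io c : mat (io c) = c%:M.
Proof. by apply/matrixP => i j; rewrite matE mulrC ff_coZ co_be !mxE eqxx mulr_natr eq_sym. Qed.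
Lemma mat0 : mat 0 = 0.
Proof. by rewrite -(rmorph0 io) mat_io raddf0. Qed.
Lemma mat_sum (T : Type) (s : seq T) (Q : pred T) (f : T -> L) :
  mat (\sum_(i <- s | Q i) f i) = \sum_(i <- s | Q i) mat (f i).
Proof. by elim/big_rec2: _ => [|i y x _ <-]; rewrite ?mat0 ?matD. Qed.

Definition Phi m n (X : 'M[L]_(m, n)) : 'M[K]_(m * g, n * g) :=
  \matrix_(I, J) mat (X (pidx I).1 (pidx J).1) (pidx I).2 (pidx J).2.

Lemma PhiM m n l (X : 'M[L]_(m, n)) (Y : 'M_(n, l)) : Phi (X *m Y) = Phi X *m Phi Y.
Proof.
apply/matrixP => I J; rewrite !mxE mat_sum summxE sum_pidx; apply: eq_bigr => i _.
by rewrite matM mxE; apply: eq_bigr => j _; rewrite !mxE !pidxK.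
Qed.
Lemma PhiD m n (X Y : 'M[L]_(m, n)) : Phi (X + Y) = Phi X + Phi Y.
Proof. by apply/matrixP => I J; rewrite !mxE matD mxE. Qed.
Lemma Phi_kron m n (X : 'M[K]_(m, n)) : Phi (map_mx io X) = kron g X.
Proof. by apply/matrixP => I J; rewrite !mxE mat_io mxE. Qed.
Lemma kron_scalar m (c : K) : kron g (c%:M : 'M_m) = c%:M.
Proof.
apply/matrixP => I J; rewrite !mxE -(inj_eq (@pidx_inj g m)) -pair_eqE /pair_eq /=.
by case: eqP => // _; rewrite mul0rn.
Qed.
Lemma Phi_scalar m c : Phi ((io c)%:M : 'M[L]_m) = c%:M.
Proof. by rewrite -map_scalar_mx Phi_kron kron_scalar. Qed.
Lemma Phi1 m : Phi (1%:M : 'M[L]_m) = 1%:M.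
Proof. by rewrite -(rmorph1 io) Phi_scalar. Qed.

Definition cv m (u : 'rV[L]_m) : 'rV[K]_(m * g) := \row_J co (u 0 (pidx J).1) 0 (pidx J).2.
Lemma cvM m n (u : 'rV[L]_m) (X : 'M[L]_(m, n)) : cv (u *m X) = cv u *m Phi X.
Proof.
apply/rowP => J; rewrite !mxE co_sum summxE sum_pidx; apply: eq_bigr => i _.
by rewrite co_mat mxE; apply: eq_bigr => j _; rewrite !mxE !pidxK.
Qed.
Lemma cv_inj m : injective (@cv m).
Proof.
move=> u v uv; apply/rowP => i; apply: ff_inj; apply/rowP => j.
by have := congr1 (fun w : 'rV_(m * g) => w 0 (mxvec_index i j)) uv; rewrite !mxE !pidxK.
Qed.
Lemma cvD m (u v : 'rV[L]_m) : cv (u + v) = cv u + cv v.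
Proof. by apply/rowP => J; rewrite !mxE ff_coD mxE. Qed.
Lemma cvZ m c (u : 'rV[L]_m) : cv (io c *: u) = c *: cv u.
Proof. by apply/rowP => J; rewrite !mxE ff_coZ mxE. Qed.
Definition vc m (v : 'rV[K]_(m * g)) : 'rV[L]_m := \row_i \sum_j io (v 0 (mxvec_index i j)) * be j.
Lemma vcK m v : cv (@vc m v) = v.
Proof.
apply/rowP => J; rewrite !mxE co_sum summxE (bigD1 (pidx J).2) //= big1 ?addr0 => [|j nj].
  by rewrite ff_coZ co_be !mxE !eqxx mulr1 pidx_mxvec.
by rewrite ff_coZ co_be !mxE eq_sym (negbTE nj) andbF mulr0.
Qed.

(** The norm to k(t) of the determinant of X, obtained as one determinant over k(t). *)
Definition psi m (X : 'M[L]_m) : K := \det (Phi X).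
Lemma psiM m (X Y : 'M[L]_m) : psi (X *m Y) = psi X * psi Y.
Proof. by rewrite /psi PhiM det_mulmx. Qed.
Lemma psi1 m : psi (1%:M : 'M_m) = 1. Proof. by rewrite /psi Phi1 det1. Qed.
Lemma psi_unit m (X : 'M[L]_m) : X \in unitmx -> psi X != 0.
Proof.
move=> uX; have : psi X * psi (invmx X) = 1 by rewrite -psiM mulmxV ?psi1.
by apply: contra_eq_neq => ->; rewrite mul0r eq_sym oner_neq0.
Qed.

(* The norm of L over k(t). *)
Definition nm (b : L) : K := psi (b%:M : 'M_1).
Lemma nmM a b : nm (a * b) = nm a * nm b.
Proof. by rewrite /nm scalar_mxM psiM. Qed.
Lemma nmX a n : nm (a ^+ n) = nm a ^+ n.
Proof. by elim: n => [|n IH]; [rewrite expr0 /nm psi1|rewrite !exprS nmM IH]. Qed.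

Lemma psi_rank1 m (c : 'cV[L]_m) (r : 'rV[L]_m) : psi (1%:M + c *m r) = nm (1 + (r *m c) 0 0).
Proof.
rewrite /nm /psi PhiD PhiM Phi1 det_sylvester -PhiM -(Phi1 1) -PhiD; congr (\det (Phi _)).
by apply/matrixP => i j; rewrite !ord1 !mxE !eqxx !mulr1n.
Qed.

Lemma psi_sing m (X : 'M[L]_m) : X \notin unitmx -> psi X = 0.
Proof.
rewrite unitmxE unitfE negbK => /det0P[v v0 vX]; apply/eqP/det0P; exists (cv v).
  by apply: contraNneq v0 => v0; apply/eqP/cv_inj; rewrite v0; apply/rowP => J; rewrite !mxE co0 mxE.
by rewrite -cvM vX; apply/rowP => J; rewrite !mxE co0 mxE.
Qed.

Section FrobeniusNorm.
Variables (p : nat) (hp : p \in [pchar k]).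
Notation F := (pFrobenius_aut (pchL hp FF)).

Lemma psi_frob_rank1 m (c : 'cV[L]_m) (r : 'rV[L]_m) :
  psi (map_mx F (1%:M + c *m r)) = psi (1%:M + c *m r) ^+ p.
Proof.
rewrite map_mxD map_mx1 map_mxM !psi_rank1 -nmX; congr nm.
rewrite -[RHS]/(F (1 + (r *m c) 0 0)) rmorphD rmorph1; congr (_ + _).
by rewrite -map_mxM mxE.
Qed.

(** Both sides are multiplicative and vanish on singular matrices. On 1 + c r they agree, because
    [psi_rank1] reduces them to the norm of one element; invertible matrices are products of such
    factors. *)
Lemma psi_frob m (X : 'M[L]_m) : psi (map_mx F X) = psi X ^+ p.
Proof.
have [uX|nX] := boolP (X \in unitmx); last first.
  rewrite !psi_sing ?expr0n ?eqn0Ngt ?(p_gt0 hp) //.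
  by rewrite unitmxE det_map_mx fmorph_unit; move: nX; rewrite unitmxE unitfE.
(* Induction on the number of rows that may differ from those of the identity. The last of them is
   removed by a factor R = 1 + e r, after a column operation T if its diagonal entry is zero. *)
have P n (A : 'M[L]_m) : (n <= m)%N -> A \in unitmx -> (forall i : 'I_m, (n <= i)%N -> row i A = delta_mx 0 i) ->
    psi (map_mx F A) = psi A ^+ p.
  elim: n A => [|n IH] A nm uA hA.
    have -> : A = 1%:M by apply/row_matrixP => i; rewrite hA // row1.
    by rewrite map_mx1 psi1 expr1n.
  pose o := Ordinal nm.
  have main (B : 'M[L]_m) : B \in unitmx -> (forall i : 'I_m, (n < i)%N -> row i B = delta_mx 0 i) ->
      B o o != 0 -> psi (map_mx F B) = psi B ^+ p.
    move=> uB hB Boo; pose e : 'cV[L]_m := delta_mx o 0; pose r := row o B - delta_mx 0 o.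
    pose R := 1%:M + e *m r.
    have rowR i : row i R = if i == o then row o B else delta_mx 0 i.
      apply/rowP => j; rewrite !mxE big_ord1 !mxE eqxx andbT.
      case: (eqVneq i o) => [->|_]; last by rewrite mul0r addr0 mxE eqxx eq_sym.
      by rewrite mul1r mxE [j == o]eq_sym addrC subrK.
    have uR : R \in unitmx.
      rewrite unitmxE det_sylvester det_mx11 mxE mxE eqxx /r mulmxBl -rowE -colE !mxE !eqxx addrC subrK unitfE.
      by [].
    have rBR (i : 'I_m) : (n <= i)%N -> row i B = row i R.
      rewrite leq_eqVlt rowR => /orP[/eqP ni|lt]; last by rewrite hB // -val_eqE /= gtn_eqF.
      by have -> : i = o; [apply/val_inj|rewrite eqxx].
    have eB : psi B = psi (B *m invmx R) * psi R by rewrite -psiM mulmxKV.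
    have eR : psi (map_mx F R) = psi R ^+ p by apply: psi_frob_rank1.
    have eF : psi (map_mx F B) = psi (map_mx F (B *m invmx R)) * psi (map_mx F R) by rewrite -psiM -map_mxM mulmxKV.
    rewrite eF eR eB exprMn; congr (_ * _).
    apply: IH => [||i ni]; first exact: ltnW.
      by rewrite unitmx_mul uB unitmx_inv.
    by rewrite row_mul rBR // -row_mul mulmxV // row1.
  have [Aoo|] := eqVneq (A o o) 0; last exact: main.
  have [c Aoc cn] : exists2 c : 'I_m, A o c != 0 & (c < n)%N.
    apply: contrapT => nex.
    have v0 : (delta_mx 0 o - row o A) *m A = 0.
      rewrite mulmxBl -rowE [row o A *m A]mulmx_sum_row; apply/eqP; rewrite subr_eq0; apply/eqP.
      rewrite [LHS]row_sum_delta; apply: eq_bigr => c _.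
      have [lt|ge] := ltnP n c; first by rewrite (hA c lt).
      rewrite mxE; have [->|nz] := eqVneq (A o c) 0; first by rewrite !scale0r.
      case: nex; exists c => //; rewrite ltn_neqAle ge andbT; apply: contraNneq nz => cn.
      by have -> : c = o; [apply/val_inj|rewrite Aoo].
    have := congr1 (fun v : 'rV[L]_m => (v *m invmx A) 0 o) v0; rewrite mulmxK // mul0mx !mxE !eqxx Aoo subr0.
    by move/eqP; rewrite oner_eq0.
  have co : c != o by rewrite -val_eqE /= ltn_eqF.
  pose T := 1%:M + (delta_mx c 0 : 'cV[L]_m) *m (delta_mx 0 o : 'rV[L]_m).
  have AT i j : (A *m T) i j = A i j + (A i c) *+ (j == o).
    by rewrite mulmxDr mulmx1 mulmxA -colE mxE mxE big_ord1 !mxE eqxx mulr_natr.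
  have uT : T \in unitmx.
    rewrite unitmxE det_sylvester det_mx11 mul_delta_mx_cond eq_sym (negbTE co) mulr0n addr0 mxE eqxx.
    exact: unitr1.
  have eT : psi (map_mx F T) = psi T ^+ p by apply: psi_frob_rank1.
  have eF : psi (map_mx F (A *m T)) = psi (map_mx F A) * psi (map_mx F T) by rewrite -psiM -map_mxM.
  have := main (A *m T) _ _ _; rewrite eF eT psiM exprMn.
  rewrite unitmx_mul uA uT AT eqxx Aoo add0r Aoc => /(_ isT) h; apply: (mulIf (expf_neq0 p (psi_unit uT))).
  apply: h => // i ni; apply/rowP => j; rewrite mxE AT eq_sym.
  have -> : A i c = 0 by have := congr1 (fun v : 'rV_m => v 0 c) (hA i ni); rewrite !mxE => ->; rewrite eqxx /= -val_eqE /= ltn_eqF // (ltn_trans cn).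
  by rewrite mul0rn addr0 -(hA i ni) mxE.
apply: (P m) => // i; by rewrite leqNgt ltn_ord.
Qed.

Lemma frobXD (R : comNzRingType) e (x y : R) : p \in [pchar R] -> (x + y) ^+ (p ^ e) = x ^+ (p ^ e) + y ^+ (p ^ e).
Proof. by move=> h; apply: exprDn_pchar; rewrite pnatX (pnatE _ (pcharf_prime h)) h. Qed.

Lemma frobX_sum (R : comNzRingType) e (T : Type) (s : seq T) (Q : pred T) (f : T -> R) :
  p \in [pchar R] -> (\sum_(i <- s | Q i) f i) ^+ (p ^ e) = \sum_(i <- s | Q i) f i ^+ (p ^ e).
Proof.
move=> h; elim/big_rec2: _ => [|i y x _ <-]; last by rewrite frobXD.
by rewrite expr0n expn_eq0 eqn0Ngt (p_gt0 hp).
Qed.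

Definition frm e m n (X : 'M[L]_(m, n)) := map_mx (fun x => x ^+ (p ^ e)) X.
Lemma frmE e m n (X : 'M[L]_(m, n)) i j : frm e X i j = X i j ^+ (p ^ e).
Proof. exact: mxE. Qed.
Lemma frmM e m n l (X : 'M[L]_(m, n)) (Y : 'M_(n, l)) : frm e (X *m Y) = frm e X *m frm e Y.
Proof.
apply/matrixP => i j; rewrite !mxE frobX_sum ?(pchL hp) //; apply: eq_bigr => a _.
by rewrite exprMn !mxE.
Qed.
Lemma frm1 e m : frm e (1%:M : 'M[L]_m) = 1%:M.
Proof.
apply/matrixP => i j; rewrite !mxE; case: eqP => _ /=; first by rewrite expr1n.
by rewrite expr0n expn_eq0 eqn0Ngt (p_gt0 hp).
Qed.
Lemma psi_frm e m (X : 'M[L]_m) : psi (frm e X) = psi X ^+ (p ^ e).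
Proof.
elim: e => [|e IH].
  by rewrite expn0 expr1; congr psi; apply/matrixP => i j; rewrite mxE expr1.
rewrite expnSr exprM -IH -psi_frob; congr psi; apply/matrixP => i j.
by rewrite !mxE [RHS]pFrobenius_autE expnSr exprM.
Qed.

End FrobeniusNorm.
End Norm.

Lemma Cayley_Hamilton_sum (F : fieldType) n (A : 'M[F]_n) :
  \sum_(i < n.+1) (char_poly A)`_i *: A ^+ i = 0.
Proof.
case: n A => [|n] A; first by apply/matrixP => - [].
have := Cayley_Hamilton A; rewrite /horner_mx /horner_morph => h.
apply: etrans h; rewrite (horner_coef_wide (n := n.+2)) ?size_map_poly ?size_char_poly //.
by apply: eq_bigr => i _; rewrite coef_map /= -mul_scalar_mx.
Qed.

Lemma char_poly_horner (F : fieldType) n (A : 'M[F]_n) z : (char_poly A).[z] = \det (z%:M - A).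
Proof.
rewrite -[LHS]/(horner_eval z (char_poly A)) /char_poly -det_map_mx; congr (\det _).
apply/matrixP => i j; rewrite !mxE /= /horner_eval hornerD hornerN hornerC.
by case: eqP => _; rewrite ?mulr1n ?hornerX // mulr0n horner0.
Qed.

Lemma size_det_leq (k : fieldType) N d (A : 'M[{poly k}]_N) :
  (forall i j, (size (A i j) <= d.+1)%N) -> (size (\det A) <= (N * d).+1)%N.
Proof.
move=> h; apply: (big_ind (fun f : {poly k} => size f <= (N * d).+1)%N) => [|f f' hf hf'|s _].
- by rewrite size_poly0.
- by apply: leq_trans (size_polyD _ _) _; rewrite geq_max hf hf'.
rewrite size_Msign; apply: leq_trans (size_poly_prod_leq _ _) _.
apply: leq_trans (leq_sub2r _ (_ : _ <= (N * d.+1).+1)%N) _; last by rewrite card_ord; lia.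
by rewrite ltnS -[X in (_ <= X * _)%N]card_ord -sum_nat_const; apply: leq_sum.
Qed.

Lemma unit_selection (F : fieldType) m n (X : 'M[F]_(m, n)) : row_free X ->
  exists f : 'I_m -> 'I_n, X *m (\matrix_(i, j) (i == f j)%:R) \in unitmx.
Proof.
move=> fX; have rX : row_full X^T by rewrite /row_full mxrank_tr.
exists (fullrankfun rX); rewrite -unitmx_tr.
have := fullrowsub_unit rX; congr (is_true (_ \in unitmx)).
apply/matrixP => i j; rewrite !mxE (bigD1 (fullrankfun rX i)) //= !mxE eqxx mulr1 big1 ?addr0 // => l nl.
by rewrite !mxE (negbTE nl) mulr0.
Qed.

(** * Content, degree at infinity, and the index of the twisted lattice *)

Section Degree.
Variables (k : closedFieldType) (FF : funfield k).
Notation P := {poly k}.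
Notation K := {fraction P}.
Notation L := (ff_L FF).
Notation io := (@ff_io k FF).
Notation g := (ff_g FF).
Notation co := (@ff_co k FF).
Notation frac := (@tofrac P).
Local Notation pol := (@pol k FF).
Local Notation cst := (@cst k FF).

(** Reducing by the equation of y writes A^q y^q through 1, y, ..., y^(h-1) with coefficients of
    degree at most q m. Only these h powers have denominators, so D and c do not depend on q. *)
Lemma int_bound (T : finType) (y : T -> L) (A : P) m h : (0 < h)%N -> (size A <= m.+1)%N ->
  (forall x, exists2 Q : 'I_h -> P, forall j, (size (Q j) <= m.+1)%N &
     pol A * y x ^+ h = \sum_j pol (Q j) * y x ^+ j) ->
  exists2 D : P, D != 0 & exists c, forall q n x u, Ob n u ->
    Ob (n + q * m + c) (pol D * (pol A ^+ q * y x ^+ q * u)).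
Proof.
case: h => // h _ sA hQ.
have [D D0 [c hc]] := Ob_mul (fun xj : T * 'I_h.+1 => y xj.1 ^+ xj.2).
exists D => //; exists c => q n x u hu; have [Q sQ eQ] := hQ x.
have mulle (f f' : P) a b : (size f <= a.+1)%N -> (size f' <= b.+1)%N -> (size (f * f')%R <= (a + b).+1)%N.
  by move=> sf sf'; apply: leq_trans (size_polyMleq _ _) _; lia.
have [a sa ea] : exists2 a : 'I_h.+1 -> P, forall j, (size (a j) <= (q * m).+1)%N &
    pol A ^+ q * y x ^+ q = \sum_j pol (a j) * y x ^+ j.
  elim: q => [|q [a sa ea]].
    exists (fun j => (j == ord0)%:R) => [j|]; first by case: eqP => _; rewrite ?size_poly1 ?size_poly0.
    rewrite (bigD1 ord0) //= big1 ?addr0 => [|j /negbTE ->]; first by rewrite rmorph1.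
    by rewrite rmorph0 mul0r.
  exists (fun j => (if unlift ord0 j is Some i then A * a (widen_ord (leqnSn h) i) else 0) + a ord_max * Q j) => [j|].
    rewrite mulSn; apply: leq_trans (size_polyD _ _) _; rewrite geq_max; apply/andP; split.
      by case: unliftP => [i _|_]; [apply: mulle|rewrite size_poly0].
    by rewrite addnC; apply: mulle.
  rewrite !exprS mulrACA ea mulr_sumr.
  under [RHS]eq_bigr do rewrite rmorphD mulrDl; rewrite big_split /=.
  rewrite big_ord_recr big_ord_recl unlift_none rmorph0 mul0r add0r; congr (_ + _).
    apply: eq_bigr => i _; rewrite liftK rmorphM /= exprS; ring.
  transitivity (pol (a ord_max) * (pol A * y x ^+ h.+1)); first by rewrite exprS /=; ring.
  by rewrite eQ mulr_sumr; apply: eq_bigr => j _; rewrite rmorphM mulrA.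
rewrite ea mulr_suml mulr_sumr; apply: Ob_sum => j _.
have -> : pol D * (pol (a j) * y x ^+ j * u) = pol (a j) * (pol D * y x ^+ j * u) by ring.
have := Ob_pol (sa j) (hc (x, j) _ _ hu); apply: Ob_le; lia.
Qed.

Lemma polM (f h : P) : pol (f * h) = pol f * pol h. Proof. exact: rmorphM. Qed.
Lemma polX (f : P) n : pol (f ^+ n) = pol f ^+ n. Proof. exact: rmorphXn. Qed.

Definition Lat (x : L) : Prop := forall j, exists f : P, co x 0 j = frac f.
Lemma Ob_Lat n x : Ob n x -> Lat x.
Proof. by move=> hx j; have [f _ e] := hx j; exists f. Qed.
Lemma Lat_Ob x : Lat x -> exists n, Ob n x.
Proof.
move=> /choice[f hf]; exists (\max_j size (f j))%N => j; exists (f j) => //.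
exact: (leq_bigmax (F := fun j => size (f j))).
Qed.
Lemma Lat_pol f x : Lat x -> Lat (pol f * x).
Proof. by move=> hx j; have [h e] := hx j; exists (f * h); rewrite co_pol mxE e rmorphM. Qed.
Lemma LatD x y : Lat x -> Lat y -> Lat (x + y).
Proof. by move=> hx hy j; have [f e] := hx j; have [f' e'] := hy j; exists (f + f'); rewrite ff_coD mxE e e' rmorphD. Qed.
Lemma Lat0 : Lat 0.
Proof. by move=> j; exists 0; rewrite co0 mxE rmorph0. Qed.
Lemma Lat_sum (T : Type) (s : seq T) (Q : pred T) (f : T -> L) :
  (forall i, Q i -> Lat (f i)) -> Lat (\sum_(i <- s | Q i) f i).
Proof. by move=> h; elim/big_ind: _ => //; [exact: Lat0|exact: LatD]. Qed.

Lemma int_lat (T : finType) (y : T -> L) (A : P) h : (0 < h)%N ->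
  (forall x, exists Q : 'I_h -> P, pol A * y x ^+ h = \sum_j pol (Q j) * y x ^+ j) ->
  exists2 D : P, D != 0 & forall q x u, Lat u -> Lat (pol D * (pol A ^+ q * y x ^+ q * u)).
Proof.
move=> h0 /choice[Q hQ]; pose m := (size A + \max_x \max_j size (Q x j))%N.
have [||D D0 [c hc]] := @int_bound T y A m h h0.
- by rewrite /m; lia.
- move=> x; exists (Q x) => // j; rewrite /m.
  have := leq_bigmax (F := fun j => size (Q x j)) j; have := leq_bigmax (F := fun x => \max_j size (Q x j))%N x.
  by move=> /= h1 h2; apply: leqW; apply: leq_trans (leq_addl _ _); apply: leq_trans h2 h1.
by exists D => // q x u /Lat_Ob[n hn]; apply: Ob_Lat (hc q n x u hn).
Qed.

Lemma size_quot (C Q R : P) m : C != 0 -> Q != 0 -> C * Q = - R -> (size R <= size C + m)%N -> (size Q <= m.+1)%N.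
Proof.
move=> C0 Q0 CQ; rewrite -size_polyN -CQ size_mul //.
have := size_poly_gt0 C; rewrite C0; case: (size C) => // l _.
by rewrite !addSn -[(l + m).+1]addnS /= leq_add2l.
Qed.

Lemma Lat_coprime (A B : P) x : coprimep A B -> Lat (pol A * x) -> Lat (pol B * x) -> Lat x.
Proof.
move=> /Bezout_coprimepP[[u v] /= uv] hA hB.
have [c c0 uvE] : exists2 c, c != 0 & u * A + v * B = c%:P.
  by apply/size_poly1P; rewrite size_poly_eq1.
have -> : x = pol (c^-1)%:P * (pol u * (pol A * x) + pol v * (pol B * x)).
  rewrite !mulrA -mulrDl -!rmorphM -rmorphD uvE mulrA -rmorphM -polyCM mulVf //.
  by rewrite rmorph1 mul1r.
by apply: Lat_pol; apply: LatD; apply: Lat_pol.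
Qed.

Lemma Ob_div n m (A : P) x : A != 0 -> size A = m.+1 -> Lat x -> Ob n (pol A * x) -> Ob (n - m) x.
Proof.
move=> A0 sA hx hAx j; have [f fE] := hx j; exists f => //.
have [f' sf'] := hAx j; rewrite co_pol mxE fE -rmorphM => /eqP; rewrite tofrac_eq => /eqP e.
have [->|f0] := eqVneq f 0; first by rewrite size_poly0.
have e' : size f' = (m + size f)%N by rewrite -e size_mul // sA.
by rewrite -(addKn m (size f)) leq_sub2r // -e'.
Qed.

Lemma cv_lat m (u : 'rV[L]_m) : (forall i, Lat (u 0 i)) -> exists z : 'rV[P]_(m * g), cv u = map_mx frac z.
Proof.
move=> hu; have h J : exists f, cv u 0 J = frac f by have [f e] := hu (pidx J).1 (pidx J).2; exists f; rewrite mxE.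
by have [f hf] := choice h; exists (\row_J f J); apply/rowP => J; rewrite hf !mxE.
Qed.

Section Content.
Variables (rho s : nat) (G : 'M[L]_(rho, s)) (Gam : 'M[P]_(rho * g, s * g)).
Hypotheses (PG : Phi G = map_mx frac Gam) (fG : row_free G).
Notation ip M := (map_mx pol M).

(** By [nuE] the norm of det (G M). These values act as Pluecker coordinates of the row space of
    G. *)
Definition nu (M : 'M[P]_(s, rho)) : P := \det (Gam *m kron g M).
(** The same determinant with one more variable, into which constants are substituted for [dvd_eval]
    and [size_eval]. *)
Definition nuP (N : 'M[{poly P}]_(s, rho)) : {poly P} := \det (map_mx polyC Gam *m kron g N).

Lemma nuE M : frac (nu M) = psi (G *m ip M).
Proof.
rewrite /psi PhiM PG /nu -det_map_mx map_mxM; congr (\det (_ *m _)).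
by rewrite map_kron -Phi_kron -map_mx_comp.
Qed.

Lemma nuP_horner N x : (nuP N).[x] = nu (map_mx (horner_eval x) N).
Proof.
rewrite -[LHS]/(horner_eval x (nuP N)) /nuP -det_map_mx map_mxM map_kron; congr (\det (_ *m _)).
by apply/matrixP => i j; rewrite !mxE; exact: hornerC.
Qed.

Lemma nu_unit M : G *m ip M \in unitmx -> nu M != 0.
Proof. by move=> /psi_unit; rewrite -nuE tofrac_eq0. Qed.

Lemma unit_of_nu M : nu M != 0 -> G *m ip M \in unitmx.
Proof. by apply: contraNT => /psi_sing; rewrite -nuE => /eqP; rewrite tofrac_eq0. Qed.

(** C is a common divisor of largest degree of the values of [nu] at matrices over k. It divides the
    values at polynomial matrices too, as these are polynomials in a new variable whose values at
    constants are known; maximality forbids a further common linear factor. *)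
Lemma content : exists C : P, [/\ C != 0, forall M, C %| nu M &
  forall a, exists M : 'M[k]_(s, rho), ~~ (C * ('X - a%:P) %| nu (map_mx polyC M))].
Proof.
have [f uf] := unit_selection fG; pose M0 : 'M[k]_(s, rho) := \matrix_(i, j) (i == f j)%:R.
have n0 : nu (map_mx polyC M0) != 0.
  apply: nu_unit; move: uf; congr (is_true (_ *m _ \in unitmx)).
  by apply/matrixP => i j; rewrite !mxE !rmorph_nat.
pose Pd d := `[< exists2 C : P, size C = d.+1 & forall M : 'M[k]_(s, rho), C %| nu (map_mx polyC M) >].
have Pd0 : exists d, Pd d by exists 0%N; apply/asboolP; exists 1 => [|M]; [rewrite size_poly1|rewrite dvd1p].
have Pdb d : Pd d -> (d <= size (nu (map_mx polyC M0)))%N.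
  by move=> /asboolP[C sC /(_ M0) /(dvdp_leq n0)]; rewrite sC; apply: ltnW.
case: (ex_maxnP Pd0 Pdb) => d /asboolP[C sC hC] max.
have C0 : C != 0 by rewrite -size_poly_eq0 sC.
exists C; split=> // [M|a].
  pose N := map_mx (map_poly polyC) M : 'M[{poly P}]_(s, rho).
  have -> : nu M = (nuP N).['X].
    rewrite nuP_horner; congr nu; apply/matrixP => i j; rewrite !mxE /horner_eval.
    by rewrite -[LHS]comp_polyXr.
  apply: dvd_horner; apply: dvd_eval => c; rewrite nuP_horner.
  have := hC (map_mx (horner_eval c) M); congr (is_true (_ %| nu _)).
  by apply/matrixP => i j; rewrite !mxE /horner_eval horner_map.
apply: contrapT => /forallNP h.
suff /max : Pd d.+1 by rewrite ltnn.
apply/asboolP; exists (C * ('X - a%:P)); first by rewrite size_Mmonic ?monicXsubC // size_XsubC sC addn2.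
by move=> M; apply/negPn/negP; apply: h.
Qed.

(** Each of the finitely many roots of A is avoided by some matrix over k. Two matrices that avoid
    different roots are joined by a line, on which each condition excludes finitely many points. *)
Lemma coprime_section (C A : P) : C != 0 -> (forall M, C %| nu M) ->
  (forall a, exists M : 'M[k]_(s, rho), ~~ (C * ('X - a%:P) %| nu (map_mx polyC M))) -> A != 0 ->
  exists (M : 'M[k]_(s, rho)) B, [/\ nu (map_mx polyC M) = C * B, B != 0 & coprimep A B].
Proof.
move=> C0 hC ha A0.
have avoid (l : seq k) : exists M : 'M[k]_(s, rho), forall a, a \in l -> ~~ (C * ('X - a%:P) %| nu (map_mx polyC M)).
  elim: l => [|a l [M1 hM1]]; first by exists 0.
  have [M2 hM2] := ha a.
  pose N := map_mx (fun x : k => x%:P%:P) M1 + 'X *: map_mx (fun x : k => x%:P%:P) (M2 - M1) : 'M[{poly P}]_(s, rho).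
  have NE c : map_mx (horner_eval c%:P) N = map_mx polyC (M1 + c *: (M2 - M1)).
    apply/matrixP => i j; rewrite !mxE /horner_eval hornerD hornerM !hornerC hornerX.
    by rewrite [RHS]polyCD [(c * _)%:P]polyCM.
  have dN i : C %| (nuP N)`_i by apply: dvd_eval => c; rewrite nuP_horner.
  pose Q : {poly P} := \poly_(i < size (nuP N)) ((nuP N)`_i %/ C).
  have QE c : nu (map_mx polyC (M1 + c *: (M2 - M1))) = C * Q.[c%:P].
    rewrite -NE -nuP_horner horner_poly horner_coef mulr_sumr; apply: eq_bigr => i _.
    by rewrite mulrA [C * _]mulrC divpK.
  pose R b := map_poly (horner_eval b) Q.
  have RE b c : (C * ('X - b%:P) %| nu (map_mx polyC (M1 + c *: (M2 - M1)))) = ((R b).[c] == 0).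
    rewrite QE dvdp_mul2l // dvdp_XsubCl /root; congr (_ == _).
    by rewrite /R -[c in RHS](hornerC c b) -[c%:P.[b]]/(horner_eval b c%:P) horner_map.
  have R0 b : b \in a :: l -> R b != 0.
    rewrite inE => /orP[/eqP ->|bl].
      apply: contraNneq hM2 => Ra; have := RE a 1; rewrite Ra horner0 eqxx scale1r [M1 + _]addrC subrK.
      by move=> ->.
    apply: contraNneq (hM1 b bl) => Rb; have := RE b 0; rewrite Rb horner0 eqxx scale0r addr0.
    by move=> ->.
  have pR : \prod_(b <- a :: l) R b != 0 by rewrite prodf_seq_neq0; apply/allP => b /R0 /= ->.
  have [c hc] : exists c, (\prod_(b <- a :: l) R b).[c] != 0.
    apply: contrapT => /forallNP h; case/negP: pR; apply/eqP/poly_eval0 => c.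
    by apply/eqP/negPn/negP; apply: h.
  exists (M1 + c *: (M2 - M1)) => b bl; rewrite RE; apply: contraNneq hc => Rb.
  rewrite horner_prod (big_rem b) //= Rb mul0r //.
have [r rE] := closed_field_poly_normal A.
(* The extra root 0 makes the list nonempty, and avoiding any root at all forces B to be nonzero. *)
have [M hM] := avoid (0 :: r); have /divpK BE := hC (map_mx polyC M).
set B := _ %/ C in BE; exists M, B; split; first by rewrite mulrC BE.
  apply: contraNneq (hM 0 (mem_head _ _)) => B0; by rewrite -BE B0 mul0r dvdp0.
apply/negPn/negP; rewrite /coprimep => /closed_rootP[a]; rewrite root_gcd => /andP[rA rB].
have ar : a \in r.
  by move: rA; rewrite rE rootZ ?lead_coef_eq0 // root_prod_XsubC.
have := hM a; rewrite inE ar orbT => /(_ isT) /negP; apply.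
by rewrite -BE mulrC dvdp_mul2r // dvdp_XsubCl.
Qed.

Definition twist (om : 'I_s -> nat) (M : 'M[k]_(s, rho)) : 'M[P]_(s, rho) :=
  \matrix_(i, j) ('X^(om i) * (M i j)%:P).

(** The counterpart at infinity of [content]: a matrix over k at which the twisted [nu] has its
    largest degree. *)
Lemma max_section om : exists2 M1 : 'M[k]_(s, rho), nu (twist om M1) != 0 &
  forall M : 'M[k]_(s, rho), (size (nu (twist om M)) <= size (nu (twist om M1)))%N.
Proof.
pose d := (\max_I \max_J size (Gam I J) + \max_i om i)%N.
have bound M : (size (nu (twist om M)) <= ((rho * g) * d).+1)%N.
  apply: size_det_leq => I J; rewrite mxE; apply: (big_ind (fun f : P => size f <= d.+1)%N).
  - by rewrite size_poly0.
  - by move=> f f' hf hf'; apply: leq_trans (size_polyD _ _) _; rewrite geq_max hf hf'.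
  move=> J' _; rewrite !mxE; case: eqP => _; last by rewrite mulr0n mulr0 size_poly0.
  rewrite mulr1n; set c := M _ _; set l := om _.
  have h1 : (size ('X^l * c%:P)%R <= l.+1)%N.
    by rewrite mulrC mul_polyC; apply: leq_trans (size_scale_leq _ _) _; rewrite size_polyXn.
  have h2 : (size (Gam I J') <= \max_I \max_J size (Gam I J))%N.
    apply: leq_trans (leq_bigmax (F := fun J => size (Gam I J)) J') _.
    exact: (leq_bigmax (F := fun I => \max_J size (Gam I J))%N).
  have h3 : (l <= \max_i om i)%N := leq_bigmax (F := om) (pidx J').1.
  apply: leq_trans (size_polyMleq _ _) _; apply: leq_trans (leq_pred _) _; rewrite /d -addnS.
  by apply: leq_add h2 (leq_trans h1 _); rewrite ltnS.
pose Pd d := `[< exists M, size (nu (twist om M)) = d >].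
have Pd0 : exists d, Pd d by exists (size (nu (twist om 0))); apply/asboolP; exists 0.
have Pdb e : Pd e -> (e <= ((rho * g) * d).+1)%N by move=> /asboolP[M <-].
case: (ex_maxnP Pd0 Pdb) => e /asboolP[M1 sM] max.
have hM M : (size (nu (twist om M)) <= size (nu (twist om M1)))%N.
  by rewrite sM; apply: max; apply/asboolP; exists M.
exists M1 => //; rewrite -size_poly_gt0.
pose D : 'M[L]_s := diag_mx (\row_i pol 'X^(om i)).
have uD : D \in unitmx.
  rewrite unitmxE det_diag unitfE; apply/prodf_neq0 => i _; rewrite mxE pol_eq0.
  exact: monic_neq0 (monicXn _ _).
have fGD : row_free (G *m D) by rewrite /row_free mxrankMfree ?row_free_unit.
have [f uf] := unit_selection fGD.
apply: leq_trans (hM (\matrix_(i, j) (i == f j)%:R)); rewrite size_poly_gt0; apply: nu_unit.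
move: uf; rewrite -mulmxA; congr (is_true (_ *m _ \in unitmx)); apply/matrixP => i j.
rewrite mul_diag_mx !mxE rmorphM /=; congr (_ * _); by case: eqP => _; rewrite ?rmorph1 ?rmorph0.
Qed.

Section Entry.
Variables (M : 'M[P]_(s, rho)) (a : 'I_rho) (j : 'I_s) (f : P).
Hypothesis nM : nu M != 0.
Let H := invmx (G *m ip M) *m G.

Definition change_col (c : P) : 'M[P]_(s, rho) :=
  \matrix_(i, b) if b == a then c * M i a + (f *+ (i == j)) else M i b.

Lemma change_colE c : psi (G *m ip (change_col c)) = psi (G *m ip M) * nm (pol c + pol f * H a j).
Proof.
have uG := unit_of_nu nM.
pose r : 'rV[L]_rho := delta_mx 0 a; pose v : 'cV[L]_rho := (pol c - 1) *: delta_mx a 0 + pol f *: col j H.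
have GH : G *m ip M *m H = G by rewrite /H mulKVmx.
have colM m n l (A : 'M[L]_(m, n)) (B : 'M_(n, l)) i : A *m col i B = col i (A *m B) by rewrite !colE mulmxA.
have -> : G *m ip (change_col c) = (G *m ip M) *m (1%:M + v *m r).
  rewrite mulmxDr mulmx1 mulmxA /v mulmxDr -!scalemxAr -colE [X in _ + pol f *: X]colM GH -colM [col j G]colE.
  transitivity (G *m (ip M + ((pol c - 1) *: col a (ip M) + pol f *: delta_mx j 0) *m r)).
    congr (_ *m _); apply/matrixP => i b; rewrite !mxE big_ord1 !mxE eqxx /= andbT.
    case: eqP => [->|_]; last by rewrite mulr0 addr0.
    rewrite mulr1 rmorphD rmorphM rmorphMn /= mulr_natr; ring.
  by rewrite mulmxDr mulmxA mulmxDr -!scalemxAr.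
rewrite psiM psi_rank1; congr (_ * nm _).
by rewrite /r /v mulmxDr -!scalemxAr -!rowE !mxE !eqxx mulr1; ring.
Qed.

(** Replacing column a of M by c times it plus f e_j multiplies G M by a rank one perturbation of 1
    and [nu M] by the norm of c + f H_aj. Hence Q is [nu M] times the characteristic polynomial of -
    f H_aj. Its values, and so its coefficients, are divisible by the content, which gives H_aj an
    equation with leading coefficient [nu M] / C. *)
Lemma entry_integral : exists Q : {poly P}, [/\ forall c, Q.[c] = nu (change_col c),
  Q`_(1 * g) = nu M & \sum_(i < (1 * g).+1) pol Q`_i * (- (pol f * H a j)) ^+ i = 0].
Proof.
pose N : 'M[{poly P}]_(s, rho) := \matrix_(i, b) if b == a then 'X * (M i a)%:P + (f%:P *+ (i == j)) else (M i b)%:P.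
have QE c : (nuP N).[c] = nu (change_col c).
  rewrite nuP_horner; congr nu; apply/matrixP => i b; rewrite !mxE /horner_eval.
  by case: eqP => _; rewrite ?hornerD ?hornerM ?hornerMn ?hornerX !hornerC.
pose y := pol f * H a j; pose Ps (b : L) := Phi (b%:M : 'M_1).
have PsM x z : Ps (x * z) = Ps x *m Ps z by rewrite /Ps scalar_mxM PhiM.
have PsD x z : Ps (x + z) = Ps x + Ps z by rewrite /Ps raddfD PhiD.
have Psio c : Ps (io c) = c%:M by rewrite /Ps Phi_scalar.
have Ps0 : Ps 0 = 0 by rewrite -(rmorph0 io) Psio raddf0.
have PsN x : Ps (- x) = - Ps x by apply/eqP; rewrite -addr_eq0 -PsD addNr Ps0.
have PsX x i : Ps (x ^+ i) = Ps x ^+ i.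
  elim: i => [|i IH]; first by rewrite !expr0 -(rmorph1 io) Psio.
  by rewrite !exprS PsM IH.
pose chi := char_poly (- Ps y).
have sQ : map_poly frac (nuP N) = frac (nu M) *: chi.
  apply/eqP; rewrite -subr_eq0; apply: contraT => nz; set R := _ - _ in nz.
  (* The two sides agree at every polynomial c, and the powers of X supply more such points than the
     degree of the difference. *)
  pose rs := [seq frac 'X^l | l <- iota 0 (size R)].
  have := @max_poly_roots _ R rs nz; rewrite size_map size_iota ltnn => h; apply: h.
    apply/allP => _ /mapP[l _ ->]; rewrite /root /R hornerD hornerN hornerZ horner_map /= QE.
    rewrite subr_eq0 !nuE change_colE char_poly_horner opprK; apply/eqP; congr (_ * \det _).
    by rewrite -[pol _]/(io _) -Psio -PsD.
  rewrite map_inj_uniq ?iota_uniq // => l l' /eqP; rewrite tofrac_eq => /eqP e.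
  by have := congr1 (fun x : P => size x) e; rewrite !size_polyXn => -[].
have Qi i : frac (nuP N)`_i = frac (nu M) * chi`_i.
  by have := congr1 (fun r : {poly K} => r`_i) sQ; rewrite coef_map coefZ.
exists (nuP N); split=> //.
  apply/eqP; rewrite -tofrac_eq Qi; have := monicP (char_poly_monic (- Ps y)).
  by rewrite lead_coefE size_char_poly /= => ->; rewrite mulr1.
transitivity (pol (nu M) * \sum_(i < (1 * g).+1) io chi`_i * (- y) ^+ i).
  rewrite mulr_sumr; apply: eq_bigr => i _.
  by rewrite -[pol _`_i]/(io (frac _)) Qi rmorphM mulrA.
set S := \sum_(_ < _) _; suff S0 : Ps S = 0.
  have : cv (1%:M *m (S%:M : 'M_1)) = cv (0 : 'rV_1).
    by rewrite cvM -/(Ps S) S0 mulmx0; apply/rowP => J; rewrite !mxE co0 mxE.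
  rewrite mul1mx => /(@cv_inj k FF)/matrixP/(_ 0 0); rewrite !mxE eqxx mulr1n => ->.
  by rewrite mulr0.
rewrite -[RHS](Cayley_Hamilton_sum (- Ps y)) /S (big_morph Ps PsD Ps0).
by apply: eq_bigr => i _; rewrite PsM Psio mul_scalar_mx PsX PsN.
Qed.
End Entry.
End Content.

Section Twists.
Variables (p : nat) (hp : p \in [pchar k]).
Variables (rho s : nat) (G : 'M[L]_(rho, s)) (om : 'I_s -> nat).
Hypotheses (fG : row_free G) (rho0 : (0 < rho)%N).
Notation ip M := (map_mx pol M).
Notation N := (rho * g)%N.
Notation VP := (restr (@polyC k) 'rV[P]_N).

Definition row_space m (A : 'M[L]_(m, s)) : set 'rV[L]_s := [set x | (x <= A)%MS].

(** The rows of H_i = (G M_i)^(-1) G form a basis of the row space whose denominators divide powers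
    of A for M_1 and of B for M_2, up to fixed factors; M_1 is also adapted to infinity. In the
    coordinates z = x M_1^(q) the vectors of bounded pole order form, up to bounded shifts, a
    lattice of index deg A^q. So r0 is deg A, the degree of [nu M1] minus that of the content. *)
Lemma deg_frob_aux (Gam : 'M[P]_(rho * g, s * g)) : Phi G = map_mx frac Gam ->
  exists r0 C, forall e, exists n1, forall n w, (n1 <= n)%N ->
    hasdim (Un (fun i => p ^ e * om i)%N (row_space (frm p e G)) n) w ->
    (N * n <= w + r0 * p ^ e + C)%N /\ (w + r0 * p ^ e <= N * n + C)%N.
Proof.
move=> PG; have [C [C0 hC ha]] := content PG fG.
have [Minf nM1 maxM] := max_section PG fG om; set M1 := twist om Minf in nM1 maxM.
have [A AE] : exists A, nu Gam M1 = C * A by exists (nu Gam M1 %/ C); rewrite mulrC divpK.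
have A0 : A != 0 by apply: contraNneq nM1 => A0; rewrite AE A0 mulr0.
have [M2c [B [BE B0 coAB]]] := coprime_section C0 hC ha A0.
set M2 := map_mx polyC M2c in BE.
have nM2 : nu Gam M2 != 0 by rewrite BE mulf_neq0.
pose m := (size A).-1; have sA : size A = m.+1 by rewrite /m prednK // size_poly_gt0.
have u1 := unit_of_nu PG nM1; have u2 := unit_of_nu PG nM2.
pose H1 := invmx (G *m ip M1) *m G; pose H2 := invmx (G *m ip M2) *m G.
have H1M : H1 *m ip M1 = 1%:M by rewrite -mulmxA mulVmx.
pose Y := H2 *m ip M1; pose Z := H1 *m ip M2.
have H2E : H2 = Y *m H1 by rewrite /Y /H2 /H1 !mulmxA -[_ *m G *m ip M1]mulmxA mulmxK.
have ZY : Z *m Y = 1%:M.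
  rewrite /Z /Y /H1 /H2 -!mulmxA [G *m (ip M2 *m _)]mulmxA mulKVmx //.
  by rewrite mulVmx.
have psiY : psi Y * frac B = frac A.
  have : psi (G *m ip M2) * psi Y = psi (G *m ip M1) by rewrite -psiM /Y /H2 -[invmx _ *m G *m _]mulmxA mulKVmx.
  rewrite -(nuE PG) -(nuE PG) AE BE !rmorphM /= mulrC mulrCA => /mulfI; apply.
  by rewrite tofrac_eq0.
have g0 := g_gt0 FF.
have entry (M : 'M[P]_(s, rho)) E a j f : nu Gam M != 0 -> nu Gam M = C * E ->
    exists2 Q : 'I_(1 * g) -> P, (forall i, exists2 R : {poly P}, (forall c, R.[c] = nu Gam (change_col M a j f c)) & C * Q i = - R`_i) &
      pol E * (- (pol f * (invmx (G *m ip M) *m G) a j)) ^+ (1 * g) =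
      \sum_i pol (Q i) * (- (pol f * (invmx (G *m ip M) *m G) a j)) ^+ i.
  move=> nM ME; have [R [hR hRg]] := entry_integral PG a j f nM.
  have dR i : C %| R`_i by apply: dvd_eval => c; rewrite hR.
  rewrite big_ord_recr /= hRg ME => h; exists (fun i => - (R`_i %/ C)) => [i|].
    by exists R => //; rewrite mulrN [C * _]mulrC divpK.
  have pC : pol C != 0 by rewrite pol_eq0.
  apply: (mulfI pC); apply/eqP; rewrite -subr_eq0 -[X in _ == X]h addrC mulr_sumr -sumrN rmorphM mulrA; apply/eqP.
  congr (_ + _); apply: eq_bigr => i _.
  by rewrite rmorphN mulNr mulrN opprK mulrA -rmorphM [C * _]mulrC divpK.
have sgn q (a b z u : L) : pol ((-1) ^+ q) * (a * (b * (- z) ^+ q * u)) = a * (b * z ^+ q * u).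
  have -> : pol ((-1) ^+ q) = (-1) ^+ q by rewrite rmorphXn rmorphN1.
  have e1 : (-1) ^+ q * (-1) ^+ q = 1 :> L by rewrite -exprMn mulrNN mulr1 expr1n.
  rewrite [(- z) ^+ q]exprNn; move: ((-1) ^+ q) e1 => v e1; transitivity (v * v * (a * (b * z ^+ q * u))); first ring.
  by rewrite e1 mul1r.
have fin (M : 'M[P]_(s, rho)) E : nu Gam M != 0 -> nu Gam M = C * E ->
    exists2 D : P, D != 0 & forall q a j u, Lat u -> Lat (pol D * (pol E ^+ q * (invmx (G *m ip M) *m G) a j ^+ q * u)).
  move=> nM ME; pose y (x : 'I_rho * 'I_s) := - (pol 1 * (invmx (G *m ip M) *m G) x.1 x.2).
  have [||D D0 hD] := @int_lat _ y E (1 * g)%N; first by rewrite mul1n.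
    by move=> x; have [Q _ e] := entry M E x.1 x.2 1 nM ME; exists Q.
  exists D => // q a j u hu; have := Lat_pol ((-1) ^+ q) (hD q (a, j) u hu).
  by congr Lat; rewrite /y /= rmorph1 mul1r sgn.
have [D1 D10 I1] := fin M1 A nM1 AE; have [D2 D20 I2] := fin M2 B nM2 BE.
have [D3 D30 [c3 I3]] : exists2 D : P, D != 0 & exists c, forall q a j n u, Ob n u ->
    Ob (n + q * m + c) (pol D * (pol A ^+ q * (pol 'X^(om j) * H1 a j) ^+ q * u)).
  pose y (x : 'I_rho * 'I_s) := - (pol 'X^(om x.2) * H1 x.1 x.2).
  have h0 : (0 < 1 * g)%N by rewrite mul1n.
  have hsA : (size A <= m.+1)%N by rewrite sA.
  have [|D D0 [c hD]] := @int_bound _ y A m (1 * g)%N h0 hsA.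
    move=> x; have [Q hQ e] := entry M1 A x.1 x.2 'X^(om x.2) nM1 AE; exists Q => // i.
    (* At constants c, the values of R are values of [nu] at twisted matrices over k, so by the
       choice of M_1 their degree is at most that of [nu M1] = C A; dividing by C leaves m. *)
    have [R hR CR] := hQ i; have sR : (size (R`_i)%R <= size C + m)%N.
      move: i {hQ CR}; apply: size_eval => c; rewrite hR.
      have -> : (size C + m)%N = size (nu Gam M1) by rewrite AE size_mul // sA addnS.
      apply: leq_trans (maxM (\matrix_(i, b) if b == x.1 then c * Minf i x.1 + (i == x.2)%:R else Minf i b)).
      rewrite leq_eqVlt; apply/orP; left; apply/eqP; congr (size (nu _ _)); apply/matrixP => i b; rewrite !mxE.
      case: eqP => // _; rewrite polyCD polyCM mulrDr mulrCA; congr (_ + _).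
      by case: eqP => [->|_]; rewrite ?mulr1n ?mulr1 // mulr0n mulr0.
    have [->|Q0] := eqVneq (Q i) 0; first by rewrite size_poly0.
    exact: size_quot C0 Q0 CR sR.
  exists D => //; exists c => q a j n u hu; have := Ob_cst ((-1) ^+ q) (hD q n (a, j) u hu).
  have -> : cst ((-1) ^+ q) = pol ((-1) ^+ q) by rewrite [LHS]rmorphXn [RHS]rmorphXn !rmorphN1.
  by rewrite /y sgn.
(* The index of the twisted lattice in the standard one is the degree of a determinant. *)
exists m, (N * (size (D1 * D2 ^+ N)%R + c3 + size D2))%N => e; set q := (p ^ e)%N.
have frH (M : 'M[P]_(s, rho)) : frm p e (H1 *m ip M) = frm p e H1 *m frm p e (ip M) by apply: frmM.
have [Am AmE] : exists Am : 'M[P]_N, map_mx frac Am = frac (D2 * B ^+ q) *: Phi (frm p e Y).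
  have h I J : exists f, frac (D2 * B ^+ q) * Phi (frm p e Y) I J = frac f.
    rewrite mxE matE.
    have : Lat (pol (D2 * B ^+ q) * (be (pidx I).2 * (frm p e Y) (pidx I).1 (pidx J).1)).
      rewrite /Y frmM // [X in _ * (_ * X)]mxE !mulr_sumr; apply: Lat_sum => j _.
      rewrite !frmE [ip M1 _ _]mxE.
      have hbe : Lat (be (pidx I).2).
        by move=> l; exists (((pidx I).2 == l)%:R); rewrite co_be !mxE eqxx rmorph_nat eq_sym.
      have := Lat_pol (M1 j (pidx J).1 ^+ q) (I2 q (pidx I).1 j _ hbe).
      by congr Lat; rewrite !(polM, polX) -/H2 -/q; ring.
    by move=> /(_ (pidx J).2)[f]; rewrite co_pol [X in X = _ -> _]mxE => e2; exists f.
  have h' IJ : exists f, frac (D2 * B ^+ q) * Phi (frm p e Y) IJ.1 IJ.2 = frac f by apply: h.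
  have [f hf] := choice h'; exists (\matrix_(I, J) f (I, J)); apply/matrixP => I J.
  by rewrite [RHS]mxE (hf (I, J)) [LHS]mxE mxE.
have N0 : (0 < N)%N by rewrite muln_gt0 rho0 g0.
have detA : \det Am = (D2 ^+ N * B ^+ (q * N.-1)) * A ^+ q.
  have nB : frac B ^+ q != 0 by rewrite expf_neq0 // tofrac_eq0.
  apply/eqP; rewrite -tofrac_eq; apply/eqP; apply: (mulIf nB).
  rewrite -det_map_mx AmE detZ -/(psi _) psi_frm // -/q -[LHS]mulrA -exprMn psiY.
  rewrite -!tofracXn -!tofracM; congr (_%:F); rewrite exprMn -exprM -{2}(prednK N0) mulnS exprD; ring.
have V10 : D2 ^+ N * B ^+ (q * N.-1) != 0 by rewrite mulf_neq0 // expf_neq0.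
have V20 : A ^+ q != 0 by rewrite expf_neq0.
(* [Am] is the integral form of the transition matrix Y^(q) between the two bases. Its determinant
   contains spurious powers of D2 and B, which go into [X1]; the lattice sought is that of [X2],
   with determinant A^q. *)
have [X1 [X2 [AX dX1 dX2]]] := peel V10 V20 detA.
have nX2 : \det X2 != 0 by rewrite -size_poly_eq0 (eqp_size dX2) size_poly_eq0.
have [n1 hn1] := lattice_index nX2.
have sX2 : (size (\det X2)).-1 = (m * q)%N by rewrite (eqp_size dX2) size_exp.
have fracI : injective frac by move=> x y /eqP; rewrite tofrac_eq => /eqP.
pose z (v : VP) : 'rV[L]_rho := vc (map_mx frac ((v : 'rV[P]_N) *m X2)).
pose th (v : VP) : restr cst 'rV[L]_s := z v *m frm p e H1.
have zc v : cv (z v) = map_mx frac ((v : 'rV[P]_N) *m X2) by rewrite vcK.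
have HM1 : frm p e H1 *m frm p e (ip M1) = 1%:M by rewrite -frmM // H1M frm1.
have thI v : th v = 0 -> v = 0.
  move=> /(congr1 (fun x : 'rV[L]_s => x *m frm p e (ip M1))); rewrite /th -mulmxA HM1 mulmx1 mul0mx => z0.
  have : map_mx frac ((v : 'rV[P]_N) *m X2) = 0.
    by rewrite -zc z0; apply/rowP => J; rewrite !mxE co0 mxE.
  move=> h; have {h} : (v : 'rV[P]_N) *m X2 = 0.
    by apply/rowP => J; apply: fracI; have := congr1 (fun x : 'rV_N => x 0 J) h; rewrite !mxE rmorph0.
  move=> /(congr1 (fun x : 'rV[P]_N => x *m \adj X2)); rewrite mul0mx -mulmxA mul_mx_adj mul_mx_scalar.
  by move/eqP; rewrite scalemx_eq0 (negbTE nX2) => /eqP.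
have zD v v' : z (v + v') = z v + z v'.
  by apply: cv_inj; rewrite cvD !zc mulmxDl map_mxD.
have zZ c v : z (c *: v) = cst c *: z v.
  by apply: cv_inj; rewrite -[cst c]/(io (frac c%:P)) cvZ !zc restrZ -scalemxAl map_mxZ.
have semi d : d != 0 -> forall S b, hasdim S b -> hasdim ((fun v => d *: (th v : 'rV[L]_s) : restr cst 'rV[L]_s) @` S) b.
  move=> d0 S b; apply: (hasdim_semilinear (s := id)) => //.
  - by move=> c; exists c.
  - by move=> x y; rewrite /th zD mulmxDl scalerDr.
  - by move=> c x; rewrite /th zZ -scalemxAl restrZ !scalerA mulrC.
  - by move=> x _ h; apply: thI; apply: (scalerI d0); rewrite [LHS]h scaler0.
have HG : frm p e H1 = frm p e (invmx (G *m ip M1)) *m frm p e G by rewrite -frmM.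
pose d1 := (size (D1 * D2 ^+ N)%R + c3)%N.
pose E1 := D1 * D2 ^+ N * D3.
have DN0 : D1 * D2 ^+ N != 0 by rewrite mulf_neq0 // expf_neq0.
have E10 : E1 != 0 by rewrite mulf_neq0.
have coAq : coprimep (A ^+ q) (B ^+ (q * N.-1)) by rewrite coprimep_expl // coprimep_expr.
(* A^q clears the denominators of H_1, and det X1, made of D2 and B, clears those that remain after
   passing to H_2; as A and B are coprime, a fixed factor times [th v] is integral. The pole at
   infinity is then bounded by dividing an estimate by A^q X^(q om_j), which [Ob_div] allows for
   integral elements. *)
have lower n v : (forall J, (size (((v : 'rV[P]_N) *m X2) ord0 J) <= n)%N) ->
    Un (fun i => q * om i)%N (row_space (frm p e G)) (n + d1) (pol E1 *: (th v : 'rV[L]_s)).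
  move=> sv; split.
    by apply: scalemx_sub; rewrite /th HG mulmxA submxMl.
  have zO a : Ob n (z v 0 a).
    move=> l; exists (((v : 'rV[P]_N) *m X2) ord0 (mxvec_index a l)) => //.
    by have := congr1 (fun x : 'rV_N => x 0 (mxvec_index a l)) (zc v); rewrite !mxE pidxK.
  move=> j; rewrite mxE; set x := (th v : 'rV[L]_s) 0 j.
  have xE : x = \sum_a z v 0 a * H1 a j ^+ q by rewrite /x mxE; apply: eq_bigr => a _; rewrite frmE.
  have LA : Lat (pol (D1 * A ^+ q) * x).
    rewrite xE mulr_sumr; apply: Lat_sum => a _; have := I1 q a j _ (Ob_Lat (zO a)).
    by congr Lat; rewrite !(polM, polX) -/H1; ring.
  pose z1 : 'rV[L]_rho := vc (map_mx frac ((v : 'rV[P]_N) *m \adj X1)).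
  have zz1 : pol (\det X1) *: z v = pol (D2 * B ^+ q) *: (z1 *m frm p e Y).
    apply: cv_inj; rewrite -[pol (\det X1)]/(io _) -[pol (D2 * _)]/(io _) !cvZ zc cvM vcK scalemxAr -AmE.
    rewrite -map_mxM -map_mxZ AX; congr map_mx.
    by rewrite -mulmxA [\adj X1 *m _]mulmxA mul_adj_mx mul_scalar_mx -scalemxAr.
  have LB0 : Lat (pol (\det X1) * x).
    have -> : pol (\det X1) * x = pol (D2 * B ^+ q) * (z1 *m frm p e H2) 0 j.
      rewrite H2E frmM // mulmxA; have := congr1 (fun y : 'rV[L]_rho => (y *m frm p e H1) 0 j) zz1.
      by rewrite -!scalemxAl !mxE => <-; congr (_ * _); rewrite /x !mxE.
    rewrite mxE mulr_sumr; apply: Lat_sum => a _.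
    have hz1 : Lat (z1 0 a).
      move=> l; exists (((v : 'rV[P]_N) *m \adj X1) ord0 (mxvec_index a l)).
      by have := congr1 (fun x : 'rV_N => x 0 (mxvec_index a l)) (vcK (map_mx frac ((v : 'rV[P]_N) *m \adj X1))); rewrite !mxE pidxK.
    have := I2 q a j _ hz1; congr Lat; rewrite frmE !(polM, polX) -/H2 -/q; ring.
  have LB : Lat (pol (D2 ^+ N * B ^+ (q * N.-1)) * x).
    have /dvdpP[W ->] : \det X1 %| D2 ^+ N * B ^+ (q * N.-1) by rewrite (eqp_dvdl _ dX1).
    by rewrite polM -mulrA; apply: Lat_pol.
  have Lx : Lat (pol (D1 * D2 ^+ N) * x).
    apply: (Lat_coprime coAq).
      by have := Lat_pol (D2 ^+ N) LA; congr Lat; rewrite !polM; ring.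
    by have := Lat_pol D1 LB; congr Lat; rewrite !polM; ring.
  have hI : Ob (n + q * m + c3) (pol D3 * (pol A ^+ q * pol 'X^(om j) ^+ q) * x).
    rewrite xE mulr_sumr; apply: Ob_sum => a _; have := I3 q a j _ _ (zO a).
    by congr (Ob _ _); rewrite exprMn -/H1; ring.
  have sF : size (A ^+ q * 'X^(om j * q)) = (m * q + om j * q).+1.
    rewrite size_mulXn ?expf_neq0 //; have := size_exp A q; rewrite sA /=.
    have : (0 < size (A ^+ q)%R)%N by rewrite size_poly_gt0 expf_neq0.
    by case: (size _) => // l _ /= ->; rewrite addnS addnC.
  have hF : Ob (n + q * m + c3 + size (D1 * D2 ^+ N)%R) (pol (A ^+ q * 'X^(om j * q)) * (pol E1 * x)).
    have := Ob_pol (leqnSn (size (D1 * D2 ^+ N)%R)) hI; congr (Ob _ _).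
    by rewrite /E1 !(polM, polX) -exprM; ring.
  have := Ob_div _ sF _ hF; rewrite mulf_neq0 ?expf_neq0 ?polyX_eq0 // => /(_ isT) h.
  apply: Ob_le (h _); first by rewrite /d1; clear; lia.
  have := Lat_pol D3 Lx; congr Lat; rewrite /E1 !polM; ring.
(* For z = x M_1^(q), both A^q z and D2 B^q z lie in the lattice of [X2]: the first by the adjugate
   of [X2], the second because z = z2 Y^(q) with z2 integral. By Bezout D2 z lies in it. *)
have upper n x : Un (fun i => q * om i)%N (row_space (frm p e G)) n x ->
    exists2 v : VP, (forall J, (size (((v : 'rV[P]_N) *m X2) ord0 J) <= n + size D2)%N) & pol D2 *: (x : 'rV[L]_s) = th v.
  move=> [/submxP[y xy] Fx]; pose zz := (x : 'rV[L]_s) *m frm p e (ip M1).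
  have GV : frm p e G *m frm p e (ip M1) *m frm p e (invmx (G *m ip M1)) = 1%:M.
    by rewrite -!frmM // mulmxV // frm1.
  have xz : (x : 'rV[L]_s) = zz *m frm p e H1.
    by rewrite HG /zz xy !mulmxA -[y *m _ *m _]mulmxA -[y *m _ *m _]mulmxA GV mulmx1.
  have zO a : Ob n (zz 0 a).
    rewrite mxE; apply: Ob_sum => j _; rewrite frmE mxE -/q.
    have [le|gt] := leqP (q * om j) n; last first.
      by have := Fx j; rewrite (eqP (ltnW gt : n - q * om j == 0)%N) => /Ob_zero ->; rewrite mul0r; apply: Ob0.
    have := @Ob_pol k FF (n - q * om j) (q * om j) (M1 j a ^+ q) _ _ (Fx j).
    rewrite subnK // polX mulrC; apply.
    rewrite mxE exprMn -rmorphXn mulrC mul_polyC; apply: leq_trans (size_scale_leq _ _) _.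
    by rewrite -exprM size_polyXn mulnC.
  have [ze sze zeE] : exists2 ze : 'rV[P]_N, (forall J, (size (ze ord0 J) <= n)%N) & cv zz = map_mx frac ze.
    have h J : exists f : P, (size f <= n)%N /\ cv zz 0 J = frac f.
      by rewrite mxE; have [f sf e2] := zO (pidx J).1 (pidx J).2; exists f.
    have [f hf] := choice h; exists (\row_J f J) => [J|]; first by rewrite mxE; case: (hf J).
    by apply/rowP => J; case: (hf J) => _ ->; rewrite !mxE.
  pose z2 := (x : 'rV[L]_s) *m frm p e (ip M2).
  have [ze2 ze2E] : exists ze2 : 'rV[P]_N, cv z2 = map_mx frac ze2.
    apply: cv_lat => a; rewrite mxE; apply: Lat_sum => j _; rewrite frmE mxE mulrC -polX.
    by apply: Lat_pol; apply: Ob_Lat (Fx j).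
  have zz2 : zz = z2 *m frm p e Y.
    have ZYf : frm p e H1 *m frm p e (ip M2) *m frm p e Y = 1%:M by rewrite -!frmM // -/Z ZY frm1.
    by rewrite /z2 {1}xz -[zz *m _ *m _]mulmxA -[zz *m _ *m _]mulmxA ZYf mulmx1.
  have rB : (D2 * B ^+ q) *: ze = ze2 *m X1 *m X2.
    have h : map_mx frac ((D2 * B ^+ q) *: ze) = map_mx frac (ze2 *m X1 *m X2).
      by rewrite -mulmxA -AX map_mxM map_mxZ AmE -zeE -ze2E zz2 cvM -scalemxAr.
    apply/rowP => J; apply: fracI; have := congr1 (fun x : 'rV_N => x 0 J) h.
    by rewrite [LHS]mxE [RHS]mxE.
  have [W AW] : exists W, A ^+ q = W * \det X2 by apply/dvdpP; rewrite (eqp_dvdl _ dX2).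
  have rA : A ^+ q *: ze = (W *: (ze *m \adj X2)) *m X2.
    by rewrite -scalemxAl -mulmxA mul_adj_mx mul_mx_scalar scalerA AW.
  have /Bezout_coprimepP[[u1' u2'] /= uv] : coprimep (A ^+ q) (B ^+ q) by rewrite coprimep_expl // coprimep_expr.
  have [c c0 uvE] : exists2 c, c != 0 & u1' * A ^+ q + u2' * B ^+ q = c%:P.
    by apply/size_poly1P; rewrite size_poly_eq1.
  pose v : VP := c^-1%:P *: ((D2 * u1') *: (W *: (ze *m \adj X2)) + u2' *: (ze2 *m X1)).
  have vE : (v : 'rV[P]_N) *m X2 = D2 *: ze.
    rewrite -scalemxAl mulmxDl -!scalemxAl -rB.
    have -> : W *: (ze *m \adj X2 *m X2) = A ^+ q *: ze by rewrite rA -scalemxAl.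
    rewrite !scalerA -scalerDl scalerA; congr (_ *: _).
    have -> : D2 * u1' * A ^+ q + u2' * (D2 * B ^+ q) = D2 * (u1' * A ^+ q + u2' * B ^+ q) by ring.
    by rewrite uvE mulrCA -polyCM mulVf // mulr1.
  exists v => [J|].
    rewrite vE mxE; apply: leq_trans (size_polyMleq _ _) _; apply: leq_trans (leq_pred _) _.
    by rewrite addnC leq_add2r.
  have -> : th v = (pol D2 *: zz) *m frm p e H1.
    rewrite /th; congr (_ *m _); apply: cv_inj; rewrite zc vE map_mxZ -zeE.
    by rewrite -[pol D2]/(io _) cvZ.
  by rewrite -scalemxAl -xz.
have fin_dim n : (n1 <= n)%N -> exists2 b, hasdim ([set u | forall j, (size ((((u : 'rV[P]_N) *m X2) ord0 j)%R) <= n)%N] : set VP) b & (b + m * q = N * n)%N.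
  by move=> /hn1; rewrite sX2.
exists (n1 + d1)%N => n w nn hw; split.
  have d1n : (d1 <= n)%N := leq_trans (leq_addl n1 d1) nn.
  have [b hb e1] := fin_dim _ (leq_trans (eq_leq (esym (addnK d1 n1))) (leq_sub2r d1 nn)).
  have pE : pol E1 != 0 by rewrite pol_eq0.
  have le' : (b <= w)%N.
    by apply: hasdim_le _ (semi _ pE _ _ hb) hw => _ [v hv <-]; have := lower _ _ hv; rewrite (subnK d1n).
  have e2 : (N * n = N * (n - d1) + N * d1)%N by rewrite -mulnDr (subnK d1n).
  by rewrite e2 -e1; apply: leq_add; [rewrite leq_add2r|rewrite leq_mul2l -/d1 leq_addr orbT].
have n2 : (n1 <= n + size D2)%N := leq_trans (leq_trans (leq_addr _ _) nn) (leq_addr _ _).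
have [b hb e1] := fin_dim _ n2.
have pD : (pol D2)^-1 != 0 by rewrite invr_eq0 pol_eq0.
have le' : (w <= b)%N.
  apply: hasdim_le _ hw (semi _ pD _ _ hb) => x /upper[v sv e2]; exists v => //.
  by rewrite -e2 scalerA mulVf ?scale1r // pol_eq0.
apply: leq_trans (leq_add le' (leqnn _)) _; rewrite e1 mulnDr leq_add2l leq_mul2l.
by rewrite [(_ + size D2)%N]addnC leq_addr orbT.
Qed.

End Twists.

(* The degree of the subbundle spanned by the rows of G is multiplied by p^e under
   Frobenius pull-back. *)
Theorem deg_frob p (hp : p \in [pchar k]) rho s (G : 'M[L]_(rho, s)) (om : 'I_s -> nat) : row_free G -> (0 < rho)%N ->
  exists r0 C, forall e, exists n1, forall n w, (n1 <= n)%N ->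
    hasdim (Un (fun i => p ^ e * om i)%N (row_space (frm p e G)) n) w ->
    (rho * g * n <= w + r0 * p ^ e + C)%N /\ (w + r0 * p ^ e <= rho * g * n + C)%N.
Proof.
move=> fG rho0; have [D D0 [c hc]] := Ob_ex (fun x : ('I_g * ('I_rho * 'I_s)) => be x.1 * G x.2.1 x.2.2).
have pD : pol D != 0 by rewrite pol_eq0.
pose G' := pol D *: G.
have fG' : row_free G' by rewrite /row_free /G' (eqmx_scale G pD).
have [Gam GamE] : exists Gam : 'M[P]_(rho * g, s * g), Phi G' = map_mx frac Gam.
  have h (IJ : 'I_(rho * g) * 'I_(s * g)) : exists f, Phi G' IJ.1 IJ.2 = frac f.
    have [f _ e] := hc ((pidx IJ.1).2, ((pidx IJ.1).1, (pidx IJ.2).1)) (pidx IJ.2).2.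
    by exists f; rewrite mxE matE /G' mxE mulrCA -e.
  have [f hf] := choice h; exists (\matrix_(I, J) f (I, J)); apply/matrixP => I J.
  by rewrite (hf (I, J)) !mxE.
have [r0 [C h]] := deg_frob_aux hp om fG' rho0 GamE; exists r0, C => e.
have -> : row_space (frm p e G) = row_space (frm p e G').
  have -> : frm p e G' = (pol D ^+ (p ^ e)) *: frm p e G.
    by apply/matrixP => i j; rewrite !mxE exprMn.
  by apply/seteqP; split=> x; rewrite /row_space /= (eqmx_scale _ (expf_neq0 _ pD)).
exact: h.
Qed.
End Degree.

(** * Frobenius-twisted relations over a function field *)

Section Knots.
Variables (m : nat).
Implicit Types (a b : 'I_m -> nat) (l : 'I_m).

Definition hinge a n : nat := (\sum_l (n - a l))%N.

Lemma hinge_ge a l x y : (forall i j : 'I_m, (i <= j)%N -> (a i <= a j)%N) -> (a l <= x)%N -> (x <= y)%N ->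
  (hinge a x + l.+1 * (y - x) <= hinge a y)%N.
Proof.
move=> sa lx xy; have -> : (l.+1 * (y - x) = \sum_(i < m) if (i <= l)%N then y - x else 0)%N.
  transitivity (\sum_(i < l.+1) (y - x))%N; first by rewrite sum_nat_const card_ord.
  by rewrite (big_ord_widen m (fun=> y - x)%N (ltn_ord l)) big_mkcond; apply: eq_bigr => i _; rewrite ltnS.
rewrite /hinge -big_split /=; apply: leq_sum => i _; case: ifP => il; last by rewrite addn0 leq_sub2r.
by rewrite addnC addnBA ?subnK // (leq_trans (sa _ _ il)).
Qed.

Lemma hinge_le a l x y : (forall i j : 'I_m, (i <= j)%N -> (a i <= a j)%N) -> (y <= a l)%N -> (x <= y)%N ->
  (hinge a y <= hinge a x + l * (y - x))%N.
Proof.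
move=> sa ly xy; have -> : (l * (y - x) = \sum_(i < m) if (i < l)%N then y - x else 0)%N.
  transitivity (\sum_(i < l) (y - x))%N; first by rewrite sum_nat_const card_ord.
  by rewrite (big_ord_widen m (fun=> y - x)%N (ltnW (ltn_ord l))) big_mkcond.
rewrite /hinge -big_split /=; apply: leq_sum => i _; case: ifP => il; first by clear - xy; lia.
by move/negbT: il; rewrite -leqNgt => /sa h; rewrite (eqP (leq_trans ly h : y - a i == 0)%N).
Qed.

(** Between two distant l-th knots one of the functions has slope at least l + 1 and the other at
    most l, so their difference changes by at least the distance; it can change by at most 2 C. The
    extra p comes from rounding b_l to a multiple of p. *)
Lemma knots_close p a b C : (0 < p)%N ->
  (forall i j : 'I_m, (i <= j)%N -> (a i <= a j)%N) -> (forall i j : 'I_m, (i <= j)%N -> (b i <= b j)%N) ->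
  (forall n, hinge b (p * n) <= p * hinge a n + C)%N -> (forall n, p * hinge a n <= hinge b (p * n) + C)%N ->
  forall l, (b l <= p * a l + (2 * C + p))%N /\ (p * a l <= b l + (2 * C + p))%N.
Proof.
move=> p0 sa sb h1 h2 l; split.
  pose y := (b l %/ p)%N; have yb : (p * y <= b l)%N by rewrite mulnC leq_trunc_div.
  have by' : (b l < p * y + p)%N by rewrite {1}(divn_eq (b l) p) [(p * y)%N]mulnC ltn_add2l ltn_mod.
  have [le|gt] := leqP y (a l).
    by have : (p * y <= p * a l)%N; [rewrite leq_mul2l le orbT|clear - by'; lia].
  have k1 := hinge_ge sa (leqnn (a l)) (ltnW gt).
  have k2 := hinge_le sb yb (_ : p * a l <= p * y)%N; rewrite leq_mul2l (ltnW gt) orbT in k2.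
  have {k2} k2 := k2 isT; rewrite -mulnBr in k2.
  have := h1 (a l); have := h2 y.
  have : (p * hinge a (a l) + p * (l.+1 * (y - a l)) <= p * hinge a y)%N by rewrite -mulnDr leq_mul2l k1 orbT.
  have e1 : (p * (l.+1 * (y - a l)) = l * (p * (y - a l)) + p * (y - a l))%N by rewrite mulnCA -mulSnr.
  have e2 : (p * (y - a l) = p * y - p * a l)%N by rewrite mulnBr.
  move: k2; rewrite e1; move: (l * _)%N => Z; move: by' e2 {h1 h2 k1 e1}; move: (hinge _ _) (hinge _ _) (hinge _ _) (hinge _ _) => ? ? ? ?.
  move: (p * (y - a l))%N (p * y)%N (p * a l)%N => ? ? ?; lia.
pose x := ((b l + p.-1) %/ p)%N.
have bx : (b l <= p * x)%N.
  have := divn_eq (b l + p.-1) p; have := ltn_pmod (b l + p.-1) p0; rewrite -/x mulnC.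
  move: (p * x)%N ((_ + _) %% _)%N => ? ?; lia.
have xb : (p * x <= b l + p)%N.
  have := leq_trunc_div (b l + p.-1) p; rewrite -/x mulnC; move: (p * x)%N => ?; lia.
have [le|gt] := leqP (a l) x.
  by have : (p * a l <= p * x)%N; [rewrite leq_mul2l le orbT|clear - xb; lia].
have k1 := hinge_le sa (leqnn (a l)) (ltnW gt).
have k2 := hinge_ge sb bx (_ : p * x <= p * a l)%N; rewrite leq_mul2l (ltnW gt) orbT in k2.
have {k2} k2 := k2 isT; rewrite -mulnBr in k2.
have := h2 x; have := h1 (a l).
have : (p * hinge a (a l) <= p * hinge a x + p * (l * (a l - x)))%N by rewrite -mulnDr leq_mul2l k1 orbT.
rewrite mulnCA; move: k2; rewrite mulSn.
have e2 : (p * (a l - x) = p * a l - p * x)%N by rewrite mulnBr.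
move: (l * _)%N => Z; move: xb e2 {h1 h2 k1}; move: (hinge _ _) (hinge _ _) (hinge _ _) (hinge _ _) => ? ? ? ?.
move: (p * (a l - x))%N (p * x)%N (p * a l)%N => ? ? ?; lia.
Qed.
End Knots.

Lemma hasdim_dsum (k : fieldType) (T : finType) (V V' : lmodType k) (X : T -> set V) (a : T -> nat) (f : T -> V -> V') :
  (forall j, hasdim (X j) (a j)) -> (forall j, {morph f j : x y / x + y}) ->
  (forall j c x, f j (c *: x) = c *: f j x) ->
  (forall x, (forall j, X j (x j)) -> \sum_j f j (x j) = 0 -> forall j, x j = 0) ->
  hasdim [set v | exists x, (forall j, X j (x j)) /\ v = \sum_j f j (x j)] (\sum_j a j).
Proof.
move=> hX fD fZ fi.
have hb j : exists e : 'I_(a j) -> V, lindep e /\ X j = lspan e by have [e h1 h2] := hX j; exists e.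
pose e j := projT1 (cid (hb j)).
have ei j : lindep (e j) by rewrite /e; case: cid => ? [].
have Xe j : X j = lspan (e j) by rewrite /e; case: cid => ? [].
have f0 j : f j 0 = 0 by apply: (addrI (f j 0)); rewrite -fD !addr0.
have fsum j (c : 'I_(a j) -> k) : f j (\sum_i c i *: e j i) = \sum_i c i *: f j (e j i).
  by rewrite (big_morph _ (fD j) (f0 j)); apply: eq_bigr => i _; rewrite fZ.
pose mk j (i : 'I_(a j)) : {j : T & 'I_(a j)} := Tagged (fun j => 'I_(a j)) i.
pose b (x : {j : T & 'I_(a j)}) : V' := f (tag x) (e (tag x) (tagged x)).
have sumE (c : {j : T & 'I_(a j)} -> k) : \sum_x c x *: b x = \sum_j f j (\sum_i c (mk j i) *: e j i).
  rewrite (eq_bigr (fun j => \sum_i c (mk j i) *: b (mk j i))); last by move=> j _; rewrite fsum.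
  rewrite (sig_big_dep (fun _ => true) (fun _ _ => true) (fun j (i : 'I_(a j)) => c (mk j i) *: b (mk j i))) /=.
  by apply: eq_bigr => -[].
have -> : (\sum_j a j = #|{: {j : T & 'I_(a j)}}|)%N.
  by rewrite card_tagged sumnE big_map big_enum /=; apply: eq_bigr => j _; rewrite card_ord.
set S := (X in hasdim X _); suff -> : S = lspan b.
  apply: hasdim_basis => c; rewrite sumE => c0 [j i].
  have := fi (fun j => \sum_i c (mk j i) *: e j i) _ c0 j; move=> h; apply: (ei j (fun i => c (mk j i))).
  by apply: h => j'; rewrite Xe; exists (fun i => c (mk j' i)).
apply/seteqP; split=> [v [x [hx ->]]|v [c ->]].
  have hc j : exists c : 'I_(a j) -> k, x j = \sum_i c i *: e j i by have := hx j; rewrite Xe.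
  pose c j := projT1 (cid (hc j)); have cE j : x j = \sum_i c j i *: e j i by rewrite /c; case: cid.
  exists (fun y => c (tag y) (tagged y)); rewrite sumE; apply: eq_bigr => j _; rewrite {1}cE //.
rewrite sumE; exists (fun j => \sum_i c (mk j i) *: e j i); split=> // j.
by rewrite Xe; exists (fun i => c (mk j i)).
Qed.

(** * Piecewise linear functions up to bounded error *)

Section Ramps.
Variable p : nat.
Hypothesis p1 : (1 < p)%N.

Definition asym (f : nat -> rat) : Prop := exists r C : rat, forall e, `|f e - r * (p ^ e)%:R| <= C.

Lemma asym_ext f h C : (forall e, `|f e - h e| <= C) -> asym h -> asym f.
Proof.
move=> fh [r [D hD]]; exists r, (C + D) => e.
rewrite -[f e](subrK (h e)) -addrA; apply: le_trans (ler_normD _ _) _; exact: lerD.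
Qed.
Lemma asymD f h : asym f -> asym h -> asym (fun e => f e + h e).
Proof.
move=> [r [C hC]] [r' [C' hC']]; exists (r + r'), (C + C') => e.
rewrite mulrDl opprD addrACA; apply: le_trans (ler_normD _ _) _; exact: lerD.
Qed.
Lemma asymZ a f : asym f -> asym (fun e => a * f e).
Proof.
move=> [r [C hC]]; exists (a * r), (`|a| * C) => e.
by rewrite -mulrA -mulrBr normrM ler_wpM2l.
Qed.
Lemma asym_eventually f e0 r C : (forall e, `|f (e0 + e)%N - r * (p ^ e)%:R| <= C) -> asym f.
Proof.
move=> h; exists (r / (p ^ e0)%:R), (C + \sum_(e < e0) `|f e - r / (p ^ e0)%:R * (p ^ e)%:R|) => e.
have p0 : (p ^ e0)%:R != 0 :> rat by rewrite pnatr_eq0 expn_eq0; case: (p) p1.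
have C0 : 0 <= C by apply: le_trans (h 0%N).
have S0 : 0 <= \sum_(e < e0) `|f e - r / (p ^ e0)%:R * (p ^ e)%:R| by apply: sumr_ge0.
have [le|lt] := leqP e0 e.
  apply: le_trans (_ : C <= _); last by rewrite lerDl.
  have := h (e - e0)%N; rewrite subnKC //.
  have -> : (p ^ e = p ^ e0 * p ^ (e - e0))%N by rewrite -expnD subnKC.
  by rewrite natrM mulrA divfK.
rewrite (bigD1 (Ordinal lt)) //= addrCA lerDl addr_ge0 //; apply: sumr_ge0 => *; exact: normr_ge0.
Qed.

Lemma norm_nat (a b C : nat) : (a <= b + C)%N -> (b <= a + C)%N -> `|a%:R - b%:R| <= C%:R :> rat.
Proof.
move=> h1 h2; have h3 : a%:R <= b%:R + C%:R :> rat by rewrite -natrD ler_nat.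
have h4 : b%:R <= a%:R + C%:R :> rat by rewrite -natrD ler_nat.
by rewrite ler_norml; apply/andP; split; lra.
Qed.

Definition pos (x : rat) : rat := Num.max 0 x.
(** With [lam] nonnegative the sum is at most a constant times n, uniformly in e; [ramp_shift]
    relies on this for small n. *)
Definition ramp (h : nat -> nat -> rat) : Prop :=
  exists N (eps lam : 'I_N -> rat) (C : rat), (forall l, 0 <= lam l) /\
    forall e n, `|h e n - \sum_l eps l * pos (n%:R - lam l * (p ^ e)%:R)| <= C.

Lemma ramp_ext h h' C : (forall e n, `|h e n - h' e n| <= C) -> ramp h' -> ramp h.
Proof.
move=> hh [N [eps [lam [D [l0 hD]]]]]; exists N, eps, lam, (C + D); split=> // e n.
rewrite -[h e n](subrK (h' e n)) -addrA; apply: le_trans (ler_normD _ _) _; exact: lerD.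
Qed.
Lemma rampD h h' : ramp h -> ramp h' -> ramp (fun e n => h e n + h' e n).
Proof.
move=> [N [eps [lam [C [l0 hC]]]]] [N' [eps' [lam' [C' [l0' hC']]]]].
exists (N + N')%N, (fun l => match fintype.split l with inl i => eps i | inr i => eps' i end),
  (fun l => match fintype.split l with inl i => lam i | inr i => lam' i end), (C + C'); split=> [l|e n].
  by case: (fintype.split l).
rewrite big_split_ord /=; under eq_bigr do rewrite (unsplitK (inl _)).
under [X in _ - (_ + X)]eq_bigr do rewrite (unsplitK (inr _)).
rewrite opprD addrACA; apply: le_trans (ler_normD _ _) _; exact: lerD.
Qed.
Lemma rampZ a h : ramp h -> ramp (fun e n => a * h e n).
Proof.
move=> [N [eps [lam [C [l0 hC]]]]]; exists N, (fun l => a * eps l), lam, (`|a| * C); split=> // e n.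
have -> : \sum_l a * eps l * pos (n%:R - lam l * (p ^ e)%:R) = a * \sum_l eps l * pos (n%:R - lam l * (p ^ e)%:R).
  by rewrite mulr_sumr; apply: eq_bigr => l _; rewrite mulrA.
by rewrite -mulrBr normrM ler_wpM2l.
Qed.
Lemma ramp0 : ramp (fun _ _ => 0).
Proof. by exists 0%N, (fun=> 0), (fun=> 0), 0; split=> // e n; rewrite big_ord0 subrr normr0. Qed.
Lemma ramp_sum (T : Type) (s : seq T) (h : T -> nat -> nat -> rat) :
  (forall x, ramp (h x)) -> ramp (fun e n => \sum_(x <- s) h x e n).
Proof.
move=> hr; elim: s => [|x s IH]; first by apply: ramp_ext ramp0 => e n; rewrite big_nil subrr normr0.
by apply: ramp_ext (rampD (hr x) IH) => e n; rewrite big_cons subrr normr0.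
Qed.

Lemma pos_lip x y : `|pos x - pos y| <= `|x - y|.
Proof. have := ler_norm (x - y); have := ler_norm (y - x); rewrite distrC; move: `|x - y| => z.
rewrite /pos ler_norml; case: (leP 0 x) => ?; case: (leP 0 y) => ? ? ?; apply/andP; split; lra. Qed.

Lemma pos_nat n m : pos (n%:R - m%:R) = (n - m)%N%:R.
Proof.
have [le|gt] := leqP m n; first by rewrite natrB // /pos max_r // subr_ge0 ler_nat.
by rewrite (eqP (ltnW gt : n - m == 0)%N) /pos max_l // subr_le0 ler_nat ltnW.
Qed.

Lemma ramp_hinge (a : nat -> nat) : asym (fun e => (a e)%:R) -> ramp (fun e n => (n - a e)%N%:R).
Proof.
move=> [r [C hC]].
(* Replacing r by [pos r] costs nothing, because a e >= 0 and [pos] is 1-Lipschitz. *)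
exists 1%N, (fun=> 1), (fun=> pos r), C; split=> [_|e n]; first by rewrite /pos le_max lexx.
rewrite big_ord1 mul1r -pos_nat; apply: le_trans (pos_lip _ _) _.
have P0 : 0 <= (p ^ e)%:R :> rat by apply: ler0n.
have -> : n%:R - (a e)%:R - (n%:R - pos r * (p ^ e)%:R) = pos (r * (p ^ e)%:R) - pos (a e)%:R.
  rewrite [pos (a e)%:R](_ : _ = (a e)%:R); last by rewrite /pos max_r.
  have -> : pos (r * (p ^ e)%:R) = pos r * (p ^ e)%:R by rewrite /pos maxr_pMl // mul0r.
  by ring.
by apply: le_trans (pos_lip _ _) _; rewrite distrC.
Qed.
End Ramps.

(** * Successive minima of relation spaces and their clusters *)

Section Field.
Variables (k : closedFieldType) (p : nat) (hp : p \in [pchar k]) (FF : funfield k).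
Notation L := (ff_L FF).
Notation g := (ff_g FF).
Local Notation pol := (@pol k FF).
Local Notation cst := (@cst k FF).

Section Rank.
Variables (s : nat) (w : 'I_s -> nat) (U : set 'rV[L]_s).
Hypothesis UL : is_subspace U.

Definition free_in n r : Prop := exists2 G : 'M[L]_(r, s), row_free G & forall l, Un w U n (row l G).

Lemma free_in_le n r : free_in n r -> (r <= s)%N.
Proof. by move=> [G fG _]; rewrite -(eqP fG) rank_leq_col. Qed.

Lemma urank_ex n : exists r, free_in n r /\ forall r', free_in n r' -> (r' <= r)%N.
Proof.
have P0 : exists r, `[< free_in n r >].
  by exists 0%N; apply/asboolP; exists 0; [rewrite /row_free mxrank0|case].
have Pb r : `[< free_in n r >] -> (r <= s)%N by move=> /asboolP/free_in_le.
case: (ex_maxnP P0 Pb) => r /asboolP h max; exists r; split=> // r' h'.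
by apply: max; apply/asboolP.
Qed.
Definition urank n := projT1 (cid (urank_ex n)).
Lemma urankP n : free_in n (urank n). Proof. by rewrite /urank; case: cid => r []. Qed.
Lemma urank_max n r : free_in n r -> (r <= urank n)%N. Proof. by have [_ h] := projT2 (cid (urank_ex n)); apply: h. Qed.
Lemma urank_le n : (urank n <= s)%N. Proof. exact: free_in_le (urankP n). Qed.
Lemma urank_mono n n' : (n <= n')%N -> (urank n <= urank n')%N.
Proof.
by move=> nn; apply: urank_max; have [G fG GU] := urankP n; exists G => // l; apply: Un_le nn _ (GU l).
Qed.
Lemma urank_span n (G : 'M[L]_(urank n, s)) : row_free G -> (forall l, Un w U n (row l G)) ->
  forall x, Un w U n x -> ((x : 'rV[L]_s) <= G)%MS.
Proof.
move=> fG GU x Ux; apply: contraT => nx.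
have : free_in n (1 + urank n)%N.
  exists (col_mx (x : 'rV[L]_s) G); last first.
    move=> l; case: (@splitP 1 (urank n) l) => j lj.
      have -> : l = lshift _ j by apply/val_inj.
      by rewrite rowKu row_id.
    have -> : l = rshift 1 j by apply/val_inj.
    by rewrite rowKd.
  rewrite /row_free eqn_leq rank_leq_row /= -(addsmxE (x : 'rV[L]_s) G) add1n.
  rewrite -{1}(eqP fG); apply: rank_ltmx; rewrite /ltmx addsmxSr /=; apply: contra nx.
  exact: submx_trans (addsmxSl _ _).
by move=> /urank_max; rewrite add1n ltnn.
Qed.

Lemma urank_slope_le n a b : hasdim (Un w U n) a -> hasdim (Un w U n.+1) b -> (b <= a + g * urank n.+1)%N.
Proof.
move=> ha hb; have [u [uU ui]] := slope_pind UL ha hb.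
have [G fG GU] := urankP n.+1.
have := pind_rank ui (fun x => urank_span fG GU (uU x)); rewrite card_ord; clear; lia.
Qed.
End Rank.

(** With [urank_slope_le]: the dimension grows by g times the rank of the sections, up to a shift c
    of the level that is uniform in [U] and [w]. *)
Lemma urank_slope_ge : exists c, forall s (w : 'I_s -> nat) (U : set 'rV[L]_s), is_subspace U -> forall n a b,
  hasdim (Un w U (n + c)) a -> hasdim (Un w U (n + c).+1) b -> (a + g * urank w U n <= b)%N.
Proof.
have [c hc] := free_slope FF; exists c => s w U UL n a b ha hb.
by have [G fG GU] := urankP w U n; apply: hc fG GU ha hb.
Qed.

Section Relations.
Variables (s : nat) (nu : 'I_s -> L) (d : 'I_s -> nat).

Definition tw e (i : 'I_s) := (p ^ e * d i)%N.
Definition Z e := rel_space (fun i => nu i ^+ (p ^ e)).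
Definition sigma := (s - [exists i, nu i != 0%R])%N.
Definition rk e n := urank (tw e) (Z e) n.

Lemma Z_rank e : exists2 G : 'M[L]_(sigma, s), row_free G & forall x, Z e x <-> (x <= G)%MS.
Proof.
pose C : 'cV[L]_s := \col_i nu i ^+ (p ^ e).
have rC : \rank C = [exists i, nu i != 0%R].
  case: existsP => [[i nui]|nex].
    apply/eqP; rewrite eqn_leq rank_leq_col lt0n mxrank_eq0; apply: contraNneq nui => /colP/(_ i).
    by rewrite !mxE => /eqP; rewrite expf_eq0 => /andP[].
  apply/eqP; rewrite mxrank_eq0; apply/eqP/colP => i; rewrite !mxE.
  have -> : nu i = 0 by apply/eqP/negPn/negP => h; apply: nex; exists i.
  by rewrite expr0n expn_eq0 eqn0Ngt (p_gt0 hp).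
have [G fG GE] : exists2 G : 'M[L]_(\rank (kermx C), s), row_free G & (G :=: kermx C)%MS.
  by exists (row_base (kermx C)); [apply: row_base_free|apply: eq_row_base].
move: G fG GE; rewrite mxrank_ker rC -/sigma => G fG GE; exists G => // x.
rewrite GE; split=> [Zx|/sub_kermxP/rowP/(_ 0)].
  apply/sub_kermxP/rowP => j; rewrite ord1 !mxE -[RHS]Zx; apply: eq_bigr => i _.
  by rewrite mxE mulrC.
rewrite !mxE => h; rewrite /Z /rel_space /= -[RHS]h; apply: eq_bigr => i _.
by rewrite mxE mulrC.
Qed.

Lemma rk_le e n : (rk e n <= sigma)%N.
Proof.
have [G fG GZ] := Z_rank e; have [H fH HU] := urankP (tw e) (Z e) n.
rewrite -(eqP fG) -[X in (X <= _)%N](eqP fH); apply/mxrankS/row_subP => i.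
by apply/GZ; case: (HU i).
Qed.

Lemma rk_full e : exists n, rk e n = sigma.
Proof.
have [G fG GZ] := Z_rank e.
have [D D0 [c hc]] := Ob_ex (fun ij : 'I_sigma * 'I_s => G ij.1 ij.2).
exists (c + \max_i tw e i)%N; apply/eqP; rewrite eqn_leq rk_le; apply: urank_max.
have pD : pol D != 0 by rewrite pol_eq0.
exists (pol D *: G); first by rewrite /row_free (eqmx_scale G pD).
move=> l; split; first by apply/GZ; rewrite linearZ scalemx_sub // row_sub.
move=> i; rewrite !mxE; apply: Ob_le (hc (l, i)).
have := leq_bigmax (F := tw e) i => /= h.
by rewrite -{1}(addnK (tw e i) c) leq_sub2r // leq_add2l.
Qed.

Lemma nl_ex e (l : 'I_sigma) : exists n, (l < rk e n)%N.
Proof. by have [n nE] := rk_full e; exists n; rewrite nE. Qed.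
(** The l-th successive minimum: the level at which the rank first exceeds l. These are the
    breakpoints of the dimension as a function of n. *)
Definition nl e (l : 'I_sigma) : nat := ex_minn (nl_ex e l).

Lemma nlP e l n : (nl e l <= n)%N = (l < rk e n)%N.
Proof.
rewrite /nl; case: ex_minnP => m lm min; apply/idP/idP => [mn|/min //].
exact: leq_trans lm (urank_mono _ _ mn).
Qed.
Lemma nl_sorted e (i j : 'I_sigma) : (i <= j)%N -> (nl e i <= nl e j)%N.
Proof. by move=> ij; rewrite nlP; apply: leq_ltn_trans ij _; rewrite -nlP. Qed.

Lemma hingeS e n : (hinge (nl e) n.+1 = hinge (nl e) n + rk e n)%N.
Proof.
rewrite /hinge -[X in (_ + X)%N]card_ord -sum1_card (big_ord_widen sigma (fun=> 1%N) (rk_le e n)).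
rewrite [X in (_ + X)%N]big_mkcond -big_split; apply: eq_bigr => l _ /=.
by rewrite -nlP; case: leqP => h; [rewrite subSn ?addn1|rewrite (eqP (h : n.+1 - _ == 0)%N) (eqP (ltnW h : n - _ == 0)%N)].
Qed.

Lemma zdim_ex e n : exists a, hasdim (Un (tw e) (Z e) n) a.
Proof. by apply: Un_hasdim; apply: rel_subspace. Qed.
Definition zdim e n := projT1 (cid (zdim_ex e n)).
Lemma zdimP e n : hasdim (Un (tw e) (Z e) n) (zdim e n). Proof. by rewrite /zdim; case: cid. Qed.

(** The increments lie between g times the rank at n - c and g times the rank at n + 1. Summing
    costs a constant that is uniform in e because c is. *)
Lemma zdim_hinge : exists C, forall e n, (zdim e n <= g * hinge (nl e) n + C)%N /\ (g * hinge (nl e) n <= zdim e n + C)%N.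
Proof.
have [c hc] := urank_slope_ge.
have hs e n m : (hinge (nl e) (n + m) <= hinge (nl e) n + m * s)%N.
  elim: m => [|m IH]; first by rewrite addn0 leq_addr.
  rewrite addnS hingeS mulSn; have := urank_le (tw e) (Z e) (n + m); rewrite -/(rk e _); move: IH; clear; lia.
exists (g * (c.+1 * s))%N => e n; have h0 : (zdim e 0 = 0)%N.
  apply: (hasdim_inj (zdimP e 0)); have -> : Un (tw e) (Z e) 0 = [set 0]; last exact: hasdim0.
  apply/seteqP; split=> [x [_ hx]|_ ->]; last first.
    by split; [case: (rel_subspace (fun i => nu i ^+ (p ^ e)))|move=> i; rewrite mxE; apply: Ob0].
  by apply/rowP => i; have := hx i; rewrite sub0n mxE => /Ob_zero.
have up m : (zdim e m <= g * hinge (nl e) m.+1)%N.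
  elim: m => [|m IH]; first by rewrite h0.
  have := urank_slope_le (rel_subspace _) (zdimP e m) (zdimP e m.+1); rewrite -/(rk e _).
  rewrite hingeS mulnDr; move: IH; clear; lia.
have lo m : (g * hinge (nl e) m <= zdim e (m + c))%N.
  elim: m => [|m IH]; first by rewrite /hinge big1 ?muln0 // => l _; rewrite sub0n.
  have := hc _ _ _ (rel_subspace _) _ _ _ (zdimP e (m + c)) (zdimP e (m + c).+1); rewrite -/(rk e _).
  rewrite hingeS mulnDr addSn; move: IH; clear; lia.
split.
  apply: leq_trans (up n) _; rewrite -mulnDr leq_mul2l; apply/orP; right.
  rewrite hingeS leq_add2l; apply: leq_trans (urank_le _ _ _) _; rewrite mulSn leq_addr //.
have [le|gt] := leqP c n.
  apply: leq_trans (_ : g * (hinge (nl e) (n - c) + c * s) <= _)%N.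
    by rewrite leq_mul2l -{1}(subnK le) hs orbT.
  rewrite mulnDr; apply: leq_add; first by have := lo (n - c)%N; rewrite subnK.
  by rewrite leq_mul2l leq_mul2r leqnSn !orbT.
apply: leq_trans (leq_addl _ _); rewrite leq_mul2l; apply/orP; right.
have := hs e 0%N n; rewrite add0n [hinge _ 0]big1 ?add0n // => h; apply: leq_trans h _.
by rewrite leq_mul2r (ltnW (ltnW _)) ?orbT // ltnS.
Qed.

(** [frob_compare] makes the two dimension functions close after rescaling by p, and functions this
    close have close knots. *)
Lemma nl_frob : exists T, forall e l, (nl e.+1 l <= p * nl e l + T)%N /\ (p * nl e l <= nl e.+1 l + T)%N.
Proof.
have [C hC] := zdim_hinge; have [B hB] := frob_compare hp FF s.
have g0 := g_gt0 FF.
pose E := (C + p * C + B)%N; exists (2 * E + p)%N => e l.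
have cmp n : (zdim e.+1 (p * n) <= p * zdim e n + B)%N /\ (p * zdim e n <= zdim e.+1 (p * n) + B)%N.
  apply: (hB (fun i => nu i ^+ (p ^ e)) (tw e)); first exact: zdimP.
  have := zdimP e.+1 (p * n); congr (hasdim (Un _ _ _) _); first by apply/funext => i; rewrite /tw expnS mulnA.
  by rewrite /Z; congr rel_space; apply/funext => i; rewrite -exprM -expnSr.
have gE x y : (g * x <= g * y + E -> x <= y + E)%N.
  by move=> h; rewrite -(leq_pmul2l g0) mulnDr; apply: leq_trans h _; rewrite leq_add2l leq_pmull.
apply: knots_close (p_gt0 hp) (@nl_sorted e) (@nl_sorted e.+1) _ _ l => n; apply: gE.
  have [h1 h2] := cmp n; have [_ h3] := hC e.+1 (p * n)%N; have [h4 _] := hC e n.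
  have : (p * zdim e n <= p * (g * hinge (nl e) n + C))%N by rewrite leq_mul2l h4 orbT.
  rewrite mulnDr [(g * (p * _))%N]mulnCA /E; move: h1 h3; clear; lia.
have [h1 h2] := cmp n; have [h3 _] := hC e.+1 (p * n)%N; have [_ h4] := hC e n.
have : (p * (g * hinge (nl e) n) <= p * (zdim e n + C))%N by rewrite leq_mul2l h4 orbT.
rewrite mulnDr [(g * (p * _))%N]mulnCA /E; move: h2 h3; clear; lia.
Qed.

Lemma p_gt1 : (1 < p)%N.
Proof. exact: prime_gt1 (pcharf_prime hp). Qed.

Lemma frob_twist : exists2 D : {poly k}, D != 0 & exists c, forall e n x, Un (tw e) (Z e) n x ->
  Un (tw e.+1) (Z e.+1) (p * n + c) (pol D *: map_mx (fun a => a ^+ p) (x : 'rV[L]_s)).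
Proof.
have [D D0 [c hc]] := frob_ub hp (fun _ : 'I_1 => 1 : L).
exists D => //; exists c => e n x [Zx Fx]; split.
  rewrite /Z /rel_space /=; transitivity (pol D * (\sum_i nu i ^+ (p ^ e) * (x : 'rV[L]_s) 0 i) ^+ p).
    rewrite (frob_sum hp) ?(pchL hp) // mulr_sumr; apply: eq_bigr => i _.
    by rewrite !mxE expnSr exprM exprMn mulrCA.
  by rewrite [X in X ^+ p]Zx expr0n eqn0Ngt (p_gt0 hp) mulr0.
move=> i; rewrite !mxE; have Fi := Fx i; have := hc _ (fun=> (x : 'rV[L]_s) 0 i) (fun=> Fi).
rewrite big_ord1 mul1r /tw expnS -mulnA; have [le|gt] := leqP (p ^ e * d i)%N n.
  by apply: Ob_le; rewrite mulnBr addnBAC ?leq_mul2l ?le ?orbT.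
move=> _; move: Fi; rewrite /tw (eqP (ltnW gt : n - p ^ e * d i == 0)%N) => /Ob_zero ->.
by rewrite expr0n eqn0Ngt (p_gt0 hp) mulr0; apply: Ob0.
Qed.

Definition cutsum b e : nat := (\sum_(l < sigma | (l < b)%N) nl e l)%N.

Section Cut.
Variables (D : {poly k}) (c : nat) (e0 b : nat) (l0 : 'I_sigma).
Hypotheses (D0 : D != 0)
  (hD : forall e n x, Un (tw e) (Z e) n x -> Un (tw e.+1) (Z e.+1) (p * n + c) (pol D *: map_mx (fun a => a ^+ p) (x : 'rV[L]_s))).
Hypotheses (bl0 : b = l0.+1)
  (gap : forall e (l : 'I_sigma), (b <= l)%N -> (p ^ e * (nl e0 l0 + c) < nl (e0 + e) l)%N).

(** The level reached by the sections of level [nl e0 l0] after e applications of [frob_twist]. *)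
Fixpoint lev e : nat := if e is e'.+1 then (p * lev e' + c)%N else nl e0 l0.

Lemma lev_le e : (lev e + c <= p ^ e * (nl e0 l0 + c))%N.
Proof.
elim: e => [|e IH] /=; first by rewrite mul1n.
rewrite expnS -mulnA; apply: leq_trans (_ : p * (lev e + c) <= _)%N; last by rewrite leq_mul2l IH orbT.
by rewrite mulnDr -addnA leq_add2l addnn -mul2n leq_mul2r p_gt1 orbT.
Qed.

Lemma lev_lt e (l : 'I_sigma) : (b <= l)%N -> (lev e < nl (e0 + e) l)%N.
Proof. by move=> bl; apply: leq_ltn_trans (gap e bl); apply: leq_trans (lev_le e); rewrite leq_addr. Qed.

Lemma rk_lev e : (b <= rk (e0 + e) (lev e))%N -> rk (e0 + e) (lev e) = b.
Proof.
move=> le; apply/eqP; rewrite eqn_leq le andbT leqNgt; apply/negP => lt.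
have bs := leq_trans lt (rk_le (e0 + e) (lev e)).
have := lev_lt e (leqnn (Ordinal bs)); rewrite ltnNge nlP /= lt //.
Qed.

(** By [frob_twist] the pull-backs of G stay in the span of level [lev e], and the gap keeps the
    rank at that level from exceeding b. Hence that span is the Frobenius pull-back of G at every
    stage. *)
Lemma cut_twist : exists2 G : 'M[L]_(b, s), row_free G & forall e,
  [/\ rk (e0 + e) (lev e) = b, row_free (frm p e G), row_space (frm p e G) `<=` Z (e0 + e) &
   Un (tw (e0 + e)) (Z (e0 + e)) (lev e) `<=` row_space (frm p e G)].
Proof.
have r0 : rk e0 (nl e0 l0) = b.
  by have := @rk_lev 0; rewrite addn0; apply; rewrite bl0 -nlP.
have [G fG GU] := urankP (tw e0) (Z e0) (nl e0 l0); move: G fG GU; rewrite -/(rk _ _) r0 => G fG GU.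
exists G => // e.
have ff : row_free (frm p e G).
  by have /row_freeP[B GB] := fG; apply/row_freeP; exists (frm p e B); rewrite -frmM // GB frm1.
have GZ : row_space (frm p e G) `<=` Z (e0 + e).
  move=> x /submxP[y ->]; rewrite /Z /rel_space /=.
  transitivity (\sum_l y 0 l * (\sum_i nu i ^+ (p ^ e0) * G l i) ^+ (p ^ e)).
    under [RHS]eq_bigr do rewrite (frobX_sum hp) ?(pchL hp) // mulr_sumr.
    rewrite [RHS]exchange_big /=; apply: eq_bigr => i _; rewrite mxE mulr_sumr; apply: eq_bigr => l _.
    by rewrite frmE exprMn expnD exprM mulrCA.
  apply: big1 => l _; have [Zl _] := GU l.
  have -> : \sum_i nu i ^+ (p ^ e0) * G l i = 0 by rewrite -[RHS]Zl; apply: eq_bigr => i _; rewrite mxE.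
  by rewrite expr0n expn_eq0 eqn0Ngt (p_gt0 hp) mulr0.
have key : exists2 M : 'M[L]_(rk (e0 + e) (lev e), s), row_free M &
    (forall l, Un (tw (e0 + e)) (Z (e0 + e)) (lev e) (row l M)) /\ (frm p e G <= M)%MS.
  elim: e {ff GZ} => [|e [M fM [MU GM]]].
    rewrite addn0 /= r0; exists G => //; split=> //; rewrite (_ : frm p 0 G = G) ?submx_refl //.
    by apply/matrixP => i j; rewrite frmE expr1.
  have [M' fM' M'U] := urankP (tw (e0 + e.+1)) (Z (e0 + e.+1)) (lev e.+1).
  exists M' => //; split=> //; apply: (@submx_trans _ _ _ _ _ _ (frm p 1 M)).
    have /submxP[X GX] := GM; have -> : frm p e.+1 G = frm p 1 (frm p e G).
      by apply/matrixP => i j; rewrite !frmE expnSr exprM expn1.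
    by rewrite GX frmM // submxMl.
  apply/row_subP => l; have pD : pol D != 0 by rewrite pol_eq0.
  rewrite -(eqmx_scale _ pD); apply: (urank_span fM' M'U).
  have -> : row l (frm p 1 M) = map_mx (fun a => a ^+ p) (row l M) by apply/rowP => i; rewrite !mxE expn1.
  by rewrite addnS; apply: hD (MU l).
have [M fM [MU GM]] := key.
have rb : rk (e0 + e) (lev e) = b.
  by apply: rk_lev; have := mxrankS GM; rewrite (eqP ff) (eqP fM).
split=> // x Ux; apply: submx_trans (urank_span fM MU Ux) _.
by rewrite -(geq_leqif (mxrank_leqif_sup GM)) (eqP ff) (eqP fM) rb.
Qed.

(** Let W be the pull-back of G. At level N = [lev e] it has the dimension of all relations, about g
    (b N) minus g times the cut sum. From N on it grows with slope g b up to O(1), and [deg_frob]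
    gives g b n - r0 q + O(1) for large n; comparison yields the cut sum. *)
Lemma cut_asym : asym p (fun e => (g * cutsum b e)%N%:R).
Proof.
have [G fG hG] := cut_twist.
have b0 : (0 < b)%N by rewrite bl0.
have [r0 [C hC]] := deg_frob hp (tw e0) fG b0.
have [C1 hC1] := zdim_hinge.
have [c' hc'] := free_slope FF.
apply: (@asym_eventually p p_gt1 _ e0 r0%:R (C + C1 + g * b * c')%N%:R) => e.
have [rb ff GZ ZG] := hG e; set W := row_space (frm p e G) in GZ ZG.
have sW : is_subspace W.
  by split=> [|a x y hx hy]; rewrite /W /row_space /= ?sub0mx // addmx_sub // scalemx_sub.
set N := lev e in rb ZG.
have twE : (fun i => p ^ e * tw e0 i)%N = tw (e0 + e).
  by apply/funext => i; rewrite /tw mulnA -expnD addnC.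
pose wd n := projT1 (cid (Un_hasdim (tw (e0 + e)) sW n)).
have wdP n : hasdim (Un (tw (e0 + e)) W n) (wd n) by rewrite /wd; case: cid.
have wdN : wd N = zdim (e0 + e) N.
  apply: (hasdim_inj (wdP N)); have -> : Un (tw (e0 + e)) W N = Un (tw (e0 + e)) (Z (e0 + e)) N; last exact: zdimP.
  apply/seteqP; split=> x [h F]; split=> //; first exact: GZ.
  by apply: ZG.
have up x : (wd (N + x) <= wd N + g * b * x)%N.
  elim: x => [|x IH]; first by rewrite addn0 leq_addr.
  rewrite addnS mulnS; have [u [uU ui]] := slope_pind sW (wdP (N + x)%N) (wdP (N + x)%N.+1).
  have := pind_rank ui (fun l => (uU l).1); rewrite card_ord; move: IH; clear; lia.
have [H fH HU] := urankP (tw (e0 + e)) (Z (e0 + e)) N; move: H fH HU; rewrite -/(rk _ _) rb => H fH HU.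
have lo x : (wd N + g * b * x <= wd (N + c' + x))%N.
  elim: x => [|x IH]; first by rewrite muln0 !addn0; apply: (hasdim_le _ (wdP _) (wdP _)); apply: Un_le; rewrite leq_addr.
  rewrite addnS mulnS. have HW l : Un (tw (e0 + e)) W (N + x) (row l H).
    by apply: Un_le (leq_addr _ _) _ _; split; [apply: ZG|case: (HU l)].
  have := hc' _ _ _ sW _ _ (N + x)%N _ _ fH HW (wdP _) (wdP _).
  by rewrite [(N + x + c')%N]addnAC; move: IH; clear; lia.
have [n1 hn1] := hC e.
have [||h1 h2] := hn1 (N + c' + n1)%N (wd (N + c' + n1)); first by rewrite leq_addl.
  by rewrite twE; apply: wdP.
have lon := lo n1; have upn := up (c' + n1)%N; rewrite addnA in upn.
have hin : (hinge (nl (e0 + e)) N + cutsum b (e0 + e) = b * N)%N.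
  have bs : (b <= sigma)%N by rewrite -rb rk_le.
  have <- : (\sum_(l < b) N = b * N)%N by rewrite sum_nat_const card_ord.
  rewrite (big_ord_widen sigma (fun=> N) bs) /hinge /cutsum [X in (_ + X)%N]big_mkcond [RHS]big_mkcond -big_split.
  apply: eq_bigr => l _ /=; case: ltnP => lb; first by rewrite subnK // nlP rb.
  by rewrite (eqP (ltnW (lev_lt e lb) : N - _ == 0)%N).
have [z1 z2] := hC1 (e0 + e)%N N; rewrite -wdN in z1 z2.
have gh : (g * hinge (nl (e0 + e)) N + g * cutsum b (e0 + e) = b * g * N)%N by rewrite -mulnDr hin mulnA [(b * g)%N]mulnC.
have e1 : (b * g * (N + c' + n1) = b * g * N + g * b * c' + g * b * n1)%N by rewrite !mulnDr [(b * g)%N]mulnC.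
rewrite mulnDr in upn; rewrite e1 in h1 h2; rewrite -natrM.
move: h1 h2 lon upn z1 z2 gh; clear.
move: (b * g * N)%N (g * b * c')%N (g * b * n1)%N (g * hinge _ _)%N (g * cutsum _ _)%N (r0 * _)%N (wd N) (wd _).
by move=> x1 x2 x3 x4 x5 x6 x7 x8 h1 h2 h3 h4 h5 h6 h7; apply: norm_nat; lia.
Qed.
End Cut.

(** Only sums of minima up to a gap are accessible to [cut_asym]. The minima between two consecutive
    cuts stay at bounded distance for all e, so each equals their mean up to O(1), and the sum of
    the cluster is a difference of two cut sums. *)
Lemma nl_asym l : asym p (fun e => (nl e l)%:R).
Proof.
have [D D0 [c hD]] := frob_twist; have [T hT] := nl_frob; have g0 := g_gt0 FF.
pose M := (c + T)%N.
(* The cuts are the two ends and every index at which some stage e0 shows a gap above M = c + T.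
   Such a gap persists: T is the error of [nl_frob] and c the shift of [frob_twist], and 2 T <= p T
   absorbs the errors of each further stage. *)
pose bd b := b = 0%N \/ b = sigma \/ exists e0 (i j : 'I_sigma), [/\ b = i.+1, b = j & (nl e0 i + M < nl e0 j)%N].
have bd_asym b : bd b -> asym p (fun e => (g * cutsum b e)%N%:R).
  move=> bb; have [b0|b0] := eqVneq b 0%N.
    apply: (@asym_ext p _ (fun=> 0) 0) => [e|]; last by exists 0, 0 => e; rewrite mul0r subrr normr0.
    by rewrite b0 /cutsum big_pred0 ?muln0 ?subrr ?normr0.
  have [s0|bs] := eqVneq b sigma.
    have lb : (b.-1 < sigma)%N by rewrite -s0 prednK // lt0n.
    apply: (@cut_asym D c 0 b (Ordinal lb) D0 hD) => [|e i]; first by rewrite /= prednK // lt0n.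
    by rewrite leqNgt (leq_trans (ltn_ord i) (eq_leq (esym s0))).
  have [e0 [i [j [bi bj gap]]]] : exists e0 (i j : 'I_sigma), [/\ b = i.+1, b = j & (nl e0 i + M < nl e0 j)%N].
    by case: bb => [b0'|[bs'|//]]; [rewrite b0' in b0|rewrite bs' eqxx in bs].
  apply: (@cut_asym D c e0 b i D0 hD bi) => e l' bl.
  have {gap} gap : (nl e0 i + M < nl e0 l')%N by apply: leq_trans gap (nl_sorted _ _); rewrite -bj.
  suff : (p ^ e * (nl e0 i + c) + T < nl (e0 + e) l')%N by apply: leq_ltn_trans; rewrite leq_addr.
  elim: e => [|e IH]; first by rewrite mul1n addn0 -addnA.
  rewrite addnS expnS -mulnA; have [_ h] := hT (e0 + e)%N l'; have p2 := p_gt1.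
  have h' : (p * (p ^ e * (nl e0 i + c) + T).+1 <= p * nl (e0 + e) l')%N by rewrite leq_mul2l IH orbT.
  have h3 : (2 * T <= p * T)%N by rewrite leq_mul2r p2 orbT.
  move: h h' h3 {IH}; set A := (p ^ e * _)%N; rewrite mulnS mulnDr; move: p2; clear.
  by move: (p * A)%N (p * T)%N (p * nl (e0 + e) l')%N (nl (e0 + e).+1 l') => ? ? ? ?; lia.
(* [b0] and [b1] are the cuts nearest to l on either side; no gap above M occurs between them at any
   stage. *)
have P0 : exists b, `[< bd b /\ (b <= l)%N >] by exists 0%N; apply/asboolP; split=> //; left.
have Pb b : `[< bd b /\ (b <= l)%N >] -> (b <= l)%N by move=> /asboolP[].
case: (ex_maxnP P0 Pb) => b0 /asboolP[bd0 b0l] max0.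
have P1 : exists b, `[< bd b /\ (l < b)%N >] by exists sigma; apply/asboolP; split=> //; right; left.
case: (ex_minnP P1) => b1 /asboolP[bd1 lb1] min1.
have b1s : (b1 <= sigma)%N by apply: min1; apply/asboolP; split=> //; right; left.
have step e (i j : 'I_sigma) : (b0 <= i)%N -> (j < b1)%N -> j = i.+1 :> nat -> (nl e j <= nl e i + M)%N.
  move=> b0i jb1 ji; rewrite leqNgt; apply/negP => gap.
  have bj : bd j by right; right; exists e, i, j.
  have [jl|lj] := leqP j l.
    by have := max0 j (introT (asboolP _) (conj bj jl)); rewrite leqNgt ji ltnS b0i.
  by have := min1 j (introT (asboolP _) (conj bj lj)); rewrite leqNgt jb1.
have near e n (i j : 'I_sigma) : (b0 <= i)%N -> (j < b1)%N -> j = (i + n)%N :> nat -> (nl e j <= nl e i + n * M)%N.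
  elim: n j => [|n IH] j b0i jb1; first by rewrite addn0 mul0n addn0 => /val_inj ->.
  rewrite addnS => ji; have ls : (i + n < sigma)%N by rewrite -ltnS -ji ltnW // ltnS ltn_ord.
  have ij : (Ordinal ls < b1)%N by apply: leq_trans (ltnW jb1); rewrite ji.
  have h1 := step e (Ordinal ls) j (leq_trans b0i (leq_addr _ _)) jb1 ji.
  by apply: leq_trans h1 _; rewrite mulSn [(M + _)%N]addnC addnA leq_add2r; apply: IH.
have near2 e (i : 'I_sigma) : (b0 <= i)%N -> (i < b1)%N -> (nl e i <= nl e l + sigma * M)%N /\ (nl e l <= nl e i + sigma * M)%N.
  move=> b0i ib1; split.
    have [il|li] := leqP i l; first by apply: leq_trans (nl_sorted e il) (leq_addr _ _).
    have := near e (i - l)%N l i b0l ib1; rewrite subnKC ?(ltnW li) // => /(_ erefl) h; apply: leq_trans h _.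
    by rewrite leq_add2l leq_mul2r (leq_trans (leq_subr _ _) (ltnW (ltn_ord i))) orbT.
  have [li|il] := leqP l i; first by apply: leq_trans (nl_sorted e li) (leq_addr _ _).
  have := near e (l - i)%N i l b0i lb1; rewrite subnKC ?(ltnW il) // => /(_ erefl) h; apply: leq_trans h _.
  by rewrite leq_add2l leq_mul2r (leq_trans (leq_subr _ _) (ltnW (ltn_ord l))) orbT.
pose m := (b1 - b0)%N; have m0 : (0 < m)%N by rewrite subn_gt0 (leq_ltn_trans b0l lb1).
pose B e := (\sum_(i < sigma | (b0 <= i)%N && (i < b1)%N) nl e i)%N.
have splitB F : (\sum_(i < sigma | (i < b1)%N) F i = \sum_(i < sigma | (i < b0)%N) F i +
    \sum_(i < sigma | (b0 <= i)%N && (i < b1)%N) F i)%N.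
  rewrite (bigID (fun i : 'I_sigma => (i < b0)%N)) /=; congr (_ + _)%N; apply: eq_bigl => i.
    by case: (ltnP i b0) => h; rewrite ?andbF // andbT (ltn_trans h) // (leq_ltn_trans b0l).
  by rewrite -leqNgt andbC.
have cardB x : (\sum_(i < sigma | (b0 <= i)%N && (i < b1)%N) x = m * x)%N.
  have e1 y : (y <= sigma)%N -> (\sum_(i < sigma | (i < y)%N) x = y * x)%N.
    by move=> ys; rewrite -(big_ord_widen sigma (fun=> x) ys) sum_nat_const card_ord.
  have := splitB (fun=> x); rewrite !e1 ?(leq_trans (ltnW (leq_ltn_trans b0l lb1))) //.
  by rewrite /m mulnBl => ->; rewrite addKn.
have cutB e : (cutsum b1 e = cutsum b0 e + B e)%N by apply: splitB.
have aB : asym p (fun e => (g * B e)%N%:R).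
  apply: (@asym_ext p _ (fun e => (g * cutsum b1 e)%N%:R + (-1) * (g * cutsum b0 e)%N%:R) 0).
    by move=> e; rewrite cutB mulnDr natrD mulN1r addrAC subrr add0r subrr normr0.
  by apply: asymD; [apply: bd_asym|apply: asymZ; apply: bd_asym].
apply: (@asym_ext p _ (fun e => (g * m)%N%:R^-1 * (g * B e)%N%:R) (m * (sigma * M))%N%:R); last exact: asymZ.
move=> e; have B1 : (B e <= m * nl e l + m * (sigma * M))%N.
  by rewrite -mulnDr -cardB; apply: leq_sum => i /andP[h1 h2]; case: (near2 e i h1 h2).
have B2 : (m * nl e l <= B e + m * (sigma * M))%N.
  by rewrite -!cardB -big_split; apply: leq_sum => i /andP[h1 h2]; case: (near2 e i h1 h2).
have gm0 : (g * m)%N%:R != 0 :> rat by rewrite pnatr_eq0 -lt0n muln_gt0 g0.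
have -> : (nl e l)%:R = (g * m)%N%:R^-1 * (g * (m * nl e l))%N%:R :> rat by rewrite mulnA [X in _ * X]natrM mulKf.
rewrite -mulrBr normrM normfV normr_nat ler_pdivrMl ?lt0r ?gm0 ?ler0n // -natrM.
apply: norm_nat; rewrite -[(g * m * _)%N]mulnA -mulnDr leq_mul2l; apply/orP; right.
  apply: leq_trans B2 _; rewrite leq_add2l leq_pmull //.
by apply: leq_trans B1 _; rewrite leq_add2l leq_pmull.
Qed.

Lemma zdim_ramp : ramp p (fun e n => (zdim e n)%:R).
Proof.
have [C hC] := zdim_hinge.
apply: (@ramp_ext _ _ (fun e n => g%:R * \sum_l (n - nl e l)%N%:R) C%:R) => [e n|].
  by rewrite -natr_sum -natrM; have [h1 h2] := hC e n; apply: norm_nat.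
apply: rampZ; apply: ramp_sum => l; apply: ramp_hinge; exact: nl_asym.
Qed.

Definition hset e n : set (restr cst L^o) :=
  [set v | exists2 m, Fw (tw e) n m & v = \sum_i nu i ^+ (p ^ e) * (m : 'rV[L]_s) 0 i].

(** Rank-nullity: the values of the form have the dimension of all vectors minus that of the
    relations, whose ramp is known. *)
Lemma hset_ramp : exists2 h : nat -> nat -> nat, forall e n, hasdim (hset e n) (h e n) &
  ramp p (fun e n => (h e n)%:R).
Proof.
exists (fun e n => g * \sum_i (n - tw e i) - zdim e n)%N => [e n|].
  pose f (m : restr cst 'rV[L]_s) : restr cst L^o := \sum_i nu i ^+ (p ^ e) * (m : 'rV[L]_s) 0 i.
  have fl : linear f.
    move=> a x y; rewrite /f restrZ scaler_sumr -big_split; apply: eq_bigr => i _ /=.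
    by rewrite !mxE mulrDr [RHS]/= mulrCA.
  pose fL := HB.pack_for {linear restr cst 'rV[L]_s -> restr cst L^o} f (GRing.isLinear.Build _ _ _ _ _ fl).
  have [a [b [ha hb ab]]] := hasdim_img fL (Fw_hasdim FF (tw e) n).
  have zb : zdim e n = b.
    apply: (hasdim_inj (zdimP e n)); move: hb; congr (hasdim _ _); apply/seteqP.
    by split=> x [h1 h2].
  rewrite ab zb addnK; move: ha; congr (hasdim _ _); apply/seteqP.
  by split=> [_ [m hm <-]|_ [m hm ->]]; exists m.
apply: (@ramp_ext _ _ (fun e n => g%:R * (\sum_i (n - tw e i)%N%:R) + (-1) * (zdim e n)%:R) 0).
  move=> e n; rewrite natrB; first by rewrite natrM natr_sum mulN1r subrr normr0.
  apply: hasdim_le _ (zdimP e n) (Fw_hasdim FF (tw e) n); by move=> x [].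
apply: rampD (rampZ _ zdim_ramp); apply: rampZ; apply: ramp_sum => i; apply: ramp_hinge.
by exists (d i)%:R, 0 => e; rewrite /tw natrM mulrC subrr normr0.
Qed.
End Relations.

Lemma diag_ramp s r (nu : 'I_s -> 'I_r -> L) (d : 'I_s -> nat) :
  exists2 h : nat -> nat -> nat, forall e n, hasdim ([set v : 'rV[L]_r | exists2 u : 'I_s -> 'rV[L]_r,
      forall i l, Ob (n - p ^ e * d i) (u i 0 l) &
      v = \row_l \sum_i nu i l ^+ (p ^ e) * u i 0 l] : set (restr cst 'rV[L]_r)) (h e n) &
  ramp p (fun e n => (h e n)%:R).
Proof.
have hl l : exists h : nat -> nat -> nat, (forall e n, hasdim (hset (fun i => nu i l) d e n) (h e n)) /\ ramp p (fun e n => (h e n)%:R).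
  by have [h h1 h2] := hset_ramp (fun i => nu i l) d; exists h.
have [h hh] := choice hl; exists (fun e n => \sum_l h l e n)%N => [e n|]; last first.
  apply: (@ramp_ext _ _ (fun e n => \sum_l (h l e n)%:R) 0) => [e n|].
    by rewrite natr_sum subrr normr0.
  by apply: ramp_sum => l; case: (hh l).
pose f l (x : restr cst L^o) : restr cst 'rV[L]_r := (x : L) *: delta_mx 0 l.
have fE (x : 'I_r -> restr cst L^o) : \sum_l f l (x l) = \row_l (x l : L) :> 'rV[L]_r.
  by rewrite [RHS]row_sum_delta; apply: eq_bigr => l _; rewrite mxE.
have := @hasdim_dsum _ _ _ _ (fun l => hset (fun i => nu i l) d e n) (fun l => h l e n) f _ _ _ _.
set S := (X in _ -> hasdim X _); set S' := (X in hasdim X _) => key.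
have -> : S = S'.
  apply/seteqP; split=> [v [u hu ->]|v [x [hx ->]]].
    exists (fun l => \sum_i nu i l ^+ (p ^ e) * u i 0 l); split=> [l|]; last by rewrite fE.
    exists (\row_i u i 0 l) => [i|]; first by rewrite mxE; apply: hu.
    by apply: eq_bigr => i _; rewrite mxE.
  have hx' l : exists m : 'rV[L]_s, Fw (tw d e) n m /\ x l = \sum_i nu i l ^+ (p ^ e) * m 0 i.
    by have [m h1 h2] := hx l; exists m.
  have [m hm] := choice hx'; exists (fun i => \row_l m l 0 i) => [i l|].
    by rewrite mxE; case: (hm l) => + _; apply.
  by rewrite fE; apply/rowP => l; rewrite !mxE (hm l).2; apply: eq_bigr => i _; rewrite mxE.
apply: key => [l|l x y|l c x|x _].
- by case: (hh l).
- exact: (scalerDl (delta_mx 0 l : 'rV[L]_r) (x : L) (y : L)).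
- by rewrite /f !restrZ scalerA.
- by rewrite fE => /rowP x0 l; have := x0 l; rewrite !mxE.
Qed.
End Field.

(** * Twists by commuting matrices *)

Lemma irreducible_divisor (F : fieldType) (f : {poly F}) : (1 < size f)%N ->
  exists2 h, irreducible_poly h & h %| f.
Proof.
move=> sf.
pose Q n := `[< exists h : {poly F}, [/\ size h = n, (1 < size h)%N & h %| f] >].
have exQ : exists n, Q n by exists (size f); apply/asboolP; exists f; split.
case: (ex_minnP exQ) => n /asboolP[h [sh h1 hf]] min; exists h => //; split=> // q sq qh.
have h0 : h != 0 by rewrite -size_poly_gt0; apply: ltn_trans h1.
have q0 : q != 0 by apply: contraNneq h0 => q0; move: qh; rewrite q0 dvd0p.
rewrite -dvdp_size_eqp // eqn_leq dvdp_leq //= sh; apply: min; apply/asboolP; exists q; split=> //.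
  by have := size_poly_eq0 q; move: sq; case: (size q) => [|[|m]] //; rewrite (negbTE q0).
exact: dvdp_trans qh hf.
Qed.

Lemma split_ex n (F : fieldType) (f : {poly F}) : f != 0 -> (size f <= n)%N ->
  exists (L : fieldExtType F) (zs : seq L), map_poly (in_alg L) f %= \prod_(z <- zs) ('X - z%:P).
Proof.
elim: n F f => [|n IH] F f f0 sf; first by move: sf; rewrite leqn0 size_poly_eq0 (negbTE f0).
have [s1|s1] := leqP (size f) 1.
  exists F^o, [::]; rewrite big_nil.
  rewrite -size_poly_eq1 size_map_poly eqn_leq s1 size_poly_gt0 //.
have [h irr hf] := irreducible_divisor s1.
have [K _ [x rx _]] := irredp_FAdjoin irr.
have {}rx : root (map_poly (in_alg K) f) x.
  by apply: root_dvdp rx; rewrite dvdp_map.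
have [q qE] := factor_theorem _ _ rx.
have q0 : q != 0 by apply: contraNneq f0 => q0; move/eqP: qE; rewrite q0 mul0r map_poly_eq0.
have sq : (size q <= n)%N.
  by have := congr1 (size : {poly K} -> nat) qE; rewrite size_map_poly size_Mmonic ?monicXsubC // size_XsubC addn2 /= => e; rewrite -ltnS -e.
have [L [zs zsE]] := IH K q q0 sq.
exists (baseFieldType L), ((x%:A : L) :: zs); rewrite big_cons.
have -> : map_poly (in_alg (baseFieldType L)) f = map_poly (in_alg L) (map_poly (in_alg K) f) :> {poly L}.
  rewrite -map_poly_comp; apply: eq_map_poly => a /=.
  by rewrite (baseField_scaleE a (1 : L)).
rewrite qE rmorphM /= map_polyXsubC /= mulrC; exact: eqp_mull.
Qed.

Section PowerDiag.
Variables (F : fieldType) (p : nat) (hp : p \in [pchar F]).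

Lemma prod_dvd_exp (zs S : seq F) : {subset zs <= S} ->
  \prod_(z <- zs) ('X - z%:P) %| (\prod_(z <- S) ('X - z%:P)) ^+ size zs.
Proof.
elim: zs => [|z zs IH] sub; first by rewrite big_nil expr0.
rewrite big_cons exprS dvdp_mul //.
  by rewrite dvdp_XsubCl root_prod_XsubC sub ?mem_head.
by apply: IH => x xz; apply: sub; rewrite inE xz orbT.
Qed.

(** The minimal polynomial of N divides the q-th power of the product of X - z over the distinct
    roots z. Since raising to the power q is additive, this says that N^q is a root of the product
    of X - z^q, and the z^q are distinct. *)
Lemma power_diagonalizable r (N : 'M[F]_r.+1) zs e : mxminpoly N %| \prod_(z <- zs) ('X - z%:P) ->
  (size zs <= p ^ e)%N -> diagonalizable (N ^+ (p ^ e)).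
Proof.
move=> mN sz; set q := (p ^ e)%N in sz *.
have frobX (R : comNzRingType) (x y : R) : p \in [pchar R] -> (x - y) ^+ q = x ^+ q - y ^+ q.
  move=> hR; apply: (addIr (y ^+ q)); rewrite subrK -/q /q -frobXD // subrK //.
apply/diagonalizableP; exists [seq z ^+ q | z <- undup zs].
  rewrite map_inj_in_uniq ?undup_uniq // => x y _ _ xy.
  apply/eqP; rewrite -subr_eq0; have := frobX _ x y hp; rewrite xy subrr => /eqP.
  by rewrite expf_eq0 => /andP[].
apply: mxminpoly_min.
have hpP : p \in [pchar {poly F}] by apply: (rmorph_pchar (@polyC F)).
have -> : horner_mx (N ^+ q) (\prod_(x <- [seq z ^+ q | z <- undup zs]) ('X - x%:P)) =
   horner_mx N ((\prod_(z <- undup zs) ('X - z%:P)) ^+ q).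
  rewrite big_map !rmorph_prod -prodrXl rmorph_prod; apply: eq_bigr => z _.
  by rewrite frobX // !rmorphB /= !rmorphXn /= !horner_mx_X !horner_mx_C -rmorphXn.
apply/mxminpoly_minP; apply: dvdp_trans mN _; apply: dvdp_trans (prod_dvd_exp (S := undup zs) _) _.
  by move=> x; rewrite mem_undup.
exact: dvdp_exp2l.
Qed.

Lemma powers_codiag r s (N : 'I_s -> 'M[F]_r.+1) zs : (forall i j, N i * N j = N j * N i) ->
  (forall i, mxminpoly (N i) %| \prod_(z <- zs) ('X - z%:P)) ->
  exists e (T : 'M[F]_r.+1) (nu : 'I_s -> 'I_r.+1 -> F), T \in unitmx /\
    forall i, T *m N i ^+ (p ^ e) = diag_mx (\row_l nu i l) *m T.
Proof.
move=> cN mN; have p1 : (1 < p)%N by apply: prime_gt1; apply: pcharf_prime hp.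
exists (size zs); pose As := [seq N i ^+ (p ^ size zs) | i <- enum 'I_s].
have : codiagonalizable As.
  apply/codiagonalizableP; split.
    move=> _ _ /mapP[i _ ->] /mapP[j _ ->].
    by apply: commrX; apply: commr_sym; apply: commrX; apply: cN.
  move=> _ /mapP[i _ ->]; apply: power_diagonalizable (mN i) _.
  by apply/ltnW/ltn_expl.
case=> T uT hT; exists T.
have h i : exists D, T *m N i ^+ (p ^ size zs) = diag_mx D *m T.
  move/allP: hT => /(_ (N i ^+ (p ^ size zs)) (map_f _ (mem_enum _ i))) /= /diagonalizable_forPex[D hD].
  by exists D; apply: simmxPp hD; apply: stablemx_unit.
have [D hD] := choice h; exists (fun i l => D i 0 l); split=> // i; rewrite hD.
by congr (diag_mx _ *m _); apply/rowP => l; rewrite mxE.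
Qed.
End PowerDiag.

Lemma funfield_split (k : closedFieldType) (f : {poly {fraction {poly k}}}) : f != 0 ->
  exists (FF : funfield k) (zs : seq (ff_L FF)), map_poly (@ff_io k FF) f %= \prod_(z <- zs) ('X - z%:P).
Proof.
move=> f0; have [L [zs zsE]] := split_ex f0 (leqnn _).
pose e := vbasis {: L}; have fe : basis_of {: L} e := vbasisP _.
pose c (b : L) : 'rV_(\dim {: L}) := \row_i coord e i b.
have cD a b : c (a + b) = c a + c b by apply/rowP => i; rewrite !mxE linearD.
have cZ (a : {fraction {poly k}}) b : c (in_alg L a * b) = a *: c b.
  by apply/rowP => i; rewrite !mxE /= mulr_algl linearZ.
have ci : injective c.
  move=> a b /rowP ab; rewrite (coord_basis fe (memvf a)) (coord_basis fe (memvf b)).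
  by apply: eq_bigr => i _; have := ab i; rewrite !mxE => ->.
have cS u : exists b, c b = u.
  exists (\sum_i u 0 i *: e`_i); apply/rowP => i; rewrite mxE coord_sum_free //; exact: basis_free fe.
by exists (@Funfield k L (in_alg L) _ c cD cZ ci cS), zs.
Qed.

(** A ramp changes by O(1) under a bounded shift of n, uniformly in e, so the two inequalities
    determine [a] up to O(1). *)
Lemma ramp_shift p (a h : nat -> nat -> nat) c c' : ramp p (fun e n => (h e n)%:R) ->
  (forall e n, (a e n <= h e (n + c))%N) -> (forall e n, (h e n <= a e (n + c'))%N) ->
  ramp p (fun e n => (a e n)%:R).
Proof.
move=> [N [eps [lam [C [l0 hC]]]]] ah ha.
pose S e (x : nat) : rat := \sum_l eps l * pos (x%:R - lam l * (p ^ e)%:R).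
pose B : rat := \sum_l `|eps l|.
have lip e x y : (x <= y)%N -> `|S e y - S e x| <= B * (y - x)%N%:R.
  move=> xy; rewrite /S -sumrB /B mulr_suml; apply: le_trans (ler_norm_sum _ _ _) _.
  apply: ler_sum => l _; rewrite -mulrBr normrM ler_wpM2l //.
  apply: le_trans (pos_lip _ _) _; rewrite opprB addrA subrK -natrB // ger0_norm //.
have small e (x : nat) : S e x <= B * x%:R.
  rewrite /S /B mulr_suml; apply: ler_sum => l _.
  have P0 y : 0 <= pos y by rewrite /pos le_max lexx.
  apply: le_trans (ler_norm _) _; rewrite normrM ler_wpM2l // ger0_norm //.
  rewrite /pos ge_max ler0n /= lerBlDr lerDl mulr_ge0 //; apply: l0.
have B0 : 0 <= B by apply: sumr_ge0.
have {}hC e n : `|(h e n)%:R - S e n| <= C := hC e n.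
exists N, eps, lam, (C + B * c%:R + B * c'%:R); split=> // e n; rewrite -/(S e n).
have Bc : 0 <= B * c%:R by apply: mulr_ge0.
have Bc' : 0 <= B * c'%:R by apply: mulr_ge0.
have C0 : 0 <= C by apply: le_trans (hC 0%N 0%N).
rewrite ler_norml; apply/andP; split.
  have [cn|nc] := leqP c' n; last first.
    have h1 := small e n; have h2 : B * n%:R <= B * c'%:R by rewrite ler_wpM2l // ler_nat ltnW.
    have h3 : 0 <= (a e n)%:R :> rat by [].
    move: (_ * _) (_ * _) (_ * _) (S e n) (a e n)%:R h1 h2 h3 Bc Bc' C0; clear; move=> *; lra.
  have h1 := lip e (n - c')%N n (leq_subr _ _); rewrite subKn // in h1.
  have h2 : (h e (n - c')%N)%:R <= (a e n)%:R :> rat by rewrite ler_nat -{2}(subnK cn).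
  have h3 := hC e (n - c')%N.
  move: h1 h3; rewrite !ler_norml => /andP[_ h1] /andP[h3 _].
  move: (B * _) (B * _) (S e n) (S e _) (a e n)%:R (h e _)%:R h1 h2 h3 Bc Bc' C0; clear; move=> *; lra.
have h1 := lip e n (n + c)%N (leq_addr _ _); rewrite addKn in h1.
have h2 : (a e n)%:R <= (h e (n + c)%N)%:R :> rat by rewrite ler_nat.
have h3 := hC e (n + c)%N.
move: h1 h3; rewrite !ler_norml => /andP[_ h1] /andP[_ h3].
move: (B * _) (B * _) (S e n) (S e _) (a e n)%:R (h e _)%:R h1 h2 h3 Bc Bc' C0; clear; move=> *; lra.
Qed.

Lemma image_subspace (k : fieldType) (V V' : lmodType k) (f : {linear V -> V'}) (W : set V) :
  is_subspace W -> is_subspace (f @` W).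
Proof.
move=> sW; split=> [|a _ _ [x Wx <-] [y Wy <-]]; first by exists 0; [case: sW|rewrite linear0].
by exists (a *: x + y); [case: sW => _; apply|rewrite linearP].
Qed.

Section CommutingMatrices.
Variables (k : closedFieldType) (p : nat) (hp : p \in [pchar k]).
Notation K := {fraction {poly k}}.
Definition ratc : k -> K := @tofrac {poly k} \o @polyC k.
HB.instance Definition _ := GRing.RMorphism.copy ratc (@tofrac {poly k} \o @polyC k).
Variables (r s : nat) (N : 'I_s -> 'M[K]_r.+1) (d : 'I_s -> nat).
Hypothesis cN : forall i j, N i * N j = N j * N i.

(** What a Frobenius piece becomes in coordinates: multiplication by a generator v_i^q acts as
    N_i^q, and the cofactors become polynomial rows of bounded degree. *)
Definition twist_span e n : set (restr ratc 'rV[K]_r.+1) :=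
  [set v | exists2 u : 'I_s -> 'I_r.+1 -> {poly k}, (forall i l, size (u i l) <= n - p ^ e * d i)%N &
    v = \sum_i (\row_l (u i l)%:F) *m N i ^+ (p ^ e)].

Lemma twist_span_subspace e n : is_subspace (twist_span e n).
Proof.
split=> [|a _ _ [u hu ->] [u' hu' ->]].
  exists (fun _ _ => 0) => [i l|]; first by rewrite size_poly0.
  rewrite big1 // => i _; rewrite (_ : \row_l _ = 0) ?mul0mx //.
  by apply/rowP => l; rewrite !mxE tofrac0.
exists (fun i l => a *: u i l + u' i l) => [i l|].
  apply: leq_trans (size_polyD _ _) _; rewrite geq_max hu' andbT.
  exact: leq_trans (size_scale_leq _ _) (hu i l).
rewrite restrZ scaler_sumr -big_split; apply: eq_bigr => i _ /=.
rewrite scalemxAl -mulmxDl; congr (_ *m _); apply/rowP => l; rewrite !mxE.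
by rewrite -mul_polyC tofracD tofracM.
Qed.

Section Split.
Variables (FF : funfield k).
Notation L := (ff_L FF).
Notation g := (ff_g FF).
Notation io := (@ff_io k FF).
Notation co := (@ff_co k FF).
Local Notation pol := (@pol k FF).
Local Notation cst := (@cst k FF).
Variables (e1 : nat) (T : 'M[L]_r.+1) (nu : 'I_s -> 'I_r.+1 -> L).
Hypothesis uT : T \in unitmx.
Hypothesis hT : forall i, T *m map_mx io (N i) ^+ (p ^ e1) = diag_mx (\row_l nu i l) *m T.

Definition ext_span e n : set (restr cst 'rV[L]_r.+1) :=
  [set v | exists2 u : 'I_s -> 'rV[L]_r.+1, (forall i l, Ob (n - p ^ e * d i) (u i 0 l)) &
    v = \sum_i u i *m map_mx io (N i) ^+ (p ^ e)].

Definition diag_span e n : set (restr cst 'rV[L]_r.+1) :=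
  [set v | exists2 u : 'I_s -> 'rV[L]_r.+1, (forall i l, Ob (n - p ^ e * (p ^ e1 * d i)) (u i 0 l)) &
    v = \row_l \sum_i nu i l ^+ (p ^ e) * u i 0 l].

Lemma diag_spanE e (u : 'I_s -> 'rV[L]_r.+1) :
  \row_l \sum_i nu i l ^+ (p ^ e) * u i 0 l = \sum_i u i *m diag_mx (\row_l nu i l ^+ (p ^ e)).
Proof.
apply/rowP => l; rewrite !mxE summxE; apply: eq_bigr => i _.
by rewrite mul_mx_diag !mxE mulrC.
Qed.

Lemma twist_diag e i : T *m map_mx io (N i) ^+ (p ^ (e1 + e)) = diag_mx (\row_l nu i l ^+ (p ^ e)) *m T.
Proof.
rewrite expnD exprM; set M := _ ^+ (p ^ e1).
have step m : T *m M ^+ m = diag_mx (\row_l nu i l ^+ m) *m T.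
  elim: m => [|m IH].
    rewrite expr0 mulmx1 (_ : diag_mx _ = 1%:M) ?mul1mx //.
    by apply/matrixP => a b; rewrite !mxE expr0.
  rewrite exprSr mulmxA IH -mulmxA hT mulmxA mulmx_diag; congr (diag_mx _ *m _).
  by apply/rowP => l; rewrite !mxE exprSr.
exact: step.
Qed.

Lemma row_shift (X : 'M[L]_r.+1) : exists2 D : {poly k}, D != 0 & exists c, forall n a (u : 'rV[L]_r.+1),
  (forall l, Ob (n - a) (u 0 l)) -> forall l, Ob (n + c - a) ((pol D *: (u *m X)) 0 l).
Proof.
have [D D0 [c hc]] := Ob_mul (fun ij : 'I_r.+1 * 'I_r.+1 => X ij.1 ij.2); exists D => //; exists c => n a u hu l.
rewrite !mxE mulr_sumr; apply: Ob_sum => i _; rewrite [u _ _ * _]mulrC.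
have [an|na] := leqP a n; first by rewrite addnC -addnBA // addnC mulrA; apply: (hc (i, l)); apply: hu.
have := hu i; rewrite (eqP (ltnW na : (n - a == 0)%N)) => /Ob_zero ->; rewrite !mulr0; exact: Ob0.
Qed.

Definition scl (D : {poly k}) (X : 'M[L]_r.+1) (v : restr cst 'rV[L]_r.+1) : restr cst 'rV[L]_r.+1 :=
  pol D *: ((v : 'rV[L]_r.+1) *m X).
Lemma scl_linear D X : linear (scl D X).
Proof.
by move=> a u v; rewrite /scl !restrZ mulmxDl scalerDr -scalemxAl scalerA mulrC -scalerA.
Qed.
HB.instance Definition _ D X := GRing.isLinear.Build _ _ _ _ (scl D X) (@scl_linear D X).
Lemma scl_inj D X v : D != 0 -> X \in unitmx -> scl D X v = 0 -> v = 0.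
Proof.
move=> D0 uX h; have /eqP : pol D *: ((v : 'rV[L]_r.+1) *m X) = 0 := h.
rewrite scaler_eq0 pol_eq0 (negbTE D0) /= => /eqP vX.
by rewrite -[LHS](mulmxK uX) vX mul0mx.
Qed.
Lemma scl_sum D X (u : 'I_s -> 'rV[L]_r.+1) (Y Z : 'I_s -> 'M[L]_r.+1) :
  (forall i, Y i *m X = X *m Z i) -> scl D X (\sum_i u i *m Y i) = \sum_i (pol D *: (u i *m X)) *m Z i.
Proof.
move=> YZ; rewrite /scl mulmx_suml scaler_sumr; apply: eq_bigr => i _.
by rewrite -mulmxA YZ mulmxA scalemxAl.
Qed.

Lemma ext_to_diag : exists2 D : {poly k}, D != 0 & exists c, forall e n v,
  ext_span (e1 + e) n v -> diag_span e (n + c) (scl D (invmx T) v).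
Proof.
have [D D0 [c hc]] := row_shift (invmx T); exists D => //; exists c => e n _ [u hu ->].
exists (fun i => pol D *: (u i *m invmx T)) => [i l|].
  by apply: hc => l'; have := hu i l'; rewrite expnD [(p ^ e1 * _)%N]mulnC -mulnA.
rewrite diag_spanE; apply: scl_sum => i.
by rewrite -[LHS](mulKmx uT) [T *m (_ *m _)]mulmxA twist_diag -mulmxA mulmxV // mulmx1.
Qed.

Lemma diag_to_ext : exists2 D : {poly k}, D != 0 & exists c, forall e n v,
  diag_span e n v -> ext_span (e1 + e) (n + c) (scl D T v).
Proof.
have [D D0 [c hc]] := row_shift T; exists D => //; exists c => e n _ [u hu ->].
exists (fun i => pol D *: (u i *m T)) => [i l|].
  by apply: hc => l'; have := hu i l'; rewrite mulnA -expnD [(e + e1)%N]addnC.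
by rewrite diag_spanE; apply: scl_sum => i; rewrite twist_diag.
Qed.

Definition embj (j : 'I_g) (v : restr ratc 'rV[K]_r.+1) : restr cst 'rV[L]_r.+1 :=
  be j *: (map_mx io (v : 'rV[K]_r.+1)).

Lemma embj_linear j : linear (embj j).
Proof.
by move=> a u v; rewrite /embj !restrZ map_mxD map_mxZ scalerDr !scalerA mulrC.
Qed.
HB.instance Definition _ j := GRing.isLinear.Build _ _ _ _ (embj j) (@embj_linear j).

Lemma embj_inj (x : 'I_g -> restr ratc 'rV[K]_r.+1) : \sum_j embj j (x j) = 0 -> forall j, x j = 0.
Proof.
move=> h j; apply/rowP => l; rewrite mxE.
have : co (\sum_j io (x j 0 l) * be j) = 0 :> 'rV[K]_g.
  rewrite -[0 in RHS](co0 FF); congr co; have /rowP/(_ l) := h; rewrite !mxE => hl; rewrite -[RHS]hl.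
  by rewrite summxE; apply: eq_bigr => i _; rewrite !mxE mulrC.
rewrite co_sum => /rowP/(_ j); rewrite mxE summxE (bigD1 j) //= big1 ?addr0 => [|i ij].
  by rewrite ff_coZ co_be !mxE !eqxx mulr1.
by rewrite ff_coZ co_be !mxE eqxx eq_sym (negbTE ij) mulr0.
Qed.

Lemma embj_sum e j (w : 'I_s -> 'rV[K]_r.+1) : embj j (\sum_i w i *m N i ^+ (p ^ e)) =
  \sum_i (be j *: map_mx io (w i)) *m map_mx io (N i) ^+ (p ^ e).
Proof.
rewrite /embj raddf_sum scaler_sumr; apply: eq_bigr => i _.
by rewrite -scalemxAl -rmorphXn /= -map_mxM.
Qed.

(** The matrices N_i are defined over k(t), so extending scalars to L yields g independent copies,
    one for each element of the basis [be]; the dimension is multiplied by g. *)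
Lemma ext_spanE e n : ext_span e n = [set v | exists x, (forall j, twist_span e n (x j)) /\ v = \sum_j embj j (x j)].
Proof.
apply/seteqP; split=> [_ [u hu ->]|v [x [hx ->]]].
  have h (x : 'I_s * 'I_r.+1 * 'I_g) : exists f : {poly k}, (size f <= n - p ^ e * d x.1.1)%N /\ co (u x.1.1 0 x.1.2) 0 x.2 = f%:F.
    by have [f h1 h2] := hu x.1.1 x.1.2 x.2; exists f.
  have [f hf] := choice h.
  exists (fun j => \sum_i (\row_l (f (i, l, j))%:F) *m N i ^+ (p ^ e)); split=> [j|].
    by exists (fun i l => f (i, l, j)) => // i l; case: (hf (i, l, j)).
  under [RHS]eq_bigr do rewrite embj_sum.
  rewrite exchange_big; apply: eq_bigr => i _.
  have -> : u i = \sum_j be j *: map_mx io (\row_l (f (i, l, j))%:F).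
    apply/rowP => l; rewrite summxE [LHS]coE; apply: eq_bigr => j _.
    by rewrite !mxE mulrC; case: (hf (i, l, j)) => _ /= ->.
  by rewrite mulmx_suml.
have h j : exists u : 'I_s -> 'I_r.+1 -> {poly k}, (forall i l, size (u i l) <= n - p ^ e * d i)%N /\
   x j = \sum_i (\row_l (u i l)%:F) *m N i ^+ (p ^ e).
  by have [u h1 h2] := hx j; exists u.
have [u hu] := choice h.
exists (fun i => \row_l \sum_j pol (u j i l) * be j) => [i l|].
  rewrite mxE => j; exists (u j i l); first by case: (hu j).
  rewrite co_sum summxE (bigD1 j) //= big1 ?addr0 => [|i' ij]; rewrite co_pol co_be !mxE eqxx.
    by rewrite eqxx mulr1.
  by rewrite eq_sym (negbTE ij) mulr0.
under [LHS]eq_bigr => j _ do rewrite (hu j).2 embj_sum.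
rewrite exchange_big; apply: eq_bigr => i _.
have -> : \row_l \sum_j pol (u j i l) * be j = \sum_j be j *: map_mx io (\row_l (u j i l)%:F).
  by apply/rowP => l; rewrite summxE mxE; apply: eq_bigr => j _; rewrite !mxE mulrC.
by rewrite mulmx_suml.
Qed.

Lemma split_ramp : exists2 h : nat -> nat -> nat, forall e n, hasdim (twist_span (e1 + e) n) (h e n) &
  ramp p (fun e n => (h e n)%:R).
Proof.
have [h hh hr] := diag_ramp hp nu (fun i => p ^ e1 * d i)%N.
have [D D0 [c hc]] := ext_to_diag; have [D' D0' [c' hc']] := diag_to_ext.
have g0 := g_gt0 FF; pose j0 := Ordinal g0.
have fd e n : exists b, hasdim (twist_span (e1 + e) n) b.
  pose f := GRing.Linear.clone _ _ _ _ (scl D (invmx T) \o embj j0) _.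
  have fS : f @` twist_span (e1 + e) n `<=` diag_span e (n + c).
    move=> _ [v hv <-]; apply: hc; rewrite ext_spanE.
    exists (fun j => if j == j0 then v else 0); split=> [j|].
      by case: ifP => _ //; case: (twist_span_subspace (e1 + e) n).
    by rewrite (bigD1 j0) //= big1 ?addr0 // => j /negbTE ->; rewrite linear0.
  have [b _ hb] := hasdim_sub (image_subspace f (twist_span_subspace _ n)) fS (hh e (n + c)%N).
  exists b; apply: (hasdim_pre (f := f)) hb => [|x _]; first exact: twist_span_subspace.
  move=> /(scl_inj D0) -/(_ _) h0; have {}h0 : embj j0 x = 0 by apply: h0; rewrite unitmx_inv.
  have := @embj_inj (fun j => if j == j0 then x else 0) _ j0; rewrite eqxx; apply.
  by rewrite (bigD1 j0) //= big1 ?addr0 // => j /negbTE ->; rewrite linear0.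
pose b e n := projT1 (cid (fd e n)); have hb e n : hasdim (twist_span (e1 + e) n) (b e n) by rewrite /b; case: cid.
have hx e n : hasdim (ext_span (e1 + e) n) (g * b e n)%N.
  rewrite ext_spanE -[g in (g * _)%N]card_ord -sum_nat_const.
  apply: (@hasdim_dsum _ _ _ _ (fun=> twist_span (e1 + e) n) (fun=> b e n) embj) => [//|j x y|j a x|x _].
  - exact: linearD.
  - exact: linearZ.
  - exact: embj_inj.
exists b => //.
apply: (@ramp_ext _ _ (fun e n => g%:R^-1 * (g * b e n)%N%:R) 0) => [e n|].
  by rewrite natrM mulKf ?subrr ?normr0 // pnatr_eq0 -lt0n.
apply: rampZ; apply: (ramp_shift (c := c) (c' := c') hr) => e n.
  have h1 := hasdim_img_inj (f := scl D (invmx T)) _ (hx e n).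
  apply: (hasdim_le _ (h1 _) (hh e (n + c)%N)) => [_ [v hv <-]|x _]; first exact: hc.
  by apply: scl_inj => //; rewrite unitmx_inv.
have h1 := hasdim_img_inj (f := scl D' T) _ (hh e n).
apply: (hasdim_le _ (h1 _) (hx e (n + c')%N)) => [_ [v hv <-]|x _]; first exact: hc'.
exact: scl_inj.
Qed.
End Split.

(** A field that splits the product of the characteristic polynomials serves for all the N_i at
    once. Diagonalization needs a first power p^e1, whence the shift of the exponent. *)
Theorem commuting_ramp : exists e1 (h : nat -> nat -> nat),
  (forall e n, hasdim (twist_span (e1 + e) n) (h e n)) /\ ramp p (fun e n => (h e n)%:R).
Proof.
have [|FF [zs zsE]] := @funfield_split k (\prod_i char_poly (N i)).
  by apply/prodf_neq0 => i _; apply: monic_neq0; apply: char_poly_monic.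
have [|i|e1 [T [nu [uT hT]]]] := @powers_codiag _ p (pchL hp FF) _ _ (fun i => map_mx (@ff_io k FF) (N i)) zs.
- by move=> i j; rewrite -[LHS]map_mxM -[RHS]map_mxM; congr (map_mx _ _); apply: cN.
- apply: dvdp_trans (mxminpoly_dvd_char _) _; rewrite -(eqp_dvdr _ zsE) -map_char_poly dvdp_map.
  by rewrite (bigD1 i) //= dvdp_mulr.
have [h h1 h2] := split_ramp uT hT; by exists e1, h.
Qed.
End CommutingMatrices.

(** * Graded algebras of dimension two *)

Section Forms.
Variables (k : closedFieldType) (A : comAlgType k) (P : nat -> set A).
Hypothesis gP : grading P.
Let sP := gr_sub gP.
Variables (x y : A).
Hypotheses (Px : P 1%N x) (Py : P 1%N y).

Lemma P_exp n a i : P n a -> P (i * n)%N (a ^+ i).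
Proof.
move=> Pa; elim: i => [|i IH]; first by rewrite expr0; exact: (P1 gP).
by rewrite exprS mulSn; apply: (gr_mul gP).
Qed.

(* The homogenization of f in degree m, evaluated at (x, y). *)
Definition hom m (f : {poly k}) : A := \sum_(i < m.+1) f`_i *: (x ^+ i * y ^+ (m - i)).

Lemma hom_linear m : linear (hom m).
Proof.
move=> a f h; rewrite /hom scaler_sumr -big_split; apply: eq_bigr => i _ /=.
by rewrite coefD coefZ scalerDl scalerA.
Qed.
HB.instance Definition _ m := GRing.isLinear.Build _ _ _ _ (hom m) (hom_linear m).

Lemma P_mono m i : (i <= m)%N -> P m (x ^+ i * y ^+ (m - i)).
Proof.
move=> im; have := gr_mul gP (P_exp i Px) (P_exp (m - i) Py).
by rewrite !muln1 subnKC.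
Qed.

Lemma hom_P m f : P m (hom m f).
Proof.
by apply: subspace_sum => // i _; apply: subspaceZ => //; apply: P_mono; rewrite -ltnS.
Qed.

Lemma hom_Xn m i : (i <= m)%N -> hom m 'X^i = x ^+ i * y ^+ (m - i).
Proof.
move=> im; have im' : (i < m.+1)%N by [].
rewrite /hom (bigD1 (Ordinal im')) //= coefXn eqxx scale1r big1 ?addr0 // => j ji.
rewrite coefXn (_ : (j == i :> nat) = false) ?scale0r //.
by apply/negbTE; apply: contra ji => /eqP ji; apply/eqP/val_inj.
Qed.

Lemma hom1 m : hom m 1 = y ^+ m.
Proof. by rewrite -(expr0 'X) hom_Xn // expr0 mul1r subn0. Qed.

Lemma polyE_le m (f : {poly k}) : (size f <= m)%N -> f = \sum_(i < m) f`_i *: 'X^i.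
Proof.
by move=> sf; rewrite -[LHS]coefK -(@poly_def _ _ (fun i => f`_i)); apply/polyP => i; rewrite !coef_poly; case: ltnP => h1; case: ltnP => h2 //; [have := leq_trans h1 sf; rewrite ltnNge h2|rewrite nth_default].
Qed.

Lemma homM m n (f h : {poly k}) : (size f <= m.+1)%N -> (size h <= n.+1)%N -> hom m f * hom n h = hom (m + n) (f * h).
Proof.
move=> sf sh; have -> : f * h = (\sum_(i < m.+1) f`_i *: 'X^i) * (\sum_(i < n.+1) h`_i *: 'X^i) by rewrite -!polyE_le.
rewrite {1 2}/hom [in RHS]mulr_suml linear_sum /= mulr_suml.
apply: eq_bigr => i _; rewrite mulr_sumr [in RHS]mulr_sumr linear_sum /=; apply: eq_bigr => j _.
have im : (i <= m)%N by rewrite -ltnS. have jn : (j <= n)%N by rewrite -ltnS.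
rewrite -!scalerAl -!scalerAr !linearZ /= -exprD hom_Xn ?leq_add //.
rewrite !scalerA [h`_j * _]mulrC; congr (_ *: _); rewrite mulrACA -!exprD; congr (_ ^+ _ * _ ^+ _); lia.
Qed.

Variable c : nat.
Hypothesis gen : forall n z, P (c + n).+1 z -> exists a b, [/\ P (c + n)%N a, P (c + n)%N b & z = x * a + y * b].

Lemma gen_mono n z : P (c + n)%N z -> exists u : 'I_n.+1 -> A,
  (forall i, P c (u i)) /\ z = \sum_(i < n.+1) x ^+ i * y ^+ (n - i) * u i.
Proof.
elim: n z => [|n IH] z; rewrite ?addn0 ?addnS.
  by move=> Pz; exists (fun=> z); split=> //; rewrite big_ord1 !expr0 !mul1r.
move=> /gen[a [b [Pa Pb ->]]]; have [u [Pu ->]] := IH _ Pa; have [w [Pw ->]] := IH _ Pb.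
pose u' (i : 'I_n.+2) : A := if unlift ord0 i is Some j then u j else 0.
pose w' (i : 'I_n.+2) : A := if unlift ord_max i is Some j then w j else 0.
exists (fun i => u' i + w' i); split.
  move=> i; apply: subspaceD => //; rewrite /u' /w'; case: unlift => [j|]; rewrite ?(P0 gP) //; exact: (P0 gP).
under [RHS]eq_bigr do rewrite mulrDr; rewrite big_split /=; congr (_ + _).
  rewrite [RHS]big_ord_recl /u' unlift_none mulr0 add0r mulr_sumr; apply: eq_bigr => i _.
  by rewrite liftK lift0 subSS exprS !mulrA.
rewrite [RHS]big_ord_recr /w' /= unlift_none mulr0 addr0 mulr_sumr; apply: eq_bigr => i _.
have -> : widen_ord (leqnSn n.+1) i = lift ord_max i by apply: val_inj; rewrite /= /bump leqNgt ltn_ord.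
have im : (i <= n)%N by rewrite -ltnS.
by rewrite liftK subSn // [y ^+ _.+1]exprS [x ^+ i * (y * _)]mulrCA -(mulrA y).
Qed.

(** P_n is spanned over P_c by the monomials x^i y^(m-i) with m = n - c >= 2 q, and each of these
    contains x^q or y^q. *)
Lemma power_gen q n z : (0 < q)%N -> (2 * q + c <= n)%N -> P n z ->
  exists a b, [/\ P (n - q)%N a, P (n - q)%N b & z = x ^+ q * a + y ^+ q * b].
Proof.
move=> q0 qn Pz; pose m := (n - c)%N; have nE : (n = c + m)%N by rewrite /m; lia.
have q2m : (2 * q <= m)%N by rewrite /m; lia.
move: Pz; rewrite nE => /gen_mono[u [Pu ->]].
exists (\sum_(i < m.+1 | (q <= i)%N) x ^+ (i - q) * y ^+ (m - i) * u i),
       (\sum_(i < m.+1 | ~~ (q <= i)%N) x ^+ i * y ^+ (m - i - q) * u i); split.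
- apply: subspace_sum => // i qi; have im := ltn_ord i; rewrite mulrC.
  have := gr_mul gP (Pu i) (gr_mul gP (P_exp (i - q) Px) (P_exp (m - i) Py)).
  by rewrite !muln1 (_ : (c + (i - q + (m - i)) = c + m - q)%N) //; lia.
- apply: subspace_sum => // i qi; have im := ltn_ord i; rewrite mulrC.
  have := gr_mul gP (Pu i) (gr_mul gP (P_exp i Px) (P_exp (m - i - q) Py)).
  by rewrite !muln1 (_ : (c + (i + (m - i - q)) = c + m - q)%N) //; lia.
rewrite (bigID (fun i : 'I_m.+1 => (q <= i)%N)) /= !mulr_sumr; congr (_ + _); apply: eq_bigr => i qi.
  by rewrite !mulrA -exprD subnKC.
have im := ltn_ord i; rewrite [RHS]mulrA [y ^+ q * _]mulrCA -exprD subnKC //.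
by move: qi; rewrite -ltnNge; lia.
Qed.

Hypothesis indep : forall m (f : {poly k}), (size f <= m.+1)%N -> hom m f = 0 -> f = 0.

Definition free_forms g (eps : 'I_g -> A) : Prop := forall m (f : 'I_g -> {poly k}),
  (forall j, size (f j) <= m.+1)%N -> \sum_j hom m (f j) * eps j = 0 -> forall j, f j = 0.

(** A maximal free family in P_c: its size is bounded by the dimension of P_c, and maximality gives
    every other element of P_c a relation with nonzero F. It is nonempty because y^c alone is free,
    so the matrices below form a ring. *)
Lemma free_forms_ex : exists g (eps : 'I_g.+1 -> A), [/\ forall j, P c (eps j), free_forms eps &
  forall z, P c z -> exists m (F : {poly k}) (f : 'I_g.+1 -> {poly k}), [/\ F != 0, (size F <= m.+1)%N,
    forall j, (size (f j) <= m.+1)%N & hom m F * z = \sum_j hom m (f j) * eps j]].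
Proof.
have [M hM] := P_hasdim gP c.
pose Q n := `[< exists eps : 'I_n -> A, (forall j, P c (eps j)) /\ free_forms eps >].
have Q1 : Q 1%N.
  apply/asboolP; exists (fun=> y ^+ c); split=> [j|m f sf]; first by have := P_exp c Py; rewrite muln1.
  rewrite big_ord1 -hom1 homM ?size_poly1 // mulr1 => h j; rewrite ord1.
  by apply: indep h; apply: leq_trans (sf _) _; rewrite ltnS leq_addr.
have QM n : Q n -> (n <= M)%N.
  move=> /asboolP[eps [Pe fe]]; rewrite -[n]card_ord; apply: (hasdim_ge hM _ Pe) => a a0 i.
  have := fe 0%N (fun j => (a j)%:P) _ _ i => /(_ _ _)/eqP; rewrite polyC_eq0 => h; apply/eqP; apply: h => [j|].
    by rewrite size_polyC leq_b1.
  rewrite -[RHS]a0; apply: eq_bigr => j _.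
  by rewrite /hom big_ord1 coefC eqxx !expr0 mulr1 mulr_algl.
case: (ex_maxnP (ex_intro (fun n => is_true (Q n)) 1%N Q1) QM) => -[|g] Qg max; first by have := max _ Q1.
move/asboolP: Qg => [eps [Pe fe]]; exists g, eps; split=> // z Pz.
apply: contrapT => nz; suff : Q g.+2 by move/max; rewrite ltnn.
pose eps' (j : 'I_g.+2) := if unlift ord0 j is Some i then eps i else z.
apply/asboolP; exists eps'; split=> [j|m f sf f0]; first by rewrite /eps'; case: unlift.
have f0' : hom m (f ord0) * z + \sum_j hom m (f (lift ord0 j)) * eps j = 0.
  rewrite -[RHS]f0 [RHS]big_ord_recl /eps' unlift_none; congr (_ + _).
  by apply: eq_bigr => j _; rewrite liftK.
have F0 : f ord0 = 0.
  apply: contrapT => /eqP F0; apply: nz.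
  exists m, (f ord0), (fun j => - f (lift ord0 j)); split=> // [j|]; first by rewrite size_polyN.
  apply/eqP; rewrite -subr_eq0 -sumrN -[X in _ == X]f0'; apply/eqP; congr (_ + _).
  by apply: eq_bigr => j _; rewrite linearN /= mulNr opprK.
move: f0'; rewrite F0 linear0 mul0r add0r => f0' j.
have := fe m (fun j => f (lift ord0 j)) (fun j => sf _) f0'.
by case: (unliftP ord0 j) => [i -> ->|->].
Qed.

End Forms.

(** * Dehomogenized coordinates *)

Section Coordinates.
Variables (k : closedFieldType) (A : comAlgType k) (P : nat -> set A).
Hypothesis gP : grading P.
Let sP := gr_sub gP.
Variables (x y : A).
Hypotheses (Px : P 1%N x) (Py : P 1%N y).
Variable c : nat.
Hypothesis gen : forall n z, P (c + n).+1 z -> exists a b, [/\ P (c + n)%N a, P (c + n)%N b & z = x * a + y * b].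
Local Notation hom := (hom x y).
Local Notation K := {fraction {poly k}}.
Variables (g : nat) (eps : 'I_g.+1 -> A).
Hypotheses (Pe : forall j, P c (eps j)) (fe : free_forms x y eps).
Hypothesis max_eps : forall z, P c z -> exists m (F : {poly k}) (f : 'I_g.+1 -> {poly k}), [/\ F != 0, (size F <= m.+1)%N,
    forall j, (size (f j) <= m.+1)%N & hom m F * z = \sum_j hom m (f j) * eps j].

(** w_j = f_j / F are the coordinates of z along [eps], dehomogenized at y = 1. The equation m' + c
    = m + n balances degrees; torsion elements have w = 0. *)
Definition Coord n z (w : 'rV[K]_g.+1) : Prop := exists m m' (F : {poly k}) (f : 'I_g.+1 -> {poly k}),
  [/\ F != 0, (size F <= m.+1)%N, forall j, (size (f j) <= m'.+1)%N, (m' + c = m + n)%N &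
     hom m F * z = \sum_j hom m' (f j) * eps j] /\ forall j, F%:F * w 0 j = (f j)%:F.

Lemma size_polyM_le (f h : {poly k}) m n : (size f <= m.+1)%N -> (size h <= n.+1)%N -> (size (f * h)%R <= (m + n).+1)%N.
Proof.
move=> sf sh; apply: leq_trans (size_polyMleq _ _) _; rewrite -subn1 leq_subLR add1n -addnS -addSn.
exact: leq_add.
Qed.

Lemma Coord_uniq n z w w' : Coord n z w -> Coord n z w' -> w = w'.
Proof.
move=> [m1 [n1 [F1 [f1 [[F10 sF1 sf1 e1 h1] w1]]]]] [m2 [n2 [F2 [f2 [[F20 sF2 sf2 e2 h2] w2]]]]].
have e : (m2 + n1 = m1 + n2)%N by lia.
have f0 : \sum_j hom (m2 + n1) (F2 * f1 j - F1 * f2 j) * eps j = 0.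
  transitivity (hom m2 F2 * (hom m1 F1 * z) - hom m1 F1 * (hom m2 F2 * z)); last by rewrite mulrCA subrr.
  rewrite h1 h2 !mulr_sumr -sumrB.
  by apply: eq_bigr => j _; rewrite !mulrA !homM // -e linearB mulrBl.
apply/rowP => j; have := fe (m := (m2 + n1)%N) _ f0 j => /(_ _)/eqP; rewrite subr_eq0 => /(_ _)/eqP ff.
have F12 : (F1 * F2)%:F != 0 by rewrite tofrac_eq0 mulf_neq0.
apply: (mulfI F12); rewrite tofracM -!mulrA [LHS]mulrCA w1 w2 -!tofracM ff // => i.
rewrite (leq_trans (size_polyD _ _)) // geq_max size_polyN size_polyM_le //=.
by rewrite e size_polyM_le.
Qed.

Lemma Coord_hom n z w l (h : {poly k}) : (size h <= l.+1)%N -> Coord n z w -> Coord (l + n) (hom l h * z) (h%:F *: w).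
Proof.
move=> sh [m [m' [F [f [[F0 sF sf e hz] wE]]]]].
exists m, (l + m')%N, F, (fun j => h * f j); split; last by move=> j; rewrite mxE mulrCA wE tofracM.
split=> // [j||]; [exact: size_polyM_le|lia|].
by rewrite mulrCA hz mulr_sumr; apply: eq_bigr => j _; rewrite mulrA homM.
Qed.

Lemma Coord_add n z w z' w' a : Coord n z w -> Coord n z' w' -> Coord n (a *: z + z') ((a%:P)%:F *: w + w').
Proof.
move=> [m1 [n1 [F1 [f1 [[F10 sF1 sf1 e1 h1] w1]]]]] [m2 [n2 [F2 [f2 [[F20 sF2 sf2 e2 h2] w2]]]]].
have e : (m2 + n1 = m1 + n2)%N by lia.
exists (m1 + m2)%N, (m2 + n1)%N, (F1 * F2), (fun j => a *: (F2 * f1 j) + F1 * f2 j); split; last first.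
  move=> j; rewrite !mxE mulrDr tofracD -mul_polyC !tofracM -w1 -w2.
  by move: (F1%:F) (F2%:F) (_%:F) (w 0 j) (w' 0 j) => *; ring.
split=> [|||| ]; [by rewrite mulf_neq0|exact: size_polyM_le| |lia|].
  move=> j; rewrite (leq_trans (size_polyD _ _)) // geq_max (leq_trans (size_scale_leq _ _)) /=; last exact: size_polyM_le.
  by rewrite e size_polyM_le.
rewrite -homM // mulrDr -scalerAr {1}[hom m1 F1 * _]mulrC -!mulrA h1 [hom m2 F2 * z']h2 !mulr_sumr scaler_sumr -big_split.
apply: eq_bigr => j _ /=; rewrite !mulrA !homM // linearD linearZ /= -e mulrDl -scalerAl.
by [].
Qed.

Lemma Coord0 n : Coord n 0 0.
Proof.
exists c, n, 1, (fun=> 0); split; last by move=> j; rewrite mxE mulr0 tofrac0.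
split=> [|||| ]; rewrite ?oner_neq0 ?size_poly1 //; first by move=> j; rewrite size_poly0.
  exact: addnC.
by rewrite mulr0 big1 // => j _; rewrite linear0 mul0r.
Qed.

Lemma Coord_sum n (T : finType) (h : T -> A) (w : T -> 'rV[K]_g.+1) :
  (forall t, Coord n (h t) (w t)) -> Coord n (\sum_t h t) (\sum_t w t).
Proof.
move=> hw; elim/big_rec2: _ => [|t u v _ IH]; first exact: Coord0.
have := Coord_add 1 (hw t) IH; by rewrite !scale1r.
Qed.

Lemma Coord_eps j : Coord c (eps j) (delta_mx 0 j).
Proof.
exists 0%N, 0%N, 1, (fun i => (i == j)%:R); split; last by move=> i; rewrite mxE eqxx mul1r; case: eqP => _; rewrite ?tofrac1 ?tofrac0.
split=> [|||| ]; rewrite ?oner_neq0 ?size_poly1 //; first by move=> i; case: eqP => _; rewrite ?size_poly0 ?size_poly1.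
rewrite (bigD1 j) //= eqxx big1 ?addr0 // => i /negbTE ->; by rewrite linear0 mul0r.
Qed.

Lemma Coord_ex n z : P n z -> exists w, Coord n z w.
Proof.
have base z' : P c z' -> exists w, Coord c z' w.
  move=> /max_eps[m [F [f [F0 sF sf hz]]]].
  exists (\row_j ((f j)%:F / F%:F)); exists m, m, F, f; split=> // j.
  by rewrite mxE mulrC divfK // tofrac_eq0.
have big m z' : P (c + m)%N z' -> exists w, Coord (c + m) z' w.
  elim: m z' => [|m IH] z'; first by rewrite addn0; apply: base.
  rewrite addnS => /gen[a [b [/IH[w hw] /IH[w' hw'] ->]]].
  have hX : hom 1 'X = x by rewrite -(expr1 'X) hom_Xn // expr1 expr0 mulr1.
  have hY : hom 1 1 = y by rewrite hom1 expr1.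
  have h1 := @Coord_hom _ _ _ 1 'X _ hw; have h2 := @Coord_hom _ _ _ 1 1 _ hw'.
  rewrite size_polyX hX in h1; rewrite size_poly1 hY in h2.
  have := Coord_add 1 (h1 isT) (h2 isT); rewrite scale1r => h; by eexists; exact: h.
(* Multiplication by y^c brings every degree into the range of [gen] and does not change the
   dehomogenized coordinates, as y^c = [hom c 1]. *)
move=> Pz; have [w hw] : exists w, Coord (c + n) (y ^+ c * z) w.
  by apply: big; apply: (gr_mul gP) => //; have := P_exp gP c Py; rewrite muln1.
exists w; move: hw => [m [m' [F [f [[F0 sF sf e hz] wE]]]]].
exists (m + c)%N, m', F, f; split=> //; split=> //; [by apply: leq_trans sF _; rewrite ltnS leq_addr|lia|].
by rewrite -hz -(hom1 x) mulrA homM ?size_poly1 // mulr1.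
Qed.

Lemma Coord_mul d v (N : 'M[K]_g.+1) n z w : P d v -> P n z -> (forall j, Coord (d + c) (v * eps j) (row j N)) ->
  Coord n z w -> Coord (d + n) (v * z) (w *m N).
Proof.
move=> Pv Pz hN hw; have [u hu] := Coord_ex (gr_mul gP Pv Pz); suff <- : u = w *m N by [].
move: hw => [m [m' [F [f [[F0 sF sf e hz] wE]]]]].
have h1 := Coord_hom sF hu.
have h2 : Coord (m + (d + n)) (hom m F * (v * z)) (\sum_j (f j)%:F *: row j N).
  rewrite mulrCA hz mulr_sumr (_ : (m + (d + n) = m' + (d + c))%N); last by lia.
  under eq_bigr do rewrite mulrCA; apply: Coord_sum => j; exact: Coord_hom.
have := Coord_uniq h1 h2; have F0' : F%:F != 0 by rewrite tofrac_eq0.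
move=> h; apply: (scalerI F0'); rewrite h scalemxAl mulmx_sum_row.
by apply: eq_bigr => j _; rewrite mxE wE.
Qed.

Definition cd n z : 'rV[K]_g.+1 := xget 0 [set w | Coord n z w].

Lemma cdP n z : P n z -> Coord n z (cd n z).
Proof. by move=> /Coord_ex[w hw]; rewrite /cd; case: xgetP => [? _|/(_ w)]. Qed.

Lemma cd_eq n z w : Coord n z w -> cd n z = w.
Proof.
move=> hw; apply: (@Coord_uniq n z) => //.
by rewrite /cd; case: xgetP => [? _|/(_ w)].
Qed.

Lemma cdZD n a z z' : P n z -> P n z' -> cd n (a *: z + z') = (a%:P)%:F *: cd n z + cd n z'.
Proof. by move=> Pz Pz'; apply: cd_eq; apply: Coord_add; apply: cdP. Qed.

(** All degrees are sent to the same space. Summing over the components makes the map linear on A,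
    as [hasdim_img] requires. *)
Definition phi (z : A) : restr (@ratc k) 'rV[K]_g.+1 := \sum_(n < size (dec gP z)) cd n (dec gP z)`_n.

Lemma phi_widen N z : (size (dec gP z) <= N)%N -> phi z = \sum_(n < N) cd n (dec gP z)`_n.
Proof.
move=> sN; rewrite /phi (big_ord_widen N (fun n => cd n (dec gP z)`_n)) // big_mkcond.
apply: eq_bigr => n _; case: ltnP => // h; rewrite nth_default //.
by apply/esym/cd_eq/Coord0.
Qed.

Lemma phi_linear : linear phi.
Proof.
move=> a z z'; pose N := maxn (size (dec gP z)) (maxn (size (dec gP z')) (size (dec gP (a *: z + z')))).
rewrite !(@phi_widen N) ?leq_max ?leqnn ?orbT // restrZ scaler_sumr -big_split; apply: eq_bigr => n _ /=.
rewrite decD decZ coefD coefZ mulr_algl; apply: cdZD; exact: decP.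
Qed.
HB.instance Definition _ := GRing.isLinear.Build _ _ _ _ phi phi_linear.

Lemma phi_cd n z : P n z -> phi z = cd n z.
Proof.
move=> Pz; rewrite (@phi_widen n.+1) (dec_hom gP Pz); last first.
  by rewrite (leq_trans (size_scale_leq _ _)) // size_polyXn.
rewrite big_ord_recr /= coefZ coefXn eqxx mulr1 big1 ?add0r // => i _.
rewrite coefZ coefXn ltn_eqF //= mulr0; exact/cd_eq/Coord0.
Qed.

Lemma phi_eq n z w : P n z -> Coord n z w -> phi z = w.
Proof. by move=> Pz /cd_eq <-; apply: phi_cd. Qed.

Lemma phi_hom n z l (h : {poly k}) : (size h <= l.+1)%N -> P n z -> phi (hom l h * z) = h%:F *: (phi z : 'rV[K]_g.+1).
Proof.
move=> sh Pz; rewrite (phi_cd Pz); apply: (phi_eq (n := (l + n)%N)); first by apply: (gr_mul gP) => //; apply: hom_P.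
by apply: Coord_hom => //; apply: cdP.
Qed.

Definition mulmat (v : A) : 'M[K]_g.+1 := \matrix_(i, j) (phi (v * eps i) : 'rV[K]_g.+1) 0 j.

Lemma phi_mul d v n z : P d v -> P n z -> phi (v * z) = (phi z : 'rV[K]_g.+1) *m mulmat v.
Proof.
move=> Pv Pz; apply: (phi_eq (gr_mul gP Pv Pz)); apply: Coord_mul => // [j|]; last by rewrite (phi_cd Pz); apply: cdP.
have -> : row j (mulmat v) = cd (d + c) (v * eps j).
  by apply/rowP => i; rewrite !mxE (phi_cd (gr_mul gP Pv (Pe j))).
by apply: cdP; apply: (gr_mul gP).
Qed.

Lemma mulmat_comm d v d' v' : P d v -> P d' v' -> mulmat v * mulmat v' = mulmat v' * mulmat v.
Proof.
move=> Pv Pv'; apply/row_matrixP => i; rewrite !row_mul.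
have rE u e : P e u -> row i (mulmat u) = phi (u * eps i) by move=> _; apply/rowP => j; rewrite !mxE.
rewrite (rE v d) // (rE v' d') //.
by rewrite -(phi_mul Pv' (gr_mul gP Pv (Pe i))) -(phi_mul Pv (gr_mul gP Pv' (Pe i))) mulrCA.
Qed.

Lemma phi_exp d v n z q : P d v -> P n z -> phi (v ^+ q * z) = (phi z : 'rV[K]_g.+1) *m mulmat v ^+ q.
Proof.
move=> Pv Pz; elim: q => [|q IH]; first by rewrite !expr0 mul1r mulmx1.
rewrite exprS -mulrA (phi_mul Pv (gr_mul gP (P_exp gP q Pv) Pz)) IH -mulmxA; congr (_ *m _).
by rewrite exprSr.
Qed.

Lemma phi_eps j : phi (eps j) = delta_mx 0 j.
Proof. by apply: (phi_eq (Pe j)); apply: Coord_eps. Qed.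

Lemma phi_lb n (f : 'I_g.+1 -> {poly k}) : (forall j, size (f j) <= n.+1)%N ->
  P (n + c) (\sum_j hom n (f j) * eps j) /\ phi (\sum_j hom n (f j) * eps j) = \row_j (f j)%:F.
Proof.
move=> sf; split.
  by apply: subspace_sum => // j _; apply: (gr_mul gP) => //; apply: hom_P.
rewrite linear_sum /= [RHS]row_sum_delta; apply: eq_bigr => j _.
by rewrite (phi_hom (sf j) (Pe j)) phi_eps mxE.
Qed.

(** With [phi_lb], the image of P_n lies between two polynomial lattices whose levels differ by a
    constant. D is a common denominator for a basis of P_c. *)
Lemma phi_ub : exists2 D : {poly k}, D != 0 & exists c', forall n z, P n z ->
  exists2 f : 'I_g.+1 -> {poly k}, (forall j, size (f j) <= n + c')%N & D%:F *: (phi z : 'rV[K]_g.+1) = \row_j (f j)%:F.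
Proof.
have [M [e _ PE]] := P_hasdim gP c.
have [D D0 [l hl]] := clear_denom (fun ij : 'I_M * 'I_g.+1 => (phi (e ij.1) : 'rV[K]_g.+1) 0 ij.2).
have Pei i : P c (e i) by rewrite PE; apply: lspan_mem.
exists D => //; exists (l + 1)%N.
pose good n z := exists2 f : 'I_g.+1 -> {poly k}, (forall j, size (f j) <= n + l)%N & D%:F *: (phi z : 'rV[K]_g.+1) = \row_j (f j)%:F.
have good0 n : good n 0.
  by exists (fun=> 0) => [j|]; rewrite ?size_poly0 // linear0 scaler0; apply/rowP => j; rewrite !mxE tofrac0.
have goodD n z z' a : good n z -> good n z' -> good n (a *: z + z').
  move=> [f sf fE] [f' sf' fE']; exists (fun j => a *: f j + f' j).
    move=> j; rewrite (leq_trans (size_polyD _ _)) // geq_max sf' andbT.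
    exact: leq_trans (size_scale_leq _ _) (sf j).
  have -> : phi (a *: z + z') = (a%:P)%:F *: (phi z : 'rV[K]_g.+1) + phi z' := phi_linear a z z'.
  rewrite scalerDr scalerA mulrC -scalerA fE fE'.
  by apply/rowP => j; rewrite !mxE -mul_polyC tofracD tofracM.
have goods n (T : finType) (F : T -> A) : (forall t, good n (F t)) -> good n (\sum_t F t).
  by move=> h; elim/big_ind: _ => // u v hu hv; rewrite -[u]scale1r; apply: goodD.
have goodZ n a z : good n z -> good n (a *: z) by move=> h; rewrite -[_ *: _]addr0; apply: goodD.
move=> n z Pz.
have : good n.+1 (y ^+ c * z).
  have : P (c + n)%N (y ^+ c * z) by apply: (gr_mul gP) => //; have := P_exp gP c Py; rewrite muln1.
  move=> /(gen_mono gP gen)[u [Pu ->]]; apply: (goods n.+1) => i.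
  have := Pu i; rewrite PE => -[b ->]; rewrite mulr_sumr; apply: (goods n.+1) => t.
  rewrite -scalerAr; apply: goodZ; have im : (i <= n)%N by rewrite -ltnS.
  rewrite -hom_Xn //; have sX : (size ('X^i : {poly k}) <= n.+1)%N by rewrite size_polyXn.
  have h j : exists f : {poly k}, (size f <= l)%N /\ D%:F * (phi (e t) : 'rV[K]_g.+1) 0 j = f%:F.
    by have [f h1 h2] := hl (t, j); exists f.
  have [f hf] := choice h; exists (fun j => 'X^i * f j) => [j|].
    apply: leq_trans (size_polyMleq _ _) _; rewrite size_polyXn addSn /=.
    by apply: leq_add; [apply: ltnW|case: (hf j)].
  rewrite (phi_hom sX (Pei t)); apply/rowP => j; rewrite !mxE mulrCA.
  by case: (hf j) => _ ->; rewrite tofracM.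
move=> [f sf fE]; exists f => [j|]; first by have := sf j; rewrite addSn addn1 addnS.
rewrite -fE; congr (_ *: _); rewrite -(hom1 x) (phi_hom _ Pz) ?size_poly1 //.
by rewrite tofrac1 scale1r.
Qed.

End Coordinates.

(** * Dimensions of Frobenius pieces in one ring *)

Section FrobeniusPieces.
Variables (k : closedFieldType) (A : comAlgType k) (P : nat -> set A).
Hypothesis gP : grading P.
Let sP := gr_sub gP.

(* The degree n piece of the shift A(-a). *)
Definition Pm n a : set A := if (a <= n)%N then P (n - a)%N else [set 0].

Definition frob_piece s (v : 'I_s -> A) (d : 'I_s -> nat) q n : set A :=
  [set z | exists2 u : 'I_s -> A, (forall i, Pm n (q * d i) (u i)) & z = \sum_i v i ^+ q * u i].

Lemma Pm0 n a : Pm n a 0.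
Proof. by rewrite /Pm; case: ifP => _ //; case: (sP (n - a)). Qed.

Lemma Pm_subspace n a : is_subspace (Pm n a).
Proof.
rewrite /Pm; case: ifP => _ //; split=> // b z w -> ->; by rewrite /= scaler0 addr0.
Qed.

Lemma frob_piece_subspace s (v : 'I_s -> A) d q n : is_subspace (frob_piece v d q n).
Proof.
split=> [|a _ _ [u hu ->] [w hw ->]].
  exists (fun=> 0) => [i|]; first exact: Pm0.
  by rewrite big1 // => i _; rewrite mulr0.
exists (fun i => a *: u i + w i) => [i|]; first by case: (Pm_subspace n (q * d i)) => _; apply.
by rewrite scaler_sumr -big_split; apply: eq_bigr => i _; rewrite mulrDr -scalerAr.
Qed.

Lemma frob_piece_sub s (v : 'I_s -> A) d q n : (forall i, P (d i) (v i)) -> frob_piece v d q n `<=` P n.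
Proof.
move=> Pv _ [u hu ->]; apply: subspace_sum => // i _; have := hu i; rewrite /Pm.
case: ifP => [le Pu|_ ->]; last by rewrite mulr0; case: (sP n).
by rewrite -(subnKC le); apply: (gr_mul gP) => //; apply: P_exp.
Qed.

Section Dimensions.
Variables (x y : A).
Hypotheses (Px : P 1%N x) (Py : P 1%N y).
Variable c : nat.
Hypothesis gen : forall n z, P (c + n).+1 z -> exists a b, [/\ P (c + n)%N a, P (c + n)%N b & z = x * a + y * b].
Local Notation hom := (hom x y).
Local Notation K := {fraction {poly k}}.
Variables (g : nat) (eps : 'I_g.+1 -> A).
Hypotheses (Pe : forall j, P c (eps j)) (fe : free_forms x y eps).
Hypothesis max_eps : forall z, P c z -> exists m (F : {poly k}) (f : 'I_g.+1 -> {poly k}), [/\ F != 0, (size F <= m.+1)%N,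
    forall j, (size (f j) <= m.+1)%N & hom m F * z = \sum_j hom m (f j) * eps j].
Let Phi := phi gP x y c eps.
Let mm := mulmat gP x y c eps.
Let philin : linear Phi := phi_linear gP Py gen fe max_eps.
HB.instance Definition _ := GRing.isLinear.Build _ _ _ _ Phi philin.

(** The relation F_i e_i = sum_j f_j eps_j reduces x^a y^(m-a) e_i to multiples of the [eps], except
    when a or m - a is below a fixed bound [mu]. The exceptions, two ranges for each e_i, make up
    B. *)
Lemma P_upper : exists B, forall m, exists2 a, (a <= g.+1 * m.+1 + B)%N & hasdim (P (m + c)%N) a.
Proof.
have [M [e _ PE]] := P_hasdim gP c.
have Pei i : P c (e i) by rewrite PE; apply: lspan_mem.
have h i : exists mFf : nat * {poly k} * ('I_g.+1 -> {poly k}), [/\ mFf.1.2 != 0, (size mFf.1.2 <= mFf.1.1.+1)%N,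
    forall j, (size (mFf.2 j) <= mFf.1.1.+1)%N & hom mFf.1.1 mFf.1.2 * e i = \sum_j hom mFf.1.1 (mFf.2 j) * eps j].
  by have [m [F [f hF]]] := max_eps (Pei i); exists (m, F, f).
have [mFf hF] := choice h.
pose mu := (\sum_i (mFf i).1.1).+1.
have mi i : ((mFf i).1.1 < mu)%N by rewrite ltnS (bigD1 i) //= leq_addr.
exists (M * (mu + mu))%N => m.
pose T : finType := ('I_g.+1 * 'I_m.+1 + 'I_M * ('I_mu + 'I_mu))%type.
pose b (t : T) : A := match t with
  | inl ja => hom m 'X^(ja.2) * eps ja.1
  | inr (i, inl a) => hom m 'X^a * e i
  | inr (i, inr a) => hom m 'X^(m - a) * e i
  end.
have sW : is_subspace (lspan b) := lspan_subspace b.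
have We (q : {poly k}) j : (size q <= m.+1)%N -> lspan b (hom m q * eps j).
  move=> sh; rewrite (polyE_le sh) linear_sum mulr_suml; apply: subspace_sum => // a _.
  by rewrite linearZ /= -scalerAl; apply: subspaceZ => //; apply: (lspan_mem b (inl (j, a))).
have Wlo i a : (a < mu)%N -> lspan b (hom m 'X^a * e i).
  by move=> am; apply: (lspan_mem b (inr (i, inl (Ordinal am)))).
have Whi i a : (a <= m)%N -> (m - a < mu)%N -> lspan b (hom m 'X^a * e i).
  by move=> am h1; have := lspan_mem b (inr (i, inr (Ordinal h1))); rewrite /= subKn.
have Wsum i (q : {poly k}) N : (size q <= N)%N -> (forall a, (a < N)%N -> q`_a = 0 \/ lspan b (hom m 'X^a * e i)) ->
    lspan b (hom m q * e i).
  move=> sh ha; rewrite (polyE_le sh) linear_sum mulr_suml; apply: subspace_sum => // a _.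
  rewrite linearZ /= -scalerAl; case: (ha a (ltn_ord a)) => [->|]; first by rewrite scale0r; case: sW.
  exact: subspaceZ.
have Wall i (h' : {poly k}) : (size h' <= m.+1)%N -> lspan b (hom m h' * e i).
  move=> sh; have [] := hF i; set mi' := (mFf i).1.1; set F := (mFf i).1.2; set f := (mFf i).2.
  move=> F0 sF sf eF; have mlt : (mi' < mu)%N := mi i.
  have [le|lt] := leqP mi' m; last first.
    apply: (Wsum _ _ _ sh) => a am; right; apply: Wlo; apply: leq_ltn_trans mlt; exact: ltnW (leq_trans am lt).
  pose dl := (size F).-1; have sF' : size F = dl.+1 by rewrite /dl prednK // size_poly_gt0.
  have dle : (dl <= mi')%N by move: sF; rewrite sF'.
  pose N := (m - (mi' - dl)).+1; pose lo := take_poly N h'.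
  (* The homogenization of F in degree mi' contains y^(mi' - dl), so only the part of degree below N
     can be divided by F. The terms left out have m - a < mu, and the remainder has a < mu. *)
  have -> : h' = (h' - lo) + (lo %% F + lo %/ F * F) by rewrite [lo %% F + _]addrC -divp_eq subrK.
  have NE : (N + (mi' - dl) = m.+1)%N by rewrite /N; move: le dle; clear; lia.
  have homD3 (q1 q2 q3 : {poly k}) : hom m (q1 + (q2 + q3)) * e i = hom m q1 * e i + (hom m q2 * e i + hom m q3 * e i).
    by rewrite linearD linearD /= !mulrDl.
  rewrite homD3; apply: subspaceD => //; last apply: subspaceD => //.
  - apply: (Wsum _ _ m.+1) => [|a am].
      rewrite (leq_trans (size_polyD _ _)) // geq_max sh size_polyN (leq_trans (size_take_poly _ _)) //.
      by rewrite -NE leq_addr.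
    rewrite coefB coef_take_poly; case: ltnP => aN; first by left; rewrite subrr.
    right; apply: Whi => //; apply: leq_ltn_trans mlt; rewrite /N in aN; move: aN dle le; clear; lia.
  - apply: (Wsum _ _ dl) => [|a ad]; first by rewrite -ltnS -sF' ltn_modp.
    right; apply: Wlo; apply: ltn_trans ad _; exact: leq_ltn_trans mlt.
  have sq : (size (lo %/ F)%R <= (m - mi').+1)%N.
    rewrite size_divp // -/dl leq_subLR; apply: leq_trans (size_take_poly _ _) _.
    by rewrite /N; move: le dle; clear; lia.
  have mE : (m = (m - mi') + mi')%N by rewrite subnK.
  have -> : hom m (lo %/ F * F) = hom (m - mi') (lo %/ F) * hom mi' F by rewrite homM // -mE.
  rewrite -mulrA eF mulr_sumr; apply: subspace_sum => // j _.
  rewrite mulrA homM // -mE; apply: We; apply: leq_trans (size_polyM_le sq (sf j)) _; rewrite -mE //.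
have PW : P (m + c)%N `<=` lspan b.
  move=> z; rewrite addnC => /(gen_mono gP gen)[u [Pu ->]]; apply: subspace_sum => // i _.
  have im : (i <= m)%N by rewrite -ltnS.
  have := Pu i; rewrite PE => -[w ->]; rewrite mulr_sumr; apply: subspace_sum => // t _.
  by rewrite -scalerAr -hom_Xn //; apply: subspaceZ => //; apply: Wall; rewrite size_polyXn.
have [a le ha] := hasdim_le_card (sP (m + c)) PW; exists a => //; apply: leq_trans le _.
by rewrite card_sum !card_prod card_sum !card_ord.
Qed.

Lemma phi_lower m a : hasdim (Phi @` P (m + c)%N) a -> (g.+1 * m.+1 <= a)%N.
Proof.
move=> ha; have -> : (g.+1 * m.+1 = #|{: 'I_g.+1 * 'I_m.+1}|)%N by rewrite card_prod !card_ord.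
pose b (t : 'I_g.+1 * 'I_m.+1) : A := hom m 'X^(t.2) * eps t.1.
apply: (hasdim_ge (e := fun t => Phi (b t)) ha) => [w w0 [j i]|t]; last first.
  by exists (b t) => //; rewrite addnC addnC; apply: (gr_mul gP) => //; apply: hom_P.
pose f j := \poly_(i < m.+1) w (j, inord i).
have sf j' : (size (f j') <= m.+1)%N by apply: size_poly.
have [_ h] := phi_lb gP Px Py gen Pe fe max_eps sf.
have e0 : \sum_t w t *: Phi (b t) = Phi (\sum_j hom m (f j) * eps j).
  transitivity (\sum_j \sum_i w (j, i) *: Phi (b (j, i))); first by rewrite pair_bigA; apply: eq_bigr => -[].
  rewrite linear_sum; apply: eq_bigr => j' _.
  rewrite (polyE_le (sf j')) linear_sum mulr_suml linear_sum; apply: eq_bigr => i' _.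
  by rewrite /= linearZ /= -scalerAl linearZ /= coef_poly ltn_ord inord_val.
move: w0; rewrite e0 /Phi h => /rowP/(_ j); rewrite !mxE => /eqP; rewrite tofrac_eq0 => /eqP/polyP/(_ i).
by rewrite coef_poly ltn_ord inord_val coef0.
Qed.

(** [P_upper] and [phi_lower] have the same main term, so by rank-nullity the kernel in each degree
    is bounded: this is the torsion that coordinates lose. *)
Lemma ker_bound : exists B, forall n b, hasdim (P n `&` [set z | Phi z = 0]) b -> (b <= B)%N.
Proof.
have [B hB] := P_upper; have [C hC] := Acum_hasdim gP c.
exists (B + C)%N => n b hb; have [nc|cn] := ltnP n c.
  apply: leq_trans (leq_addl _ _); apply: hasdim_le hb hC => z [Pz _]; exact: (Acum_hom gP Pz nc).
have [a le ha] := hB (n - c)%N; rewrite subnK // in ha.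
have [a' [b' [ha' hb' e]]] := hasdim_img Phi ha.
have lo : (g.+1 * (n - c).+1 <= a')%N by apply: phi_lower; rewrite subnK.
rewrite (hasdim_inj hb hb'); move: le lo; rewrite e; move: (g.+1 * _)%N; clear; lia.
Qed.

Variables (p : nat) (hp : p \in [pchar k]).

(** Up to the bounded kernel of [Phi], the piece is sandwiched between twisted spans: D times its
    image lies in the span at level n + c', and the span at level n lifts to the piece of degree n +
    c. *)
Lemma frob_piece_ramp s (v : 'I_s -> A) (d : 'I_s -> nat) : (forall i, P (d i) (v i)) ->
  exists e1 (h : nat -> nat -> nat), (forall e n, hasdim (frob_piece v d (p ^ (e1 + e)) n) (h e n)) /\
    ramp p (fun e n => (h e n)%:R).
Proof.
move=> Pv.
have cN i j : mm (v i) * mm (v j) = mm (v j) * mm (v i).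
  exact: (mulmat_comm gP Py gen Pe fe max_eps (Pv i) (Pv j)).
have [e1 [h [hh hr]]] := commuting_ramp hp d cN.
have phiX i q u m : P m u -> Phi (v i ^+ q * u) = (Phi u : 'rV[K]_g.+1) *m mm (v i) ^+ q.
  exact: (phi_exp gP Py gen Pe fe max_eps).
pose F e n := frob_piece v d (p ^ (e1 + e)) n.
have hF e n : exists a, hasdim (F e n) a.
  have [M hM] := P_hasdim gP n.
  have [a _ ha] := hasdim_sub (frob_piece_subspace v d (p ^ (e1 + e)) n) (frob_piece_sub Pv) hM.
  by exists a.
have hab e n : exists ab : nat * nat, [/\ hasdim (F e n) (ab.1 + ab.2), hasdim (Phi @` F e n) ab.1 &
    hasdim (F e n `&` [set z | Phi z = 0]) ab.2].
  by have [t ht] := hF e n; have [a [b [ha hb tE]]] := hasdim_img Phi ht; exists (a, b); rewrite -tE.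
pose ab e n := projT1 (cid (hab e n)).
have abP e n : [/\ hasdim (F e n) ((ab e n).1 + (ab e n).2), hasdim (Phi @` F e n) (ab e n).1 &
    hasdim (F e n `&` [set z | Phi z = 0]) (ab e n).2] by rewrite /ab; case: cid.
have [B hB] := ker_bound.
have bB e n : ((ab e n).2 <= B)%N.
  have [M hM] := P_hasdim gP n; have [a [b [_ hb _]]] := hasdim_img Phi hM.
  have [_ _ h2] := abP e n; apply: leq_trans (hB _ _ hb); apply: hasdim_le h2 hb => z [Fz z0].
  by split=> //; apply: frob_piece_sub Fz.
exists e1, (fun e n => (ab e n).1 + (ab e n).2)%N; split=> [e n|]; first by case: (abP e n).
apply: (@ramp_ext _ _ (fun e n => (ab e n).1%:R) B%:R) => [e n|].
  by rewrite natrD addrC addKr ger0_norm // ler_nat.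
have [D D0 [c' hc']] := phi_ub gP Px Py gen fe max_eps.
apply: (ramp_shift (c := c') (c' := c) hr) => e n.
  have [_ h1 _] := abP e n.
  pose sc (w : restr (@ratc k) 'rV[K]_g.+1) : restr (@ratc k) 'rV[K]_g.+1 := D%:F *: (w : 'rV[K]_g.+1).
  have scD : {morph sc : w w' / w + w'} by move=> w w'; exact: (scalerDr D%:F (w : 'rV[K]_g.+1) w').
  have sc0 : sc 0 = 0 := scaler0 _ (D%:F).
  have h2 : hasdim (sc @` (Phi @` F e n)) (ab e n).1.
    apply: (@hasdim_semilinear _ _ _ id) h1 => [a||a w|w _].
    - by exists a.
    - exact: scD.
    - by rewrite /sc !restrZ !scalerA mulrC.
    - move=> w0; have /eqP : D%:F *: (w : 'rV[K]_g.+1) = 0 := w0.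
      by rewrite scaler_eq0 tofrac_eq0 (negbTE D0) => /eqP.
  apply: hasdim_le h2 (hh e (n + c')%N) => _ [_ [_ [u hu ->] <-] <-].
  have hu' i : exists f : 'I_g.+1 -> {poly k}, (forall j, size (f j) <= n + c' - p ^ (e1 + e) * d i)%N /\
     D%:F *: (Phi (u i) : 'rV[K]_g.+1) = \row_j (f j)%:F.
    have := hu i; rewrite /Pm; case: ifP => [le|_ ->].
      by move=> /hc'[f sf fE]; exists f; rewrite addnC -addnBA // addnC.
    exists (fun=> 0); split=> [j|]; rewrite ?size_poly0 //.
    by rewrite linear0 scaler0; apply/rowP => j; rewrite !mxE tofrac0.
  have [f hf] := choice hu'; exists f => [i l|]; first by case: (hf i).
  rewrite linear_sum (big_morph sc scD sc0) /sc; apply: eq_bigr => i _ /=.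
  have [m Pu] : exists m, P m (u i).
    have := hu i; rewrite /Pm; case: ifP => _; first by exists (n - p ^ (e1 + e) * d i)%N.
    by move=> ->; exists 0%N; case: (sP 0).
  by rewrite (phiX _ _ _ _ Pu) scalemxAl; case: (hf i) => _ ->.
have [_ h1 _] := abP e (n + c)%N.
apply: hasdim_le (hh e n) h1 => _ [u hu ->].
have hU i : exists U m, [/\ Pm (n + c) (p ^ (e1 + e) * d i) U, P m U & Phi U = \row_l (u i l)%:F].
  have [le|lt] := leqP (p ^ (e1 + e) * d i) n.
    have sf j : (size (u i j) <= (n - p ^ (e1 + e) * d i).+1)%N by apply: leq_trans (hu i j) _.
    have [h2 h3] := phi_lb gP Px Py gen Pe fe max_eps sf.
    exists (\sum_j hom (n - p ^ (e1 + e) * d i) (u i j) * eps j), (n - p ^ (e1 + e) * d i + c)%N; split=> //.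
    by rewrite /Pm (leq_trans le (leq_addr _ _)) addnC -addnBA // addnC.
  exists 0, 0%N; split; [exact: Pm0|by case: (sP 0)|].
  rewrite linear0; apply/rowP => l; rewrite !mxE.
  by have := hu i l; rewrite (eqP (ltnW lt : (n - _ == 0)%N)) size_poly_leq0 => /eqP ->; rewrite tofrac0.
have [U hU'] := choice hU.
exists (\sum_i v i ^+ (p ^ (e1 + e)) * U i); first by exists U => // i; case: (hU' i) => m [].
by rewrite linear_sum; apply: eq_bigr => i _; case: (hU' i) => m [_ PU <-]; apply: phiX PU.
Qed.

End Dimensions.
End FrobeniusPieces.

Lemma ideal_gen_min (A : comNzRingType) (X J : set A) : is_ideal J -> X `<=` J -> ideal_gen X `<=` J.
Proof. by move=> hJ XJ x; apply. Qed.

Lemma ideal_gen_sum (A : comNzRingType) (X : set A) z : ideal_gen X z ->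
  exists s : seq (A * A), (forall t, t \in s -> X t.2) /\ z = \sum_(t <- s) t.1 * t.2.
Proof.
move: z; apply: ideal_gen_min; last first.
  move=> z Xz; exists [:: (1, z)]; split=> [t|]; first by rewrite inE => /eqP ->.
  by rewrite big_seq1 mul1r.
split=> [|_ _ [s [hs ->]] [s' [hs' ->]]|a _ [s [hs ->]]].
- by exists [::]; rewrite big_nil.
- exists (s ++ s'); rewrite big_cat; split=> // t; rewrite mem_cat => /orP[]; [exact: hs|exact: hs'].
exists [seq (a * t.1, t.2) | t <- s]; split=> [_ /mapP[t ts ->]|]; first exact: (hs t ts).
by rewrite big_map mulr_sumr; apply: eq_bigr => t _; rewrite mulrA.
Qed.

(** * Finiteness and generation in a standard graded ring *)

Section StandardGraded.
Variables (k : fieldType) (R : std_graded k).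
Local Notation P := (@sg_piece k R).
Let sP n : is_subspace (P n) := @sg_subspace k R n.

Lemma sg_coef0 (f : {poly R}) : (forall n, P n f`_n) -> f.[1] = 0 -> f = 0.
Proof.
move=> hf f0; apply/polyP => i; rewrite coef0; case: (ltnP i (size f)) => [lt|]; last exact: nth_default.
apply: (@sg_direct _ R _ (fun i => f`_i)) lt => //.
by rewrite -[RHS]f0 horner_coef; apply: eq_bigr => j _; rewrite expr1n mulr1.
Qed.

Lemma sg_poly (z : R) : exists f : {poly R}, (forall n, P n f`_n) /\ f.[1] = z.
Proof.
have [N [c [Pc ->]]] := sg_decomp z; exists (\poly_(n < N) c n); split=> [n|].
  by rewrite coef_poly; case: ifP => // _; case: (sP n).
by rewrite horner_poly; apply: eq_bigr => i _; rewrite expr1n mulr1.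
Qed.

(** G_n is the span of the products of n linear forms. The sums of elements of the G_n form a
    subalgebra containing P_1, hence everything, and comparing degrees gives G_n = P_n. *)
Lemma sg_gen_piece n : P n.+1 `<=` kspan [set z | exists a b, [/\ P 1%N a, P n b & z = a * b]].
Proof.
pose G := fix G n : set R := if n is m.+1 then kspan [set z | exists a b, [/\ P 1%N a, G m b & z = a * b]] else P 0%N.
have sG m : is_subspace (G m) by case: m => [|m]; [exact: sP|exact: kspan_subspace].
have GP m : G m `<=` P m.
  elim: m => [//|m IH]; apply: kspan_min => // _ [a [b [Pa Gb ->]]].
  by apply: (sg_mul (m := 1)) => //; apply: IH.
have GM m l a b : G m a -> G l b -> G (m + l)%N (a * b).
  move=> + Gb; elim: m a => [|m IH] a.
    by rewrite /= sg_piece0 => -[e _ <-]; rewrite mulr_algl; apply: subspaceZ.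
  rewrite addSn; move: a; apply: kspan_min => [|_ [a [a' [Pa Ga' ->]]]].
    split=> [|e u v hu hv]; first by rewrite /= mul0r; case: (sG (m + l).+1).
    by rewrite /= mulrDl -scalerAl; case: (sG (m + l).+1) => _; apply.
  rewrite /= -mulrA; apply: kspan_incl; exists a, (a' * b); split=> //; exact: IH.
have GX (f h : {poly R}) : (forall m, G m f`_m) -> (forall m, G m h`_m) -> forall m, G m (f * h)`_m.
  move=> hf hh m; rewrite coefM; apply: subspace_sum => // i _.
  by have := GM _ _ _ _ (hf i) (hh (m - i)%N); rewrite subnKC // -ltnS.
pose B := [set z | exists f : {poly R}, (forall m, G m f`_m) /\ f.[1] = z].
have Bmon m z : G m z -> B z.
  move=> Gz; exists (z *: 'X^m); split=> [i|]; last by rewrite hornerZ hornerXn expr1n mulr1.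
  rewrite coefZ coefXn; case: eqP => [->|_]; rewrite ?mulr1 // mulr0; by case: (sG i).
have P1 : P 0%N 1 by rewrite sg_piece0; exists 1; rewrite ?scale1r.
have BT : B = setT.
  apply: sg_gen.
  - split=> [|a _ _ [f [hf <-]] [h [hh <-]]]; first by apply: (Bmon 0%N); case: (sG 0%N).
    exists (a%:A *: f + h); split=> [m|]; last by rewrite hornerD hornerZ mulr_algl.
    by rewrite coefD coefZ mulr_algl; case: (sG m) => _; apply.
  - exact: (Bmon 0%N).
  - by move=> _ _ [f [hf <-]] [h [hh <-]]; exists (f * h); split; [exact: GX|rewrite hornerM].
  move=> z Pz; apply: (Bmon 1%N); apply: kspan_incl; exists z, 1; split=> //; by rewrite mulr1.
move=> z Pz; have [f [hf fz]] : B z by rewrite BT.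
pose mon : {poly R} := (z : R) *: 'X^(n.+1); have : f - mon = 0.
  apply: sg_coef0 => [m|]; last by rewrite hornerD hornerN hornerZ hornerXn expr1n mulr1 fz subrr.
  rewrite coefB coefZ coefXn; apply: subspaceB => //; first exact: GP.
  by case: eqP => [->|_]; rewrite ?mulr1 // mulr0; case: (sP m).
move/polyP/(_ n.+1); rewrite coefB coefZ coefXn eqxx mulr1 coef0 => /eqP; rewrite subr_eq0 => /eqP <-.
have := hf n.+1; apply: kspanS => _ [a [b [Pa Gb ->]]]; exists a, b; split=> //; exact: GP.
Qed.

(** Finitely many elements of P_1 generate the ideal of P_1; in degree 1 their coefficients can be
    taken in degree 0, that is in k. *)
Lemma sg_fin : exists m, hasdim (P 1%N) m.
Proof.
have [s sE] := sg_noetherian (is_ideal_gen (P 1%N)).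
have [bs [Pbs hbs]] : exists bs : seq R, (forall b, b \in bs -> P 1%N b) /\ {in s, forall z, ideal_gen [set` bs] z}.
  have : {in s, forall z, ideal_gen (P 1%N) z}.
    by move=> z zs; rewrite sE; move=> J _; apply.
  elim: s {sE} => [|z s IH] hs; first by exists [::].
  have [|bs [Pbs hbs]] := IH; first by move=> y ys; apply: hs; rewrite inE ys orbT.
  have [ts [Pts zE]] := ideal_gen_sum (hs z (mem_head _ _)).
  exists ([seq t.2 | t <- ts] ++ bs); split=> [b|y].
    by rewrite mem_cat => /orP[/mapP[t tts ->]|]; [exact: Pts|exact: Pbs].
  rewrite inE => /orP[/eqP ->|ys]; last first.
    by move: (hbs y ys); apply: ideal_gen_min; [exact: is_ideal_gen|move=> b /= bb J _; apply; rewrite /= mem_cat bb orbT].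
  rewrite zE big_seq; apply: ideal_sum; first exact: is_ideal_gen.
  move=> t tts; have [_ _ hM] := is_ideal_gen ([set` [seq t.2 | t <- ts] ++ bs] : set R); apply: hM.
  by move=> J _; apply; rewrite /= mem_cat map_f.
suff PW : P 1%N `<=` lspan (fun i : 'I_(size bs) => nth 0 bs i).
  by have [m _ hm] := hasdim_le_card (sP 1) PW; exists m.
move=> z Pz.
have /ideal_gen_sum[ts [hts zE]] : ideal_gen [set` bs] z.
  have : ideal_gen (P 1%N) z by move=> J _; apply.
  by rewrite sE; apply: ideal_gen_min; [exact: is_ideal_gen|exact: hbs].
have /choice[f hf] := fun t : R * R => sg_poly t.1.
pose F := \sum_(t <- ts) f t * (t.2 *: 'X) - z *: 'X.
have : F = 0.
  apply: sg_coef0 => [m|]; last first.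
    rewrite hornerD hornerN hornerZ hornerX mulr1 horner_sum zE -[X in _ - X]addr0; apply/eqP; rewrite subr_eq add0r addr0; apply/eqP.
    by apply: eq_bigr => t _; rewrite hornerM hornerZ hornerX mulr1 (hf t).2.
  have PX b : P 1%N b -> forall j, P j (b *: 'X)`_j.
    move=> Pb j; rewrite coefZ coefX; case: eqP => [->|_]; rewrite ?mulr1 // mulr0; by case: (sP j).
  rewrite coefB coef_sum; apply: subspaceB => //; last exact: PX.
  rewrite big_seq; apply: subspace_sum => // t tts; rewrite coefM; apply: subspace_sum => // j _.
  have := sg_mul ((hf t).1 j) (PX t.2 (Pbs _ (hts t tts)) (m - j)%N).
  by rewrite subnKC // -ltnS.
move/polyP/(_ 1%N); rewrite coefB coefZ coefX eqxx mulr1 coef0 coef_sum => /eqP; rewrite subr_eq0 => /eqP <-.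
rewrite big_seq; apply: subspace_sum => [|t tts]; first exact: lspan_subspace.
rewrite -scalerAr coefZ coefMX /=; have := (hf t).1 0%N; rewrite sg_piece0 => -[a _ <-].
rewrite mulrC mulr_algl; apply: subspaceZ; first exact: lspan_subspace.
have tb : t.2 \in bs := hts t tts.
have ib : (index t.2 bs < size bs)%N by rewrite index_mem.
have := lspan_mem (fun i : 'I_(size bs) => nth 0 bs i) (Ordinal ib); by rewrite /= nth_index.
Qed.

Lemma sg_grading : grading P.
Proof.
split.
- exact: sP.
- exact: sg_decomp.
- exact: sg_direct.
- exact: sg_mul.
- exact: sg_piece0.
- exact: sg_fin.
- exact: sg_gen_piece.
Qed.
End StandardGraded.

(** * Consequences of Krull dimension two *)

Section Dimension2.
Variables (k : closedFieldType) (A : comAlgType k) (P : nat -> set A).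
Hypothesis gP : grading P.
Let sP := gr_sub gP.

Lemma gen_ex (x y : A) c : P 1%N x -> P 1%N y -> P c `<=` idadd [set 0] (fun i : 'I_2 => if i == ord0 then x else y) ->
  forall n z, P (c + n).+1 z -> exists a b, [/\ P (c + n)%N a, P (c + n)%N b & z = x * a + y * b].
Proof.
move=> Px Py Pc n z Pz; have /(_ z Pz) := P_incl_ideal gP (idadd_ideal _ (homog0 gP).1) Pc (leqW (leq_addr n c)).
move=> [_ [a [-> zE]]]; rewrite add0r !big_ord_recl big_ord0 addr0 /= in zE.
exists (dec gP (a ord0))`_(c + n), (dec gP (a (lift ord0 ord0)))`_(c + n).
split; [exact: decP|exact: decP|].
have := dec_hom gP Pz; rewrite {1}zE decD !decM (dec_hom gP Px) (dec_hom gP Py).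
move/polyP/(_ (c + n).+1); rewrite coefD !expr1 -!scalerAr !coefZ !coefMX /= coefXn eqxx mulr1 => <-.
by [].
Qed.

(** Suppose f(x, y) = 0 and f(t) is nonzero. Modulo l = x - t y the relation reads f(t) y^m = 0, so
    (l) contains y^m and x^i y^(m-i) for all i; then l alone would be a parameter. *)
Lemma forms_indep (x y : A) c : P 1%N x -> P 1%N y ->
  (forall n z, P (c + n).+1 z -> exists a b, [/\ P (c + n)%N a, P (c + n)%N b & z = x * a + y * b]) ->
  ~ sopdim P [set 0] 1 -> forall m (f : {poly k}), (size f <= m.+1)%N -> hom x y m f = 0 -> f = 0.
Proof.
move=> Px Py gen nsop m f sf f0; apply: contrapT => fn0; apply: nsop.
have [t ft] : exists t, f.[t] != 0.
  apply: contrapT => h; apply: fn0; apply: poly_eval0 => t; apply/eqP; apply: contrapT => /negP ft.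
  by apply: h; exists t.
pose l := x - t *: y; pose J := idadd [set 0] (fun _ : 'I_1 => l).
have hJ : is_ideal J := idadd_ideal _ (homog0 gP).1.
have Jl : J l := idadd_mem (fun=> l) ord0 (homog0 gP).1.
have mono n i : (i <= n)%N -> J (x ^+ i * y ^+ (n - i) - t ^+ i *: y ^+ n).
  move=> le; rewrite -{2}(subnKC le) exprD scalerAl -exprZn -mulrBl subrXX.
  by apply: idealMr => //; apply: idealMr.
have Jy : J (y ^+ m).
  have : J (f.[t] *: y ^+ m).
    rewrite -[_ *: _]opprK; apply: idealN => //; rewrite -[- _]add0r -f0 (horner_coef_wide _ sf) scaler_suml -sumrB.
    apply: ideal_sum => // i _; rewrite -scalerA -scalerBr; apply: idealZ => //.
    by apply: mono; rewrite -ltnS.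
  by move=> h; rewrite -[y ^+ m](scalerK ft); apply: idealZ.
exists (fun=> l); split=> [_|]; first by apply: subspaceB => //; apply: subspaceZ.
exists (c + m)%N => z /(gen_mono gP gen)[u [_ ->]]; apply: ideal_sum => // i _; apply: idealMr => //.
have im : (i <= m)%N by rewrite -ltnS.
by rewrite -[_ * _](subrK (t ^+ i *: y ^+ m)); apply: idealD; [|exact: mono|exact: idealZ].
Qed.

(** Without r + 1 parameters there would be a chain of r + 2 inclusions. With r parameters the
    growth would have order at most r, whereas a chain of r + 1 inclusions forces order r + 1. *)
Lemma krull_sop r : krull_dim A r.+1 -> sopdim P [set 0] r.+1 /\ ~ sopdim P [set 0] r.
Proof.
move=> [hc max]; split.
  apply: contrapT => ns; have [C [C1 C2 _]] := prime_chain_ex (homog0 gP) ns.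
  by have := max r.+2 (ex_intro _ C (conj C1 C2)); rewrite ltnn.
move=> hs; have [D hD] := chain_growth gP hc; have [K hK] := sop_growth gP hs.
(* Chosen so that N^(r+1) exceeds K N^r ((r + 1) D + 2)^r, which is what r parameters allow. *)
pose N := (K * (r.+1 * D + 2) ^ r).+1.
have [a le ha] := hK (r.+1 * N * D + 1)%N; have := hD N _ ha.
rewrite leqNgt => /negP; apply; apply: leq_ltn_trans le _.
have leX m i j : (i <= j)%N -> (i ^ m <= j ^ m)%N by case: m => // m ij; rewrite leq_exp2r.
have h1 : ((r.+1 * N * D + 1).+1 <= N * (r.+1 * D + 2))%N.
  rewrite mulnDr -[in X in (X <= _)%N]addn1 -addnA; apply: leq_add; last by rewrite /N mulSn leq_addr.
  by rewrite [(r.+1 * N)%N]mulnC mulnA.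
have h2 : ((r.+1 * N * D + 1).+1 ^ r <= N ^ r * (r.+1 * D + 2) ^ r)%N by rewrite -expnMn; apply: leX.
apply: leq_ltn_trans (leq_mul (leqnn K) h2) _.
by rewrite mulnCA expnSr ltn_pmul2l // expn_gt0.
Qed.

Lemma P_lower (x y : A) : P 1%N x -> P 1%N y ->
  (forall m (f : {poly k}), (size f <= m.+1)%N -> hom x y m f = 0 -> f = 0) ->
  forall n a, hasdim (P n) a -> (n < a)%N.
Proof.
move=> Px Py indep n a ha; rewrite -[n.+1]card_ord.
apply: (hasdim_ge (e := fun i : 'I_n.+1 => hom x y n 'X^i) ha) => [w w0 i|i]; last exact: hom_P.
pose f := \poly_(i < n.+1) w (inord i).
have sf : (size f <= n.+1)%N by apply: size_poly.
have : f = 0.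
  apply: (indep n) => //; rewrite (polyE_le sf) linear_sum -[RHS]w0; apply: eq_bigr => j _ /=.
  by rewrite linearZ /= coef_poly ltn_ord inord_val.
by move=> /polyP/(_ i); rewrite coef_poly ltn_ord inord_val coef0.
Qed.

Lemma P_linear (x y : A) c :
  (forall n z, P (c + n).+1 z -> exists a b, [/\ P (c + n)%N a, P (c + n)%N b & z = x * a + y * b]) ->
  exists C, forall n a, hasdim (P n) a -> (a <= C * n.+1)%N.
Proof.
move=> gen; have [M [e _ PE]] := P_hasdim gP c; have [C hC] := Acum_hasdim gP c.
exists (M + C)%N => n a ha; have [nc|cn] := ltnP n c.
  apply: leq_trans (leq_pmulr _ _) => //; apply: leq_trans (leq_addl _ _).
  by apply: hasdim_le ha hC => z Pz; apply: (Acum_hom gP Pz nc).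
pose b (t : 'I_M * 'I_(n - c).+1) := x ^+ t.2 * y ^+ (n - c - t.2) * e t.1.
have Pb : P n `<=` lspan b.
  move=> z; rewrite -{1}(subnKC cn) => /(gen_mono gP gen)[u [Pu ->]].
  apply: subspace_sum => [|i _]; first exact: lspan_subspace.
  have := Pu i; rewrite PE => -[w ->]; rewrite mulr_sumr; apply: subspace_sum => [|t _]; first exact: lspan_subspace.
  rewrite -scalerAr; apply: subspaceZ; first exact: lspan_subspace.
  exact: (lspan_mem b (t, i)).
have [a' le ha'] := hasdim_le_card (sP n) Pb; rewrite (hasdim_inj ha ha'); apply: leq_trans le _.
rewrite card_prod !card_ord; apply: leq_mul; [exact: leq_addr|by rewrite ltnS leq_subr].
Qed.

(** The form in which dimension two of a factor enters the study of the Segre product. *)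
Record curve p : Prop := Curve {
  cv_power : exists c x y, [/\ P 1%N x, P 1%N y & forall q n z, (0 < q)%N -> (2 * q + c <= n)%N -> P n z ->
    exists a b, [/\ P (n - q)%N a, P (n - q)%N b & z = x ^+ q * a + y ^+ q * b]];
  cv_ramp : forall s (v : 'I_s -> A) d, (forall i, P (d i) (v i)) -> exists e1 (h : nat -> nat -> nat),
    (forall e n, hasdim (frob_piece P v d (p ^ (e1 + e)) n) (h e n)) /\ ramp p (fun e n => (h e n)%:R);
  cv_lower : forall n a, hasdim (P n) a -> (n < a)%N;
  cv_upper : exists C, forall n a, hasdim (P n) a -> (a <= C * n.+1)%N
}.

Lemma krull2_curve p : p \in [pchar k] -> krull_dim A 2 -> curve p.
Proof.
move=> hp hk; have [[z [Pz [c Pc]]] ns] := krull_sop hk.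
have Px := Pz ord0; have Py := Pz (lift ord0 ord0).
have gen := @gen_ex (z ord0) (z (lift ord0 ord0)) c Px Py.
have {}gen := gen _; have {}gen := gen (_ : _ `<=` _).
have Pc' : P c `<=` idadd [set 0] (fun i : 'I_2 => if i == ord0 then z ord0 else z (lift ord0 ord0)).
  have -> : (fun i : 'I_2 => if i == ord0 then z ord0 else z (lift ord0 ord0)) = z; last by [].
  by apply/funext => i; have [j ->|->] := unliftP ord0 i; [rewrite [j]ord1|rewrite eqxx].
have {Pc Pc'}gen := gen Pc'; have indep := forms_indep Px Py gen ns.
have [g [eps [Pe fe me]]] := free_forms_ex gP Py c indep.
split.
- by exists c, (z ord0), (z (lift ord0 ord0)); split=> //; apply: power_gen gen.
- move=> s v d Pv; exact: (frob_piece_ramp gP Px Py gen Pe fe me hp Pv).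
- exact: P_lower indep.
- exact: P_linear gen.
Qed.
End Dimension2.

(** * Segre products *)

Section SubsetSpans.
Variables (k : fieldType) (V : lmodType k).

Definition lspanS (T : finType) (e : T -> V) (S : {set T}) : set V :=
  [set x | exists a : T -> k, x = \sum_(i in S) a i *: e i].

Lemma lspanS_subspace (T : finType) (e : T -> V) S : is_subspace (lspanS e S).
Proof.
split=> [|a _ _ [b ->] [c ->]].
  by exists (fun=> 0); rewrite big1 // => i _; rewrite scale0r.
exists (fun i => a * b i + c i); rewrite scaler_sumr -big_split; apply: eq_bigr => i _.
by rewrite scalerA scalerDl.
Qed.

Lemma lspanS_mem (T : finType) (e : T -> V) (S : {set T}) i : i \in S -> lspanS e S (e i).
Proof.
move=> iS; exists (fun j => (j == i)%:R); rewrite (bigD1 i) //= eqxx scale1r big1 ?addr0 // => j /andP[_ /negbTE ->].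
by rewrite scale0r.
Qed.

Lemma lspanS_min (T : finType) (e : T -> V) (S : {set T}) W : is_subspace W -> (forall i, i \in S -> W (e i)) ->
  lspanS e S `<=` W.
Proof. by move=> sW We _ [a ->]; apply: subspace_sum => // i iS; apply: subspaceZ => //; apply: We. Qed.

Lemma lspanS_hasdim (T : finType) (e : T -> V) S : lindep e -> hasdim (lspanS e S) #|S|.
Proof.
move=> ie; exists (fun i : 'I_#|S| => e (enum_val i)).
  move=> a a0 i; pose b x := \sum_j a j *+ (enum_val j == x).
  have : \sum_x b x *: e x = 0.
    rewrite -[RHS]a0; under eq_bigr do rewrite scaler_suml; rewrite exchange_big; apply: eq_bigr => j _.
    rewrite (bigD1 (enum_val j)) //= eqxx mulr1n big1 ?addr0 // => x /negbTE.
    by rewrite eq_sym => ->; rewrite mulr0n scale0r.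
  move=> /ie/(_ (enum_val i)); rewrite /b (bigD1 i) //= eqxx mulr1n big1 ?addr0 // => j ji.
  by rewrite (inj_eq enum_val_inj) (negbTE ji) mulr0n.
apply/seteqP; split=> [_ [a ->]|_ [a ->]].
  by exists (fun i => a (enum_val i)); rewrite big_enum_val.
apply: subspace_sum => [|i _]; first exact: lspanS_subspace.
by apply: subspaceZ; [exact: lspanS_subspace|apply: lspanS_mem; apply: enum_valP].
Qed.

Lemma lspanS_add (T : finType) (e : T -> V) (S S' : {set T}) : sadd (lspanS e S) (lspanS e S') = lspanS e (S :|: S').
Proof.
apply/seteqP; split.
  apply: sadd_sub; first exact: lspanS_subspace.
    by apply: lspanS_min => [|i iS]; [exact: lspanS_subspace|apply: lspanS_mem; rewrite inE iS].
  by apply: lspanS_min => [|i iS]; [exact: lspanS_subspace|apply: lspanS_mem; rewrite inE iS orbT].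
apply: lspanS_min => [|i]; first by apply: sadd_subspace; apply: lspanS_subspace.
rewrite inE => /orP[iS|iS].
  by apply: sadd_subl; [exact: lspanS_subspace|exact: lspanS_mem].
by apply: sadd_subr; [exact: lspanS_subspace|exact: lspanS_mem].
Qed.

(** Coordinates exist in a basis of [Y] only, so the functionals are total functions whose linearity
    is claimed on [Y]. *)
Lemma dual_family (Y : set V) m (T : finType) (e : T -> V) : hasdim Y m -> lindep e -> (forall t, Y (e t)) ->
  exists lam : T -> V -> k, (forall t a x y, Y x -> Y y -> lam t (a *: x + y) = a * lam t x + lam t y) /\
    forall t t', lam t (e t') = (t == t')%:R.
Proof.
move=> [b ib Yb] ie Ye.
have hco x : exists c : 'rV[k]_m, Y x -> x = lcomb b c.
  have [Yx|nYx] := pselect (Y x); last by exists 0.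
  by have := Yx; rewrite Yb lspan_lcomb => -[c _ <-]; exists c.
have [co hc] := choice hco.
pose C : 'M[k]_(#|T|, m) := \matrix_(i, j) co (e (enum_val i)) 0 j.
have rC i : row i C = co (e (enum_val i)) by apply/rowP => j; rewrite !mxE.
have : row_free C.
  apply: inj_row_free => v vC; apply/rowP => i; rewrite mxE.
  have : \sum_t v 0 (enum_rank t) *: e t = 0.
    rewrite (reindex (@enum_val T predT)) /=; last by apply: onW_bij; apply: enum_val_bij.
    transitivity (lcomb b (v *m C)); last by rewrite vC /lcomb big1 // => j _; rewrite mxE scale0r.
    by rewrite lcomb_mul; apply: eq_bigr => j _; rewrite enum_valK rC -(hc _ (Ye _)).
  by move=> /ie/(_ (enum_val i)); rewrite enum_valK.
move=> /row_freeP[D CD].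
exists (fun t x => (co x *m D) 0 (enum_rank t)); split=> [t a x y Yx Yy|t t'].
  have Yxy : Y (a *: x + y) by rewrite Yb; case: (lspan_subspace b) => _; apply; rewrite -Yb.
  have -> : co (a *: x + y) = a *: co x + co y.
    by apply: (lcomb_inj ib); rewrite -(hc _ Yxy) lcomb_linear -(hc _ Yx) -(hc _ Yy).
  by rewrite mulmxDl -scalemxAl !mxE.
have -> : co (e t') = row (enum_rank t') C by rewrite rC enum_rankK.
by rewrite -row_mul CD !mxE (inj_eq enum_rank_inj) eq_sym.
Qed.
End SubsetSpans.

Section Tensors.
Variables (k : closedFieldType) (r : nat) (R : 'I_r -> std_graded k).
Local Notation S := (segre R).
Local Notation P i n := (@sg_piece k (R i) n).
Implicit Types (t u : htuple R).

Lemma hcomp_mk n (x : forall i, R i) (hx : forall i, sg_piece n (x i)) i : hcomp (mk_htuple hx) i = x i.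
Proof. exact: ffunE. Qed.

Lemma slot_ex t i (x : R i) : sg_piece (hdeg t) x ->
  exists u, [/\ hdeg u = hdeg t, hcomp u i = x & forall j, j != i -> hcomp u j = hcomp t j].
Proof.
move=> Px; pose y := @dfwith _ (fun i => R i) (hcomp t) i x.
have Py j : sg_piece (hdeg t) (y j).
  by rewrite /y; case: (dfwithP (hcomp t : forall i, R i) x j) => // j' _; apply: hcompP.
exists (mk_htuple Py); split=> [//||j ji]; rewrite hcomp_mk /y; first exact: dfwith_in.
by apply: dfwith_out; rewrite eq_sym.
Qed.

Lemma pure_tensor_slot0 t i : hcomp t i = 0 -> pure_tensor t = 0.
Proof.
move=> t0; have : slot_comb i (-1) t t t by split=> //; rewrite t0 scaler0 addr0.
by move/(@pure_tensor_multilinear _ _ R) ->; rewrite scaleN1r addNr.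
Qed.

Definition tens n (W : forall i, set (R i)) : set S :=
  kspan [set pure_tensor t | t in [set t | hdeg t = n /\ forall i, W i (hcomp t i)]].

Lemma tens_subspace n W : is_subspace (tens n W). Proof. exact: kspan_subspace. Qed.

Lemma tens_mem n (W : forall i, set (R i)) t : hdeg t = n -> (forall i, W i (hcomp t i)) -> tens n W (pure_tensor t).
Proof. by move=> dt Wt; apply: kspan_incl; exists t. Qed.

Lemma tensS n (W W' : forall i, set (R i)) : (forall i, W i `<=` W' i) -> tens n W `<=` tens n W'.
Proof. by move=> WW; apply: kspanS => _ [t [dt Wt] <-]; exists t => //; split=> // i; apply: WW. Qed.

(** Multilinearity applied one slot at a time: the slots below l are known only up to a span, the
    others lie in the sets X_i themselves. *)
Lemma expand (X : forall i, set (R i)) n t : (forall i, X i `<=` sg_piece n) -> hdeg t = n ->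
  (forall i, kspan (X i) (hcomp t i)) -> tens n X (pure_tensor t).
Proof.
move=> XP; suff H l : forall t, hdeg t = n -> (forall i : 'I_r, (i < l)%N -> kspan (X i) (hcomp t i)) ->
    (forall i : 'I_r, (l <= i)%N -> X i (hcomp t i)) -> tens n X (pure_tensor t).
  by move=> dt Xt; apply: (H r) => // i; rewrite leqNgt ltn_ord.
elim: l => [|l IH] {}t dt lo hi; first by apply: tens_mem => // i; apply: hi.
have [lr|rl] := ltnP l r; last first.
  apply: IH => // i il; first by apply: lo; apply: ltnW.
  by have := leq_trans (ltn_ord i) (leq_trans rl il); rewrite ltnn.
pose i0 := Ordinal lr.
(* The entries at slot i0 for which the claim holds whatever the other slots are. They form a
   subspace containing [X i0], which makes minimality of the span applicable. *)
pose W : set (R i0) := [set z | sg_piece n z /\ forall u, hdeg u = n -> hcomp u i0 = z ->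
   (forall i : 'I_r, (i < l)%N -> kspan (X i) (hcomp u i)) ->
   (forall i : 'I_r, (l < i)%N -> X i (hcomp u i)) -> tens n X (pure_tensor u)].
suff : W (hcomp t i0).
  by case=> _ hW; apply: hW => // i il; apply: lo; apply: ltnW.
have : kspan (X i0) (hcomp t i0) by apply: lo.
apply: kspan_min => [|z Xz]; last first.
  split=> [|u du uz h1 h2]; first exact: XP.
  apply: IH => // i; rewrite leq_eqVlt => /orP[/eqP li|]; last exact: h2.
  have -> : i = i0 by apply: val_inj. by rewrite uz.
split=> [|a x y [Px hx] [Py hy]].
  split=> [|u du u0 _ _]; first by case: (@sg_subspace k (R i0) n).
  by rewrite (pure_tensor_slot0 u0); case: (tens_subspace n X).
split=> [|u du uE h1 h2]; first by case: (@sg_subspace k (R i0) n) => _; apply.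
have [|ux [dx ex ox]] := @slot_ex u i0 x; first by rewrite du.
have [|uy [dy ey oy]] := @slot_ex u i0 y; first by rewrite du.
have sc : slot_comb i0 a ux uy u.
  by split=> //; [rewrite uE ex ey|move=> j ji; rewrite ox ?oy].
rewrite (pure_tensor_multilinear sc); case: (tens_subspace n X) => _; apply.
  apply: hx => // [|i il|i li]; first by rewrite dx.
    by rewrite ox; [exact: h1|apply: contraTneq il => ->; rewrite ltnn].
  by rewrite ox; [exact: h2|apply: contraTneq li => ->; rewrite ltnn].
apply: hy => // [|i il|i li]; first by rewrite dy.
  by rewrite oy; [exact: h1|apply: contraTneq il => ->; rewrite ltnn].
by rewrite oy; [exact: h2|apply: contraTneq li => ->; rewrite ltnn].
Qed.

Section Basis.
Variables (n : nat) (T : 'I_r -> finType) (e : forall i, T i -> R i).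
Hypotheses (ie : forall i, lindep (@e i)) (Pe : forall i (x : T i), sg_piece n (@e i x)).

Definition btens (s : {dffun forall i, T i}) : S := pure_tensor (mk_htuple (fun i => @Pe i (s i))).

(** A product of functionals dual to the [e i], set to 0 outside degree n, is multilinear. The
    universal property turns it into a functional on the Segre product that singles out one basis
    tensor. *)
Lemma btens_lindep : lindep btens.
Proof.
have hd i : exists lam : T i -> R i -> k, (forall (z : T i) a x y, sg_piece n x -> sg_piece n y -> lam z (a *: x + y) = a * lam z x + lam z y) /\
    forall z z', lam z (@e i z') = (z == z')%:R.
  have [m hm] := P_hasdim (sg_grading (R i)) n; apply: dual_family hm _ _; [exact: ie|exact: Pe].
pose lam i := projT1 (cid (hd i)).
have lamD i (z : T i) a x y : sg_piece n x -> sg_piece n y -> lam i z (a *: x + y) = a * lam i z x + lam i z y.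
  by rewrite /lam; case: cid => /= l [h _]; apply: h.
have lamE i (z z' : T i) : lam i z (@e i z') = (z == z')%:R by rewrite /lam; case: cid => /= l [].
move=> a a0 s0.
pose f t : k^o := if hdeg t == n then \prod_i lam i (s0 i) (hcomp t i) else 0.
have fm : multilinear f.
  move=> i b x y z [dx dy zE oth]; rewrite /f dx dy; case: eqP => [dz|_]; last by rewrite scaler0 addr0.
  have prodE u : (forall j, j != i -> hcomp u j = hcomp z j) ->
      \prod_j lam j (s0 j) (hcomp u j) = lam i (s0 i) (hcomp u i) * \prod_(j | j != i) lam j (s0 j) (hcomp z j).
    by move=> uz; rewrite (bigD1 i) //=; congr (_ * _); apply: eq_bigr => j /uz->.
  rewrite (prodE x) => [|j /oth[]//]; rewrite (prodE y) => [|j /oth[]//].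
  rewrite (prodE z) // zE lamD; last 2 first.
  - by rewrite -dz -dx; apply: hcompP.
  - by rewrite -dz -dy; apply: hcompP.
  by rewrite mulrDl -mulrA.
have [g [gl gE]] := segre_universal fm.
have g0 : g 0 = 0 by have := gl (-1) 0 0; rewrite scaler0 add0r scaleN1r addNr.
have gD : {morph g : x y / x + y} by move=> x y; have := gl 1 x y; rewrite !scale1r.
have gZ b x : g (b *: x) = b *: g x by have := gl b x 0; rewrite g0 !addr0.
have := congr1 g a0; rewrite (big_morph g gD g0) g0 (bigD1 s0) //= big1 ?addr0 => [|s ss0].
  rewrite gZ gE /f eqxx big1 => [|i _]; last by rewrite hcomp_mk lamE eqxx.
  by rewrite /GRing.scale /= mulr1.
have [i si] : exists i, s0 i != s i.
  apply: contrapT => h; move/eqP: ss0; apply; apply/ffunP => i; apply/eqP; apply: contrapT => /negP si.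
  by apply: h; exists i; rewrite eq_sym.
rewrite gZ gE /f eqxx (bigD1 i) //= hcomp_mk lamE (negbTE si) mul0r; exact: scaler0.
Qed.

Lemma tens_span (A : forall i, {set T i}) : tens n (fun i => lspanS (@e i) (A i)) = lspanS btens (setXn A).
Proof.
apply/seteqP; split; last first.
  apply: lspanS_min => [|s /setXnP sA]; first exact: tens_subspace.
  by apply: tens_mem => // i; rewrite hcomp_mk; apply: lspanS_mem.
apply: kspan_min => [|_ [t [dt Wt] <-]]; first exact: lspanS_subspace.
pose X i : set (R i) := [set @e i x | x in [set x | x \in A i]].
have : tens n X (pure_tensor t).
  apply: expand => // [i _ [x _ <-]|i]; first exact: Pe.
  have := Wt i; apply: lspanS_min => [|x xA]; first exact: kspan_subspace.
  by apply: kspan_incl; exists x.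
apply: kspan_min => [|_ [u [du Xu] <-]]; first exact: lspanS_subspace.
have hx i : exists x : T i, x \in A i /\ @e i x = hcomp u i by have [x h1 h2] := Xu i; exists x.
pose s : {dffun forall i, T i} := finfun (fun i => projT1 (cid (hx i))).
have sE i : s i \in A i /\ @e i (s i) = hcomp u i by rewrite ffunE; case: cid.
have -> : pure_tensor u = btens s.
  by congr pure_tensor; apply: htuple_eq => [//|i]; rewrite hcomp_mk; case: (sE i).
by apply: lspanS_mem; apply/setXnP => i; case: (sE i).
Qed.
End Basis.

Lemma adapted (V : lmodType k) (W W' : set V) w w' s : hasdim W w -> hasdim W' w' -> hasdim (sadd W W') s ->
  exists (T : finType) (e : T -> V) (B B' : {set T}), [/\ lindep e, W = lspanS e B, W' = lspanS e B',
    (#|B| = w /\ #|B'| = w')%N & B :|: B' = [set: T]%SET /\ (#|B :&: B'| = w + w' - s)%N].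
Proof.
move=> hW hW' hs; have [s' [c [hs' hc e]]] := hasdim_add hW hW'.
rewrite (hasdim_inj hs hs') -e addKn.
have sW := hasdim_subspace hW; have sW' := hasdim_subspace hW'; have sc := hasdim_subspace hc.
have [b ib cE] := hc.
have [u [Wu iu]] := complement hc hW (@subIsetl _ _ _).
have [u' [Wu' iu']] := complement hc hW' (@subIsetr _ _ _).
have cw : (c <= w)%N := hasdim_le (@subIsetl _ _ _) hc hW.
have cw' : (c <= w')%N := hasdim_le (@subIsetr _ _ _) hc hW'.
pose T : finType := ('I_c + 'I_(w - c) + 'I_(w' - c))%type.
pose f (t : T) : V := match t with inl (inl i) => b i | inl (inr i) => u i | inr i => u' i end.
have fsum (a : T -> k) : \sum_t a t *: f t = \sum_i a (inl (inl i)) *: b i + \sum_i a (inl (inr i)) *: u i + \sum_i a (inr i) *: u' i.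
  by rewrite !big_sumType.
have bc (a : 'I_c -> k) : (W `&` W') (\sum_i a i *: b i) by rewrite cE; exists a.
have fi : lindep f.
  move=> a; rewrite fsum => a0.
  have u'0 : forall i, a (inr i) = 0.
    apply: (iu' (fun i => a (inr i))); split; last by apply: subspace_sum => // i _; apply: subspaceZ.
    move/eqP: a0; rewrite addrC addr_eq0 => /eqP ->; apply: subspaceN => //; apply: subspaceD => //.
      by case: (bc (fun i => a (inl (inl i)))).
    by apply: subspace_sum => // i _; apply: subspaceZ.
  move: a0; rewrite [X in _ + X]big1 ?addr0 => [a0|i _]; last by rewrite u'0 scale0r.
  have u0 : forall i, a (inl (inr i)) = 0.
    apply: (iu (fun i => a (inl (inr i)))).
    by move/eqP: a0; rewrite addrC addr_eq0 => /eqP ->; apply: subspaceN.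
  move: a0; rewrite [X in _ + X]big1 ?addr0 => [a0|i _]; last by rewrite u0 scale0r.
  by move=> [[i|i]|i]; [exact: (ib (fun i => a (inl (inl i))))|exact: u0|exact: u'0].
pose B : {set T} := [set t | if t is inl _ then true else false]%SET.
pose B' : {set T} := [set t | if t is inl (inr _) then false else true]%SET.
have cB (Q : pred T) : #|[set t | Q t]%SET| = (\sum_(i < c) Q (inl (inl i)) + \sum_(i < w - c) Q (inl (inr i)) + \sum_(i < w' - c) Q (inr i))%N.
  rewrite -sum1_card big_mkcond !big_sumType /=; congr (_ + _ + _)%N; apply: eq_bigr => i _; rewrite inE; by case: (Q _).
have nB : #|B| = w by rewrite cB /= !sum_nat_const !card_ord muln0 addn0 !muln1 subnKC.
have nB' : #|B'| = w' by rewrite cB /= !sum_nat_const !card_ord muln0 addn0 !muln1 subnKC.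
have nI : #|B :&: B'| = c.
  have -> : B :&: B' = [set t | if t is inl (inl _) then true else false]%SET.
    by apply/setP => -[[i|i]|i]; rewrite !inE.
  by rewrite cB /= !sum_nat_const !card_ord !muln0 !addn0 muln1.
have Wb i : W (b i) /\ W' (b i).
  by have : (W `&` W') (b i) by rewrite cE; apply: lspan_mem.
exists T, f, B, B'; split=> //.
- apply/esym; apply: (hasdim_eq (n := w)) => //; first by rewrite -nB; apply: lspanS_hasdim.
  apply: lspanS_min => // -[[i|i]|i]; rewrite inE //= => _; by case: (Wb i).
- apply/esym; apply: (hasdim_eq (n := w')) => //; first by rewrite -nB'; apply: lspanS_hasdim.
  apply: lspanS_min => // -[[i|i]|i]; rewrite inE //= => _; by case: (Wb i).
- by split=> //; apply/setP => -[[i|i]|i]; rewrite !inE.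
Qed.

(** In bases adapted to W_i and W'_i at once, both tensor products are spanned by subsets of a
    single basis, so the dimension of their sum is a count by inclusion-exclusion. The factor w i +
    w' i - s i is the dimension of the intersection in R_i. *)
Lemma tens_sum_dim n (W W' : forall i, set (R i)) (w w' s : 'I_r -> nat) :
  (forall i, W i `<=` sg_piece n) -> (forall i, W' i `<=` sg_piece n) ->
  (forall i, hasdim (W i) (w i)) -> (forall i, hasdim (W' i) (w' i)) -> (forall i, hasdim (sadd (W i) (W' i)) (s i)) ->
  hasdim (sadd (tens n W) (tens n W')) (\prod_i w i + \prod_i w' i - \prod_i (w i + w' i - s i))%N.
Proof.
move=> WP WP' hw hw' hs.
pose D (i : 'I_r) := {T : finType & (T -> R i) * ({set T} * {set T})}%type.
have h i : exists d : D i, let: existT T (e, (B, B')) := d in [/\ lindep e, W i = lspanS e B, W' i = lspanS e B',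
    (#|B| = w i /\ #|B'| = w' i)%N & B :|: B' = [set: T]%SET /\ (#|B :&: B'| = w i + w' i - s i)%N].
  by have [T [e [B [B' hT]]]] := adapted (hw i) (hw' i) (hs i); exists (existT _ T (e, (B, B'))).
pose d i := projT1 (cid (h i)).
pose T i := projT1 (d i); pose e i : T i -> R i := (projT2 (d i)).1.
pose B i : {set T i} := (projT2 (d i)).2.1; pose B' i : {set T i} := (projT2 (d i)).2.2.
have dP i : [/\ lindep (e i), W i = lspanS (e i) (B i), W' i = lspanS (e i) (B' i),
    (#|B i| = w i /\ #|B' i| = w' i)%N & B i :|: B' i = [set: T i]%SET /\ (#|B i :&: B' i| = w i + w' i - s i)%N].
  by rewrite /B /B' /e /T /d; case: cid => -[T1 [e1 [B1 B1']]].
have ie i : lindep (e i) by case: (dP i).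
have WE i : W i = lspanS (e i) (B i) by case: (dP i).
have WE' i : W' i = lspanS (e i) (B' i) by case: (dP i).
have Pe i x : sg_piece n (e i x).
  have [_ _ _ _ [BT _]] := dP i; have : x \in B i :|: B' i by rewrite BT inE.
  by rewrite inE => /orP[xB|xB]; [apply: WP; rewrite WE|apply: WP'; rewrite WE']; apply: lspanS_mem.
have -> : W = fun i => lspanS (e i) (B i) by apply: functional_extensionality_dep => i.
have -> : W' = fun i => lspanS (e i) (B' i) by apply: functional_extensionality_dep => i.
rewrite !(tens_span Pe) lspanS_add.
have -> : (\prod_i w i + \prod_i w' i - \prod_i (w i + w' i - s i) = #|setXn B :|: setXn B'|)%N.
  rewrite cardsU; congr (_ + _ - _)%N.
  - by rewrite cardsXn; apply: eq_bigr => i _; case: (dP i) => _ _ _ [].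
  - by rewrite cardsXn; apply: eq_bigr => i _; case: (dP i) => _ _ _ [].
  have -> : setXn B :&: setXn B' = setXn (fun i => B i :&: B' i).
    apply/setP => x; rewrite inE; apply/andP/setXnP => [[/setXnP h1 /setXnP h2] i|h1]; first by rewrite inE h1 h2.
    by split; apply/setXnP => i; have := h1 i; rewrite inE => /andP[].
  by rewrite cardsXn; apply: eq_bigr => i _; case: (dP i) => _ _ _ _ [].
by apply: lspanS_hasdim; apply: btens_lindep.
Qed.

Lemma tens_dim n (W : forall i, set (R i)) (w : 'I_r -> nat) :
  (forall i, W i `<=` sg_piece n) -> (forall i, hasdim (W i) (w i)) -> hasdim (tens n W) (\prod_i w i).
Proof.
move=> WP hw; have sid (V : lmodType k) (X : set V) : is_subspace X -> sadd X X = X.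
  move=> sX; apply/seteqP; split; first by apply: sadd_sub.
  exact: sadd_subl.
have := tens_sum_dim WP WP hw hw (s := w); rewrite sid ?addnn; last exact: tens_subspace.
have -> : (\prod_i (w i + w i - w i) = \prod_i w i)%N by apply: eq_bigr => i _; rewrite addnK.
rewrite -addnn addnK; apply=> i; rewrite sid //; exact: (hasdim_subspace (hw i)).
Qed.
End Tensors.

Lemma scalars_dim (k : fieldType) (A : comAlgType k) : hasdim (range (fun a : k => a%:A : A)) 1.
Proof.
exists (fun=> 1 : A) => [a a0 i|].
  by rewrite (ord1 i); move: a0; rewrite big_ord1 => /eqP; rewrite scaler_eq0 oner_eq0 orbF => /eqP.
apply/seteqP; split=> [_ [a _ <-]|_ [a ->]]; first by exists (fun=> a); rewrite big_ord1.
by exists (a ord0) => //; rewrite big_ord1.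
Qed.

(** * Grading and Krull dimension of the Segre product *)

Section SegreGrading.
Variables (k : closedFieldType) (r : nat) (R : 'I_r -> std_graded k).
Local Notation S := (segre R).
Local Notation SP := (@segre_piece k r R).

Lemma segre_pieceE n : SP n = tens n (fun i => @sg_piece k (R i) n).
Proof.
apply/seteqP; split; apply: kspanS => _ [t h <-]; exists t => //; last by case: h.
by split=> // i; rewrite -h; apply: hcompP.
Qed.

Lemma segre_piece_sub n : is_subspace (SP n). Proof. exact: kspan_subspace. Qed.

Lemma segre_piece_pt t n : hdeg t = n -> SP n (pure_tensor t).
Proof. by move=> dt; apply: kspan_incl; exists t. Qed.

Lemma segre_mul m n x y : SP m x -> SP n y -> SP (m + n)%N (x * y).
Proof.
move=> + Py; move: x; apply: kspan_min => [|_ [t <- <-]].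
  split=> [|a u v hu hv]; rewrite /= ?mul0r; first by case: (segre_piece_sub (m + n)).
  by rewrite mulrDl -scalerAl; case: (segre_piece_sub (m + n)) => _; apply.
move: y Py; apply: kspan_min => [|_ [u <- <-]].
  split=> [|a u v hu hv]; rewrite /= ?mulr0; first by case: (segre_piece_sub (hdeg t + n)).
  by rewrite mulrDr -scalerAr; case: (segre_piece_sub (hdeg t + n)) => _; apply.
by rewrite pure_tensorM; apply: segre_piece_pt.
Qed.

Lemma segre_poly (z : S) : exists f : {poly S}, (forall n, SP n f`_n) /\ f.[1] = z.
Proof.
have : kspan (range (@pure_tensor k r R)) z by rewrite segre_span.
move: z; apply: kspan_min => [|_ [t _ <-]].
  split=> [|a _ _ [f [hf <-]] [h [hh <-]]].
    by exists 0; split=> [n|]; rewrite ?coef0 ?horner0 //; case: (segre_piece_sub n).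
  exists (a%:A *: f + h); split=> [n|]; last by rewrite hornerD hornerZ mulr_algl.
  by rewrite coefD coefZ mulr_algl; case: (segre_piece_sub n) => _; apply.
exists (pure_tensor t *: 'X^(hdeg t)); split=> [n|]; last by rewrite hornerZ hornerXn expr1n mulr1.
rewrite coefZ coefXn; case: eqP => [->|_]; rewrite ?mulr1 ?mulr0; first exact: segre_piece_pt.
by case: (segre_piece_sub n).
Qed.

Lemma multilinear_deg (W : lmodType k) (f : htuple R -> W) n : multilinear f ->
  multilinear (fun t => if hdeg t == n then f t else 0).
Proof.
move=> fm i a x y z xyz; have [dx dy _ _] := xyz; rewrite dx dy.
by case: ifP => _; [exact: fm xyz|rewrite scaler0 addr0].
Qed.

(** The universal property yields the projection to degree n, from which directness of the grading
    follows. *)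
Lemma segre_proj n : exists2 g : S -> S, linear g & forall m z, SP m z -> g z = if m == n then z else 0.
Proof.
pose f (t : htuple R) : S := if hdeg t == n then pure_tensor t else 0.
have fm : multilinear f := multilinear_deg n (@pure_tensor_multilinear k r R).
have [g [gl gE]] := segre_universal fm; exists g => // m z.
have g0 : g 0 = 0 by have := gl (-1) 0 0; rewrite scaler0 add0r scaleN1r addNr.
move: z; apply: kspan_min => [|_ [t <- <-]]; last by rewrite /= gE.
split=> [|a x y /= gx gy]; first by rewrite /= g0 if_same.
by rewrite gl gx gy; case: ifP => _ //; rewrite scaler0 addr0.
Qed.

Definition segre_alpha n i : nat := projT1 (cid (P_hasdim (sg_grading (R i)) n)).
Lemma segre_alphaP n i : hasdim (@sg_piece k (R i) n) (segre_alpha n i).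
Proof. by rewrite /segre_alpha; case: cid. Qed.

Lemma segre_dim n : hasdim (SP n) (\prod_i segre_alpha n i).
Proof. rewrite segre_pieceE; exact: (tens_dim (W := fun i => @sg_piece k (R i) n) (fun i x h => h) (segre_alphaP n)). Qed.

Lemma segre_grading : grading SP.
Proof.
split.
- exact: segre_piece_sub.
- move=> z; have [f [hf <-]] := segre_poly z; exists (size f), (fun n => f`_n); split=> //.
  by rewrite horner_coef; apply: eq_bigr => i _; rewrite expr1n mulr1.
- move=> N c hc c0 n nN; have [g gl gE] := segre_proj n.
  have g0 : g 0 = 0 by have := gl (-1) 0 0; rewrite scaler0 add0r scaleN1r addNr.
  have gD : {morph g : x y / x + y} by move=> x y; have := gl 1 x y; rewrite !scale1r.
  have := congr1 g c0; rewrite (big_morph g gD g0) g0 (bigD1 (Ordinal nN)) //= (gE _ _ (hc n)) eqxx big1 ?addr0 //.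
  move=> i ni; rewrite (gE _ _ (hc i)); case: eqP => // e; case/eqP: ni; exact: val_inj.
- exact: segre_mul.
- apply/esym/(hasdim_eq (n := 1%N)); first exact: scalars_dim.
    have -> : 1%N = \prod_(i < r) segre_alpha 0 i; last exact: segre_dim.
    rewrite big1 // => i _; apply: (hasdim_inj (segre_alphaP 0 i)).
    by rewrite sg_piece0; apply: scalars_dim.
  have S1 : SP 0 1 by rewrite -(pure_tensor1 R); apply: segre_piece_pt.
  by move=> _ [a _ <-]; exact: (subspaceZ a (segre_piece_sub 0) S1).
- by exists (\prod_i segre_alpha 1 i)%N; apply: segre_dim.
move=> n; apply: kspan_min => [|_ [t dt <-]]; first exact: kspan_subspace.
pose X i : set (R i) := [set z | exists a b, [/\ sg_piece 1%N a, sg_piece n b & z = a * b]].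
have : tens n.+1 X (pure_tensor t).
  apply: expand => // [i _ [a [b [Pa Pb ->]]]|i]; first exact: (sg_mul (m := 1)).
  by apply: sg_gen_piece; rewrite -dt; apply: hcompP.
apply: kspan_min => [|_ [u [du Xu] <-]]; first exact: kspan_subspace.
have hab i : exists ab : R i * R i, [/\ sg_piece 1%N ab.1, sg_piece n ab.2 & hcomp u i = ab.1 * ab.2].
  by have [a [b h]] := Xu i; exists (a, b).
pose ab i := projT1 (cid (hab i)).
have abP i : [/\ sg_piece 1%N (ab i).1, sg_piece n (ab i).2 & hcomp u i = (ab i).1 * (ab i).2] by rewrite /ab; case: cid.
have P1 i : sg_piece 1%N (ab i).1 by case: (abP i).
have P2 i : sg_piece n (ab i).2 by case: (abP i).
pose ta := mk_htuple P1; pose tb := mk_htuple P2.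
apply: kspan_incl; exists (pure_tensor ta), (pure_tensor tb); split.
- exact: segre_piece_pt.
- exact: segre_piece_pt.
rewrite pure_tensorM; congr pure_tensor; apply: htuple_eq => [|i]; first by rewrite du.
by rewrite hcomp_mul !hcomp_mk; case: (abP i).
Qed.

Lemma segre_Acum n : hasdim (Acum segre_grading n) (\sum_(m < n) \prod_i segre_alpha m i).
Proof.
elim: n => [|n IH]; first by rewrite big_ord0; apply: Acum0.
by rewrite big_ord_recr; apply: AcumS IH (segre_dim n).
Qed.

Hypothesis lower : forall i n a, hasdim (@sg_piece k (R i) n) a -> (n < a)%N.
Variable C : nat.
Hypothesis upper : forall i n a, hasdim (@sg_piece k (R i) n) a -> (a <= C * n.+1)%N.

Lemma segre_alpha_le n i : (segre_alpha n i <= C * n.+1)%N.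
Proof. exact: upper (segre_alphaP n i). Qed.

Lemma segre_dim_le n : (\prod_i segre_alpha n i <= (C * n.+1) ^ r)%N.
Proof.
rewrite -[r in (_ ^ r)%N]card_ord -prod_nat_const; apply: leq_prod => i _; exact: segre_alpha_le.
Qed.

(** The piece of degree n has dimension between (n + 1)^r and (C (n + 1))^r, so the growth has order
    r + 1. The lower bound excludes r parameters and thus produces a chain; the upper bound excludes
    longer chains. *)
Lemma segre_krull : krull_dim S r.+1.
Proof.
have leX m i j : (i <= j)%N -> (i ^ m <= j ^ m)%N by case: m => // m ij; rewrite leq_exp2r.
split.
  have ns : ~ sopdim SP [set 0] r.
    move=> /(sop_growth segre_grading)[K hK].
    (* The degrees from M to 2 M - 1 contribute at least M^(r+1), against the bound K (2 M + 1)^r <=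
       K (3 M)^r from r parameters. *)
    pose M := (K * 3 ^ r).+1; have [a le ha] := hK (M + M)%N.
    have := hasdim_inj ha (segre_Acum _); rewrite big_split_ord /= => aE.
    have h1 : (M * M ^ r <= a)%N.
      rewrite aE; apply: leq_trans (leq_addl _ _).
      rewrite -[X in (X * _)%N]card_ord -sum_nat_const; apply: leq_sum => i _.
      rewrite -[X in (_ ^ X)%N]card_ord -prod_nat_const; apply: leq_prod => j _.
      by apply: leq_trans (leq_addr i M) _; apply: ltnW; apply: lower (segre_alphaP _ _).
    have h2 : ((M + M).+1 ^ r <= (3 * M) ^ r)%N by apply: leX; rewrite /M; lia.
    have : (M * M ^ r <= K * (3 ^ r * M ^ r))%N.
      by apply: leq_trans h1 (leq_trans le _); rewrite leq_mul2l -expnMn h2 orbT.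
    by rewrite mulnA leq_pmul2r ?expn_gt0 // ltnn.
  have [Ch [C1 C2 _]] := prime_chain_ex (homog0 segre_grading) ns; by exists Ch.
move=> L hc; rewrite leqNgt; apply/negP => Lr; have [D hD] := chain_growth segre_grading hc.
pose B := (C ^ r * (L * D + 1) ^ r.+1)%N; pose N := B.+1.
have := hD N _ (segre_Acum _); set n := (L * N * D + 1)%N.
have h1 : (\sum_(m < n) \prod_i segre_alpha m i <= n * (C * n) ^ r)%N.
  rewrite -[X in (X * _)%N]card_ord -sum_nat_const; apply: leq_sum => i _.
  apply: leq_trans (segre_dim_le i) _; apply: leX; rewrite leq_mul2l; apply/orP; right; exact: ltn_ord.
have nN : (n <= (L * D + 1) * N)%N by rewrite /n /N; nia.
have h2 : (n * (C * n) ^ r <= B * N ^ r.+1)%N.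
  by rewrite expnMn mulnCA -expnS /B -mulnA -expnMn leq_mul2l leX ?orbT.
move=> h; have : (N ^ r.+2 <= B * N ^ r.+1)%N.
  by apply: leq_trans (leq_trans h (leq_trans h1 h2)); rewrite leq_pexp2l.
by rewrite expnS leq_pmul2r ?expn_gt0 // ltnn.
Qed.
End SegreGrading.

(** * Colengths *)

Section Colength.
Variables (k : closedFieldType) (A : comAlgType k) (P : nat -> set A).
Hypothesis gP : grading P.
Let sP := gr_sub gP.
Local Notation dec := (dec gP).

Lemma tail_split (X : set A) N z : is_ideal X -> (forall n, (N <= n)%N -> P n `<=` X) ->
  exists x w, [/\ X x, Acum gP N w & z = x + w].
Proof.
move=> hX XN; exists (\sum_(i < size (dec z) | (N <= i)%N) (dec z)`_i), (\sum_(i < size (dec z) | ~~ (N <= i)%N) (dec z)`_i).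
split.
- apply: ideal_sum => // i Ni; apply: XN Ni _ _; exact: decP.
- apply: subspace_sum => [|i]; first exact: Acum_subspace.
  by rewrite -ltnNge => iN; apply: Acum_hom iN; apply: decP.
by rewrite {1}(dec_sumE gP z) (bigID (fun i : 'I_(size (dec z)) => (N <= i)%N)).
Qed.

(** Take u outside X in the largest degree not contained in X. Products of u with positive degrees
    fall into X, so X + k u is already an ideal. *)
Lemma ideal_extend (X : set A) N d a : is_ideal X -> (forall n, (N <= n)%N -> P n `<=` X) ->
  hasdim (X `&` Acum gP N) d -> hasdim (Acum gP N) a -> (d < a)%N ->
  exists X', [/\ is_ideal X', X `<` X' & hasdim (X' `&` Acum gP N) d.+1].
Proof.
move=> hX XN hd ha da; have sX := ideal_subspace hX.
pose Bad m := `[< ~ (P m `<=` X) >].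
have exB : exists m, Bad m.
  apply: contrapT => nB; have AX : Acum gP N `<=` X.
    move=> z _; rewrite (dec_sumE gP z); apply: ideal_sum => // i _.
    have : P i `<=` X by apply: contrapT => h; apply: nB; exists i; apply/asboolP.
    by apply; apply: decP.
  have e : X `&` Acum gP N = Acum gP N by apply/seteqP; split=> [z []//|z Az]; split=> //; apply: AX.
  by move: da; rewrite e in hd; rewrite (hasdim_inj hd ha) ltnn.
have ubB m : Bad m -> (m <= N)%N.
  by move=> /asboolP h; rewrite leqNgt; apply/negP => Nm; apply: h; apply: XN; apply: ltnW.
case: (ex_maxnP exB ubB) => m /asboolP Bm max.
have mN : (m < N)%N by rewrite ltnNge; apply/negP => /XN.
have [u [Pu nXu]] : exists u, P m u /\ ~ X u.
  by apply: contrapT => h; apply: Bm => u Pu; apply: contrapT => nXu; apply: h; exists u.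
have above i : (m < i)%N -> P i `<=` X.
  move=> mi; apply: contrapT => h; have : Bad i by apply/asboolP.
  by move/max; rewrite leqNgt mi.
pose X' : set A := [set z | exists x c, X x /\ z = x + c *: u].
have X'u c x : X x -> X' (x + c *: u) by exists x, c.
have XX' : X `<=` X' by move=> x Xx; exists x, 0; rewrite scale0r addr0.
have sX' : is_subspace X'.
  split=> [|e _ _ [x [c [Xx ->]]] [y [c' [Xy ->]]]]; first by apply: XX'; case: sX.
  exists (e *: x + y), (e * c + c'); split; first by case: sX => _; apply.
  by rewrite scalerDr scalerA scalerDl addrACA.
have Xu : X' u by have := X'u 1 0 (proj1 sX); rewrite scale1r add0r.
have hX' : is_ideal X'.
  split; [by case: sX'|by move=> x y; apply: subspaceD|].
  move=> e _ [x [c [Xx ->]]]; rewrite mulrDr; apply: subspaceD => //; first by apply: XX'; apply: idealMl.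
  rewrite -scalerAr; apply: subspaceZ => //; rewrite (dec_sumE gP e) mulr_suml; apply: subspace_sum => // i _.
  have [i0|i0] := posnP i; last first.
    apply: XX'; apply: (above (i + m)%N); first by rewrite -[X in (X < _)%N]add0n ltn_add2r.
    by apply: (gr_mul gP) => //; apply: decP.
  have := decP gP e i; rewrite {1}i0 (gr_0 gP) => -[c' _ <-].
  by rewrite mulr_algl; apply: subspaceZ.
exists X'; split=> //; first by split=> // /(_ u Xu).
have [d' _ hd'] := hasdim_sub (setI_subspace sX' (Acum_subspace gP N)) (@subIsetr _ _ _) ha.
have lt : (d < d')%N.
  apply: (hasdim_lt hd hd'); split; first by move=> z [Xz Az]; split=> //; apply: XX'.
  move=> h; apply: nXu; have [] := h u; first by split=> //; apply: Acum_hom mN.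
  by [].
suff le : (d' <= d + 1)%N.
  have <- : d' = d.+1 by apply/eqP; rewrite eqn_leq lt -addn1 le. by [].
have [l l1 hl] := lspan_hasdim (fun _ : 'I_1 => u).
have [s [t [hs _ _]]] := hasdim_add hd hl.
apply: leq_trans (leq_trans (hasdim_add_le hd hl hs) _); last by rewrite leq_add2l.
apply: hasdim_le hd' hs => _ [[x [c [Xx ->]]] Az].
exists x, (c *: u); split=> //; last by exists (fun=> c); rewrite big_ord1.
split=> //; rewrite -[x](addrK (c *: u)); apply: subspaceB => //; first exact: Acum_subspace.
by apply: subspaceZ; [exact: Acum_subspace|apply: Acum_hom mN].
Qed.

(** All degrees from N on lie in [Q], so an ideal above [Q] is determined by its part below degree
    N, and strict inclusions raise the dimension there. Conversely [ideal_extend] builds a chain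
    with steps of dimension 1. *)
Lemma colength_dim (Q : set A) N a b : is_ideal Q -> (forall n, (N <= n)%N -> P n `<=` Q) ->
  hasdim (Acum gP N) a -> hasdim (Q `&` Acum gP N) b -> colength Q (a - b).
Proof.
move=> hQ QN ha hb; have ba : (b <= a)%N by apply: hasdim_le hb ha; apply: subIsetr.
split.
  suff H j : (j <= a - b)%N -> exists J : nat -> set A, [/\ forall i, (i <= j)%N -> is_ideal (J i), Q `<=` J 0%N,
      forall i, (i < j)%N -> J i `<` J i.+1, Q `<=` J j & hasdim (J j `&` Acum gP N) (b + j)].
    by have [J [J1 J2 J3 _ _]] := H _ (leqnn _); exists J.
  elim: j => [|j IH] jab; first by exists (fun=> Q); split=> //; rewrite addn0.
  have [J [J1 J2 J3 J4 J5]] := IH (ltnW jab).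
  have [|X' [hX' lt hd]] := ideal_extend (J1 j (leqnn j)) (fun n Nn => subset_trans (QN n Nn) J4) J5 ha _.
    by rewrite -ltn_subRL.
  exists (fun i => if (i <= j)%N then J i else X'); rewrite leq0n ltnn; split=> //.
  - by move=> i _; case: ifP => // ij; apply: J1.
  - move=> i; rewrite ltnS => ij; rewrite ij; move: ij; rewrite leq_eqVlt => /orP[/eqP ->|ij]; first by rewrite ltnn.
    by rewrite ij; apply: J3.
  - by apply: subset_trans J4 _; case: lt.
  - by rewrite addnS.
move=> n [J [J1 J2 J3]].
have chain i : (i <= n)%N -> exists2 d, (b + i <= d)%N & hasdim (J i `&` Acum gP N) d.
  have JA j : (j <= n)%N -> exists d, hasdim (J j `&` Acum gP N) d.
    move=> jn; have [d _ hd] := hasdim_sub (setI_subspace (ideal_subspace (J1 j jn)) (Acum_subspace gP N)) (@subIsetr _ _ _) ha.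
    by exists d.
  have QJ j : (j <= n)%N -> Q `<=` J j.
    by elim: j => [//|j IH] jn; apply: subset_trans (IH (ltnW jn)) _; case: (J3 j jn).
  elim: i => [|i IH] iN.
    have [d hd] := JA _ iN; exists d => //; rewrite addn0; apply: hasdim_le hb hd => z [Qz Az].
    by split=> //; apply: J2.
  have [d le hd] := IH (ltnW iN); have [d' hd'] := JA _ iN; exists d' => //.
  rewrite addnS; apply: leq_ltn_trans le _; apply: (hasdim_lt hd hd'); have [sub nsub] := J3 i iN.
  split=> [z [Jz Az]|h]; first by split=> //; apply: sub.
  apply: nsub => z Jz; have [x [w [Qx Aw zE]]] := tail_split z hQ QN.
  have hJ := J1 _ iN; have hJ' := J1 _ (ltnW iN).
  rewrite zE; apply: idealD => //; first by apply: QJ Qx; apply: ltnW.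
  have [] // := h w; split=> //; have -> : w = z - x by rewrite zE addrC addKr.
  by apply: idealB => //; apply: QJ Qx.
have [d le hd] := chain n (leqnn n); have da : (d <= a)%N by apply: hasdim_le hd ha; apply: subIsetr.
by rewrite -(leq_add2l b) subnKC // (leq_trans le).
Qed.

Lemma homog_dim (Q : set A) (beta : nat -> nat) n : homog gP Q -> (forall m, hasdim (Q `&` P m) (beta m)) ->
  hasdim (Q `&` Acum gP n) (\sum_(m < n) beta m).
Proof.
move=> [hQ Qh] hbeta; have sQ := ideal_subspace hQ.
elim: n => [|n IH].
  rewrite big_ord0 (_ : Q `&` Acum gP 0 = [set 0]); first exact: hasdim0.
  apply/seteqP; split=> [z [_]|_ ->]; last by split; [case: sQ|case: (Acum_subspace gP 0)].
  by rewrite /Acum /= leqn0 size_poly_eq0 => /eqP z0; rewrite /= -(decK gP z) z0 horner0.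
have [c [d [hc hd e]]] := hasdim_add IH (hbeta n).
have d0 : d = 0%N.
  have [d' le hd'] : exists2 d', (d' <= 0)%N & hasdim ([set 0] : set A) d' by exists 0%N; [|exact: hasdim0].
  apply/eqP; rewrite -leqn0; apply: leq_trans le; apply: hasdim_le hd hd' => z [[_ Az] [_ Pz]].
  have := leq_sizeP _ _ Az n (leqnn n).
  by rewrite (dec_hom gP Pz) coefZ coefXn eqxx mulr1.
rewrite big_ord_recr /= -e d0 addn0; suff -> : Q `&` Acum gP n.+1 = sadd (Q `&` Acum gP n) (Q `&` P n) by [].
apply/seteqP; split.
  move=> z [Qz Az]; exists (z - (dec z)`_n), (dec z)`_n; split; last by rewrite subrK.
    split; first by apply: idealB => //; apply: Qh.
    apply/leq_sizeP => i ni; rewrite decD -scaleN1r decZ coefD coefZ (dec_hom gP (decP gP z n)) coefZ coefXn.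
    rewrite scaleN1r mulN1r; case: eqP => [->|/eqP ne]; first by rewrite mulr1 subrr.
    by rewrite mulr0 subr0; apply: (leq_sizeP _ _ Az); rewrite ltn_neqAle eq_sym ne.
  by split; [apply: Qh|apply: decP].
apply: sadd_sub; first by apply: setI_subspace => //; apply: Acum_subspace.
  by move=> z [Qz Az]; split=> //; rewrite /Acum /=; apply: leqW.
by move=> z [Qz Pz]; split=> //; apply: Acum_hom Pz _.
Qed.
End Colength.

(** * Frobenius powers of Segre products of ideals *)

Lemma homogeneous_homog (k : closedFieldType) (R : std_graded k) (I : set R) :
  homogeneous_ideal I -> homog (sg_grading R) I.
Proof.
move=> [hI Ih]; split=> // x n Ix; case: (ltnP n (size (dec (sg_grading R) x))) => [lt|ge]; last first.
  by rewrite nth_default //; case: hI.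
apply: (Ih _ (fun i => (dec (sg_grading R) x)`_i)) lt; first exact: decP.
by rewrite -dec_sumE.
Qed.

(** Otherwise the ideals of elements whose components in degrees below m lie in [I] decrease
    strictly with m and give arbitrarily long chains above [I]. *)
Lemma colength_irrelevant (k : closedFieldType) (A : comAlgType k) (P : nat -> set A) (gP : grading P) (I : set A) n :
  homog gP I -> colength I n -> exists D, P D `<=` I.
Proof.
move=> [hI Ih] [_ max]; apply: contrapT => nD.
pose J m : set A := [set z | forall l, (l < m)%N -> I (dec gP z)`_l].
have hJ m : is_ideal (J m).
  split=> [l _|x y hx hy l lm|a x hx l lm]; first by rewrite dec0 coef0; case: hI.
    by rewrite decD coefD; apply: idealD => //; [apply: hx|apply: hy].
  rewrite decM coefM; apply: ideal_sum => // i _; apply: idealMl => //; apply: hx.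
  by apply: leq_ltn_trans lm; apply: leq_subr.
have := max n.+1; rewrite ltnn => h; apply: notF; apply: h.
exists (fun i => J (n.+1 - i)%N); split=> [i _|z Iz l _|i iN]; [exact: hJ|exact: Ih|].
rewrite -(subnSK iN); set m := (n.+1 - i.+1)%N; split=> [z hz l lm|sub]; first by apply: hz; apply: ltnW.
apply: nD; exists m => u Pu; have : J m u.
  move=> l lm; rewrite (dec_hom gP Pu) coefZ coefXn (ltn_eqF lm) mulr0; by case: hI.
by move/sub/(_ m (ltnSn m)); rewrite (dec_hom gP Pu) coefZ coefXn eqxx mulr1.
Qed.

Section FrobeniusPower.
Variables (k : closedFieldType) (p : nat) (hp : p \in [pchar k]) (r : nat) (hr : (0 < r)%N).
Variables (R : 'I_r -> std_graded k) (I : forall i, set (R i)).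
Hypothesis hI : forall i, homogeneous_ideal (@I i).
Arguments I : clear implicits.
Local Notation S := (segre R).
Local Notation SP := (@segre_piece k r R).
Local Notation P i n := (@sg_piece k (R i) n).
Local Notation dec := (dec (segre_grading R)).
Let sSP := @segre_piece_sub k r R.

Lemma pchar_alg (A : comAlgType k) : p \in [pchar A].
Proof. exact: (rmorph_pchar (in_alg A)). Qed.

Definition Xgen q d n i : set (R i) := [set z | exists v u, [/\ I i v, P i d v, P i (n - q * d)%N u & z = v ^+ q * u]].
(** The degree d is common to all slots, because a generator is the q-th power of a pure tensor of
    elements of the (I_i)_d. This is why a sum over d of tensor products appears instead of a tensor
    product of ideals. *)
Definition Qn q n : set S := kspan [set pure_tensor w | w in [set w : htuple R | hdeg w = n /\
  exists d, (q * d <= n)%N /\ forall i, Xgen q d n (hcomp w i)]].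

Lemma Qn_subspace q n : is_subspace (Qn q n). Proof. exact: kspan_subspace. Qed.

Lemma Qn_sub q n : Qn q n `<=` SP n.
Proof. by apply: kspan_min => [|_ [w [dw _] <-]]; [exact: sSP|exact: segre_piece_pt]. Qed.

Lemma Qn_mul q m n x y : SP m x -> Qn q n y -> Qn q (m + n)%N (x * y).
Proof.
move=> + Qy; move: x; apply: kspan_min => [|_ [t dt <-]].
  split=> [|a u v hu hv]; rewrite /= ?mul0r; first by case: (Qn_subspace q (m + n)).
  by rewrite mulrDl -scalerAl; case: (Qn_subspace q (m + n)) => _; apply.
move: y Qy; apply: kspan_min => [|_ [w [dw [d [qd Xw]]] <-]].
  split=> [|a u v hu hv]; rewrite /= ?mulr0; first by case: (Qn_subspace q (m + n)).
  by rewrite mulrDr -scalerAr; case: (Qn_subspace q (m + n)) => _; apply.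
rewrite /= pure_tensorM; apply: kspan_incl; exists (htuple_mul t w) => //; split; first by rewrite -dw -dt.
exists d; split=> [|i]; first exact: leq_trans qd (leq_addl _ _).
have [v [u [Iv Pv Pu wE]]] := Xw i; exists v, (hcomp t i * u); split=> //.
  by rewrite -addnBA //; apply: sg_mul => //; rewrite -dt; apply: hcompP.
by rewrite hcomp_mul wE mulrCA.
Qed.

Definition Qset q : set S := [set z | forall n, Qn q n (dec z)`_n].

Lemma Qset_ideal q : is_ideal (Qset q).
Proof.
split=> [n|x y hx hy n|a x hx n].
- by rewrite dec0 coef0; case: (Qn_subspace q n).
- by rewrite decD coefD; exact: (subspaceD (Qn_subspace q n) (hx n) (hy n)).
rewrite decM coefM; apply: subspace_sum => [|i _]; first exact: Qn_subspace.
by have := Qn_mul (decP (segre_grading R) a i) (hx (n - i)%N); rewrite subnKC // -ltnS.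
Qed.

Lemma Qn_Qset q n z : Qn q n z -> Qset q z.
Proof.
move=> Qz m; rewrite (dec_hom _ (Qn_sub Qz)) coefZ coefXn.
by case: eqP => [->|_]; rewrite ?mulr1 ?mulr0 //; case: (Qn_subspace q m).
Qed.

Lemma pure_tensorX (t : htuple R) q : exists u, [/\ hdeg u = (q * hdeg t)%N, forall i, hcomp u i = hcomp t i ^+ q &
  pure_tensor t ^+ q = pure_tensor u].
Proof.
elim: q => [|q [u [du uE ptE]]].
  by exists (htuple_one R); split=> [//|i|]; rewrite ?hcomp_one ?pure_tensor1 ?expr0.
exists (htuple_mul t u); split=> [|i|]; first by rewrite mulSn -du.
  by rewrite hcomp_mul uE exprS.
transitivity (pure_tensor t * pure_tensor t ^+ q); first exact: exprS.
by rewrite ptE; exact: pure_tensorM.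
Qed.

(** Raising to the power q is additive, so the elements whose q-th power lies in [Qset] form a
    subspace and only pure tensors need checking. Conversely each spanning tensor of [Qn] factors as
    a tensor of the u times the q-th power of one of the v. *)
Lemma frobenius_powerE e : frobenius_power (segre_ideal I) (p ^ e) = Qset (p ^ e).
Proof.
set q := (p ^ e)%N; have hS := @pchar_alg S.
apply/seteqP; split.
  apply: ideal_gen_min => [|_ [x Ix <-]]; first exact: Qset_ideal.
  have sub : is_subspace [set x : S | Qset q (x ^+ q)].
    split=> [|a y z hy hz] /=.
      by rewrite expr0n expn_eq0 -leqn0 leqNgt (p_gt0 hp) /=; case: (Qset_ideal q).
    have h1 : Qset q (a ^+ q *: y ^+ q) by exact: (idealZ _ (Qset_ideal q) hy).
    by rewrite /= /q frobXD // -/q exprZn; exact: (idealD (Qset_ideal q) h1 hz).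
  suff : [set x : S | Qset q (x ^+ q)] x by [].
  move: x Ix; apply: kspan_min => // x [n _]; move: x; apply: kspan_min => // _ [t [dt It] <-] /=.
  have [u [du uE ->]] := pure_tensorX t q.
  apply: (@Qn_Qset _ (q * n)); apply: kspan_incl; exists u => //; split; first by rewrite du dt.
  exists n; split=> // i; exists (hcomp t i), 1; split=> //; first by rewrite -dt; apply: hcompP.
    by rewrite subnn; exact: (P1 (sg_grading (R i))).
  by rewrite mulr1 uE.
move=> z Qz; rewrite (dec_sumE (segre_grading R) z); apply: ideal_sum => [|n _]; first exact: is_ideal_gen.
move: (Qz n); move: ((dec z)`_n); apply: kspan_min; first exact: ideal_subspace (is_ideal_gen _).
move=> _ [w [dw [d [qd Xw]]] <-].
have hvu i : exists vu : R i * R i, [/\ I i vu.1, P i d vu.1, P i (n - q * d)%N vu.2 & hcomp w i = vu.1 ^+ q * vu.2].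
  by have [v [u h]] := Xw i; exists (v, u).
pose vu i := projT1 (cid (hvu i)).
have vuP i : [/\ I i (vu i).1, P i d (vu i).1, P i (n - q * d)%N (vu i).2 & hcomp w i = (vu i).1 ^+ q * (vu i).2].
  by rewrite /vu; case: cid.
have Pv i : P i d (vu i).1 by case: (vuP i).
have Pu i : P i (n - q * d)%N (vu i).2 by case: (vuP i).
have [u [du uE ptE]] := pure_tensorX (mk_htuple Pv) q.
have -> : pure_tensor w = pure_tensor (mk_htuple Pu) * pure_tensor (mk_htuple Pv) ^+ q.
  rewrite ptE pure_tensorM; congr pure_tensor; apply: htuple_eq => [|i].
    have -> : hdeg (htuple_mul (mk_htuple Pu) u) = (n - q * d + hdeg u)%N by [].
    by rewrite du dw /= -[hdeg (mk_htuple Pv)]/d subnK.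
  by rewrite hcomp_mul uE !hcomp_mk mulrC; case: (vuP i).
have [_ _ hM] := is_ideal_gen [set x ^+ q | x in segre_ideal I]; apply: hM => J _; apply.
exists (pure_tensor (mk_htuple Pv)) => //; apply: kspan_incl; exists d => //; apply: kspan_incl.
exists (mk_htuple Pv); last exact: erefl.
split; first exact: erefl.
by move=> i; rewrite hcomp_mk; case: (vuP i).
Qed.

Lemma Qset_homog q : homog (segre_grading R) (Qset q).
Proof. by split=> [|z n Qz]; [exact: Qset_ideal|exact: Qn_Qset (Qz n)]. Qed.

Lemma Qset_piece q n : Qset q `&` SP n = Qn q n.
Proof.
apply/seteqP; split=> [z [Qz Pz]|z Qz]; last by split; [exact: Qn_Qset Qz|exact: Qn_sub Qz].
by have := Qz n; rewrite (dec_hom _ Pz) coefZ coefXn eqxx mulr1.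
Qed.

Lemma Ideg_ex i d : exists mv : {m : nat & 'I_m -> R i}, I i `&` P i d = lspan (projT2 mv).
Proof.
have [m hm] := P_hasdim (sg_grading (R i)) d.
have sI : is_subspace (I i `&` P i d).
  by apply: setI_subspace; [apply: ideal_subspace; case: (hI i)|apply: sg_subspace].
by have [s _ [v iv vE]] := hasdim_sub sI (@subIsetr _ _ _) hm; exists (existT _ s v).
Qed.
Definition Isize i d : nat := projT1 (projT1 (cid (Ideg_ex i d))).
Definition Ibasis i d : 'I_(Isize i d) -> R i := projT2 (projT1 (cid (Ideg_ex i d))).
Lemma IbasisE i d : I i `&` P i d = lspan (@Ibasis i d).
Proof. by rewrite /Ibasis /Isize; case: cid. Qed.
Lemma Ibasis_in i d j : I i (@Ibasis i d j) /\ P i d (@Ibasis i d j).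
Proof. by have : (I i `&` P i d) (@Ibasis i d j) by rewrite IbasisE; apply: lspan_mem. Qed.

Definition AA d q n i : set (R i) := frob_piece (@sg_piece k (R i)) (@Ibasis i d) (fun=> d) q n.

Lemma AA_subspace d q n i : is_subspace (@AA d q n i).
Proof. exact: (frob_piece_subspace (sg_grading (R i))). Qed.

Lemma AA_sub d q n i : @AA d q n i `<=` P i n.
Proof. by apply: (frob_piece_sub (sg_grading (R i))) => j; case: (Ibasis_in j). Qed.

(** The q-th power of a combination of the basis is a combination of q-th powers, so finitely many
    generators suffice in each degree d. *)
Lemma AA_mem d e n i v u : I i v -> P i d v -> Pm (@sg_piece k (R i)) n (p ^ e * d) u -> @AA d (p ^ e) n i (v ^+ (p ^ e) * u).
Proof.
move=> Iv Pv Pu; have : (I i `&` P i d) v by [].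
rewrite IbasisE => -[a ->]; exists (fun j => a j ^+ (p ^ e) *: u).
  by move=> j; apply: subspaceZ => //; apply: Pm_subspace (sg_grading (R i)) _ _.
rewrite (frobX_sum hp) ?mulr_suml; last exact: pchar_alg.
by apply: eq_bigr => j _; rewrite exprZn -scalerAl -scalerAr.
Qed.

Lemma AA_span d q n i : (q * d <= n)%N -> @AA d q n i `<=` kspan (@Xgen q d n i).
Proof.
move=> qd _ [u hu ->]; apply: subspace_sum => [|j _]; first exact: kspan_subspace.
apply: kspan_incl; have [Iv Pv] := Ibasis_in j; exists (@Ibasis i d j), (u j); split=> //.
by have := hu j; rewrite /Pm qd.
Qed.

Lemma Xgen_sub q d n i : (q * d <= n)%N -> @Xgen q d n i `<=` P i n.
Proof.
move=> qd _ [v [u [Iv Pv Pu ->]]]; rewrite -(subnKC qd); apply: sg_mul => //.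
exact: (P_exp (sg_grading (R i)) q Pv).
Qed.

Lemma tens_AA d q n : tens n (AA d q n) `<=` Qn q n.
Proof.
have [qd|nq] := leqP (q * d) n; last first.
  apply: kspan_min => [|_ [t [dt At] <-]]; first exact: Qn_subspace.
  (* For n < q d every [AA] is zero, and the tensor vanishes because there is at least one slot. *)
  rewrite (@pure_tensor_slot0 _ _ _ _ (Ordinal hr)); first by case: (Qn_subspace q n).
  have [u hu ->] := At (Ordinal hr); rewrite big1 // => j _.
  by have := hu j; rewrite /Pm leqNgt nq => ->; rewrite mulr0.
apply: kspan_min => [|_ [t [dt At] <-]]; first exact: Qn_subspace.
have : tens n (fun i => @Xgen q d n i) (pure_tensor t).
  by apply: expand => // i; [exact: Xgen_sub|apply: AA_span].
by apply: kspanS => _ [w [dw Xw] <-]; exists w => //; split=> //; exists d.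
Qed.

Lemma Xgen_AA e d n i : (p ^ e * d <= n)%N -> @Xgen (p ^ e) d n i `<=` @AA d (p ^ e) n i.
Proof. by move=> qd _ [v [u [Iv Pv Pu ->]]]; apply: AA_mem => //; rewrite /Pm qd. Qed.

Variable c : nat.
Hypothesis power : forall i, exists x y, [/\ P i 1%N x, P i 1%N y & forall q n z, (0 < q)%N -> (2 * q + c <= n)%N -> P i n z ->
    exists a b, [/\ P i (n - q)%N a, P i (n - q)%N b & z = x ^+ q * a + y ^+ q * b]].

(* Away from the first c degrees of a block, P_m = x^q P_(m-q) + y^q P_(m-q), and
   v^q x^q = (v x)^q moves a generator from I_d to I_(d+1). *)
Lemma AA_step e d n i : (p ^ e * d.+2 + c <= n)%N -> @AA d (p ^ e) n i `<=` @AA d.+1 (p ^ e) n i.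
Proof.
set q := (p ^ e)%N => h; have q0 : (0 < q)%N by rewrite expn_gt0 (p_gt0 hp).
have h1 : (q * d <= n)%N by move: h; nia.
have h2 : (2 * q + c <= n - q * d)%N by move: h; nia.
have h3 : (q * d.+1 <= n)%N by move: h; nia.
move=> z /(AA_span h1); move: z; apply: kspan_min => [|_ [v [u [Iv Pv Pu ->]]]]; first exact: AA_subspace.
have [x [y [Px Py /(_ q _ u q0 h2 Pu)[a [b [Pa Pb ->]]]]]] := power i.
have hIi : is_ideal (I i) by case: (hI i).
have nE : (n - q * d - q = n - q * d.+1)%N by rewrite mulnS; lia.
rewrite nE in Pa Pb; rewrite mulrDr !mulrA -!exprMn; apply: subspaceD; first exact: AA_subspace.
  by apply: AA_mem; rewrite /Pm ?h3 //; [apply: idealMr|rewrite -addn1; apply: sg_mul].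
by apply: AA_mem; rewrite /Pm ?h3 //; [apply: idealMr|rewrite -addn1; apply: sg_mul].
Qed.

Lemma AA_mono e d d' n i : (d <= d')%N -> (p ^ e * d'.+1 + c <= n)%N -> @AA d (p ^ e) n i `<=` @AA d' (p ^ e) n i.
Proof.
elim: d' => [|d' IH]; first by rewrite leqn0 => /eqP -> _.
rewrite leq_eqVlt => /orP[/eqP -> _ z //|dd' h]; rewrite ltnS in dd'.
have h' : (p ^ e * d'.+1 + c <= n)%N.
  by apply: leq_trans h; rewrite leq_add2r leq_mul2l leqnSn orbT.
by apply: subset_trans (IH dd' h') _; apply: AA_step.
Qed.

(** The upper bound on n excludes d > J, and the lower one lets [AA_mono] absorb every d < J into J
    - 1. For J = 0 the two summands coincide. *)
Lemma Qn_good e J n : (p ^ e * J + c <= n)%N -> (n < p ^ e * J.+1)%N ->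
  Qn (p ^ e) n = sadd (tens n (AA J.-1 (p ^ e) n)) (tens n (AA J (p ^ e) n)).
Proof.
move=> h1 h2; apply/seteqP; split; last first.
  by apply: sadd_sub; [exact: Qn_subspace|exact: tens_AA|exact: tens_AA].
have sT : is_subspace (sadd (tens n (AA J.-1 (p ^ e) n)) (tens n (AA J (p ^ e) n))).
  by apply: sadd_subspace; apply: tens_subspace.
apply: kspan_min => // _ [w [dw [d [qd Xw]]] <-].
have q0 : (0 < p ^ e)%N by rewrite expn_gt0 (p_gt0 hp).
have dJ : (d <= J)%N by rewrite -ltnS -(ltn_pmul2l q0); apply: leq_ltn_trans qd h2.
have wA i : @AA d (p ^ e) n i (hcomp w i) by apply: Xgen_AA.
move: dJ; rewrite leq_eqVlt => /orP[/eqP dJ|dJ].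
  by apply: sadd_subr; [exact: tens_subspace|apply: tens_mem => // i; rewrite -dJ].
have J0 : (0 < J)%N by apply: leq_ltn_trans dJ.
apply: sadd_subl; [exact: tens_subspace|apply: tens_mem => // i; apply: AA_mono (wA i)].
  by rewrite -ltnS prednK.
by rewrite prednK.
Qed.

(** Splitting off x^q and y^q D times writes P_n as the span of the v^q u with v in P_D, which lies
    in I_i. *)
Lemma Qn_full e D n : (forall i, P i D `<=` I i) -> (p ^ e * D.+1 + c <= n)%N -> Qn (p ^ e) n = SP n.
Proof.
set q := (p ^ e)%N => DI h; have q0 : (0 < q)%N by rewrite expn_gt0 (p_gt0 hp).
apply/seteqP; split; first exact: Qn_sub.
suff PA i : P i n `<=` @AA D q n i.
  by rewrite segre_pieceE; apply: subset_trans (tensS PA) _; apply: tens_AA.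
have [x [y [Px Py hxy]]] := power i.
suff H j : (j <= D)%N -> P i n `<=` kspan [set z | exists v u, [/\ P i j v, P i (n - q * j)%N u & z = v ^+ q * u]].
  apply: subset_trans (H D (leqnn D)) _; apply: kspan_min => [|_ [v [u [Pv Pu ->]]]]; first exact: AA_subspace.
  apply: AA_mem => //; first exact: DI.
  by rewrite /Pm; case: ifP => //; move: h; rewrite mulnS; nia.
elim: j => [|j IH] jD.
  move=> z Pz; apply: kspan_incl; exists 1, z; split; rewrite ?expr1n ?mul1r ?muln0 ?subn0 //.
  exact: (P1 (sg_grading (R i))).
apply: subset_trans (IH (ltnW jD)) _; apply: kspan_min => [|_ [v [u [Pv Pu ->]]]]; first exact: kspan_subspace.
have h2 : (2 * q + c <= n - q * j)%N.
  have : (q * j.+2 <= q * D.+1)%N by rewrite leq_mul2l ltnS jD orbT.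
  by move: h; rewrite !mulnS; lia.
have [a [b [Pa Pb ->]]] := hxy q _ u q0 h2 Pu.
have nE : (n - q * j - q = n - q * j.+1)%N by rewrite mulnS; lia.
rewrite nE in Pa Pb; rewrite mulrDr !mulrA -!exprMn; apply: (subspaceD (kspan_subspace _)).
  by apply: kspan_incl; exists (v * x), a; split=> //; rewrite -addn1; apply: sg_mul.
by apply: kspan_incl; exists (v * y), b; split=> //; rewrite -addn1; apply: sg_mul.
Qed.

Lemma AA_dim d e n i : exists a, hasdim (@AA d (p ^ e) n i) a.
Proof.
have [m hm] := P_hasdim (sg_grading (R i)) n.
by have [a _ ha] := hasdim_sub (@AA_subspace d (p ^ e) n i) (@AA_sub d (p ^ e) n i) hm; exists a.
Qed.

Lemma AA_sum_dim d d' e n i : exists a, hasdim (sadd (@AA d (p ^ e) n i) (@AA d' (p ^ e) n i)) a.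
Proof.
have [m hm] := P_hasdim (sg_grading (R i)) n.
have sub : sadd (@AA d (p ^ e) n i) (@AA d' (p ^ e) n i) `<=` P i n.
  by apply: sadd_sub; [apply: sg_subspace|exact: AA_sub|exact: AA_sub].
have [a _ ha] := hasdim_sub (sadd_subspace (@AA_subspace d (p ^ e) n i) (@AA_subspace d' (p ^ e) n i)) sub hm.
by exists a.
Qed.

Definition adim d e n i : nat := projT1 (cid (AA_dim d e n i)).
Definition sdim d d' e n i : nat := projT1 (cid (AA_sum_dim d d' e n i)).
Lemma adimP d e n i : hasdim (@AA d (p ^ e) n i) (adim d e n i). Proof. by rewrite /adim; case: cid. Qed.
Lemma sdimP d d' e n i : hasdim (sadd (@AA d (p ^ e) n i) (@AA d' (p ^ e) n i)) (sdim d d' e n i).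
Proof. by rewrite /sdim; case: cid. Qed.

(** The sum is again a Frobenius piece, for the concatenated generators, so that its dimension is a
    ramp as well. *)
Lemma AA_addE d d' e n i : sadd (@AA d (p ^ e) n i) (@AA d' (p ^ e) n i) =
  frob_piece (@sg_piece k (R i)) (fun j : 'I_(Isize i d + Isize i d') => match fintype.split j with inl j => Ibasis j | inr j => Ibasis j end)
    (fun j => match fintype.split j with inl _ => d | inr _ => d' end) (p ^ e) n.
Proof.
apply/seteqP; split.
  move=> _ [_ [_ [[u hu ->] [w hw ->] ->]]].
  exists (fun j => match fintype.split j with inl j => u j | inr j => w j end).
    by move=> j; case: fintype.split.
  rewrite big_split_ord; congr (_ + _); apply: eq_bigr => j _.
    by rewrite (unsplitK (inl j)).
  by rewrite (unsplitK (inr j)).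
move=> _ [u hu ->]; rewrite big_split_ord; eexists; eexists; split; last reflexivity.
  exists (fun j => u (lshift _ j)) => [j|].
    by have := hu (lshift (Isize i d') j); rewrite (unsplitK (inl j)).
  by apply: eq_bigr => j _; rewrite (unsplitK (inl j)).
exists (fun j => u (rshift _ j)) => [j|].
  by have := hu (rshift (Isize i d) j); rewrite (unsplitK (inr j)).
by apply: eq_bigr => j _; rewrite (unsplitK (inr j)).
Qed.

Hypothesis ramps : forall i s (v : 'I_s -> R i) d, (forall j, P i (d j) (v j)) -> exists e1 (h : nat -> nat -> nat),
    (forall e n, hasdim (frob_piece (@sg_piece k (R i)) v d (p ^ (e1 + e)) n) (h e n)) /\ ramp p (fun e n => (h e n)%:R).

Lemma adim_ramp d i : exists e1, ramp p (fun e n => (adim d (e1 + e) n i)%:R).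
Proof.
have [j|e1 [h [hh hr']]] := @ramps i _ (@Ibasis i d) (fun=> d); first by case: (Ibasis_in j).
exists e1; apply: (@ramp_ext _ _ _ 0) hr' => e n.
by rewrite (hasdim_inj (adimP d (e1 + e) n i) (hh e n)) subrr normr0.
Qed.

Lemma sdim_ramp d d' i : exists e1, ramp p (fun e n => (sdim d d' (e1 + e) n i)%:R).
Proof.
have [j|e1 [h [hh hr']]] := @ramps i _ (fun j : 'I_(Isize i d + Isize i d') => match fintype.split j with inl j => Ibasis j | inr j => Ibasis j end)
    (fun j => match fintype.split j with inl _ => d | inr _ => d' end).
  by case: fintype.split => j'; case: (Ibasis_in j').
exists e1; apply: (@ramp_ext _ _ _ 0) hr' => e n.
have h1 := sdimP d d' (e1 + e) n i; rewrite AA_addE in h1.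
by rewrite (hasdim_inj h1 (hh e n)) subrr normr0.
Qed.

(** P_n is the Frobenius piece of the single generator 1 in degree 0. *)
Lemma alpha_ramp i : ramp p (fun _ n => (segre_alpha R n i)%:R).
Proof.
have [j|e1 [h [hh hr']]] := @ramps i 1 (fun=> 1) (fun=> 0%N); first exact: (P1 (sg_grading (R i))).
apply: (@ramp_ext _ _ _ 0) hr' => e n.
have h1 := hh e n; rewrite (_ : frob_piece _ _ _ _ _ = P i n) in h1.
  by rewrite (hasdim_inj (segre_alphaP R n i) h1) subrr normr0.
apply/seteqP; split; first by apply: (frob_piece_sub (sg_grading (R i))) => _; exact: (P1 (sg_grading (R i))).
by move=> z Pz; exists (fun=> z) => [j|]; rewrite ?big_ord1 ?expr1n ?mul1r // /Pm muln0 leq0n subn0.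
Qed.
End FrobeniusPower.

(** * Sums of products of ramps *)

Lemma diff_exp_bounds (n m : nat) : ((m.+1)%:R * n%:R ^+ m <= (n.+1)%:R ^+ m.+1 - n%:R ^+ m.+1 :> rat) &&
  ((n.+1)%:R ^+ m.+1 - n%:R ^+ m.+1 <= (m.+1)%:R * (n.+1)%:R ^+ m :> rat).
Proof.
have n0 : 0 <= n%:R :> rat by []. have nn : n%:R <= (n.+1)%:R :> rat by rewrite ler_nat.
rewrite subrXX -[X in (X - _)]natr1 addrAC subrr add0r mul1r.
have sE (x : rat) : (m.+1)%:R * x = \sum_(i < m.+1) x by rewrite sumr_const card_ord mulr_natl.
rewrite !sE; apply/andP; split; apply: ler_sum => i _; have im : (i <= m)%N by rewrite -ltnS.
  rewrite [m.+1.-1]/= -{1}(subnK im) exprD; apply: ler_wpM2r; first exact: exprn_ge0.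
  by apply: lerXn2r; rewrite ?nnegrE ?natr1 //; rewrite natr1.
have -> : (n.+1)%:R ^+ m = (n.+1)%:R ^+ (m - i) * (n.+1)%:R ^+ i :> rat by rewrite -exprD subnK.
rewrite [m.+1.-1]/=; apply: ler_wpM2l; first exact: exprn_ge0.
by apply: lerXn2r; rewrite ?nnegrE.
Qed.

Lemma power_sum m M : (0 <= M%:R ^+ m.+1 - (m.+1)%:R * \sum_(n < M) n%:R ^+ m :> rat) &&
  (M%:R ^+ m.+1 - (m.+1)%:R * \sum_(n < M) n%:R ^+ m <= (m.+1)%:R * M%:R ^+ m :> rat).
Proof.
elim: M => [|M IH]; first by rewrite big_ord0 mulr0 expr0n subr0 lexx mulr_ge0 ?exprn_ge0.
rewrite big_ord_recr /= mulrDr; have := diff_exp_bounds M m; move: IH.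
move: (_%:R * \sum_(n < M) _) (_%:R * M%:R ^+ m) (_ * M.+1%:R ^+ m) (M%:R ^+ m.+1) (M.+1%:R ^+ m.+1) => a b c d e.
by move=> /andP[h1 h2] /andP[h3 h4]; apply/andP; split; lra.
Qed.

Lemma sum_tail (F : nat -> rat) M B : (M <= B)%N ->
  \sum_(n < B) (if (M <= n)%N then F n else 0) = \sum_(n < B) F n + -1 * \sum_(n < M) F n.
Proof.
move=> MB; rewrite -(subnKC MB); elim: (B - M)%N => [|j IH].
  by rewrite addn0 mulN1r subrr big1 // => n _; rewrite leqNgt ltn_ord.
by rewrite addnS !big_ord_recr /= leq_addr IH; ring.
Qed.

Section Asymptotics.
Variables (p : nat) (p1 : (1 < p)%N).
Local Notation q e := ((p ^ e)%:R : rat).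

Lemma q_ge1 e : 1 <= q e.
Proof. by rewrite ler1n expn_gt0 (ltnW p1). Qed.
Lemma q_gt0 e : 0 < q e. Proof. exact: lt_le_trans ltr01 (q_ge1 e). Qed.

Definition approx d (f : nat -> rat) : Prop := exists rho C : rat, forall e, `|f e - rho * q e ^+ d.+1| <= C * q e ^+ d.

Lemma approx_ext d f h C : (forall e, `|f e - h e| <= C * q e ^+ d) -> approx d h -> approx d f.
Proof.
move=> fh [rho [D hD]]; exists rho, (C + D) => e.
by rewrite -[f e](subrK (h e)) -addrA mulrDl; apply: le_trans (ler_normD _ _) _; apply: lerD.
Qed.

Lemma approxD d f h : approx d f -> approx d h -> approx d (fun e => f e + h e).
Proof.
move=> [r [C hC]] [r' [C' hC']]; exists (r + r'), (C + C') => e.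
by rewrite mulrDl opprD addrACA mulrDl; apply: le_trans (ler_normD _ _) _; apply: lerD.
Qed.

Lemma approxZ d a f : approx d f -> approx d (fun e => a * f e).
Proof.
move=> [r [C hC]]; exists (a * r), (`|a| * C) => e.
by rewrite -mulrA -mulrBr normrM -mulrA ler_wpM2l.
Qed.

Lemma approx0 d : approx d (fun=> 0).
Proof. by exists 0, 0 => e; rewrite !mul0r subrr normr0. Qed.

Lemma approx_sum d (T : Type) (s : seq T) (f : T -> nat -> rat) :
  (forall x, approx d (f x)) -> approx d (fun e => \sum_(x <- s) f x e).
Proof.
move=> h; elim: s => [|x s IH].
  by apply: (@approx_ext _ _ (fun=> 0) 0) (approx0 d) => e; rewrite big_nil subrr normr0 mul0r.
apply: (@approx_ext _ _ (fun e => f x e + \sum_(x <- s) f x e) 0) (approxD (h x) IH) => e.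
by rewrite big_cons subrr normr0 mul0r.
Qed.

Lemma approx_power d m (beta : rat) (M : nat -> nat) : (m <= d)%N -> 0 <= beta -> (forall e, `|(M e)%:R - beta * q e| <= 1) ->
  approx d (fun e => q e ^+ (d - m) * \sum_(n < M e) n%:R ^+ m).
Proof.
move=> md b0 hM.
have key e : `|(m.+1)%:R * \sum_(n < M e) n%:R ^+ m - (beta * q e) ^+ m.+1| <= (m.+1)%:R *+ 2 * (beta + 1) ^+ m * q e ^+ m.
  have /andP[h1 h2] := power_sum m (M e); have := hM e; set x : rat := (M e)%:R in h1 h2 *; set z := beta * q e => hx.
  have q1 := q_ge1 e; have z0 : 0 <= z by apply: mulr_ge0 => //; apply: ltW (q_gt0 e).
  have x0 : 0 <= x by []. set w := (beta + 1) * q e.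
  have zw : z <= w by rewrite /z /w mulrDl mul1r lerDl ltW ?q_gt0.
  have xw : x <= w.
    have : x <= z + 1 by have := ler_norm (x - z); move: hx; lra.
    by rewrite /w mulrDl mul1r -/z; lra.
  have w0 : 0 <= w by apply: le_trans zw.
  have h3 : `|x ^+ m.+1 - z ^+ m.+1| <= (m.+1)%:R * w ^+ m.
    rewrite subrXX normrM; apply: le_trans (ler_piMl _ hx) _; first exact: normr_ge0.
    apply: le_trans (ler_norm_sum _ _ _) _; rewrite mulr_natl -[X in _ *+ X]card_ord -sumr_const.
    apply: ler_sum => i _; have im : (i <= m)%N by rewrite -ltnS.
    have -> : w ^+ m = w ^+ (m - i) * w ^+ i by rewrite -exprD subnK.
    rewrite [m.+1.-1]/= ger0_norm ?mulr_ge0 ?exprn_ge0 //.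
    by apply: ler_pM; rewrite ?exprn_ge0 //; apply: lerXn2r; rewrite ?nnegrE.
  have h4 : (m.+1)%:R * x ^+ m <= (m.+1)%:R * w ^+ m.
    by apply: ler_wpM2l => //; apply: lerXn2r; rewrite ?nnegrE.
  have -> : (m.+1)%:R *+ 2 * (beta + 1) ^+ m * q e ^+ m = (m.+1)%:R * w ^+ m + (m.+1)%:R * w ^+ m.
    by rewrite /w exprMn mulr2n; ring.
  move: h3 h4 h1 h2; rewrite !ler_norml => /andP[]; move: (x ^+ m.+1) (z ^+ m.+1) (_ * w ^+ m) (_ * x ^+ m) (_ * \sum_(n < M e) _).
  by move=> u1 u2 u3 u4 u5 *; apply/andP; split; lra.
exists (beta ^+ m.+1 / (m.+1)%:R), (2%:R * (beta + 1) ^+ m) => e.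
have m0 : (m.+1)%:R != 0 :> rat by rewrite pnatr_eq0.
have -> : beta ^+ m.+1 / m.+1%:R * q e ^+ d.+1 = q e ^+ (d - m) * ((beta * q e) ^+ m.+1 / m.+1%:R).
  by rewrite -{1}(subnK md) -addnS exprD exprMn; ring.
rewrite -mulrBr normrM ger0_norm ?exprn_ge0 ?ler0n //.
have -> : \sum_(n < M e) n%:R ^+ m - (beta * q e) ^+ m.+1 / m.+1%:R =
   (m.+1%:R * \sum_(n < M e) n%:R ^+ m - (beta * q e) ^+ m.+1) / m.+1%:R.
  by rewrite mulrBl mulrAC mulfV ?mul1r.
have -> : q e ^+ d = q e ^+ (d - m) * q e ^+ m by rewrite -exprD subnK.
rewrite normrM [X in _ <= X]mulrCA; apply: ler_wpM2l.
  by apply: exprn_ge0.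
rewrite (ger0_norm (x := m.+1%:R^-1)) ?invr_ge0 // ler_pdivrMr ?ltr0n //.
apply: le_trans (key e) _; rewrite mulr2n; rewrite le_eqVlt; apply/orP; left; apply/eqP; ring.
Qed.

(** Sums from 0 to b q are required for every b, so that differences give the sum over a single
    block. *)
Definition PP d (g : nat -> nat -> rat) : Prop := forall b, approx d (fun e => \sum_(n < p ^ e * b) g e n).

Lemma PP_ext d g h : (forall e n, g e n = h e n) -> PP d h -> PP d g.
Proof.
move=> gh hh b; apply: (@approx_ext _ _ _ 0) (hh b) => e.
under eq_bigr do rewrite gh; by rewrite subrr normr0 mul0r.
Qed.

Lemma PP_lin d (T : Type) (s : seq T) (a : T -> rat) (g : T -> nat -> nat -> rat) : (forall x, PP d (g x)) ->
  PP d (fun e n => \sum_(x <- s) a x * g x e n).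
Proof.
move=> hg b; apply: (@approx_ext _ _ (fun e => \sum_(x <- s) a x * \sum_(n < p ^ e * b) g x e n) 0) => [e|].
  by rewrite exchange_big /=; under eq_bigr do rewrite -mulr_sumr; rewrite subrr normr0 mul0r.
by apply: approx_sum => x; apply: approxZ; apply: hg.
Qed.

Lemma nat_ceil (x : rat) : 0 <= x -> exists M : nat, (forall n : nat, (x <= n%:R) = (M <= n)%N) /\ `|M%:R - x| <= 1.
Proof.
move=> x0; have ex : exists n : nat, x <= n%:R.
  by have := archi_boundP x0 => h; exists (Num.bound x); apply: ltW.
case: (ex_minnP ex) => M xM min; exists M; split=> [n|].
  by apply/idP/idP => [/min //|Mn]; apply: le_trans xM _; rewrite ler_nat.
rewrite ger0_norm ?subr_ge0 //; case: M min xM => [|M] min xM; first by move: x0 xM; lra.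
rewrite lerBlDr -natr1 addrC lerD2l leNgt; apply/negP => /ltW; move/min; by rewrite ltnn.
Qed.

(** Past the largest breakpoint Lam q the product is the polynomial q^d G(n / q), and before it one
    factor vanishes. So the sum is zero or a difference of two sums of a polynomial. *)
Lemma PP_pos (ls : seq rat) : (forall l, l \in ls -> 0 <= l) ->
  PP (size ls) (fun e n => \prod_(l <- ls) pos (n%:R - l * q e)).
Proof.
move=> ls0 b; set d := size ls.
pose G : {poly rat} := \prod_(l <- ls) ('X - l%:P).
have sG : size G = d.+1 by rewrite size_prod_XsubC.
have GE e (n : nat) : \prod_(l <- ls) (n%:R - l * q e) = \sum_(m < d.+1) G`_m * (q e ^+ (d - m) * n%:R ^+ m).
  have q0 : q e != 0 by rewrite gt_eqF ?q_gt0.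
  have -> : \prod_(l <- ls) (n%:R - l * q e) = q e ^+ d * G.[n%:R / q e].
    rewrite /G horner_prod /d; elim: (ls) => [|l s IH]; first by rewrite !big_nil expr0 mulr1.
    rewrite !big_cons IH /= exprS hornerXsubC; field; exact: q0.
  rewrite horner_coef sG mulr_sumr; apply: eq_bigr => m _; have md : (m <= d)%N by rewrite -ltnS.
  rewrite -{1}(subnK md) exprD exprMn exprVn; field; exact: expf_neq0.
have HE (M : nat -> nat) beta : 0 <= beta -> (forall e, `|(M e)%:R - beta * q e| <= 1) ->
    approx d (fun e => \sum_(n < M e) \prod_(l <- ls) (n%:R - l * q e)).
  move=> b0 hM; apply: (@approx_ext _ _ (fun e => \sum_(m <- index_enum 'I_d.+1) G`_m * (q e ^+ (d - m) * \sum_(n < M e) n%:R ^+ m)) 0).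
    move=> e; under [X in `|X - _|]eq_bigr do rewrite GE.
    rewrite exchange_big /=; under [X in `|X - _|]eq_bigr do rewrite -mulr_sumr -mulr_sumr.
    by rewrite subrr normr0 mul0r.
  apply: approx_sum => m; apply: approxZ; apply: approx_power b0 hM; by rewrite -ltnS.
pose Lam : rat := \big[Num.max/0]_(l <- ls) l.
have Lge l : l \in ls -> l <= Lam by move=> lls; rewrite /Lam; apply: le_bigmax_seq.
have L0 : 0 <= Lam by rewrite /Lam; elim: (ls) => [|l s IH]; rewrite ?big_nil // big_cons le_max IH orbT.
have Lin : Lam = 0 \/ Lam \in ls.
  rewrite /Lam; elim: (ls) => [|l s [IH|IH]]; rewrite ?big_nil ?big_cons; first by left.
    by rewrite IH /Num.max; case: ifP => _; [left|right; rewrite mem_head].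
  by right; rewrite /Num.max; case: ifP => _; rewrite inE ?eqxx // IH orbT.
have gE e (n : nat) : \prod_(l <- ls) pos (n%:R - l * q e) =
    if Lam * q e <= n%:R then \prod_(l <- ls) (n%:R - l * q e) else 0.
  case: ifP => [h|/negbT]; last first.
    rewrite -ltNge => h; case: Lin => [L|L]; first by move: h; rewrite L mul0r ltNge ler0n.
    rewrite (big_rem _ L) /= /pos max_l ?mul0r // subr_le0; exact: ltW.
  rewrite big_seq [RHS]big_seq; apply: eq_bigr => l lls; rewrite /pos max_r // subr_ge0.
  by apply: le_trans h; apply: ler_wpM2r; [apply: ltW (q_gt0 e)|apply: Lge].
have [bL|Lb] := leP b%:R Lam.
  apply: (@approx_ext _ _ (fun=> 0) 0) (approx0 d) => e; rewrite big1 ?subrr ?normr0 ?mul0r // => n _.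
  have := ltn_ord n; move: (nat_of_ord n) => {}n nb; rewrite gE leNgt (lt_le_trans (y := b%:R * q e)) //.
    by rewrite -natrM ltr_nat mulnC.
  by apply: ler_wpM2r => //; apply: ltW (q_gt0 e).
have hM e : exists M : nat, (forall n : nat, (Lam * q e <= n%:R) = (M <= n)%N) /\ `|M%:R - Lam * q e| <= 1.
  by apply: nat_ceil; apply: mulr_ge0 => //; apply: ltW (q_gt0 e).
have [M /all_and2[hM1 hM2]] := choice hM.
have Mb e : (M e <= p ^ e * b)%N.
  by rewrite -hM1 natrM [X in _ <= X]mulrC; apply: ler_wpM2r; [apply: ltW (q_gt0 e)|apply: ltW].
apply: (@approx_ext _ _ (fun e => \sum_(n < p ^ e * b) \prod_(l <- ls) (n%:R - l * q e) +
   (-1) * \sum_(n < M e) \prod_(l <- ls) (n%:R - l * q e)) 0) => [e|]; last first.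
  apply: approxD; last by apply: approxZ; apply: HE hM2.
  by apply: (HE _ b%:R) => // e; rewrite natrM mulrC subrr normr0.
under eq_bigr do rewrite gE hM1.
by rewrite (sum_tail (fun n => \prod_(l <- ls) (n%:R - l * q e)) (Mb e)) subrr normr0 mul0r.
Qed.

Definition hinge_sum (S : nat -> nat -> rat) : Prop := exists N (eps lam : 'I_N -> rat), (forall l, 0 <= lam l) /\
  forall e n, S e n = \sum_l eps l * pos (n%:R - lam l * q e).

(** The factors S_i are expanded one at a time; the breakpoints already chosen accumulate in
    [ls]. *)
Lemma PP_hinges r (S : 'I_r -> nat -> nat -> rat) (s : seq 'I_r) (ls : seq rat) : (forall i, hinge_sum (S i)) ->
  (forall l, l \in ls -> 0 <= l) ->
  PP (size ls + size s) (fun e n => \prod_(l <- ls) pos (n%:R - l * q e) * \prod_(i <- s) S i e n).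
Proof.
move=> hS; elim: s ls => [|i s IH] ls ls0.
  by rewrite addn0; apply: PP_ext (PP_pos ls0) => e n; rewrite big_nil mulr1.
have [N [eps [lam [l0 SE]]]] := hS i.
apply: (@PP_ext _ _ (fun e n => \sum_(t <- index_enum 'I_N) eps t *
   (\prod_(l <- lam t :: ls) pos (n%:R - l * q e) * \prod_(i <- s) S i e n))).
  move=> e n; rewrite big_cons SE mulr_suml mulr_sumr; apply: eq_bigr => t _.
  by rewrite big_cons; ring.
apply: PP_lin => t; rewrite [size (i :: s)]/= addnS -addSn; apply: (IH (lam t :: ls)) => l.
by rewrite inE => /orP[/eqP ->|]; [exact: l0|exact: ls0].
Qed.

(** The factors are exchanged one by one. The factor x on the left records the gain of one power
    over the trivial bound, without a division. *)
Lemma prod_close (T : Type) (s : seq T) (h S : T -> rat) (B x : rat) : 1 <= B -> 1 <= x ->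
  (forall i, `|h i| <= B * x) -> (forall i, `|S i| <= B * x) -> (forall i, `|h i - S i| <= B) ->
  `|\prod_(i <- s) h i - \prod_(i <- s) S i| * x <= (size s)%:R * (B * x) ^+ size s.
Proof.
move=> B1 x1 hh hS hd; have B0 : 0 <= B by apply: le_trans B1. have x0 : 0 <= x by apply: le_trans x1.
have Bx : 0 <= B * x by apply: mulr_ge0.
elim: s => [|i s IH]; first by rewrite !big_nil subrr normr0 !mul0r.
have hp : `|\prod_(i <- s) h i| <= (B * x) ^+ size s.
  elim: (s) => [|j t IHt]; first by rewrite big_nil normr1 expr0.
  by rewrite big_cons normrM exprS; apply: ler_pM.
rewrite !big_cons; move: hp IH; set H := \prod_(i <- s) h i; set T' := \prod_(i <- s) S i => hp IH.
have -> : h i * H - S i * T' = (h i - S i) * H + S i * (H - T') by ring.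
have h1 : `|h i - S i| * `|H| * x <= (B * x) * (B * x) ^+ size s.
  by rewrite mulrAC; apply: ler_pM => //; [exact: mulr_ge0|exact: ler_wpM2r].
have h2 : `|S i| * `|H - T'| * x <= (size s)%:R * ((B * x) * (B * x) ^+ size s).
  by rewrite mulrCA -mulrA; apply: ler_pM => //; exact: mulr_ge0.
apply: le_trans (ler_wpM2r x0 (ler_normD _ _)) _; rewrite !normrM /= -natr1 mulrDl [X in _ <= X]mulrDl mul1r exprS addrC.
exact: lerD.
Qed.

Lemma PP_ramps r (h : 'I_r -> nat -> nat -> rat) : (forall i, ramp p (h i)) -> PP r (fun e n => \prod_i h i e n).
Proof.
move=> hr b.
have hS i : exists S C, [/\ hinge_sum S, forall e n, `|h i e n - S e n| <= C &
   forall e n, (n < p ^ e * b)%N -> `|S e n| <= C * q e].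
  have [N [eps [lam [C [l0 hC]]]]] := hr i.
  pose E : rat := \sum_l `|eps l|; have E0 : 0 <= E by apply: sumr_ge0.
  exists (fun e n => \sum_l eps l * pos (n%:R - lam l * q e)), (`|C| + E * b%:R); split.
  - by exists N, eps, lam.
  - move=> e n; apply: le_trans (hC e n) _; apply: le_trans (ler_norm C) _.
    by rewrite lerDl mulr_ge0.
  move=> e n nb; apply: le_trans (_ : E * b%:R * q e <= _); last first.
    by apply: ler_wpM2r; [apply: ltW (q_gt0 e)|rewrite lerDr].
  apply: le_trans (ler_norm_sum _ _ _) _; rewrite -mulrA mulr_suml; apply: ler_sum => l _.
  rewrite normrM; apply: ler_wpM2l => //; rewrite ger0_norm; last by rewrite /pos le_max lexx.
  rewrite /pos ge_max -natrM ler0n /= lerBlDr; apply: le_trans (_ : n%:R <= _) _.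
    by [].
  apply: le_trans (_ : (b * p ^ e)%:R <= _); first by rewrite ler_nat mulnC ltnW.
  by rewrite lerDl mulr_ge0 // ?(l0 l) // ltW ?q_gt0.
have [S hS1] := choice hS; have [C hC] := choice hS1.
(* B has to bound h_i / q and S_i / q as well as their difference: S_i is at most |C_i| q and h_i
   differs from it by at most |C_i|, hence the factor 2. *)
pose B : rat := 1 + \sum_i `|C i| *+ 2.
have CB i : `|C i| *+ 2 <= B - 1.
  by rewrite /B addrAC subrr add0r (bigD1 i) //= lerDl sumr_ge0 // => j _; rewrite mulrn_wge0.
have B1 : 1 <= B by rewrite lerDl sumr_ge0 // => j _; rewrite mulrn_wge0.
have PS : PP r (fun e n => \prod_i S i e n).
  have := @PP_hinges r S (index_enum 'I_r) [::] (fun i => let: And3 h _ _ := hC i in h) (fun _ _ => ltac:(done)).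
  rewrite add0n (_ : size _ = r); last by rewrite -sum1_size sum1_card card_ord.
  by apply: PP_ext => e n; rewrite big_nil mul1r.
apply: (@approx_ext _ _ _ (b%:R * (r%:R * B ^+ r))) (PS b) => e.
rewrite -sumrB; apply: le_trans (ler_norm_sum _ _ _) _.
apply: le_trans (_ : \sum_(n < p ^ e * b) (r%:R * (B * q e) ^+ r) / q e <= _).
  apply: ler_sum => n _; rewrite ler_pdivlMr ?q_gt0 //.
  have := @prod_close _ (index_enum 'I_r) (fun i => h i e n) (fun i => S i e n) B (q e) B1 (q_ge1 e).
  rewrite (_ : size _ = r); last by rewrite -sum1_size sum1_card card_ord.
  have q1 := q_ge1 e; have q0 : 0 <= q e by apply: ltW (q_gt0 e).
  have C2 i : `|C i| <= B by have := CB i; have := normr_ge0 (C i); rewrite mulr2n; lra.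
  have hd i : `|h i e n - S i e n| <= `|C i|.
    by case: (hC i) => _ h1 _; apply: le_trans (h1 e n) (ler_norm _).
  have hSb i : `|S i e n| <= `|C i| * q e.
    case: (hC i) => _ _ h1; apply: le_trans (h1 e n (ltn_ord n)) _; apply: ler_wpM2r => //; exact: ler_norm.
  apply=> i.
  - rewrite -[h i e n](subrK (S i e n)); apply: le_trans (ler_normD _ _) _.
    apply: le_trans (_ : (`|C i| *+ 2) * q e <= _).
      rewrite mulr2n mulrDl; apply: lerD => //; apply: le_trans (hd i) _; exact: ler_peMr.
    by apply: ler_wpM2r => //; have := CB i; lra.
  - by apply: le_trans (hSb i) _; apply: ler_wpM2r.
  - exact: le_trans (hd i) (C2 i).
rewrite sumr_const card_ord -[X in X <= _]mulr_natl natrM exprMn; rewrite le_eqVlt; apply/orP; left; apply/eqP.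
have q0 : q e != 0 by rewrite gt_eqF ?q_gt0.
by field; exact: q0.
Qed.

Lemma ramp_later e0 h : ramp p h -> ramp p (fun e n => h (e0 + e)%N n).
Proof.
move=> [N [eps [lam [C [l0 hC]]]]]; exists N, eps, (fun l => lam l * q e0), C; split=> [l|e n].
  by apply: mulr_ge0 => //; apply: ltW (q_gt0 e0).
have := hC (e0 + e)%N n; rewrite expnD natrM; congr (`|_ - _| <= _).
by apply: eq_bigr => l _; rewrite mulrA.
Qed.
End Asymptotics.

(** * Summation over blocks and passage to the limit *)

Section Blocks.
Variables (p : nat) (p1 : (1 < p)%N).
Local Notation q e := ((p ^ e)%:R : rat).

Lemma PPD d g h : PP p d g -> PP p d h -> PP p d (fun e n => g e n + h e n).
Proof.
move=> hg hh b; apply: (@approx_ext _ _ _ _ 0) (approxD (hg b) (hh b)) => e.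
by rewrite big_split subrr normr0 mul0r.
Qed.

Lemma PPN d g : PP p d g -> PP p d (fun e n => - g e n).
Proof.
move=> hg b; apply: (@approx_ext _ _ _ _ 0) (approxZ (-1) (hg b)) => e.
by rewrite sumrN mulN1r subrr normr0 mul0r.
Qed.

Lemma sum_blocks (f : nat -> rat) q' b : \sum_(n < q' * b) f n = \sum_(J < b) \sum_(j < q') f (q' * J + j)%N.
Proof.
elim: b => [|b IH]; first by rewrite muln0 !big_ord0.
by rewrite mulnS addnC big_split_ord big_ord_recr -IH.
Qed.

Lemma sum_head_le (F : nat -> rat) X c m : 0 <= X -> (forall j, `|F j| <= X) -> (forall j, (c <= j)%N -> (j < m)%N -> F j = 0) ->
  `|\sum_(j < m) F j| <= c%:R * X.
Proof.
move=> X0 hX h0; apply: le_trans (_ : (minn m c)%:R * X <= _); last first.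
  by apply: ler_wpM2r => //; rewrite ler_nat geq_minr.
elim: m h0 => [|m IH] h0; first by rewrite big_ord0 normr0 min0n mul0r.
rewrite big_ord_recr /=; apply: le_trans (ler_normD _ _) _.
have {}IH := IH (fun j cj jm => h0 j cj (ltnW jm)).
have [cm|mc] := leqP c m.
  rewrite h0 // normr0 addr0; apply: le_trans IH _; apply: ler_wpM2r => //.
  by rewrite ler_nat (minn_idPr cm) leq_min (leq_trans cm) ?leqnn.
rewrite (minn_idPl mc) -natr1 mulrDl mul1r; apply: lerD => //.
by rewrite (minn_idPl (ltnW mc)) in IH.
Qed.

(* The c exceptional degrees of each of the D + 1 blocks, and the c last degrees, each
   contribute O(q^d). *)
Lemma blocks_approx d D c e1 (tm : nat -> nat -> rat) (g : nat -> nat -> nat -> rat) (B : rat) : 0 <= B ->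
  (forall J, PP p d (g J)) ->
  (forall e n, (n < p ^ (e1 + e) * D.+1 + c)%N -> `|tm e n| <= B * q e ^+ d) ->
  (forall J e n, (n < p ^ (e1 + e) * D.+1 + c)%N -> `|g J e n| <= B * q e ^+ d) ->
  (forall e J n, (J <= D)%N -> (p ^ (e1 + e) * J + c <= n)%N -> (n < p ^ (e1 + e) * J.+1)%N -> tm e n = g J e n) ->
  approx p d (fun e => \sum_(n < p ^ (e1 + e) * D.+1 + c) tm e n).
Proof.
move=> B0 hg tB gB tg.
pose G J e := \sum_(n < p ^ (e1 + e) * J.+1) g J e n - \sum_(n < p ^ (e1 + e) * J) g J e n.
have hG J : approx p d (G J).
  have pE e b : (p ^ (e1 + e) * b = p ^ e * (p ^ e1 * b))%N by rewrite expnD mulnA (mulnC (p ^ e)%N).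
  apply: (@approx_ext _ _ _ _ 0) (approxD (hg J (p ^ e1 * J.+1)%N) (approxZ (-1) (hg J (p ^ e1 * J)%N))) => e.
  by rewrite /G !pE mulN1r subrr normr0 mul0r.
apply: (@approx_ext _ _ _ (fun e => \sum_(J <- index_enum 'I_D.+1) G J e) (D.+2%:R * (c%:R * (2 * B)))); last first.
  by apply: approx_sum => J; apply: hG.
move=> e; set Q := (p ^ (e1 + e))%N; set X := B * q e ^+ d.
have X0 : 0 <= X by rewrite /X mulr_ge0 // exprn_ge0.
have GE (J : 'I_D.+1) : G J e = \sum_(j < Q) g J e (Q * J + j)%N.
  by rewrite /G -/Q mulnS addnC big_split_ord /= addrAC subrr add0r.
rewrite big_split_ord sum_blocks /= addrAC -sumrB -!mulrA.
rewrite -/X.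
have Jlt (J : 'I_D.+1) (j : nat) : (j < Q)%N -> (Q * J + j < Q * D.+1 + c)%N.
  move=> jQ; have := ltn_ord J; rewrite ltnS => JD; apply: leq_trans (leq_addr _ _).
  by apply: leq_trans (_ : Q * J.+1 <= _)%N; rewrite ?leq_mul2l ?ltnS ?JD ?orbT // mulnS addnC ltn_add2r.
apply: le_trans (ler_normD _ _) _; rewrite -natr1 mulrDl mul1r; apply: lerD.
  apply: le_trans (ler_norm_sum _ _ _) _; rewrite mulr_natl -[X in _ *+ X]card_ord -sumr_const.
  apply: ler_sum => J _; rewrite GE -sumrB.
  pose F j := if (j < Q)%N then tm e (Q * J + j)%N - g J e (Q * J + j)%N else 0.
  have -> : \sum_(j < Q) (tm e (Q * J + j)%N - g J e (Q * J + j)%N) = \sum_(j < Q) F j.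
    by apply: eq_bigr => j _; rewrite /F ltn_ord.
  apply: sum_head_le => [|j|j cj jQ]; first by rewrite mulr_ge0.
    rewrite /F; case: ifP => jQ; last by rewrite normr0 mulr_ge0.
    apply: le_trans (ler_normB _ _) _; rewrite mulr_natl mulr2n; apply: lerD; [apply: tB|apply: gB]; exact: Jlt.
  rewrite /F jQ (tg e J) ?subrr //; first by rewrite -ltnS.
    by rewrite -/Q leq_add2l.
  by rewrite -/Q mulnS addnC ltn_add2r.
pose F j := if (j < c)%N then tm e (Q * D.+1 + j)%N else 0.
have -> : \sum_(j < c) tm e (Q * D.+1 + j)%N = \sum_(j < c) F j.
  by apply: eq_bigr => j _; rewrite /F ltn_ord.
apply: sum_head_le => [|j|j cj jc]; first by rewrite mulr_ge0.
  rewrite /F; case: ifP => jc; last by rewrite normr0 mulr_ge0.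
  apply: le_trans (tB e _ _) _; first by rewrite ltn_add2l.
  by rewrite -/X mulr_natl mulr2n lerDl.
by rewrite /F ltnNge cj.
Qed.

Lemma approx_cvg (K : realType) d e1 (l : nat -> nat) : approx p d (fun e => (l (e1 + e)%N)%:R) ->
  exists a : rat, ((l n)%:R / (p ^ (n * d.+1))%:R : K) @[n --> \oo] --> (ratr a : K).
Proof.
move=> [rho [C hC]]; set Q := q e1 ^+ d.+1; have Q0 : 0 < Q by apply/exprn_gt0/q_gt0.
exists (rho / Q).
have C0 : 0 <= C by have := hC 0%N; rewrite expn0 !expr1n mulr1 => /(le_trans (normr_ge0 _)); rewrite mulr1.
(* The error relative to q^(d+1) is O(1 / q), and q > e turns it into O(1 / (e + 1)), to which the
   archimedean property applies directly. *)
have key e : `|rho / Q - (l (e1 + e)%N)%:R / (p ^ ((e1 + e) * d.+1))%:R| <= (C / Q) / e.+1%:R.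
  have q0 := q_gt0 p1 e; have qn : q e != 0 by rewrite gt_eqF.
  have -> : (p ^ ((e1 + e) * d.+1))%:R = Q * q e ^+ d.+1 :> rat.
    by rewrite expnM natrX expnD natrM exprMn.
  have -> : rho / Q - (l (e1 + e)%N)%:R / (Q * q e ^+ d.+1) = - ((l (e1 + e)%N)%:R - rho * q e ^+ d.+1) / (Q * q e ^+ d.+1).
    by field; rewrite !expf_neq0 // gt_eqF // q_gt0.
  rewrite mulNr normrN normrM [X in _ * X]ger0_norm; last by rewrite invr_ge0 mulr_ge0 ?exprn_ge0 // ltW.
  have Qq : 0 < Q * q e ^+ d.+1 by apply: mulr_gt0 => //; apply: exprn_gt0.
  rewrite (ler_pdivrMr _ _ Qq); apply: le_trans (hC e) _.
  have -> : C / Q / e.+1%:R * (Q * q e ^+ d.+1) = C * q e ^+ d * (q e / e.+1%:R).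
    have e0 : e.+1%:R != 0 :> rat by rewrite pnatr_eq0.
    have Qn : Q != 0 by rewrite gt_eqF.
    by rewrite exprS; move: (e.+1%:R) e0 (Q) Qn => E E0 Q' Q'0; field; rewrite E0 Q'0.
  rewrite ler_peMr ?mulr_ge0 ?exprn_ge0 // ler_pdivlMr ?ltr0n // mul1r ler_nat.
  exact: ltn_expl.
apply/cvgrPdist_le => eps eps0.
set M : K := ratr (C / Q); have M0 : 0 <= M by rewrite ler0q divr_ge0 // ltW.
have hb := archi_boundP (divr_ge0 M0 (ltW eps0)); set N := Num.bound _ in hb.
exists (e1 + N)%N => //= n /= Nn; have en : (e1 <= n)%N by apply: leq_trans Nn; apply: leq_addr.
have := key (n - e1)%N; rewrite subnKC // -(ler_rat K) => h.
have -> : `|ratr (rho / Q) - (l n)%:R / (p ^ (n * d.+1))%:R : K| = ratr `|rho / Q - (l n)%:R / (p ^ (n * d.+1))%:R|.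
  by rewrite ratr_norm rmorphB /= [ratr (_%:R / _)]fmorph_div /= !ratr_nat.
apply: le_trans h _; rewrite fmorph_div /= ratr_nat -/M ler_pdivrMr ?ltr0n //.
move: hb; rewrite ltr_pdivrMr // => /ltW hb; apply: le_trans hb _; rewrite mulrC; apply: ler_wpM2l; first exact: ltW.
by rewrite ler_nat; lia.
Qed.
End Blocks.

(** * The Hilbert-Kunz function *)

Section Assembly.
Variables (k : closedFieldType) (p : nat) (hp : p \in [pchar k]) (r : nat) (hr : (0 < r)%N).
Variables (R : 'I_r -> std_graded k) (I : forall i, set (R i)).
Hypothesis hI : forall i, homogeneous_ideal (@I i).
Arguments I : clear implicits.
Local Notation P i n := (@sg_piece k (R i) n).
Local Notation SP := (@segre_piece k r R).
Let al n i := segre_alpha R n i.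
Let ad := adim p hI.
Let sd := sdim p hI.
Let p1 : (1 < p)%N := p_gt1 hp.

Hypothesis hc : forall i, curve (@sg_piece k (R i)) p.
Hypothesis hfin : forall i, exists n, colength (I i) n.

Lemma uniform (T : finType) (Q : T -> nat -> Prop) : (forall t m n, (m <= n)%N -> Q t m -> Q t n) ->
  (forall t, exists n, Q t n) -> exists n, forall t, Q t n.
Proof.
move=> mono /choice[f hf]; exists (\sum_t f t)%N => t; apply: mono (hf t).
by rewrite (bigD1 t) //= leq_addr.
Qed.

Lemma uniform_power : exists c, forall i, exists x y, [/\ P i 1%N x, P i 1%N y & forall q n z, (0 < q)%N -> (2 * q + c <= n)%N -> P i n z ->
    exists a b, [/\ P i (n - q)%N a, P i (n - q)%N b & z = x ^+ q * a + y ^+ q * b]].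
Proof.
apply: uniform => [i m n mn [x [y [Px Py h]]]|i]; last exact: cv_power (hc i).
exists x, y; split=> // q l z q0 le; apply: h => //; apply: leq_trans le; by rewrite leq_add2l.
Qed.

Lemma uniform_upper : exists C, forall i n a, hasdim (P i n) a -> (a <= C * n.+1)%N.
Proof.
apply: uniform => [i m n mn h l a ha|i]; last exact: cv_upper (hc i).
by apply: leq_trans (h l a ha) _; rewrite leq_mul2r mn orbT.
Qed.

Lemma uniform_irrelevant : exists D, forall i, P i D `<=` I i.
Proof.
apply: uniform => [i m n mn h|i].
  by apply: (P_incl_ideal (sg_grading (R i))) mn => //; case: (hI i).
by have [n hn] := hfin i; apply: (colength_irrelevant (homogeneous_homog (hI i)) hn).
Qed.

Lemma uniform_ramp D : exists e1, forall d i, (d <= D)%N ->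
  ramp p (fun e n => (ad d (e1 + e) n i)%:R) /\ ramp p (fun e n => (sd d.-1 d (e1 + e) n i)%:R).
Proof.
have later e1 e2 (h : nat -> nat -> nat) : (e1 <= e2)%N -> ramp p (fun e n => (h (e1 + e)%N n)%:R) -> ramp p (fun e n => (h (e2 + e)%N n)%:R).
  move=> le hr1; 
  have hr2 : ramp p (fun e n => (h (e1 + (e2 - e1 + e))%N n)%:R) by apply: (ramp_later (e2 - e1) hr1).
  apply: (@ramp_ext p _ _ 0) hr2 => e n.
  by rewrite addnA subnKC // subrr normr0.
have [e1 he1] : exists e1, forall di : 'I_D.+1 * 'I_r,
    ramp p (fun e n => (ad di.1 (e1 + e) n di.2)%:R) /\ ramp p (fun e n => (sd di.1.-1 di.1 (e1 + e) n di.2)%:R).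
  apply: uniform => [[d i] m n mn [h1 h2]|[d i]].
    by split; [exact: (later _ _ (fun e n => ad d e n i) mn h1)|exact: (later _ _ (fun e n => sd d.-1 d e n i) mn h2)].
  have ramps j := cv_ramp (hc j).
  have [e1 h1] := adim_ramp hI ramps d i; have [e2 h2] := sdim_ramp hI ramps d.-1 d i.
  exists (e1 + e2)%N; split.
    exact: (later _ _ (fun e n => ad d e n i) (leq_addr e2 e1) h1).
  exact: (later _ _ (fun e n => sd d.-1 d e n i) (leq_addl e1 e2) h2).
exists e1 => d i dD; rewrite -ltnS in dD; exact: (he1 (Ordinal dD, i)).
Qed.

Lemma Qn_hasdim : exists b, forall e n, hasdim (Qn I (p ^ e) n) (b e n) /\ (b e n <= \prod_i al n i)%N.
Proof.
have h (en : nat * nat) : exists b, hasdim (Qn I (p ^ en.1) en.2) b /\ (b <= \prod_i al en.2 i)%N.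
  have [b le hb] := hasdim_sub (@Qn_subspace _ _ _ I _ _) (@Qn_sub _ _ _ I (p ^ en.1) en.2) (segre_dim R en.2).
  by exists b.
have [b hb] := choice h; exists (fun e n => b (e, n)) => e n; exact: (hb (e, n)).
Qed.

Lemma adim_le d e n i : (ad d e n i <= al n i)%N.
Proof. exact: hasdim_le (@AA_sub _ _ _ _ hI d (p ^ e)%N n i) (adimP p hI d e n i) (segre_alphaP R n i). Qed.

Lemma adim_sdim_le d d' e n i : (ad d e n i + ad d' e n i - sd d d' e n i <= al n i)%N /\ (sd d d' e n i <= ad d e n i + ad d' e n i)%N.
Proof.
have h1 := adimP p hI d e n i; have h2 := adimP p hI d' e n i; have h3 := sdimP p hI d d' e n i.
have le : (ad d' e n i <= sd d d' e n i)%N.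
  by apply: hasdim_le h2 h3; apply: sadd_subr; exact: AA_subspace.
split; last exact: (hasdim_add_le h1 h2 h3).
by apply: leq_trans (adim_le d e n i); rewrite leq_subLR addnC leq_add2r.
Qed.

Lemma colength_approx : exists e1 (l : nat -> nat),
  (forall e, colength (frobenius_power (segre_ideal I) (p ^ e)) (l e)) /\
  approx p r (fun e => (l (e1 + e)%N)%:R).
Proof.
have [c power] := uniform_power; have [C upper] := uniform_upper.
have [D irr] := uniform_irrelevant; have [e1 he1] := uniform_ramp D.
have [b hb] := Qn_hasdim.
pose s n := (\prod_i al n i)%N.
pose N e := (p ^ e * D.+1 + c)%N.
pose l e := (\sum_(n < N e) s n - \sum_(n < N e) b e n)%N.
exists e1, l; split=> [e|].
  rewrite (frobenius_powerE hp I e).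
  apply: (colength_dim (gP := segre_grading R) (N := N e)).
  - exact: Qset_ideal.
  - move=> n Nn; rewrite -(Qn_full hp hr hI power irr Nn) => z; exact: Qn_Qset.
  - exact: segre_Acum.
  apply: homog_dim; first exact: Qset_homog.
  by move=> m; rewrite Qset_piece; case: (hb e m).
(* [blocks_approx] asks for a function for every J, while uniform ramps are available for indices up
   to D only; larger J are never reached by the sum. *)
pose J' J := minn J D.
pose a1 J e n i := ad (J' J).-1 (e1 + e) n i.
pose a2 J e n i := ad (J' J) (e1 + e) n i.
pose a12 J e n i := (a1 J e n i + a2 J e n i - sd (J' J).-1 (J' J) (e1 + e) n i)%N.
pose tm e n : rat := (s n)%:R - (b (e1 + e)%N n)%:R.
pose g J e n : rat := ((\prod_i al n i)%:R - (\prod_i a1 J e n i)%:R) - (\prod_i a2 J e n i)%:R + (\prod_i a12 J e n i)%:R.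
(* In the range of summation n + 1 is at most (p^e1 (D + 1) + c) p^e, so every piece of an R_i has
   dimension at most C0 p^e. *)
pose C0 := (C * (p ^ e1 * D.+1 + c))%N.
have sB e n : (n < p ^ (e1 + e) * D.+1 + c)%N -> (s n)%:R <= (C0 ^ r)%:R * (p ^ e)%:R ^+ r :> rat.
  move=> nlt; rewrite -natrX -natrM ler_nat; apply: leq_trans (segre_dim_le upper n) _.
  rewrite -expnMn; rewrite leq_exp2r // /C0 -mulnA leq_mul2l; apply/orP; right.
  apply: leq_trans nlt _; rewrite mulnDl expnD mulnAC leq_add2l leq_pmulr // expn_gt0 (ltnW p1) //.
apply: (@approx_ext _ _ _ (fun e => \sum_(n < p ^ (e1 + e) * D.+1 + c) tm e n) 0) => [e|].
  rewrite /l natrB; last by apply: leq_sum => n _; case: (hb (e1 + e)%N n).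
  by rewrite !natr_sum -sumrB subrr normr0 mul0r.
(* The factor 4 accounts for the four products in [g], each at most [s n]. *)
apply: (@blocks_approx p r D c e1 tm g (4 * (C0 ^ r)%:R)).
- by rewrite mulr_ge0.
- move=> J; have hJ := he1 _ _ (geq_minr J D); have hJ1 i := he1 (J' J).-1 i (leq_trans (leq_pred _) (geq_minr J D)).
  have PPnat (f : nat -> nat -> 'I_r -> nat) : (forall i, ramp p (fun e n => (f e n i)%:R)) -> PP p r (fun e n => (\prod_i f e n i)%:R).
    by move=> hf; apply: PP_ext (PP_ramps p1 hf) => e n; rewrite natr_prod.
  apply: PPD; last first.
    apply: PPnat => i; apply: (@ramp_ext p _ (fun e n => ((a1 J e n i)%:R + (a2 J e n i)%:R) + (-1) * (sd (J' J).-1 (J' J) (e1 + e) n i)%:R) 0).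
      move=> e n; rewrite /a12 natrB ?natrD ?mulN1r ?subrr ?normr0 //.
      by case: (adim_sdim_le (J' J).-1 (J' J) (e1 + e) n i).
    apply: rampD; first by apply: rampD; [case: (hJ1 i)|case: (hJ i)].
    by apply: rampZ; case: (hJ i).
  apply: PPD; last by apply: PPN; apply: PPnat => i; case: (hJ i).
  apply: PPD; last by apply: PPN; apply: PPnat => i; case: (hJ1 i).
  by apply: (PPnat (fun _ n => al n)) => i; exact: (alpha_ramp (fun j => cv_ramp (hc j)) i).
- move=> e n nlt; have sn := sB e n nlt; rewrite /tm ger0_norm ?subr_ge0 ?ler_nat; last by case: (hb (e1 + e)%N n).
  have b0 : 0 <= (b (e1 + e)%N n)%:R :> rat by []. have s0 : 0 <= (s n)%:R :> rat by [].
  by rewrite -mulrA; lra.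
- move=> J e n nlt; have sn := sB e n nlt.
  have h1 : (\prod_i a1 J e n i)%:R <= (s n)%:R :> rat by rewrite ler_nat; apply: leq_prod => i _; apply: adim_le.
  have h2 : (\prod_i a2 J e n i)%:R <= (s n)%:R :> rat by rewrite ler_nat; apply: leq_prod => i _; apply: adim_le.
  have h3 : (\prod_i a12 J e n i)%:R <= (s n)%:R :> rat.
    by rewrite ler_nat; apply: leq_prod => i _; case: (adim_sdim_le (J' J).-1 (J' J) (e1 + e) n i).
  rewrite /g -/(s n) -mulrA; move: h1 h2 h3 sn; move: (ler0n rat (\prod_i a1 J e n i)) (ler0n rat (\prod_i a2 J e n i)) (ler0n rat (\prod_i a12 J e n i)).
  move: (_ * _) (s n)%:R (_%:R) (_%:R) (_%:R) => x1 x2 x3 x4 x5 *; rewrite ler_norml; apply/andP; split; lra.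
move=> e J n JD h1 h2; rewrite /tm /g /a12 /a1 /a2 /J' (minn_idPl JD).
have [hbn _] := hb (e1 + e)%N n; rewrite (Qn_good hp hr hI power h1 h2) in hbn.
have hA d i := adimP p hI d (e1 + e) n i.
have hS := tens_sum_dim (fun i => @AA_sub _ _ _ _ hI J.-1 (p ^ (e1 + e))%N n i) (fun i => @AA_sub _ _ _ _ hI J (p ^ (e1 + e))%N n i)
  (hA J.-1) (hA J) (fun i => sdimP p hI J.-1 J (e1 + e) n i).
rewrite (hasdim_inj hbn hS) natrB ?natrD /s /ad; first by ring.
apply: leq_trans (leq_addr _ _); apply: leq_prod => i _.
have le := hasdim_le (sadd_subr (@AA_subspace _ _ _ _ hI J.-1 (p ^ (e1 + e))%N n i)) (hA J i) (sdimP p hI J.-1 J (e1 + e) n i).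
by rewrite leq_subLR addnC leq_add2r.
Qed.
End Assembly.

Theorem corollary3p5 (K : realType) (k : closedFieldType) (p : nat)
    (hp : p \in [pchar k]) (r : nat) (hr : (0 < r)%N)
    (R : 'I_r -> std_graded k) (hdim : forall i, krull_dim (R i) 2)
    (I : forall i, set (R i)) (hI : forall i, homogeneous_ideal (I i))
    (hfin : forall i, exists n, colength (I i) n) :
  exists q : rat, hilbert_kunz p (segre_ideal I) (ratr q : K).
Proof.
have hc i : curve (@sg_piece k (R i)) p := krull2_curve (sg_grading (R i)) hp (hdim i).
have [C upper] := uniform_upper hc.
have [e1 [l [hl al]]] := colength_approx hp hr hI hc hfin.
have [q hq] := approx_cvg (p_gt1 hp) K al.
exists q, r.+1, l; split=> //.
exact: (segre_krull (fun i => cv_lower (hc i)) upper).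
Qed.
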